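(* Let $\Omega\subset\mathbb{R}^3$ be a bounded, simply connected open set with $C^4$ boundary, $T>0$, $\alpha\in(0,1)$, and let $(u,p)$ with $u,p\in L^\infty((0,T);C^{0,\alpha}(\Omega))$ be a weak solution of the incompressible Euler equations on $\Omega\times(0,T)$. Then the modified pressure $P:=p+\phi(x)(u\cdot n)^2$ satisfies the weak formulation of the pressure boundary-value problem: for almost every $t\in(0,T)$ and all $\Phi\in\mathcal{D}(\overline\Omega)$, $$\int_\Omega P\,\Delta\Phi\,dx-\int_{\partial\Omega}P\,\partial_n\Phi\,dS=\int_\Omega\Big[-u\otimes u:(\nabla\otimes\nabla)\Phi+(u\cdot n)^2\phi(x)\,\Delta\Phi\Big]dx .$$
   Context: Weak solution: $u\in L^\infty((0,T);L^2(\Omega;\mathbb{R}^3))$, $p\in L^\infty((0,T);L^1(\Omega))$, and for all $\chi\in\mathcal{D}(\Omega\times(0,T);\mathbb{R}^3)$ $$\int_0^T\!\!\int_\Omega\big[u\cdot\partial_t\chi+u\otimes u:\nabla\chi+p\,\nabla\cdot\chi\big]dx\,dt=0,$$ for all $\zeta\in\mathcal{D}(\Omega\times(0,T);\mathbb{R})$ one has $\int_0^T\int_\Omega u\cdot\nabla\zeta\,dx\,dt=0$, and $(u\cdot n)|_{\partial\Omega}=0$ (in the trace sense in $H^{-1/2}(\partial\Omega)$; pointwise for Hölder continuous $u$). $n$ is the outward unit normal. $\delta>0$ is small enough that points within distance $2\delta$ of $\partial\Omega$ have a unique nearest boundary point $\widetilde\sigma(x)$; $n$ is extended by $n(x)=n(\widetilde\sigma(x))$.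 $\phi(x)=\widetilde\phi(d(x,\partial\Omega))$ with $\widetilde\phi:[0,\infty)\to[0,1]$ smooth nonincreasing, equal to $1$ on $[0,\delta]$ and $0$ on $[2\delta,\infty)$. $\mathcal{D}(\overline\Omega)$ denotes functions smooth up to the boundary. *)

(* Defs.v *)
From HB Require Import structures.
From mathcomp Require Import all_boot all_order all_algebra.
From mathcomp Require Import all_classical all_reals all_analysis.
Set Implicit Arguments.
Unset Strict Implicit.
Unset Printing Implicit Defensive.
Import Order.TTheory GRing.Theory Num.Theory.
Import numFieldNormedType.Exports.
Local Open Scope classical_set_scope.
Local Open Scope ring_scope.

Section Topology.
Context {T : topologicalType}.

Definition boundary (A : set T) : set T := closure A `\` interior A.

Definition path_connected (A : set T) (R : realType) : Prop :=
  forall x y, A x -> A y -> exists g : R -> T,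
    [/\ {within `[0, 1], continuous g}, g @` `[0, 1] `<=` A, g 0 = x & g 1 = y].

(* H is a homotopy with fixed base point from the loop g to a constant. *)
Definition null_homotopic (A : set T) (R : realType) (g : R -> T) : Prop :=
  exists H : R * R -> T,
    [/\ {within `[0, 1] `*` `[0, 1], continuous H},
        H @` (`[0, 1] `*` `[0, 1]) `<=` A,
        (forall t, `[0, 1]%classic t -> H (0, t) = g t /\ H (1, t) = g 0) &
        (forall s, `[0, 1]%classic s -> H (s, 0) = g 0 /\ H (s, 1) = g 0)].

Definition simply_connected (A : set T) (R : realType) : Prop :=
  path_connected A R /\
  forall g : R -> T, {within `[0, 1], continuous g} ->
    g @` `[0, 1] `<=` A -> g 0 = g 1 -> null_homotopic A g.

(* Value at a boundary point x of the continuous extension of f, which is only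
   meaningful on the open set A. *)
Definition btrace (R : realType) (A : set T) (f : T -> R) (x : T) : R :=
  lim (f y @[y --> within A (nbhs x)]).

Definition tsupport (W : nmodType) (f : T -> W) : set T :=
  closure [set x | f x != 0].

End Topology.

Section Smoothness.
Context {R : realType} {V W : normedModType R}.

Definition iter_derive (vs : seq V) (f : V -> W) : V -> W :=
  foldr (fun v g => 'D_v g) f vs.

(* On finite-dimensional V: f is of class C^m on the open set A. *)
Definition Ck (m : nat) (A : set V) (f : V -> W) : Prop :=
  forall (vs : seq V) (x : V), A x ->
    ((size vs < m)%N -> differentiable (iter_derive vs f) x) /\
    ((size vs <= m)%N -> {for x, continuous (iter_derive vs f)}).

Definition smooth (A : set V) (f : V -> W) : Prop := forall m, Ck m A f.

(* The space D(A; W) of test functions on the open set A. *)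
Definition test_function (A : set V) (f : V -> W) : Prop :=
  [/\ smooth setT f, compact (tsupport f) & tsupport f `<=` A].

Definition holder_norm (alpha : R) (A : set V) (f : V -> W) : \bar R :=
  (ereal_sup [set `|f x|%:E | x in A] +
   ereal_sup [set (`|f z.1 - f z.2| / `|z.1 - z.2| `^ alpha)%:E
             | z in A `*` A])%E.

End Smoothness.

(* Functions smooth up to the boundary of the open set A: all derivatives
   extend continuously to the closure. *)
Definition smooth_closure (R : realType) (V : normedModType R)
    (A : set V) (f : V -> R) : Prop :=
  smooth A f /\
  forall (vs : seq V) (x : V), boundary A x ->
    cvg (iter_derive vs f y @[y --> within A (nbhs x)]).

Section Euclidean.
Context {R : realType}.

Definition dot n (x y : 'rV[R]_n) : R := \sum_i x 0 i * y 0 i.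

(* The library norm on 'rV[R]_n is the max norm. *)
Definition enorm n (x : 'rV[R]_n) : R := Num.sqrt (dot x x).

Definition edist_set n (x : 'rV[R]_n) (A : set 'rV[R]_n) : R :=
  inf [set enorm (x - y) | y in A].

Definition basis_vec n (i : 'I_n) : 'rV[R]_n := delta_mx 0 i.

Definition partial n (i : 'I_n) (f : 'rV[R]_n -> R) : 'rV[R]_n -> R :=
  'D_(basis_vec i) f.

Definition grad n (f : 'rV[R]_n -> R) (x : 'rV[R]_n) : 'rV[R]_n :=
  \row_i partial i f x.

Definition laplacian n (f : 'rV[R]_n -> R) (x : 'rV[R]_n) : R :=
  \sum_i partial i (partial i f) x.

End Euclidean.

Section Integration.
Context {R : realType}.
Let mu := @lebesgue_measure R.

Definition vec2 (q : R * R) : 'rV[R]_2 := \row_i [:: q.1; q.2]`_i.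
Definition vec3 (q : R * R * R) : 'rV[R]_3 := \row_i [:: q.1.1; q.1.2; q.2]`_i.

Definition integral_R2 (f : 'rV[R]_2 -> R) : R :=
  \int[(mu \x mu)%E]_q f (vec2 q).

Definition eintegral_R3 (A : set 'rV[R]_3) (f : 'rV[R]_3 -> R) : \bar R :=
  (\int[((mu \x mu) \x mu)%E]_(q in vec3 @^-1` A) (f (vec3 q))%:E)%E.

Definition integral_R3 (A : set 'rV[R]_3) (f : 'rV[R]_3 -> R) : R :=
  fine (eintegral_R3 A f).

End Integration.

Section SurfaceGeometry.
Context {R : realType}.

(* Near its boundary the set is the part of cdom lying on one side, given by
   cneg, of the graph x_ck = cgraph (the other two coordinates of x). *)
Record chart := Chart {
  cdom : set 'rV[R]_3 ;
  ck : 'I_3 ;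
  cneg : bool ;
  cgraph : 'rV[R]_2 -> R }.

Definition is_C4_chart (Omega : set 'rV[R]_3) (c : chart) : Prop :=
  [/\ open (cdom c), Ck 4 setT (cgraph c) &
      forall x, cdom c x ->
        (Omega x <->
         0 < (-1) ^+ cneg c * (x 0 (ck c) - cgraph c (col' (ck c) x)))].

Definition C4_boundary (Omega : set 'rV[R]_3) : Prop :=
  forall x, boundary Omega x ->
    exists c, is_C4_chart Omega c /\ cdom c x.

(* The vector with k-th coordinate z, its other coordinates being those of y. *)
Definition insert_coord (k : 'I_3) (y : 'rV[R]_2) (z : R) : 'rV[R]_3 :=
  \row_j (if unlift k j is Some i then y 0 i else z).

Definition area_factor (c : chart) (y : 'rV[R]_2) : R :=
  Num.sqrt (1 + dot (grad (cgraph c) y) (grad (cgraph c) y)).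

(* grad h / |grad h| for the defining function
   h(x) = - (-1)^cneg (x_ck - cgraph(...)), negative inside the set. *)
Definition chart_normal (c : chart) (x : 'rV[R]_3) : 'rV[R]_3 :=
  let y := col' (ck c) x in
  ((-1) ^+ cneg c / area_factor c y) *:
    insert_coord (ck c) (grad (cgraph c) y) (-1).

(* The value does not depend on the chart around x. *)
Definition outward_normal (Omega : set 'rV[R]_3) (x : 'rV[R]_3) : 'rV[R]_3 :=
  get [set v | exists c,
    [/\ is_C4_chart Omega c, cdom c x & v = chart_normal c x]].

(* A finite family of charts with a subordinate smooth partition of unity. *)
Definition is_atlas (Omega : set 'rV[R]_3) (N : nat)
    (c : 'I_N -> chart) (psi : 'I_N -> 'rV[R]_3 -> R) : Prop :=
  [/\ forall i, is_C4_chart Omega (c i),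
      forall i, test_function (cdom (c i)) (psi i),
      forall i x, 0 <= psi i x &
      forall x, boundary Omega x -> \sum_(i < N) psi i x = 1].

Definition atlas_integral (N : nat) (c : 'I_N -> chart)
    (psi : 'I_N -> 'rV[R]_3 -> R) (f : 'rV[R]_3 -> R) : R :=
  \sum_(i < N) integral_R2 (fun y =>
    let x := insert_coord (ck (c i)) y (cgraph (c i) y) in
    psi i x * f x * area_factor (c i) y).

(* The integral of f over the boundary against surface measure; the value does
   not depend on the atlas, and an atlas exists for a bounded open set with C^4
   boundary since its boundary is compact. *)
Definition surface_integral (Omega : set 'rV[R]_3) (f : 'rV[R]_3 -> R) : R :=
  get [set I | exists N (c : 'I_N -> chart) (psi : 'I_N -> 'rV[R]_3 -> R),
    is_atlas Omega c psi /\ I = atlas_integral c psi f].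

Definition nearest (A : set 'rV[R]_3) (x y : 'rV[R]_3) : Prop :=
  A y /\ enorm (x - y) = edist_set x A.

Definition boundary_proj (Omega : set 'rV[R]_3) (x : 'rV[R]_3) : 'rV[R]_3 :=
  get (nearest (boundary Omega) x).

Definition tubular_radius (Omega : set 'rV[R]_3) (delta : R) : Prop :=
  0 < delta /\
  forall x, edist_set x (boundary Omega) <= 2 * delta ->
    exists! y, nearest (boundary Omega) x y.

Definition normal_ext (Omega : set 'rV[R]_3) (x : 'rV[R]_3) : 'rV[R]_3 :=
  outward_normal Omega (boundary_proj Omega x).

(* Since phit = 1 on [0, delta], smoothness on [0, oo[ amounts to smoothness on
   ]0, oo[. *)
Definition cutoff_profile (delta : R) (phit : R -> R) : Prop :=
  [/\ @smooth R R R `]0, +oo[%classic phit,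
      forall r, 0 <= r -> 0 <= phit r <= 1,
      forall r s, 0 <= r -> r <= s -> phit s <= phit r,
      forall r, 0 <= r <= delta -> phit r = 1 &
      forall r, 2 * delta <= r -> phit r = 0].

Definition cutoff (Omega : set 'rV[R]_3) (phit : R -> R) (x : 'rV[R]_3) : R :=
  phit (edist_set x (boundary Omega)).

End SurfaceGeometry.
Arguments chart : clear implicits.

Section Euler.
Context {R : realType}.
Let mu := @lebesgue_measure R.

Definition Linfty_time (T : R) (N : R -> \bar R) : Prop :=
  exists M : R, {ae mu, forall t, `]0, T[%classic t -> (N t <= M%:E)%E}.

Definition measurable_spacetime (Omega : set 'rV[R]_3) (T : R)
    (f : R -> 'rV[R]_3 -> R) : Prop :=
  measurable_fun ((vec3 @^-1` Omega) `*` `]0, T[)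
    (fun q : (R * R * R) * R => f q.2 (vec3 q.1)).

Definition Linfty_L2 (Omega : set 'rV[R]_3) (T : R)
    (u : R -> 'rV[R]_3 -> 'rV[R]_3) : Prop :=
  (forall i, measurable_spacetime Omega T (fun t x => u t x 0 i)) /\
  Linfty_time T (fun t => eintegral_R3 Omega (fun x => dot (u t x) (u t x))).

Definition Linfty_L1 (Omega : set 'rV[R]_3) (T : R)
    (p : R -> 'rV[R]_3 -> R) : Prop :=
  measurable_spacetime Omega T p /\
  Linfty_time T (fun t => eintegral_R3 Omega (fun x => `|p t x|)).

Definition Linfty_holder_vec (alpha : R) (Omega : set 'rV[R]_3) (T : R)
    (u : R -> 'rV[R]_3 -> 'rV[R]_3) : Prop :=
  (forall i, measurable_spacetime Omega T (fun t x => u t x 0 i)) /\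
  Linfty_time T (fun t => holder_norm alpha Omega (u t)).

Definition Linfty_holder (alpha : R) (Omega : set 'rV[R]_3) (T : R)
    (p : R -> 'rV[R]_3 -> R) : Prop :=
  measurable_spacetime Omega T p /\
  Linfty_time T (fun t => holder_norm alpha Omega (p t)).

(* Test functions live on pairs (x, t). *)
Definition dt (W : normedModType R) (f : 'rV[R]_3 * R -> W) :
  'rV[R]_3 * R -> W := 'D_((0, 1) : 'rV[R]_3 * R) f.

Definition dx (W : normedModType R) (i : 'I_3) (f : 'rV[R]_3 * R -> W) :
  'rV[R]_3 * R -> W := 'D_((basis_vec i, 0) : 'rV[R]_3 * R) f.

Definition weak_momentum (Omega : set 'rV[R]_3) (T : R)
    (u : R -> 'rV[R]_3 -> 'rV[R]_3) (p : R -> 'rV[R]_3 -> R) : Prop :=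
  forall chi : 'rV[R]_3 * R -> 'rV[R]_3,
    test_function (Omega `*` `]0, T[) chi ->
    \int[mu]_(t in `]0, T[) integral_R3 Omega (fun x =>
      dot (u t x) (dt chi (x, t)) +
      \sum_i \sum_j u t x 0 i * u t x 0 j * dx j chi (x, t) 0 i +
      p t x * \sum_i dx i chi (x, t) 0 i) = 0.

Definition weak_div_free (Omega : set 'rV[R]_3) (T : R)
    (u : R -> 'rV[R]_3 -> 'rV[R]_3) : Prop :=
  forall zeta : 'rV[R]_3 * R -> R,
    test_function (Omega `*` `]0, T[) zeta ->
    \int[mu]_(t in `]0, T[) integral_R3 Omega (fun x =>
      \sum_i u t x 0 i * dx i zeta (x, t)) = 0.

(* The impermeability condition in its pointwise form, which is the one that
   applies to Hoelder continuous velocities. *)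
Definition impermeable (Omega : set 'rV[R]_3) (T : R)
    (u : R -> 'rV[R]_3 -> 'rV[R]_3) : Prop :=
  {ae mu, forall t, `]0, T[%classic t -> forall x, boundary Omega x ->
    \sum_i btrace Omega (fun y => u t y 0 i) x * outward_normal Omega x 0 i
    = 0}.

Definition weak_solution (Omega : set 'rV[R]_3) (T : R)
    (u : R -> 'rV[R]_3 -> 'rV[R]_3) (p : R -> 'rV[R]_3 -> R) : Prop :=
  [/\ Linfty_L2 Omega T u, Linfty_L1 Omega T p,
      weak_momentum Omega T u p, weak_div_free Omega T u &
      impermeable Omega T u].

Definition modified_pressure (Omega : set 'rV[R]_3) (phi : 'rV[R]_3 -> R)
    (u : R -> 'rV[R]_3 -> 'rV[R]_3) (p : R -> 'rV[R]_3 -> R)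
    (t : R) (x : 'rV[R]_3) : R :=
  p t x + phi x * dot (u t x) (normal_ext Omega x) ^+ 2.

Definition normal_derivative (Omega : set 'rV[R]_3) (f : 'rV[R]_3 -> R)
    (x : 'rV[R]_3) : R :=
  \sum_i outward_normal Omega x 0 i * btrace Omega (partial i f) x.

End Euler.

(* Main.v *)
Require Import Defs.
From HB Require Import structures.
From mathcomp Require Import all_boot all_order all_algebra.
From mathcomp Require Import all_classical all_reals all_analysis.
From mathcomp Require Import ring lra measurable_realfun.
Set Implicit Arguments.
Unset Strict Implicit.
Unset Printing Implicit Defensive.
Import Order.TTheory GRing.Theory Num.Theory.
Import numFieldNormedType.Exports.
Local Open Scope classical_set_scope.
Local Open Scope ring_scope.

(** On the boundary [P] equals [p], because [u . n] tends to 0 there by impermeability, and the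
    terms with [phi (u . n)^2] are the same on both sides.  So the claim is that for almost every
    [t] and all [Phi]
      [int_Omega (u (x) u : D^2 Phi + p Delta Phi) = int_(boundary Omega) p dn Phi].
    Let [eta_n] be cut-offs supported in [Omega] that tend to 1 and are, near the boundary, sums of
    [psi_i S(n * height_i)] for a partition of unity [psi_i] and the chart defining functions
    [height_i].  The momentum equation tested with [theta(t) eta_n grad Phi] gives a bulk term
    [eta_n (u (x) u : D^2 Phi + p Delta Phi)], a layer term
    [(u (u . grad Phi) + p grad Phi) . grad eta_n] and a term [theta' eta_n u . grad Phi].  The
    second converges to minus the flux of the traces through the boundary, that is to
    [- int p dn Phi] by impermeability.  By the divergence equation tested with
    [theta' eta_n Phi], the third equals a layer term [- theta' Phi u . grad eta_n], whose limit is
    a flux that vanishes by impermeability.  This gives the identity for each [Phi] off a null set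
    of times; since bulk and layer terms are bounded by the sup norm of the first two derivatives
    of [Phi], uniformly in [n], a countable dense family of potentials yields a common null set.
    The surface integral does not depend on the atlas: for smooth fields it is the integral of the
    divergence, and continuous fields are uniform limits of smooth ones. *)

(** * Calculus of C^m functions *)

Section CkTheory.
Context {R : realType}.

(** The field [eta_n grad Phi] is not a legitimate test field: the charts are only C^4 and Phi is
    smooth only inside Omega, while the weak formulations accept smooth fields alone. Both equations
    are therefore first extended to C^1 fields with compact support in Omega, by approximation in
    the C^1 norm. The bounds on u and p hold for almost every t. Replacing both by 0 outside Omega
    and outside a measurable set of good times turns them into statements about all t with uniform
    bounds, so that only bounded functions on sets of finite measure have to be integrated. At the
    boundary the explicit form of the layers does the work: in a chart, the derivative of a layer is
    an approximate identity in the vertical variable times a conormal that depends on the horizontal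
    variables alone. The L1 norm of this kernel is bounded uniformly in n, so the limit follows from
    continuity up to the boundary, which the Hoelder bound provides. *)

Lemma near_eq_differentiable (V W : normedModType R) (f g : V -> W) (x : V) :
  (\near x, f x = g x) -> differentiable f x -> differentiable g x.
Proof.
move=> fg df.
have h0 : \forall y \near x, (g - f) y = 0.
  near=> y; have e : f y = g y by near: y.
  by rewrite -[LHS]/(g y - f y) e subrr.
have gx : (g - f) x = 0 by exact: nbhs_singleton h0.
have eqh : (g - f) \o shift x = cst ((g - f) x) + (\0 : V -> W) +o_ 0 id.
  apply/eqaddoP => _/posnumP[e].
  rewrite gx; near=> y.
  have -> : ((g - f) \o shift x - (cst 0 + (\0 : V -> W))) y = (g - f) (y + x).
    by rewrite -[LHS]/((g - f) (y + x) - (0 + 0)) addr0 subr0.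
  have -> : (g - f) (y + x) = 0.
    near: y; have := h0; rewrite (near_shift 0) /= subr0 => h1.
    by apply: filterS h1 => y.
  by rewrite normr0 mulr_ge0.
have d0 : continuous (\0 : V -> W) by apply: cst_continuous.
have e0 := diff_unique d0 eqh.
have dh : differentiable (g - f) x.
  by apply/diff_locallyP; rewrite e0.
have -> : g = f + (g - f) by rewrite addrC subrK.
exact: differentiableD.
Unshelve. all: by end_near. Qed.

Section general.
Context {V W : normedModType R}.

Lemma Ck0P (A : set V) (f : V -> W) :
  Ck 0 A f <-> forall x, A x -> {for x, continuous f}.
Proof.
split=> [h x Ax|h vs x Ax]; first by have [_] := h [::] x Ax; exact.
by split=> //; rewrite leqn0 size_eq0 => /eqP ->; exact: h.
Qed.

(** The recursion behind the closure properties below. [foldr] differentiates along the last vector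
    of the list first, so passing from f to ['D_v f] removes a vector at the end of the list. *)
Lemma CkSP m (A : set V) (f : V -> W) :
  Ck m.+1 A f <-> (forall x, A x -> differentiable f x) /\
                  (forall v, Ck m A ('D_v f)).
Proof.
split=> [h|[h1 h2] vs x Ax].
  split=> [x Ax|v vs x Ax]; first by have [+ _] := h [::] x Ax; exact.
  have [] := h (rcons vs v) x Ax.
  by rewrite size_rcons !ltnS /iter_derive foldr_rcons.
case/lastP: vs => [|vs v]; first by split=> _; [|apply: differentiable_continuous]; apply: h1.
have [] := h2 v vs x Ax.
by rewrite size_rcons !ltnS /iter_derive foldr_rcons.
Qed.

Lemma CkW m n (A : set V) (f : V -> W) : (m <= n)%N -> Ck n A f -> Ck m A f.
Proof.
move=> mn h vs x Ax; have [h1 h2] := h vs x Ax.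
by split=> sz; [apply: h1|apply: h2]; [exact: leq_trans sz mn|exact: leq_trans sz mn].
Qed.

Lemma Ck_continuous m (A : set V) (f : V -> W) x :
  Ck m A f -> A x -> {for x, continuous f}.
Proof. by move=> /(CkW (leq0n _)) /Ck0P h Ax; exact: h. Qed.

Lemma CkS_differentiable m (A : set V) (f : V -> W) x :
  Ck m.+1 A f -> A x -> differentiable f x.
Proof. by move=> /CkSP[h _]; exact: h. Qed.

Lemma CkS_derive m (A : set V) (f : V -> W) v : Ck m.+1 A f -> Ck m A ('D_v f).
Proof. by move=> /CkSP[]. Qed.

Lemma sub_Ck m (A B : set V) (f : V -> W) : B `<=` A -> Ck m A f -> Ck m B f.
Proof. by move=> BA h vs x Bx; exact: h (BA _ Bx). Qed.

Lemma CkU m (A B : set V) (f : V -> W) : Ck m A f -> Ck m B f -> Ck m (A `|` B) f.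
Proof. by move=> hA hB vs x [Ax|Bx]; [exact: hA|exact: hB]. Qed.

Lemma open_near_eq (A : set V) (f g : V -> W) x : open A -> A x ->
  (forall y, A y -> f y = g y) -> \forall y \near x, f y = g y.
Proof. by move=> oA Ax fg; apply: filterS (open_nbhs_nbhs (conj oA Ax)). Qed.

Lemma eq_derive_open (A : set V) (f g : V -> W) v : open A ->
  (forall y, A y -> f y = g y) -> forall y, A y -> 'D_v f y = 'D_v g y.
Proof. by move=> oA fg y Ay; apply: near_eq_derive; exact: (open_near_eq oA). Qed.

Lemma near_eq_continuous_for (f g : V -> W) x : (\near x, f x = g x) ->
  {for x, continuous f} -> {for x, continuous g}.
Proof.
move=> fg cf; rewrite /prop_for/continuous_at -(nbhs_singleton fg).
by apply: cvg_trans cf; apply: near_eq_cvg.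
Qed.

Lemma eq_Ck m (A : set V) (f g : V -> W) : open A ->
  (forall x, A x -> f x = g x) -> Ck m A f -> Ck m A g.
Proof.
move=> oA; elim: m f g => [|m IH] f g fg.
  move=> /Ck0P h; apply/Ck0P => x Ax; apply: near_eq_continuous_for (h _ Ax).
  exact: (open_near_eq oA).
move=> /CkSP[h1 h2]; apply/CkSP; split=> [x Ax|v].
  by apply: near_eq_differentiable (h1 _ Ax); exact: (open_near_eq oA).
by apply: IH (h2 v); exact: eq_derive_open.
Qed.

Lemma Ck_cst m (A : set V) (c : W) : Ck m A (cst c).
Proof.
elim: m c => [|m IH] c; first by apply/Ck0P => x _; exact: cst_continuous.
apply/CkSP; split=> [x _|v]; first exact: differentiable_cst.
have -> : 'D_v (cst c : V -> W) = cst 0 by apply/funext => x; rewrite derive_cst.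
exact: IH.
Qed.

Lemma CkD m (A : set V) (f g : V -> W) : open A ->
  Ck m A f -> Ck m A g -> Ck m A (f + g).
Proof.
move=> oA; elim: m f g => [|m IH] f g.
  move=> /Ck0P hf /Ck0P hg; apply/Ck0P => x Ax.
  by apply: continuousD; [exact: hf|exact: hg].
move=> /CkSP[f1 f2] /CkSP[g1 g2]; apply/CkSP; split=> [x Ax|v].
  by apply: differentiableD; [exact: f1|exact: g1].
apply: (@eq_Ck _ _ ('D_v f + 'D_v g)) => //; last exact: IH.
move=> x Ax; rewrite deriveD //; apply: diff_derivable; [exact: f1|exact: g1].
Qed.

Lemma Ck_sum m (A : set V) (I : Type) (r : seq I) (P : pred I) (F : I -> V -> W) :
  open A -> (forall i, P i -> Ck m A (F i)) -> Ck m A (\sum_(i <- r | P i) F i).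
Proof.
move=> oA h; elim/big_ind : _ => //; first exact: Ck_cst.
by move=> *; exact: CkD.
Qed.

Lemma derive_bigsum (I : Type) (r : seq I) (P : pred I) (F : I -> V -> W) x v :
  (forall i, P i -> derivable (F i) x v) ->
  derivable (\sum_(i <- r | P i) F i) x v /\
  'D_v (\sum_(i <- r | P i) F i) x = \sum_(i <- r | P i) 'D_v (F i) x.
Proof.
move=> h; elim: r => [|i r [IH1 IH2]].
  by rewrite !big_nil; split; [exact: derivable_cst|exact: derive_cst].
rewrite !big_cons; have [Pi|Pi] := boolP (P i); last by [].
by split; [apply: derivableD => //; exact: h|rewrite deriveD ?IH2//; exact: h].
Qed.

Lemma Ck_linear m (A : set V) (f : {linear V -> W}) : continuous f -> Ck m A f.
Proof.
move=> cf; case: m => [|m]; first by apply/Ck0P => x _; exact: cf.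
apply/CkSP; split=> [x _|v]; first exact: linear_differentiable.
have -> : 'D_v f = cst (f v).
  apply/funext => x; rewrite deriveE ?diff_lin//.
  exact: linear_differentiable.
exact: Ck_cst.
Qed.

End general.

Lemma Ck_coord m n (A : set 'rV[R]_n) (j : 'I_n) :
  Ck m A (fun x : 'rV[R]_n => x 0 j).
Proof.
have lc : linear (fun x : 'rV[R]_n => x 0 j : R).
  by move=> a u v; rewrite !mxE.
pose L : {linear 'rV[R]_n -> R} := HB.pack (fun x : 'rV[R]_n => x 0 j : R)
  (GRing.isLinear.Build _ _ _ _ _ lc).
by apply: (@Ck_linear _ _ m A L) => x; exact: coord_continuous.
Qed.

Lemma Ck_id m (V : normedModType R) (A : set V) : Ck m A (id : V -> V).
Proof.
by apply: (@Ck_linear _ _ _ _ (idfun : {linear V -> V})) => x; exact: cvg_id.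
Qed.

(** The vector is constant because this serves to assemble a vector field from its scalar components
    and the basis vectors. *)
Lemma CkZ m (V W : normedModType R) (A : set V) (f : V -> R) (g : V -> W) : open A ->
  Ck m A f -> (exists w, g = cst w) -> Ck m A (fun x => f x *: g x).
Proof.
move=> oA + [w ->].
rewrite (_ : (fun x => f x *: cst w x) = ( *:%R^~ w) \o f) //.
elim: m f => [|m IH] f.
  move=> /Ck0P hf; apply/Ck0P => x Ax.
  by apply: continuousZl; exact: hf.
move=> /CkSP[f1 f2]; apply/CkSP; split=> [x Ax|v].
  by apply: differentiableZl; exact: f1.
apply: (@eq_Ck _ _ _ _ ( *:%R^~ w \o 'D_v f)) => //; last exact: IH.
move=> x Ax /=; have df := f1 _ Ax.
have dZ : differentiable ( *:%R^~ w \o f) x by exact: differentiableZl.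
by rewrite !deriveE// (diffZl w df).
Qed.

Lemma CkM m (V : normedModType R) (A : set V) (f g : V -> R) : open A ->
  Ck m A f -> Ck m A g -> Ck m A (f * g).
Proof.
move=> oA; elim: m f g => [|m IH] f g.
  move=> /Ck0P hf /Ck0P hg; apply/Ck0P => x Ax.
  by apply: continuousM; [exact: hf|exact: hg].
move=> hf hg; have /CkSP[f1 f2] := hf; have /CkSP[g1 g2] := hg.
apply/CkSP; split=> [x Ax|v].
  by apply: differentiableM; [exact: f1|exact: g1].
apply: (@eq_Ck _ _ _ _ (f * 'D_v g + g * 'D_v f)) => //.
  move=> x Ax; rewrite deriveM //; apply: diff_derivable; [exact: f1|exact: g1].
by apply: CkD => //; apply: IH => //; apply: CkW (leqnSn _) _.
Qed.

Lemma Ck_prod m (V : normedModType R) (A : set V) (I : Type) (r : seq I) (P : pred I)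
    (F : I -> V -> R) : open A ->
  (forall i, P i -> Ck m A (F i)) -> Ck m A (fun x => \prod_(i <- r | P i) F i x).
Proof.
move=> oA h.
elim: r => [|i r IH].
  by rewrite (_ : (fun x => _) = cst 1) ?big_nil; [exact: Ck_cst|apply/funext => x; rewrite big_nil].
have [Pi|Pi] := boolP (P i).
  rewrite (_ : (fun x => _) = F i * (fun x => \prod_(i <- r | P i) F i x)).
    by apply: CkM => //; exact: h.
  by apply/funext => x; rewrite big_cons Pi.
rewrite (_ : (fun x => _) = (fun x => \prod_(i <- r | P i) F i x)) //.
by apply/funext => x; rewrite big_cons (negPf Pi).
Qed.

Lemma derive_comp1 (V : normedModType R) (S : R -> R) (f : V -> R) x v :
  differentiable f x -> differentiable S (f x) ->
  'D_v (S \o f) x = 'D_1 S (f x) * 'D_v f x.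
Proof.
move=> df dS; rewrite !deriveE//; last exact: differentiable_comp.
rewrite diff_comp //= -[X in 'd S _ X](mulr1 ('d f x v)).
by rewrite -[_ * 1]/(_ *: (1 : R)) linearZ/= mulrC.
Qed.

Lemma Ck_comp1 m (V : normedModType R) (A : set V) (B : set R) (S : R -> R) (f : V -> R) :
  open A -> (forall x, A x -> B (f x)) ->
  Ck m B S -> Ck m A f -> Ck m A (S \o f).
Proof.
move=> oA AB; elim: m S => [|m IH] S.
  move=> /Ck0P hS /Ck0P hf; apply/Ck0P => x Ax.
  by apply: continuous_comp; [exact: hf|apply/hS/AB].
move=> /CkSP[S1 S2] hf; have /CkSP[f1 f2] := hf; apply/CkSP; split=> [x Ax|v].
  by apply: differentiable_comp; [exact: f1|apply/S1/AB].
apply: (@eq_Ck _ _ _ _ (('D_1 S \o f) * 'D_v f)) => //.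
  by move=> x Ax; rewrite derive_comp1 //; [exact: f1|apply/S1/AB].
by apply: CkM => //; apply: IH => //; exact: CkW hf.
Qed.

Lemma derive_comp_linear (U V W : normedModType R) (L : {linear U -> V}) (g : V -> W) x v :
  continuous L -> differentiable g (L x) -> 'D_v (g \o L) x = 'D_(L v) g (L x).
Proof.
move=> cL dg; have dL := @linear_differentiable _ _ _ L x cL.
have dgL : differentiable (g \o L) x by exact: differentiable_comp.
by rewrite !deriveE// diff_comp//= (diff_lin x cL).
Qed.

Lemma Ck_comp_linear m (U V W : normedModType R) (A : set U) (B : set V)
    (L : {linear U -> V}) (g : V -> W) :
  continuous L -> open A -> (forall x, A x -> B (L x)) ->
  Ck m B g -> Ck m A (g \o L).
Proof.
move=> cL oA AB; elim: m g => [|m IH] g.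
  move=> /Ck0P hS; apply/Ck0P => x Ax.
  by apply: continuous_comp; [exact: cL|apply/hS/AB].
move=> /CkSP[g1 g2]; apply/CkSP; split=> [x Ax|v].
  by apply: differentiable_comp; [exact: linear_differentiable|apply/g1/AB].
apply: (@eq_Ck _ _ _ _ ('D_(L v) g \o L)) => //; last exact: IH.
move=> x Ax /=; rewrite derive_comp_linear//; exact: g1 (AB _ Ax).
Qed.

Lemma smooth_derive (V W : normedModType R) (A : set V) (f : V -> W) v :
  smooth A f -> smooth A ('D_v f).
Proof. by move=> h m; apply: CkS_derive; exact: h. Qed.

End CkTheory.

(** * Smooth steps and smooth approximation *)

Section RowNorm.
Context {R : realType}.

Lemma rV_norm_le n (x : 'rV[R]_n) (c : R) : 0 <= c ->
  (forall i, `|x 0 i| <= c) -> `|x| <= c.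
Proof.
move=> c0 h; rewrite [`|x|]mx_normrE; apply/bigmax_leP; split=> // -[i j] _ /=.
by rewrite (ord1 i).
Qed.

Lemma rV_coord_le n (x : 'rV[R]_n) i : `|x 0 i| <= `|x|.
Proof.
by rewrite [`|x|]mx_normrE; apply/bigmax_geP; right; exists (0, i).
Qed.

Lemma rV_norm_lt n (x : 'rV[R]_n) (c : R) : 0 < c ->
  (forall i, `|x 0 i| < c) -> `|x| < c.
Proof.
move=> c0 h; rewrite [`|x|]mx_normrE; apply/bigmax_ltP; split=> // -[i j] _ /=.
by rewrite (ord1 i).
Qed.

Lemma near_dist (V : normedModType R) (x : V) r : 0 < r ->
  \forall y \near x, `|x - y| < r.
Proof. by move=> r0; apply/nbhs_normP; exists r. Qed.

Lemma rV_sum_basis n (v : 'rV[R]_n) : v = \sum_i v 0 i *: basis_vec i.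
Proof. exact: row_sum_delta. Qed.

Lemma derive_partial n (f : 'rV[R]_n -> R) x v : differentiable f x ->
  'D_v f x = \sum_i v 0 i * partial i f x.
Proof.
move=> df; rewrite deriveE// {1}(rV_sum_basis v) linear_sum.
by apply: eq_bigr => i _; rewrite linearZ /partial deriveE.
Qed.

Lemma derive_line (V W : normedModType R) (f : V -> W) a v :
  'D_v f a = 'D_1 (fun t : R => f (t *: v + a)) 0.
Proof.
rewrite /derive.
set F := (X in lim (X @ _)); set G := (X in _ = lim (X @ _)).
suff -> : F = G by [].
by apply/funext => h; rewrite /F/G/= addr0 scale0r add0r [_%:A]mulr1.
Qed.

Lemma mean_value_rV n (f : 'rV[R]_n -> R) (x z : 'rV[R]_n) :
  (forall y, differentiable f y) ->
  exists2 y, `|y - z| <= `|x - z| &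
    f x - f z = \sum_i (x - z) 0 i * partial i f y.
Proof.
move=> df; pose g (t : R) := f (t *: (x - z) + z).
have dg (t : R) : is_derive t (1 : R) g ('D_(x - z) f (t *: (x - z) + z)).
  have dl : differentiable (fun t : R => t *: (x - z) + z) t.
    by apply: differentiableD => //; apply: differentiableZl.
  have dg : differentiable g t by apply: (differentiable_comp dl).
  apply: DeriveDef; first exact: diff_derivable.
  rewrite (derive_line f) (derive_line g).
  suff -> : (fun s : R => g (s *: (1 : R) + t)) =
     (fun s : R => f (s *: (x - z) + (t *: (x - z) + z))) by [].
  by apply/funext => s; rewrite /g [s *: 1]mulr1 scalerDl addrA.
have [c cI] : exists2 c, c \in `[0, 1] &
    g 1 - g 0 = 'D_(x - z) f (c *: (x - z) + z) * (1 - 0).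
  apply: MVT_segment => //.
  by apply: derivable_within_continuous => t _; have [] := dg t.
rewrite /g scale1r scale0r subrK add0r subr0 mulr1 => e.
exists (c *: (x - z) + z); last by rewrite e derive_partial.
move: cI; rewrite in_itv/= => /andP[c0 c1].
by rewrite addrK normrZ ger0_norm// ler_piMl.
Qed.

(** Only x is taken in K: continuity at the points of K is that of f on the whole space, so y may
    lie outside. This covers pairs of points across the edge of a compact support. *)
Lemma compact_continuous_near n (K : set 'rV[R]_n) (f : 'rV[R]_n -> R) e :
  compact K -> (forall x, K x -> {for x, continuous f}) -> 0 < e ->
  exists2 d, 0 < d & forall x y, K x -> `|x - y| < d -> `|f x - f y| < e.
Proof.
move=> /compact_near_coveringP cK cf e0.
pose P (d : R) (x : 'rV[R]_n) := forall y, `|x - y| < d -> `|f x - f y| < e.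
have : \forall d \near 0^'+, K `<=` P d.
  apply: cK => x Kx.
  have := cf x Kx; move/cvgrPdist_lt/(_ (e / 2)); rewrite divr_gt0// => /(_ isT).
  move=> /nbhs_normP[r /= r0 hr].
  near=> x' d.
  have x'x : `|x - x'| < r / 2.
    by near: x'; apply: (@near_dist 'rV[R]_n x); rewrite divr_gt0.
  have dr : d < r / 2.
    by near: d; apply: nbhs_right_lt; rewrite divr_gt0.
  move=> y x'y.
  rewrite (splitr e) (le_lt_trans (ler_distD (f x) _ _))//.
  rewrite ltrD//.
    by rewrite distrC; apply: hr; rewrite /= /ball_ (lt_trans x'x)// ltr_pdivrMr// ltr_pMr// ltr1n.
  apply: hr; rewrite /= /ball_ (splitr r) (le_lt_trans (ler_distD x' _ _))// ltrD//.
  exact: lt_trans dr.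
move=> h; near (0 : R)^'+ => d; exists d; first by [].
have : K `<=` P d by near: d.
by move=> h' x y Kx; exact: h'.
Unshelve. all: by end_near. Qed.

End RowNorm.

Section Step.
Context {R : realType}.

Definition smooth_step (S : R -> R) :=
  [/\ @smooth R R R setT S, forall x, x <= 0 -> S x = 0,
      forall x, 1 <= x -> S x = 1 & {homo S : x y / x <= y}].

(** The step is read off from the given profile: [1 - phit] climbs from 0 at [delta] to 1 at
    [2 * delta], and the argument [delta * (1 + x)] moves this range to [0, 1]. The explicit value 0
    to the left of -1/2 keeps the argument positive, since the profile is assumed smooth only
    there. *)
Lemma exists_smooth_step (delta : R) (phit : R -> R) : 0 < delta ->
  cutoff_profile delta phit -> exists S, smooth_step S.
Proof.
move=> d0 [sm p01 pdec p1 p0].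
pose S x := if x < - 2^-1 then 0 else 1 - phit (delta * (1 + x)).
have SE x : -1 < x -> S x = 1 - phit (delta * (1 + x)).
  move=> x1; rewrite /S; case: ifPn => // xh.
  rewrite p1 ?subrr//; apply/andP; split; first by rewrite mulr_ge0 ?ltW//; lra.
  by rewrite ger_pMr//; lra.
have S0 x : x <= 0 -> S x = 0.
  move=> x0; rewrite /S; case: ifPn => //; rewrite -leNgt => xh.
  rewrite p1 ?subrr//; apply/andP; split; first by rewrite mulr_ge0 ?ltW//; lra.
  by rewrite ger_pMr//; lra.
exists S; split => //.
- move=> m.
  (* The formula is smooth on the first open set, and S is 0 on the second; together they cover the
     line. *)
  have -> : [set: R] = [set x | -1 < x] `|` [set x | x < 0].
    by apply/seteqP; split => // x _; have [x0|x0] := ltP x 0; [right|left => /=; lra].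
  apply: CkU; last first.
    apply: (@eq_Ck _ R R _ _ (cst 0)) => //.
      by move=> x /= x0; rewrite S0 ?ltW.
    exact: Ck_cst.
  have o1 : open [set x : R | -1 < x] by exact: open_gt.
  apply: (@eq_Ck _ R R _ _ (cst 1 + (cst (-1) * (phit \o (cst delta * (cst 1 + id)))))) => //.
    by move=> x /= x0; rewrite SE//= -[LHS]/(1 + (-1) * phit (delta * (1 + x))) mulN1r.
  apply: CkD => //; first exact: Ck_cst.
  apply: CkM => //; first exact: Ck_cst.
  apply: (@Ck_comp1 _ _ _ _ `]0, +oo[%classic) => //.
    by move=> x /= x1; rewrite in_itv/= andbT -[ltRHS]/(delta * (1 + x)) mulr_gt0//; lra.
  apply: CkM => //; first exact: Ck_cst.
  apply: CkD => //; first exact: Ck_cst.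
  exact: (@Ck_id _ _ _).
- move=> x x1; rewrite SE; last lra.
  by rewrite p0 ?subr0// mulrC ler_pM2l//; lra.
- move=> x y xy; have [x0|x0] := leP x 0.
    rewrite S0//; rewrite /S; case: ifPn => //; rewrite -leNgt => yh.
    rewrite subr_ge0; have /andP[//] : 0 <= phit (delta * (1 + y)) <= 1.
    by apply: p01; rewrite mulr_ge0 ?ltW//; lra.
  rewrite !SE ?lerD2l ?lerN2; [|lra|lra].
  by apply: pdec; [rewrite mulr_ge0 ?ltW//; lra|rewrite ler_pM2l//; lra].
Qed.

Variable S : R -> R.
Hypothesis hS : smooth_step S.

Let Ssm : @smooth R R R setT S. Proof. by have [] := hS. Qed.
Let S0 x : x <= 0 -> S x = 0. Proof. by have [_ h _ _] := hS; exact: h. Qed.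
Let S1 x : 1 <= x -> S x = 1. Proof. by have [_ _ h _] := hS; exact: h. Qed.
Let Sle : {homo S : x y / x <= y}. Proof. by have [_ _ _ h] := hS; exact: h. Qed.

Lemma step_ge0 x : 0 <= S x.
Proof.
have [x0|x0] := leP x 0; first by rewrite S0.
by rewrite -(S0 (lexx 0)); apply/Sle/ltW.
Qed.

Lemma step_le1 x : S x <= 1.
Proof.
have [x0|x0] := leP 1 x; first by rewrite S1.
by rewrite -(S1 (lexx 1)); apply/Sle/ltW.
Qed.

Lemma step_Ck m : Ck m setT S. Proof. exact: Ssm. Qed.

Lemma step_differentiable x : differentiable S x.
Proof. exact: (CkS_differentiable (step_Ck 1)). Qed.

Lemma step_derive_continuous : continuous ('D_1 S).
Proof. by move=> x; apply: (@Ck_continuous _ _ _ 0 setT) => //; exact: CkS_derive (step_Ck 1). Qed.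

Lemma step_derive0 x : (x < 0) || (1 < x) -> 'D_1 S x = 0.
Proof.
move=> /orP[x0|x1].
  rewrite (@near_eq_derive _ _ _ _ (cst 0)) ?derive_cst//.
  by near=> y; rewrite S0//; near: y; exact: lt_le_nbhsl.
rewrite (@near_eq_derive _ _ _ _ (cst (1 : R))) ?derive_cst//.
by near=> y; rewrite S1//; near: y; exact: lt_le_nbhsr.
Unshelve. all: by end_near. Qed.

Lemma step_derive_bound : exists2 C, 0 < C & forall x, `|'D_1 S x| <= C.
Proof.
have [|c _ hc] := @EVT_max R (fun x => `|'D_1 S x|) 0 1 ler01.
  apply: continuous_subspaceT => x.
  by apply: cvg_norm; exact: step_derive_continuous.
exists (`|'D_1 S c| + 1); first by rewrite ltr_wpDl.
move=> x; have [xI|xI] := boolP (x \in `[0, 1]).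
  by rewrite (le_trans (hc _ xI))// lerDl.
rewrite step_derive0 ?normr0 ?addr_ge0//.
by move: xI; rewrite in_itv/= negb_and -!ltNge.
Qed.

(** A bump supported in [0, 2]. Its integer translates telescope, so they form a partition of unity
    without normalisation. *)
Definition hat (x : R) := S x - S (x - 1).

Lemma hat_ge0 x : 0 <= hat x.
Proof. by rewrite subr_ge0; apply: Sle; lra. Qed.

Lemma hat_supp x : hat x != 0 -> 0 <= x <= 2.
Proof.
apply: contraNT; rewrite negb_and -!ltNge => /orP[h|h]; rewrite /hat.
  by rewrite !S0 ?subrr//; lra.
by rewrite !S1 ?subrr//; lra.
Qed.

Lemma hatE : hat = S + (cst (-1) * (S \o (cst (-1) + id))).
Proof.
apply/funext => x; rewrite /hat -[RHS]/(S x + (-1) * S (-1 + x)).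
by rewrite mulN1r addrC [-1 + x]addrC [RHS]addrC.
Qed.

Lemma hat_Ck m : Ck m setT hat.
Proof.
rewrite hatE; apply: CkD; [exact: openT|exact: step_Ck|].
apply: CkM; [exact: openT|exact: Ck_cst|].
apply: (@Ck_comp1 _ _ _ _ setT) => //; [exact: openT|].
by apply: CkD; [exact: openT|exact: Ck_cst|exact: (@Ck_id _ _ _)].
Qed.

Lemma hat_derive0 x : (x < 0) || (2 < x) -> 'D_1 hat x = 0.
Proof.
have hn y : (y < 0) || (2 < y) -> hat y = 0.
  by move=> h; apply/eqP; apply: contraTT h => /hat_supp; rewrite negb_or -!leNgt.
move=> /orP[x0|x1]; rewrite (@near_eq_derive _ _ _ _ (cst 0)) ?derive_cst//.
  near=> y; rewrite hn//; apply/orP; left; near: y; exact: lt_nbhsl.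
near=> y; rewrite hn//; apply/orP; right; near: y; exact: lt_nbhsr.
Unshelve. all: by end_near. Qed.

Lemma hat_derive_bound : exists2 C, 0 < C & forall x, `|'D_1 hat x| <= C.
Proof.
have ch : continuous ('D_1 hat).
  move=> x; apply: (@Ck_continuous _ _ _ 0 setT) => //.
  exact: CkS_derive (hat_Ck 1).
have [|c _ hc] := @EVT_max R (fun x => `|'D_1 hat x|) 0 2 (ler0n _ 2).
  apply: continuous_subspaceT => x.
  by apply: cvg_norm; exact: ch.
exists (`|'D_1 hat c| + 1); first by rewrite ltr_wpDl.
move=> x; have [xI|xI] := boolP (x \in `[0, 2]).
  by rewrite (le_trans (hc _ xI))// lerDl.
rewrite hat_derive0 ?normr0 ?addr_ge0//.
by move: xI; rewrite in_itv/= negb_and -!ltNge.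
Qed.

Lemma sum_step_telescope (n : nat) (s : R) :
  \sum_(a < n) (S (s - a%:R) - S (s - a%:R - 1)) = S s - S (s - n%:R).
Proof.
elim: n => [|n IH]; first by rewrite big_ord0 subr0 subrr.
by rewrite big_ord_recr/= IH addrA subrK -addrA -opprD (natr1 n).
Qed.

Lemma sum_hat (N : nat) (s : R) : 1 - N%:R <= s <= N%:R ->
  \sum_(a < N + N) hat (s + N%:R - a%:R) = 1.
Proof.
move=> /andP[h1 h2]; rewrite sum_step_telescope S1; last lra.
by rewrite S0 ?subr0// natrD; lra.
Qed.

(** Instead of counting overlapping translates, ['D_1 hat] at t is dominated by C times S(t + 1) -
    S(t - 2), which is nonnegative and equals 1 on the support [0, 2]. This difference splits into
    three telescoping sums, each at most 1. *)
Lemma sum_hat_derive : exists2 K, 0 < K & forall (n : nat) (s : R),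
  \sum_(a < n) `|'D_1 hat (s - a%:R)| <= K.
Proof.
have [C C0 hC] := hat_derive_bound.
exists (C * 3); first by rewrite mulr_gt0.
move=> n s.
have tele t : \sum_(a < n) (S (t - a%:R) - S (t - a%:R - 1)) <= 1.
  rewrite sum_step_telescope.
  by have := step_ge0 (t - n%:R); have := step_le1 t; lra.
apply: (@le_trans _ _ (\sum_(a < n) C * ((S (s + 1 - a%:R) - S (s + 1 - a%:R - 1)) +
   (S (s - a%:R) - S (s - a%:R - 1)) + (S (s - 1 - a%:R) - S (s - 1 - a%:R - 1))))).
  apply: ler_sum => a _.
  have -> : s + 1 - a%:R - 1 = s - a%:R by lra.
  have -> : s - 1 - a%:R = s - a%:R - 1 by lra.
  have -> : s + 1 - a%:R = s - a%:R + 1 by lra.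
  move: (s - a%:R) => t.
  rewrite [X in C * X](_ : _ = S (t + 1) - S (t - 1 - 1)); last lra.
  have [tI|tI] := boolP (0 <= t <= 2).
    move: tI => /andP[t0 t2].
    by rewrite S1 ?S0 ?subr0 ?mulr1//; lra.
  rewrite hat_derive0; last by move: tI; rewrite negb_and -!ltNge.
  by rewrite normr0 mulr_ge0 ?(ltW C0)// subr_ge0; apply: Sle; lra.
rewrite -mulr_sumr ler_pM2l// 2!big_split/=.
have := tele (s + 1); have := tele s; have := tele (s - 1); lra.
Qed.

End Step.

(** * Partitions of unity on a cubic grid *)

Section Cells.
Context {R : realType}.
Variable S : R -> R.
Hypothesis hS : smooth_step S.
Notation E := 'rV[R]_3.
Notation hat := (hat S).
Variables (h : R) (N : nat).
Hypothesis h0 : 0 < h.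

(** The corner with the smallest coordinates of the cube of side 2h that carries [cell m]. *)
Definition cell_node (m : {ffun 'I_3 -> 'I_(N + N)}) : E :=
  \row_j (h * ((m j)%:R - N%:R)).

Definition cell (m : {ffun 'I_3 -> 'I_(N + N)}) (x : E) : R :=
  \prod_(j < 3) hat (x 0 j / h + N%:R - (m j)%:R).

Lemma Ck_cell k m : Ck k setT (cell m).
Proof.
have oT : open [set: E] by exact: openT.
have := @Ck_prod R k E setT 'I_3 (index_enum _) xpredT
  (fun j x => hat (x 0 j / h + N%:R - (m j)%:R)) oT; apply => j _.
rewrite (_ : (fun x => _) =
    hat \o ((fun x : E => x 0 j) * cst h^-1 + cst (N%:R - (m j)%:R))); last first.
  by apply/funext => x /=; congr (hat _); rewrite -addrA.
apply: (@Ck_comp1 _ k _ setT setT) => //; first exact: hat_Ck.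
apply: CkD => //; last exact: Ck_cst.
by apply: CkM => //; [exact: Ck_coord|exact: Ck_cst].
Qed.

Lemma cell_ge0 m x : 0 <= cell m x.
Proof. by apply: prodr_ge0 => j _; exact: hat_ge0. Qed.

Lemma cell_supp m x : cell m x != 0 -> `|x - cell_node m| <= h * 2.
Proof.
move=> /prodf_neq0 hm; apply: rV_norm_le => [|j]; first by rewrite mulr_ge0// ltW.
have /(hat_supp hS)/andP[a b] := hm j isT.
rewrite !mxE ler_norml; apply/andP; split.
  rewrite -subr_ge0 opprK; have := mulr_ge0 (ltW h0) a.
  rewrite mulrBr mulrDr mulrCA divff ?gt_eqF// mulr1.
  by have := ltW h0; nra.
have : h * (x 0 j / h + N%:R - (m j)%:R) <= h * 2 by rewrite ler_pM2l.
by rewrite mulrBr mulrDr mulrCA divff ?gt_eqF// mulr1; nra.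
Qed.

Lemma cell_inE (x : E) j : `|x| <= h * (N%:R - 1) -> 1 - N%:R <= x 0 j / h <= N%:R.
Proof.
move=> hx; have := le_trans (rV_coord_le x j) hx; rewrite ler_norml => /andP[a b].
rewrite ler_pdivlMr// ler_pdivrMr//; move: a b; rewrite mulrBr mulrBl mul1r mulr1.
rewrite [N%:R * h]mulrC => a b; apply/andP; split; first by rewrite -opprB.
by rewrite (le_trans b)// gerBl ltW.
Qed.

Lemma sum_cell x : `|x| <= h * (N%:R - 1) -> \sum_m cell m x = 1.
Proof.
move=> hx; rewrite -(bigA_distr_bigA (fun j a => hat (x 0 j / h + N%:R - (a : 'I_(N + N))%:R))).
by rewrite big1// => j _; rewrite sum_hat//; exact: cell_inE.
Qed.

Lemma partial_cell m x j : partial j (cell m) x =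
  h^-1 * 'D_1 hat (x 0 j / h + N%:R - (m j)%:R) *
  \prod_(i < 3 | i != j) hat (x 0 i / h + N%:R - (m i)%:R).
Proof.
rewrite /partial derive_line.
set P := \prod_(i < 3 | i != j) _.
set s := x 0 j / h + N%:R - (m j)%:R.
pose A : R -> R := cst h^-1 * id + cst s.
have -> : (fun t : R => cell m (t *: basis_vec j + x)) = cst P * (hat \o A).
  apply/funext => t; rewrite /cell (bigD1 j)//= mulrC; congr (_ * _).
    apply: eq_bigr => i ij; rewrite !mxE eqxx/= (negPf ij) mulr0 add0r//.
  congr (hat _); rewrite !mxE !eqxx mulr1 -[RHS]/(h^-1 * t + s) /s.
  by rewrite mulrDl [t / h]mulrC !addrA.
have dA t : differentiable A t.
  by apply: differentiableD => //; apply: differentiableM.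
have dh t : differentiable hat t by exact: (CkS_differentiable (hat_Ck hS 1)).
have dhA : differentiable (hat \o A) 0 by exact: differentiable_comp.
rewrite deriveM; [|exact: derivable_cst|exact: diff_derivable].
rewrite derive_cst scaler0 addr0 derive_comp1//.
have -> : 'D_1 A 0 = h^-1.
  rewrite deriveD; [|by apply: diff_derivable; apply: differentiableM|exact: derivable_cst].
  rewrite derive_cst addr0 deriveM; [|exact: derivable_cst|exact: derivable_id].
  by rewrite derive_cst derive_id scaler0 addr0 [_ *: _]mulr1.
have -> : A 0 = s by rewrite -[LHS]/(h^-1 * 0 + s) mulr0 add0r.
by rewrite [LHS]mulrC [h^-1 * _]mulrC.
Qed.

Lemma cell_near0 m x : h * 2 < `|x - cell_node m| -> \forall y \near x, cell m y = 0.
Proof.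
move=> hx; pose r := `|x - cell_node m| - h * 2.
have r0 : 0 < r by rewrite subr_gt0.
have := @near_dist R 'rV[R]_3 x _ r0; apply: filterS => y xy.
apply/eqP; apply: contraTT isT => /cell_supp yh.
have := ler_distD y x (cell_node m); rewrite /r in xy; lra.
Qed.

Lemma partial_cell_supp m x j : partial j (cell m) x != 0 -> `|x - cell_node m| <= h * 2.
Proof.
apply: contraNT; rewrite -ltNge => /cell_near0 h1.
by rewrite /partial (@near_eq_derive _ _ _ _ (cst 0)) ?derive_cst.
Qed.

Lemma sum_partial_cell0 x j : `|x| < h * (N%:R - 1) -> \sum_m partial j (cell m) x = 0.
Proof.
move=> hx; have dc m y : differentiable (cell m) y by exact: (CkS_differentiable (Ck_cell 1 m)).
transitivity (partial j (fun y => \sum_m cell m y) x).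
  rewrite /partial (_ : (fun y => _) = \sum_m cell m); last first.
    by apply/funext => y; rewrite fct_sumE.
  have dd m : derivable (cell m) x (basis_vec j) by exact: diff_derivable.
  by rewrite (derive_bigsum _ (fun m _ => dd m)).2.
rewrite /partial (@near_eq_derive _ _ _ _ (cst (1 : R))) ?derive_cst//.
have r0 : 0 < h * (N%:R - 1) - `|x| by rewrite subr_gt0.
have := @near_dist R 'rV[R]_3 x _ r0; apply: filterS => y xy.
rewrite sum_cell//.
by have := lerB_dist y x; rewrite distrC; lra.
Qed.

End Cells.

(** The sum over multi-indices is a product of one-dimensional sums: the differentiated factor gives
    at most K, each of the other two gives 1, and the chain rule contributes 1 / h. *)
Lemma sum_partial_cell_bound (R : realType) (S : R -> R) : smooth_step S ->
  exists2 K, 0 < K & forall h N (x : 'rV[R]_3) j, 0 < h -> `|x| <= h * (N%:R - 1) ->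
    \sum_m `|partial j (@cell R S h N m) x| <= K / h.
Proof.
move=> hS; have [K K0 hK] := sum_hat_derive hS; exists K => // h N x j h0 hx.
pose F (i : 'I_3) (a : 'I_(N + N)) := if i == j then `|'D_1 (hat S) (x 0 j / h + N%:R - a%:R)|
   else hat S (x 0 i / h + N%:R - a%:R).
have -> : \sum_m `|partial j (@cell R S h N m) x| = h^-1 * \sum_(m : {ffun 'I_3 -> 'I_(N + N)}) \prod_i F i (m i).
  rewrite mulr_sumr; apply: eq_bigr => m _; rewrite partial_cell// !normrM.
  rewrite [in RHS](bigD1 j)//= {1}/F eqxx mulrA ger0_norm ?invr_ge0 ?ltW//; congr (_ * _).
  rewrite ger0_norm; last by apply: prodr_ge0 => i _; exact: hat_ge0.
  by apply: eq_bigr => i ij; rewrite /F (negPf ij).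
rewrite -bigA_distr_bigA mulrC ler_pM2r ?invr_gt0// (bigD1 j)//= [X in _ * X]big1 ?mulr1.
  by rewrite /F eqxx; exact: hK.
move=> i ij; rewrite /F (negPf ij) sum_hat//; exact: cell_inE h0 _ _ hx.
Qed.

(** * Uniform and C^1 approximation by smooth functions *)

Section Approximation.
Context {R : realType}.
Variable S : R -> R.
Hypothesis hS : smooth_step S.
Notation E := 'rV[R]_3.

Lemma compact_rV_bounded n (K : set 'rV[R]_n) : compact K ->
  exists2 r, 0 < r & forall x, K x -> `|x| < r.
Proof.
move=> /compact_bounded[M [_ hM]]; exists (`|M| + 2); first by rewrite ltr_wpDl.
move=> x Kx; apply: (@le_lt_trans _ _ (`|M| + 1)); last by rewrite ltrD2l ltr1n.
by apply: hM => //; rewrite (le_lt_trans (ler_norm _))// ltrDl.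
Qed.

Lemma tsupport_off (V : topologicalType) (f : V -> R) x : ~ tsupport f x -> f x = 0.
Proof.
by move=> h; apply/eqP/negPn/negP => fx; apply: h; exact: subset_closure.
Qed.

Lemma tsupport_off_near (V : topologicalType) (f : V -> R) x : ~ tsupport f x ->
  \forall y \near x, f y = 0.
Proof.
move=> h; have oC : open (~` tsupport f) by apply: closed_openC; exact: closed_closure.
by apply: filterS (open_nbhs_nbhs (conj oC h)) => y; exact: tsupport_off.
Qed.

Lemma tsupport_sub_closed (V : topologicalType) (f : V -> R) (K : set V) :
  closed K -> (forall x, f x != 0 -> K x) -> tsupport f `<=` K.
Proof. by move=> cK h; rewrite /tsupport closureE => x; apply; split. Qed.

Lemma compact_open_dist n (K A : set 'rV[R]_n) : compact K -> open A -> K `<=` A ->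
  exists2 d, 0 < d & forall x y, K x -> `|x - y| < d -> A y.
Proof.
move=> /compact_near_coveringP cK oA KA.
pose P (d : R) (x : 'rV[R]_n) := forall y, `|x - y| < d -> A y.
have : \forall d \near 0^'+, K `<=` P d.
  apply: cK => x Kx.
  have /nbhs_normP[r /= r0 hr] := open_nbhs_nbhs (conj oA (KA _ Kx)).
  near=> x' d.
  have x'x : `|x - x'| < r / 2.
    by near: x'; apply: (@near_dist _ 'rV[R]_n x); rewrite divr_gt0.
  have dr : d < r / 2.
    by near: d; apply: nbhs_right_lt; rewrite divr_gt0.
  move=> y x'y; apply: hr; rewrite /= /ball_.
  by rewrite (splitr r) (le_lt_trans (ler_distD x' _ _))// ltrD//; exact: lt_trans dr.
move=> h; near (0 : R)^'+ => d; exists d; first by [].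
have : K `<=` P d by near: d.
by move=> h' x y Kx; exact: h'.
Unshelve. all: by end_near. Qed.

Definition near_set n (K : set 'rV[R]_n) (r : R) :=
  [set x | exists2 z, K z & `|x - z| <= r].

Lemma closed_near_set n (K : set 'rV[R]_n) r : compact K -> closed (near_set K r).
Proof.
move=> cK x hx.
have [/eqP K0|/set0P K0] := boolP (K == set0).
  by have [y [[z]]] := hx setT filterT; rewrite K0.
have cf : {within K, continuous (fun z => `|x - z|)}.
  apply: continuous_subspaceT => z.
  have c1 : {for z, continuous (fun z : 'rV[R]_n => x - z)}.
    by apply: (@continuousB _ _ _ (cst x) id); [exact: cst_continuous|exact: cvg_id].
  exact: (continuous_comp c1 (@norm_continuous _ _ _)).
have [z Kz hz] := EVT_min_rV K0 cK cf.
exists z; first exact: set_mem.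
apply/ler_addgt0Pr => e e0.
have [y [[w Kw yw] xy]] := hx _ (@near_dist R 'rV[R]_n x _ e0).
have := hz w (mem_set Kw).
have := ler_distD y x w; lra.
Qed.

Lemma compact_near_set n (K : set 'rV[R]_n) r : compact K -> compact (near_set K r).
Proof.
move=> cK; apply: bounded_closed_compact; last exact: closed_near_set.
have [M M0 hM] := compact_rV_bounded cK.
exists (M + r); split; first by rewrite num_real.
move=> t tM x [z Kz xz]; apply: ltW; apply: le_lt_trans tM.
rewrite -(subrK z x) (le_trans (ler_normD _ _))// addrC lerD// ltW//; exact: hM.
Qed.

Lemma differentiable_coord_affine n (x : 'rV[R]_n) i c p :
  differentiable (((fun x : 'rV[R]_n => x 0 i) + cst c) * cst p) x.
Proof.
apply: differentiableM; last exact: differentiable_cst.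
by apply: differentiableD; [exact: differentiable_coord|exact: differentiable_cst].
Qed.

Lemma derive_affine1 (a b t : R) : 'D_1 (fun t : R => a * t + b) t = a.
Proof.
rewrite (_ : (fun t : R => _) = a *: id + cst b)//.
rewrite deriveD; [|by apply: derivableZ; exact: derivable_id|exact: derivable_cst].
by rewrite derive_cst addr0 deriveZ ?derive_id ?[_ *: _]mulr1//; exact: derivable_id.
Qed.

Lemma derive_coord_affine n (x : 'rV[R]_n) i j c p :
  'D_(basis_vec j) (((fun x : 'rV[R]_n => x 0 i) + cst c) * cst p) x = (i == j)%:R * p.
Proof.
rewrite derive_line (_ : (fun t : R => _) =
  (fun t : R => ((i == j)%:R * p) * t + (x 0 i + c) * p)) ?derive_affine1//.
apply/funext => t; rewrite -[LHS]/(((t *: basis_vec j + x) 0 i + c) * p).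
by rewrite !mxE eqxx/= -addrA mulrDl; rewrite [t * _]mulrC mulrAC.
Qed.

Lemma uniform_approx_smooth (A : set E) (f : E -> R) M e :
  (forall x, A x -> `|x| <= M) ->
  (forall e, 0 < e -> exists2 d, 0 < d & forall x y, A x -> A y -> `|x - y| < d -> `|f x - f y| < e) ->
  0 < e ->
  exists2 g : E -> R, smooth setT g & forall x, A x -> `|g x - f x| <= e.
Proof.
move=> AM uf e0; have [d d0 hd] := uf e e0.
pose h := d / 8; have h0 : 0 < h by rewrite divr_gt0.
have [N hN] : exists N : nat, M <= h * (N%:R - 1).
  exists (Num.bound `|M / h|).+1.
  rewrite -natr1 addrK mulrC -ler_pdivrMr//.
  by rewrite (le_trans (ler_norm _))// ltW// archi_boundP.
(* A sample point of A in reach of the node. The default of [get] concerns only cells that vanish on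
   A. *)
pose y m := get [set y : E | A y /\ `|y - @cell_node R h N m| <= h * 2].
pose g : E -> R := fun x => \sum_m cell S h m x * f (y m).
exists g => [k|x Ax].
  rewrite (_ : g = \sum_m (cell S h m * cst (f (y m)))); last first.
    by apply/funext => x; rewrite fct_sumE.
  have oT : open [set: E] by exact: openT.
  apply: Ck_sum => // m _; apply: CkM => //; [exact: Ck_cell|exact: Ck_cst].
have xN : `|x| <= h * (N%:R - 1) by rewrite (le_trans (AM _ Ax)).
rewrite -[f x]mul1r -(sum_cell hS h0 xN) mulr_suml -sumrB.
rewrite -[e]mul1r -(sum_cell hS h0 xN) mulr_suml.
rewrite (le_trans (ler_norm_sum _ _ _))//; apply: ler_sum => m _.
rewrite -mulrBr normrM ger0_norm ?cell_ge0//.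
have [->|/(cell_supp hS h0) xm] := eqVneq (cell S h m x) 0; first by rewrite !mul0r.
rewrite ler_wpM2l ?cell_ge0//.
have [Ay ym] : A (y m) /\ `|y m - cell_node h m| <= h * 2.
  by apply: (@getPex _ [set y : E | A y /\ `|y - cell_node h m| <= h * 2]); exists x.
rewrite ltW// hd//.
have := ler_distD (cell_node h m) (y m) x; rewrite [`|cell_node h m - x|]distrC.
rewrite /h in xm ym *; lra.
Qed.

(** Glues the affine Taylor polynomials of f at the grid nodes. Derivatives of the cells have size 1
    / h; they meet the error of the polynomials, which is of order h times the oscillation w of the
    gradient, so the mesh size cancels. Locally constant approximations would control the values but
    not the gradient. *)
Lemma C1_approx_smooth (A : set E) (f : E -> R) e : open A ->
  Ck 1 setT f -> compact (tsupport f) -> tsupport f `<=` A -> 0 < e ->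
  exists g : E -> R, [/\ test_function A g, forall x, `|g x - f x| <= e &
    forall j x, `|partial j g x - partial j f x| <= e].
Proof.
move=> oA Cf cK KA e0; set K := tsupport f in cK KA *.
have df y : differentiable f y by exact: (CkS_differentiable Cf).
have cf j : continuous (partial j f).
  by move=> x; apply: (@Ck_continuous _ _ _ 0 setT) => //; exact: CkS_derive Cf.
have K0 x : ~ K x -> f x = 0 /\ forall j, partial j f x = 0.
  move=> /tsupport_off_near f0; split=> [|j]; first exact: nbhs_singleton f0.
  by rewrite /partial (@near_eq_derive _ _ _ _ (cst 0)) ?derive_cst.
have [K1 K10 hK1] := sum_partial_cell_bound hS.
have [d1 d10 hd1] := compact_open_dist cK oA KA.
(* The error will be 6 h w for the function, with h <= 1, and (6 K1 + 1) w for its derivatives; this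
   w makes both at most e. *)
pose w := e / (6 * K1 + 7).
have w0 : 0 < w by rewrite divr_gt0// addr_gt0// mulr_gt0.
have [d d0 hd] : exists2 d, 0 < d & forall j x y, `|x - y| < d ->
    `|partial j f x - partial j f y| <= w.
  have hj j : exists2 d, 0 < d & forall x y, K x -> `|x - y| < d ->
      `|partial j f x - partial j f y| < w.
    by apply: compact_continuous_near => // x _; exact: cf.
  have hj' j : {d : R | 0 < d & forall x y, K x -> `|x - y| < d ->
      `|partial j f x - partial j f y| < w} by apply: cid2.
  pose D := \big[Order.min/1]_j s2val (hj' j).
  exists D.
    apply/bigmin_gtP; split=> // j _; exact: (s2valP (hj' j)).
  move=> j x y xy.
  have xyj : `|x - y| < s2val (hj' j) by apply: lt_le_trans xy _; exact: bigmin_le_cond.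
  have [Kx|Kx] := pselect (K x); first exact: ltW (s2valP' (hj' j) _ _ Kx xyj).
  have [Ky|Ky] := pselect (K y).
    by rewrite distrC ltW//; apply: (s2valP' (hj' j) _ _ Ky); rewrite distrC.
  by rewrite (K0 _ Kx).2 (K0 _ Ky).2 subrr normr0 ltW.
(* With 4h <= d the gradient oscillates by at most w over a cell, and with 4h <= d1 the support,
   enlarged by 2h, stays in A. *)
pose h := Order.min 1 (Order.min d d1) / 4.
have m0 : 0 < Order.min 1 (Order.min d d1) by rewrite !lt_min ltr01 d0 d10.
have h0 : 0 < h by rewrite divr_gt0.
have hh : [/\ h * 4 <= 1, h * 4 <= d & h * 4 <= d1].
  rewrite /h divfK//; split; first by rewrite ge_min lexx.
    by rewrite !ge_min lexx orbT.
  by rewrite !ge_min lexx !orbT.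
have [h1 h2 h3] := hh.
have [r r0 hr] := compact_rV_bounded cK.
have [N hN] : exists N : nat, r + 2 < h * (N%:R - 1).
  exists (Num.bound `|(r + 2) / h|).+1.
  rewrite -[X in _ * (X - _)]natr1 addrK mulrC -ltr_pdivrMr//.
  by rewrite (le_lt_trans (ler_norm _))// archi_boundP.
pose z m := @cell_node R h N m.
pose T m (x : E) := f (z m) + \sum_i (x 0 i - z m 0 i) * partial i f (z m).
pose g : E -> R := fun x => \sum_m cell S h m x * T m x.
have oT : open [set: E] by exact: openT.
have TE m : T m = cst (f (z m)) + \sum_i ((fun x : E => x 0 i) + cst (- z m 0 i)) * cst (partial i f (z m)).
  by apply/funext => x; rewrite /T -[RHS]/(_ + _) fct_sumE.
have sT k m : Ck k setT (T m).
  rewrite TE; apply: CkD => //; first exact: Ck_cst.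
  apply: Ck_sum => // i _; apply: CkM => //; last exact: Ck_cst.
  by apply: CkD => //; [exact: Ck_coord|exact: Ck_cst].
have gE : g = \sum_m (cell S h m * T m) by apply/funext => x; rewrite /g fct_sumE.
have sg : smooth setT g.
  move=> k; rewrite gE; apply: Ck_sum => // m _; apply: CkM => //; exact: Ck_cell.
have T0 m x : ~ K (z m) -> T m x = 0.
  move=> /K0[f0 p0]; rewrite /T f0 add0r big1// => i _; by rewrite p0 mulr0.
have dT m j x : partial j (T m) x = partial j f (z m).
  have dTi i : 'D_(basis_vec j) (((fun x : E => x 0 i) + cst (- z m 0 i)) * cst (partial i f (z m))) x
      = (i == j)%:R * partial i f (z m) by exact: derive_coord_affine.
  have aTi i : derivable (((fun x : E => x 0 i) + cst (- z m 0 i)) * cst (partial i f (z m))) x (basis_vec j).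
    by apply: diff_derivable; exact: differentiable_coord_affine.
  rewrite /partial TE deriveD; [|exact: derivable_cst|].
    rewrite derive_cst add0r (derive_bigsum _ (fun i _ => aTi i)).2.
    rewrite (bigD1 j)//= big1 ?addr0; first by rewrite dTi eqxx mul1r.
    by move=> i ij; rewrite dTi (negPf ij) mul0r.
  exact: (derive_bigsum _ (fun i _ => aTi i)).1.
have Tf m x : `|x - z m| <= h * 2 -> `|T m x - f x| <= 6 * h * w.
  move=> xz; have [y yz fxy] := mean_value_rV x (z m) df.
  have -> : T m x - f x = \sum_i (x 0 i - z m 0 i) * (partial i f (z m) - partial i f y).
    rewrite /T addrAC -[X in _ + X]opprK.
    have -> : f (z m) - f x = - (f x - f (z m)) by rewrite opprB.
    rewrite fxy addrC opprK -sumrB; apply: eq_bigr => i _.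
    by rewrite [(x - z m) 0 i]mxE [(- z m) 0 i]mxE mulrBr.
  rewrite (le_trans (ler_norm_sum _ _ _))//.
  apply: (@le_trans _ _ (\sum_(i < 3) h * 2 * w)).
    apply: ler_sum => i _; rewrite normrM ler_pM//.
      by have := rV_coord_le (x - z m) i; rewrite !mxE => /le_trans; apply.
    apply: hd; rewrite distrC; apply: le_lt_trans yz _.
    by apply: le_lt_trans xz _; lra.
  by rewrite sumr_const card_ord -mulr_natl; lra.
have kw : (6 * K1 + 1) * w <= e.
  rewrite /w mulrA ler_pdivrMr; last by rewrite addr_gt0// mulr_gt0.
  by rewrite mulrC ler_pM2l//; lra.
have hw : 6 * h * w <= e.
  have : 6 * h * w <= (6 * K1 + 7) * w by rewrite ler_pM2r//; lra.
  by rewrite /w [X in _ <= X](mulrC (6 * K1 + 7)) divfK// gt_eqF// addr_gt0// mulr_gt0.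
have gsupp x : g x != 0 -> near_set K (h * 2) x.
  move=> gx; apply: contrapT => nK; move: gx; rewrite /g big1 ?eqxx// => m _.
  have [->|/(cell_supp hS h0) xz] := eqVneq (cell S h m x) 0; first by rewrite mul0r.
  by rewrite T0 ?mulr0// => Kz; apply: nK; exists (z m).
have tg : tsupport g `<=` near_set K (h * 2).
  by apply: tsupport_sub_closed => //; exact: closed_near_set.
(* The grid covers the ball of radius r + 2; beyond r + 1 both f and g vanish and nothing has to be
   estimated. *)
have far x : r + 1 <= `|x| -> ~ K x /\ ~ near_set K (h * 2) x.
  move=> rx; split=> [/hr|[y /hr yr xy]]; first lra.
  have := ler_distD 0 x y; have := lerB_dist x y; lra.
exists g; split.
- split=> //.
    apply: subclosed_compact tg; first exact: closed_closure.
    exact: compact_near_set.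
  move=> x /tg[y Ky xy]; apply: (hd1 y) => //; rewrite distrC.
  apply: le_lt_trans xy _; lra.
- move=> x; have [xr|xr] := ltP `|x| (r + 1); last first.
    have [Kx nK] := far _ xr.
    rewrite (K0 _ Kx).1 subr0 (_ : g x = 0) ?normr0 ?(ltW e0)//.
    by apply/eqP/negPn/negP => /gsupp.
  have xN : `|x| <= h * (N%:R - 1) by lra.
  rewrite -[f x]mul1r -(sum_cell hS h0 xN) mulr_suml -sumrB.
  rewrite -[e]mul1r -(sum_cell hS h0 xN) mulr_suml.
  rewrite (le_trans (ler_norm_sum _ _ _))//; apply: ler_sum => m _.
  rewrite -mulrBr normrM ger0_norm ?cell_ge0//.
  have [->|/(cell_supp hS h0) xm] := eqVneq (cell S h m x) 0; first by rewrite !mul0r.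
  rewrite ler_wpM2l ?cell_ge0//; exact: le_trans (Tf _ _ xm) hw.
- move=> j x; have [xr|xr] := ltP `|x| (r + 1); last first.
    have [Kx nK] := far _ xr.
    rewrite (K0 _ Kx).2 subr0 (_ : partial j g x = 0) ?normr0 ?(ltW e0)//.
    rewrite /partial (@near_eq_derive _ _ _ _ (cst 0)) ?derive_cst//.
    by apply: tsupport_off_near => /tg.
  have xN : `|x| < h * (N%:R - 1) by lra.
  have dc m : differentiable (cell S h m) x by exact: (CkS_differentiable (Ck_cell hS h 1 m)).
  have dTm m : differentiable (T m) x by exact: (CkS_differentiable (sT 1%N m)).
  have dcT m : derivable (cell S h m * T m) x (basis_vec j).
    by apply: diff_derivable; exact: differentiableM.
  have -> : partial j g x = \sum_m (cell S h m x * partial j f (z m) + T m x * partial j (cell S h m) x).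
    rewrite /partial gE (derive_bigsum _ (fun m _ => dcT m)).2.
    apply: eq_bigr => m _; rewrite deriveM; [|exact: diff_derivable|exact: diff_derivable].
    by rewrite -/(partial j (T m) x) dT.
  (* The derivatives of the cells add up to 0, so f x may be subtracted from every [T m x]; this
     produces the small Taylor error. *)
  have -> : \sum_m (cell S h m x * partial j f (z m) + T m x * partial j (cell S h m) x) - partial j f x =
    \sum_m (cell S h m x * (partial j f (z m) - partial j f x)) +
    \sum_m (partial j (cell S h m) x * (T m x - f x)).
    have -> : \sum_m (cell S h m x * (partial j f (z m) - partial j f x)) =
       \sum_m (cell S h m x * partial j f (z m)) - partial j f x.
      rewrite -[X in _ = _ - X]mul1r -(sum_cell hS h0 (ltW xN)) mulr_suml -sumrB.
      by apply: eq_bigr => m _; rewrite mulrBr.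
    have -> : \sum_m (partial j (cell S h m) x * (T m x - f x)) = \sum_m (T m x * partial j (cell S h m) x).
      rewrite (eq_bigr (fun m => T m x * partial j (cell S h m) x - partial j (cell S h m) x * f x)).
        by rewrite sumrB -mulr_suml (sum_partial_cell0 hS h0 j xN) mul0r subr0.
      by move=> m _; rewrite mulrBr [T m x * _]mulrC.
    by rewrite big_split/= addrAC.
  rewrite (le_trans (ler_normD _ _))// (le_trans _ kw)// mulrDl mul1r addrC lerD//.
    rewrite (le_trans (ler_norm_sum _ _ _))//.
    apply: (@le_trans _ _ (\sum_m `|partial j (cell S h m) x| * (6 * h * w))).
      apply: ler_sum => m _; rewrite normrM.
      have [->|/(partial_cell_supp hS h0) xm] := eqVneq (partial j (cell S h m) x) 0.
        by rewrite normr0 !mul0r.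
      by rewrite ler_wpM2l//; exact: Tf.
    rewrite -mulr_suml (le_trans (ler_wpM2r _ (hK1 _ _ _ j h0 (ltW xN))))//.
      by rewrite mulr_ge0 ?(ltW w0)// mulr_ge0// ltW.
    have -> : K1 / h * (6 * h * w) = 6 * K1 * w * (h / h) by ring.
    by rewrite divff ?gt_eqF// mulr1.
  rewrite -[w]mul1r -(sum_cell hS h0 (ltW xN)) mulr_suml.
  rewrite (le_trans (ler_norm_sum _ _ _))//; apply: ler_sum => m _.
  rewrite normrM ger0_norm ?cell_ge0//.
  have [->|/(cell_supp hS h0) xm] := eqVneq (cell S h m x) 0; first by rewrite !mul0r.
  rewrite ler_wpM2l ?cell_ge0//; apply: hd; rewrite distrC.
  by apply: le_lt_trans xm _; lra.
Qed.

End Approximation.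

(** * Integrals of bounded functions with bounded support *)

Section FiniteSupport.
Context {R : realType} {d : measure_display} {T : measurableType d}.
Variable mu : {measure set T -> \bar R}.

(* bfs: bounded with finite support, the finiteness being that of the measure *)
Definition bfs (f : T -> R) :=
  measurable_fun setT f /\ exists A M, [/\ measurable A, (mu A < +oo)%E &
    forall x, `|f x| <= M * \1_A x].

Lemma bfs_integrable f : bfs f -> mu.-integrable setT (EFin \o f).
Proof.
move=> [mf [A [M [mA muA hM]]]].
have -> : EFin \o f = (EFin \o f) \_ A.
  apply/funext => x; rewrite patchE; case: ifPn => // xA; rewrite /=.
  have := hM x; rewrite indicE (negPf xA) mulr0 normr_le0 => /eqP ->//.
apply/(integrable_mkcond _ mA); apply: measurable_bounded_integrable => //.
  exact: measurable_funTS.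
exists `|M|; split; first by rewrite num_real.
move=> t Mt x Ax /=; rewrite (le_trans (hM x))// indicE mem_set// mulr1.
by rewrite (le_trans (ler_norm M))// ltW.
Qed.

Lemma bfs_measurable f : bfs f -> measurable_fun setT f.
Proof. by case. Qed.

Lemma bfs_le (f g : T -> R) : measurable_fun setT f -> (forall x, `|f x| <= `|g x|) -> bfs g -> bfs f.
Proof.
move=> mf fg [mg [A [M [mA muA hM]]]]; split => //; exists A, M; split => // x.
exact: le_trans (fg x) (hM x).
Qed.

Lemma bfs_norm f : bfs f -> bfs (fun x => `|f x|).
Proof.
move=> hf; have mf := bfs_measurable hf.
by apply: (bfs_le _ _ hf) => [|x]; [exact: measurableT_comp|rewrite normr_id].
Qed.

Lemma bfsD f g : bfs f -> bfs g -> bfs (fun x => f x + g x).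
Proof.
move=> [mf [A [M [mA muA hA]]]] [mg [B [N [mB muB hB]]]].
split; first exact: measurable_funD.
exists (A `|` B), (`|M| + `|N|); split.
- exact: measurableU.
- have /= := @measureU2 _ _ _ mu A B mA mB => /le_lt_trans; apply.
  by rewrite lte_add_pinfty.
- move=> x; rewrite mulrDl (le_trans (ler_normD _ _))// lerD//.
    rewrite (le_trans (hA x))// !indicE; have [xA|xA] := boolP (x \in A).
      by rewrite in_setU xA/= !mulr1 ler_norm.
    by rewrite mulr0 mulr_ge0.
  rewrite (le_trans (hB x))// !indicE; have [xB|xB] := boolP (x \in B).
    by rewrite in_setU xB orbT/= !mulr1 ler_norm.
  by rewrite mulr0 mulr_ge0.
Qed.

Lemma bfsMl (g f : T -> R) M : measurable_fun setT g -> (forall x, `|g x| <= M) ->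
  bfs f -> bfs (fun x => g x * f x).
Proof.
move=> mg hg [mf [A [N [mA muA hA]]]]; split; first exact: measurable_funM.
exists A, (M * N); split => // x; rewrite normrM -mulrA ler_pM//.
Qed.

Lemma bfsZ k f : bfs f -> bfs (fun x => k * f x).
Proof. by move=> hf; apply: (@bfsMl (cst k) f `|k|). Qed.

Lemma bfsN f : bfs f -> bfs (fun x => - f x).
Proof.
move=> hf; rewrite (_ : (fun x => - f x) = fun x => -1 * f x).
  exact: bfsZ.
by apply/funext => x; rewrite mulN1r.
Qed.

Lemma bfsB f g : bfs f -> bfs g -> bfs (fun x => f x - g x).
Proof. by move=> hf hg; apply: bfsD => //; exact: bfsN. Qed.

Lemma bfs0 : bfs (fun=> 0).
Proof.
by split => //; exists set0, 0; split => // [|x]; rewrite ?measure0 ?normr0 ?mul0r.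
Qed.

Lemma bfs_sum (I : Type) (r : seq I) (P : pred I) (F : I -> T -> R) :
  (forall i, P i -> bfs (F i)) -> bfs (fun x => \sum_(i <- r | P i) F i x).
Proof.
move=> h; elim: r => [|i r IH].
  by rewrite (_ : (fun x => _) = fun=> 0); [exact: bfs0|apply/funext => x; rewrite big_nil].
have [Pi|Pi] := boolP (P i).
  rewrite (_ : (fun x => _) = fun x => F i x + \sum_(i <- r | P i) F i x).
    by apply: bfsD => //; exact: h.
  by apply/funext => x; rewrite big_cons Pi.
rewrite (_ : (fun x => _) = fun x => \sum_(i <- r | P i) F i x) //.
by apply/funext => x; rewrite big_cons (negPf Pi).
Qed.

Lemma bfs_intD f g : bfs f -> bfs g ->
  \int[mu]_x (f x + g x) = \int[mu]_x f x + \int[mu]_x g x.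
Proof. by move=> hf hg; rewrite RintegralD//; exact: bfs_integrable. Qed.

Lemma bfs_intB f g : bfs f -> bfs g ->
  \int[mu]_x (f x - g x) = \int[mu]_x f x - \int[mu]_x g x.
Proof. by move=> hf hg; rewrite RintegralB//; exact: bfs_integrable. Qed.

Lemma bfs_intZ k f : bfs f -> \int[mu]_x (k * f x) = k * \int[mu]_x f x.
Proof. by move=> hf; rewrite RintegralZl//; exact: bfs_integrable. Qed.

Lemma bfs_intN f : bfs f -> \int[mu]_x (- f x) = - \int[mu]_x f x.
Proof.
by move=> hf; rewrite -mulN1r -bfs_intZ//; apply: eq_Rintegral => x _; rewrite mulN1r.
Qed.

Lemma bfs_int_sum (I : Type) (r : seq I) (P : pred I) (F : I -> T -> R) :
  (forall i, P i -> bfs (F i)) ->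
  \int[mu]_x (\sum_(i <- r | P i) F i x) = \sum_(i <- r | P i) \int[mu]_x F i x.
Proof.
move=> h; elim: r => [|i r IH].
  rewrite big_nil (_ : (fun x => _) = fun=> 0); last by apply/funext => x; rewrite big_nil.
  by rewrite Rintegral_cst// mul0r.
rewrite big_cons -IH; have [Pi|Pi] := boolP (P i).
  rewrite -bfs_intD; [|exact: h|exact: bfs_sum].
  by apply: eq_Rintegral => x _; rewrite big_cons Pi.
by apply: eq_Rintegral => x _; rewrite big_cons (negPf Pi).
Qed.

Lemma bfs_int_le f g : bfs f -> bfs g -> (forall x, f x <= g x) ->
  \int[mu]_x f x <= \int[mu]_x g x.
Proof. by move=> hf hg fg; apply: le_Rintegral => //; exact: bfs_integrable. Qed.

Lemma bfs_int_norm f g : bfs f -> bfs g -> (forall x, `|f x| <= g x) ->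
  `|\int[mu]_x f x| <= \int[mu]_x g x.
Proof.
move=> hf hg fg; rewrite (le_trans (le_normr_Rintegral _ (bfs_integrable hf)))//.
by apply: bfs_int_le => //; exact: bfs_norm.
Qed.

Lemma Rdominated_cvg (f_ : nat -> T -> R) (f g : T -> R) :
  (forall n, measurable_fun setT (f_ n)) ->
  (forall x, f_ n x @[n --> \oo] --> f x) ->
  mu.-integrable setT (EFin \o g) -> (forall n x, `|f_ n x| <= g x) ->
  measurable_fun setT f /\ \int[mu]_x f_ n x @[n --> \oo] --> \int[mu]_x f x.
Proof.
move=> mf ff ig fg.
have mff : measurable_fun setT f.
  by apply: (@measurable_fun_cvg _ _ _ _ f_) => // x _; exact: ff.
have mf' n : measurable_fun setT (EFin \o f_ n) by exact/measurable_EFinP.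
have mff' : measurable_fun setT (EFin \o f) by exact/measurable_EFinP.
have cv : \forall x \ae mu, setT x -> (EFin \o f_ n) x @[n --> \oo] --> (EFin \o f) x.
  by apply: aeW => x _; apply: cvg_EFin; [exact: nearW|exact: ff].
have le : \forall x \ae mu, forall n, setT x -> (`|(EFin \o f_ n) x| <= (EFin \o g) x)%E.
  by apply: aeW => x n _; rewrite /= lee_fin; exact: fg.
have [i1 _ i2] := dominated_convergence measurableT mf' mff' cv ig le.
split => //; apply: fine_cvg.
by rewrite fineK//; exact: integrable_fin_num.
Qed.

End FiniteSupport.

(** * Fubini for bounded functions on rectangles of finite measure *)

Section FubiniFiniteSupport.
Context {R : realType} {d1 d2 : measure_display}
  {T1 : measurableType d1} {T2 : measurableType d2}.
Variables (m1 : {sigma_finite_measure set T1 -> \bar R})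
          (m2 : {sigma_finite_measure set T2 -> \bar R}).
Variables (f : T1 * T2 -> R) (A : set T1) (B : set T2) (M : R).
Hypotheses (mf : measurable_fun setT f) (mA : measurable A) (mB : measurable B)
  (fA : (m1 A < +oo)%E) (fB : (m2 B < +oo)%E)
  (hM : forall x y, `|f (x, y)| <= M * \1_A x * \1_B y).

Let M0 x y : A x -> B y -> 0 <= M.
Proof.
move=> Ax By; have := hM x y; rewrite !indicE !mem_set// !mulr1.
exact: le_trans.
Qed.

Lemma bfs_pair : bfs (m1 \x m2)%E f.
Proof.
split => //; exists (A `*` B), M; split.
- exact: measurableX.
- have e := @product_measure1E _ _ _ _ _ m1 m2 A B mA mB.
  apply: (@le_lt_trans _ _ (m1 A * m2 B)%E); first by rewrite -e.
  by apply: lte_mul_pinfty => //; rewrite ge0_fin_numE.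
- move=> [x y]; rewrite (le_trans (hM x y))// -mulrA.
  by rewrite !indicE in_setX/= -natrM mulnb.
Qed.

Lemma bfs_pair1 x : bfs m2 (fun y => f (x, y)).
Proof.
split; first exact: measurable_fun_pair2.
by exists B, (M * \1_A x); split => // y; exact: hM.
Qed.

Lemma bfs_pair2 y : bfs m1 (fun x => f (x, y)).
Proof.
split; first exact: measurable_fun_pair1.
by exists A, (M * \1_B y); split => // x; rewrite mulrAC; exact: hM.
Qed.

Let intf : (m1 \x m2)%E.-integrable setT (EFin \o f).
Proof. by apply: bfs_integrable; exact: bfs_pair. Qed.

Lemma bfs_Fubini1 : bfs m1 (fun x => \int[m2]_y f (x, y)) /\
  \int[(m1 \x m2)%E]_z f z = \int[m1]_x (\int[m2]_y f (x, y)).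
Proof.
have F_E x : fubini_F m2 (EFin \o f) x = (\int[m2]_y f (x, y))%:E.
  rewrite fineK//; apply: integrable_fin_num => //.
  exact: (bfs_integrable (bfs_pair1 x)).
split; last first.
  by rewrite /Rintegral -integral12_prod_meas1//; congr fine; apply: eq_integral => x _.
split.
  apply/measurable_EFinP.
  rewrite (_ : EFin \o _ = fubini_F m2 (EFin \o f)); first exact: measurable_fubini_F intf.
  by apply/funext => x; rewrite F_E.
have bB : bfs m2 (\1_B : T2 -> R).
  by split; [exact: measurable_indic|exists B, 1; split => // x; rewrite mul1r ger0_norm].
exists A, (M * \int[m2]_y \1_B y); split => // x.
have [Ax|Ax] := boolP (x \in A).
  rewrite indicE Ax mulr1 -bfs_intZ//.
  apply: bfs_int_norm; [exact: bfs_pair1|exact: bfsZ|].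
  by move=> y; rewrite (le_trans (hM x y))// indicE Ax mulr1.
rewrite indicE (negPf Ax) mulr0 (_ : (fun y => f (x, y)) = fun=> 0).
  by rewrite Rintegral_cst// mul0r normr0.
apply/funext => y; apply/eqP; rewrite -normr_le0 (le_trans (hM x y))//.
by rewrite indicE (negPf Ax) mulr0 mul0r.
Qed.

Lemma bfs_Fubini2 : bfs m2 (fun y => \int[m1]_x f (x, y)) /\
  \int[(m1 \x m2)%E]_z f z = \int[m2]_y (\int[m1]_x f (x, y)).
Proof.
have F_E y : fubini_G m1 (EFin \o f) y = (\int[m1]_x f (x, y))%:E.
  rewrite fineK//; apply: integrable_fin_num => //.
  exact: (bfs_integrable (bfs_pair2 y)).
split; last first.
  by rewrite /Rintegral -integral21_prod_meas1//; congr fine; apply: eq_integral => x _.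
split.
  apply/measurable_EFinP.
  rewrite (_ : EFin \o _ = fubini_G m1 (EFin \o f)); first exact: measurable_fubini_G intf.
  by apply/funext => x; rewrite F_E.
have bA : bfs m1 (\1_A : T1 -> R).
  by split; [exact: measurable_indic|exists A, 1; split => // x; rewrite mul1r ger0_norm].
exists B, (M * \int[m1]_y \1_A y); split => // y.
have [By|By] := boolP (y \in B).
  rewrite indicE By mulr1 -bfs_intZ//.
  apply: bfs_int_norm; [exact: bfs_pair2|exact: bfsZ|].
  by move=> x; rewrite (le_trans (hM x y))// [X in _ * X]indicE By mulr1.
rewrite indicE (negPf By) mulr0 (_ : (fun x => f (x, y)) = fun=> 0).
  by rewrite Rintegral_cst// mul0r normr0.
apply/funext => x; apply/eqP; rewrite -normr_le0 (le_trans (hM x y))//.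
by rewrite [X in _ * X]indicE (negPf By) mulr0.
Qed.

End FubiniFiniteSupport.

(** * Measurability of vector-valued maps *)

Section BorelRow.
Context {R : realType} {d : measure_display} {T : measurableType d} {n : nat}.
Variable g : T -> 'rV[R]_n.
Hypothesis mg : forall i, measurable_fun setT (fun t => g t 0 i).

(** Measurability is given coordinate by coordinate. An open set is a countable union of cubes with
    rational centre and radius 1 / (n + 1), and the preimage of each cube is a finite intersection
    of measurable sets. *)
Lemma measurable_preimage_open (A : set 'rV[R]_n) : open A -> measurable (g @^-1` A).
Proof.
move=> oA.
pose box (k : {ffun 'I_n -> rat} * nat) : set 'rV[R]_n :=
  [set x | forall i, `|x 0 i - ratr (k.1 i)| < k.2.+1%:R^-1].
pose F k : set T := if `[< box k `<=` A >] then g @^-1` box k else set0.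
have -> : g @^-1` A = \bigcup_k F k.
  apply/seteqP; split=> [t /= gA|t [k _]]; last first.
    by rewrite /F; case: ifPn => // /asboolP kA /kA.
  have /nbhs_normP[r /= r0 hr] := open_nbhs_nbhs (conj oA gA).
  have [N hN] : exists N : nat, N.+1%:R^-1 < r / 2.
    exists (Num.bound (r / 2)^-1).
    rewrite invf_plt ?posrE ?divr_gt0//.
    rewrite (lt_trans (archi_boundP _))// ?ltr_nat//.
    by rewrite invr_ge0 ltW// divr_gt0.
  have q i : {q : rat | `|g t 0 i - ratr q| < N.+1%:R^-1}.
    apply: cid.
    have : (0 : R) < N.+1%:R^-1 by rewrite invr_gt0.
    move: (N.+1%:R^-1) => e e0; move: (g t 0 i) => y.
    have ye : y - e < y + e by lra.
    have [q] := rat_in_itvoo ye.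
    rewrite in_itv/= => /andP[q1 q2]; exists q.
    by rewrite ltr_norml; apply/andP; split; lra.
  exists ([ffun i => sval (q i)], N) => //; rewrite /F; case: ifPn => [_ i/=|/asboolP].
    by rewrite ffunE; exact: svalP (q i).
  apply: contra_notP => _ x xb; apply: hr; rewrite /= /ball_.
  apply: rV_norm_lt => // i; rewrite !mxE.
  have := xb i; rewrite /= ffunE; have /= := svalP (q i).
  move: (sval (q i)) => s; move: hN; move: (N.+1%:R^-1) => e hN.
  by have := ler_distD (ratr s) (g t 0 i) (x 0 i); rewrite [`|ratr _ - x 0 i|]distrC; lra.
apply: countable_bigcupT_measurable; first exact: countableP.
move=> k; rewrite /F; case: ifPn => // _.
rewrite (_ : g @^-1` box k = \bigcap_(i in [set: 'I_n])
    ((fun t => g t 0 i) @^-1` (ball (ratr (k.1 i) : R) k.2.+1%:R^-1))).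
  apply: fin_bigcap_measurable => // i _.
  by rewrite -[X in measurable X]setTI; apply: mg => //; exact: measurable_ball.
by apply/seteqP; split=> t /= h i; have := h i; rewrite -ball_normE/= distrC//; apply.
Qed.

Lemma measurable_preimage_closed (A : set 'rV[R]_n) : closed A -> measurable (g @^-1` A).
Proof.
move=> cA; rewrite -(setCK A) preimage_setC; apply: measurableC.
have oA : open (~` A) by exact: closed_openC.
exact: measurable_preimage_open oA.
Qed.

Lemma measurable_continuous_open (A : set 'rV[R]_n) (f : 'rV[R]_n -> R) : open A ->
  (forall x, A x -> {for x, continuous f}) -> measurable_fun (g @^-1` A) (f \o g).
Proof.
move=> oA cf; apply: (measurability _ (RGenOInfty.measurableE R)).
move=> _ [_ [a ->] <-].
rewrite (_ : _ `&` _ = g @^-1` (A `&` f @^-1` `]a, +oo[)).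
  apply: measurable_preimage_open; rewrite openE => x [Ax fx].
  apply: filterI; first exact: open_nbhs_nbhs (conj oA Ax).
  apply: (cf x Ax); apply: open_nbhs_nbhs; split => //.
by apply/seteqP; split.
Qed.

Lemma measurable_continuous (f : 'rV[R]_n -> R) : continuous f ->
  measurable_fun setT (f \o g).
Proof.
move=> cf; rewrite -(preimage_setT g).
by apply: measurable_continuous_open; [exact: openT|move=> x _; exact: cf].
Qed.

End BorelRow.

(** * Integration along a chosen coordinate *)

Section CoordinateFubini.
Context {R : realType}.
Notation mu := (@lebesgue_measure R).
Notation nu2 := (mu \x mu)%E.
Notation nu3 := ((mu \x mu) \x mu)%E.
Notation E := 'rV[R]_3.
Notation E2 := 'rV[R]_2.

Definition box_bounded (G : R * R * R -> R) (M r : R) := measurable_fun setT G /\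
  forall a b c, `|G (a, b, c)| <= M * \1_(`[- r, r]) a * \1_(`[- r, r]) b * \1_(`[- r, r]) c.

Lemma finite_itv (a b : R) : (mu `[a, b] < +oo)%E.
Proof. by rewrite lebesgue_measure_itv/=; case: ifP => // _; rewrite -EFinD ltry. Qed.

Lemma finite_sq (I : set R) : measurable I -> (mu I < +oo)%E -> ((mu \x mu)%E (I `*` I) < +oo)%E.
Proof.
move=> mI fI; have e := @product_measure1E _ _ _ _ _ mu mu I I mI mI.
apply: (@le_lt_trans _ _ (mu I * mu I)%E); first by rewrite -e.
by apply: lte_mul_pinfty; rewrite ?ge0_fin_numE.
Qed.

Lemma sigma_finite_lebesgue2 : sigma_finite setT (mu \x mu)%E.
Proof.
pose I n : set R := `[- n%:R, n%:R]%classic.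
exists (fun n => I n `*` I n).
  apply/seteqP; split => // -[a b] _.
  exists (Num.bound (`|a| + `|b|)) => //.
  have := archi_boundP (addr_ge0 (normr_ge0 a) (normr_ge0 b)).
  move=> hN.
  split => /=; rewrite /I/= in_itv/= -ler_norml.
    by rewrite (le_trans _ (ltW hN))// lerDl.
  by rewrite (le_trans _ (ltW hN))// lerDr.
move=> n; have mI : measurable (I n) by exact: measurable_itv.
split; first exact: measurableX.
by apply: finite_sq => //; exact: finite_itv.
Qed.

(** The planar measure repackaged with its sigma-finiteness, so that it can be a factor in Fubini's
    theorem. *)
Definition lebesgue2 : {sigma_finite_measure set (measurableTypeR R * measurableTypeR R)%type -> \bar R} :=
  HB.pack_for {sigma_finite_measure set (measurableTypeR R * measurableTypeR R)%type -> \bar R} (mu \x mu)%E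
  (@Measure_isSigmaFinite.Build _ _ _ (mu \x mu)%E sigma_finite_lebesgue2).


Lemma box_bounded_pair1 G M r : box_bounded G M r ->
  forall ab c, `|G (ab, c)| <= M * \1_(`[- r, r]%classic `*` `[- r, r]%classic) ab * \1_(`[- r, r]) c.
Proof.
move=> [_ hG] [a b] c; rewrite (le_trans (hG _ _ _))//.
by rewrite [X in _ * X * _ <= _]indicE [X in _ * X * _ * _ <= _]indicE [X in _ <= _ * X * _]indicE
  in_setX/= -[M * _ * _]mulrA -natrM mulnb.
Qed.

Lemma box_bounded_slice G M r a : box_bounded G M r ->
  measurable_fun setT (fun bc : R * R => G (a, bc.1, bc.2)) /\
  forall b c, `|G (a, b, c)| <= (M * \1_(`[- r, r]) a) * \1_(`[- r, r]) b * \1_(`[- r, r]) c.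
Proof.
move=> [mG hG]; split; last by move=> b c; exact: hG.
apply: (measurableT_comp mG); apply: measurable_fun_pair; last exact: measurable_snd.
by apply: measurable_fun_pair; [exact: measurable_cst|exact: measurable_fst].
Qed.

Section iterated.
Variables (G : R * R * R -> R) (M r : R).
Hypothesis bG : box_bounded G M r.
Let I : set R := `[- r, r]%classic.
Let mI : measurable I. Proof. exact: measurable_itv. Qed.
Let fI : (mu I < +oo)%E. Proof. exact: finite_itv. Qed.
Let mI2 : measurable (I `*` I). Proof. exact: measurableX. Qed.

Lemma iterated_int : bfs nu3 G /\
  \int[nu3]_q G q = \int[mu]_a \int[mu]_b \int[mu]_c G (a, b, c).
Proof.
have [mG _] := bG.
split; first exact: (@bfs_pair _ _ _ _ _ lebesgue2 mu _ _ _ _ mG mI2 mI (finite_sq mI fI) fI (box_bounded_pair1 bG)).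
have [h1 ->] := @bfs_Fubini1 _ _ _ _ _ lebesgue2 mu _ _ _ _ mG mI2 mI (finite_sq mI fI) fI (box_bounded_pair1 bG).
have [mH _] := h1.
have c1 c : `|(\1_I c : R)| <= \1_I c by rewrite ger0_norm.
have bI : bfs mu (\1_I : R -> R).
  by split; [exact: measurable_indic|exists I, 1; split => // x; rewrite mul1r].
have hb a b : `|\int[mu]_c G (a, b, c)| <= (M * \int[mu]_c \1_I c) * \1_I a * \1_I b.
  apply: (@le_trans _ _ (\int[mu]_c (M * \1_I a * \1_I b * \1_I c))).
    apply: bfs_int_norm; last by move=> c; exact: bG.2.
      exact: (@bfs_pair1 _ _ _ _ _ mu _ _ _ _ mG mI fI (box_bounded_pair1 bG) (a, b)).
    exact: bfsZ.
  rewrite bfs_intZ//; set J := Rintegral _ _ _.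
  by rewrite le_eqVlt; apply/orP; left; apply/eqP; ring.
by have [_ ->] := @bfs_Fubini1 _ _ _ _ _ mu mu _ _ _ _ mH mI mI fI fI hb.
Qed.

Lemma iterated_int_swap : \int[nu3]_q G q = \int[mu]_a \int[mu]_c \int[mu]_b G (a, b, c).
Proof.
rewrite iterated_int.2; apply: eq_Rintegral => a _.
have [mG hG] := box_bounded_slice a bG.
have [_ <-] := @bfs_Fubini1 _ _ _ _ _ mu mu _ _ _ _ mG mI mI fI fI hG.
by have [_ <-] := @bfs_Fubini2 _ _ _ _ _ mu mu _ _ _ _ mG mI mI fI fI hG.
Qed.

End iterated.

Lemma box_bounded_swap12 G M r : box_bounded G M r ->
  box_bounded (fun q => G (q.1.1, q.2, q.1.2)) M r.
Proof.
move=> [mG hG]; split.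
  apply: (measurableT_comp mG); apply: measurable_fun_pair; last first.
    by apply: measurableT_comp => //; exact: measurable_snd.
  apply: measurable_fun_pair; last exact: measurable_snd.
  by apply: measurableT_comp => //; exact: measurable_fst.
by move=> a b c; rewrite /= mulrAC; exact: hG.
Qed.

Lemma box_bounded_swap01 G M r : box_bounded G M r ->
  box_bounded (fun q => G (q.1.2, q.1.1, q.2)) M r.
Proof.
move=> [mG hG]; split.
  apply: (measurableT_comp mG); apply: measurable_fun_pair; last exact: measurable_snd.
  apply: measurable_fun_pair; apply: measurableT_comp => //; exact: measurable_snd.
by move=> a b c; rewrite /= -[X in X * _]mulrAC; exact: hG.
Qed.

Lemma int_swap12 G M r : box_bounded G M r ->
  \int[nu3]_q G q = \int[nu3]_q G (q.1.1, q.2, q.1.2).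
Proof.
move=> bG; rewrite (iterated_int_swap bG).
by have [_ ->] := iterated_int (box_bounded_swap12 bG).
Qed.

Lemma int_swap01 G M r : box_bounded G M r ->
  \int[nu3]_q G q = \int[nu3]_q G (q.1.2, q.1.1, q.2).
Proof.
move=> bG; have bG' := box_bounded_swap01 bG.
have mI : measurable (`[- r, r]%classic : set R) by exact: measurable_itv.
have fI := finite_itv (- r) r.
have [h1 ->] := @bfs_Fubini1 _ _ _ _ _ lebesgue2 mu _ _ _ _ bG.1 (measurableX mI mI) mI (finite_sq mI fI) fI (box_bounded_pair1 bG).
have [h2 ->] := @bfs_Fubini1 _ _ _ _ _ lebesgue2 mu _ _ _ _ bG'.1 (measurableX mI mI) mI (finite_sq mI fI) fI (box_bounded_pair1 bG').
have bI : bfs mu (\1_(`[- r, r]%classic) : R -> R).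
  split; first exact: measurable_indic.
  by exists `[- r, r]%classic, 1; split => // x; rewrite mul1r ger0_norm.
have hb a b : `|\int[mu]_c G (a, b, c)| <=
    (M * \int[mu]_c \1_(`[- r, r]) c) * \1_(`[- r, r]) a * \1_(`[- r, r]) b.
  apply: (@le_trans _ _ (\int[mu]_c (M * \1_(`[- r, r]) a * \1_(`[- r, r]) b * \1_(`[- r, r]) c))).
    apply: bfs_int_norm; last by move=> c; exact: bG.2.
      exact: (@bfs_pair1 _ _ _ _ _ mu _ _ _ _ bG.1 mI fI (box_bounded_pair1 bG) (a, b)).
    exact: bfsZ.
  rewrite bfs_intZ//; set J := Rintegral _ _ _.
  by rewrite le_eqVlt; apply/orP; left; apply/eqP; ring.
have [_ ->] := @bfs_Fubini1 _ _ _ _ _ mu mu _ _ _ _ h1.1 mI mI fI fI hb.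
have hb' a b : `|\int[mu]_c G (b, a, c)| <=
    (M * \int[mu]_c \1_(`[- r, r]) c) * \1_(`[- r, r]) a * \1_(`[- r, r]) b.
  by rewrite mulrAC.
by have [_ ->] := @bfs_Fubini2 _ _ _ _ _ mu mu _ _ _ _ h2.1 mI mI fI fI hb'.
Qed.

(* bms: bounded measurable with bounded support *)
Definition bms3 (f : E -> R) := measurable_fun setT (fun q => f (vec3 q)) /\
  exists M : R, forall x, `|f x| <= M /\ (M < `|x| -> f x = 0).

Definition bms2 (g : E2 -> R) := measurable_fun setT (fun q => g (vec2 q)) /\
  exists M : R, forall x, `|g x| <= M /\ (M < `|x| -> g x = 0).

Lemma vec3E (q : R * R * R) : [/\ vec3 q 0 ord0 = q.1.1,
  vec3 q 0 (lift ord0 ord0) = q.1.2 & vec3 q 0 ord_max = q.2].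
Proof. by rewrite !mxE. Qed.

Lemma vec2E (q : R * R) : vec2 q 0 ord0 = q.1 /\ vec2 q 0 ord_max = q.2.
Proof. by rewrite !mxE. Qed.

Lemma bms3_box f : bms3 f -> exists M r, box_bounded (fun q => f (vec3 q)) M r.
Proof.
move=> [mf [M hM]]; exists M, M; split => // a b c.
have [h0|h0] := eqVneq (f (vec3 (a, b, c))) 0.
  have M0 : 0 <= M by have [/(le_trans _)->] := hM 0.
  by rewrite h0 normr0 !mulr_ge0.
have xM : `|vec3 (a, b, c)| <= M.
  by rewrite leNgt; apply/negP => /(hM _).2/eqP; rewrite (negPf h0).
have [/= e1 e2 e3] := vec3E (a, b, c).
have I1 x : `|x| <= M -> \1_(`[- M, M]) x = 1 :> R.
  by rewrite ler_norml => h; rewrite indicE mem_set//= in_itv.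
rewrite !I1 ?mulr1; first exact: (hM _).1.
- by rewrite -e3 (le_trans (rV_coord_le _ _)).
- by rewrite -e2 (le_trans (rV_coord_le _ _)).
- by rewrite -e1 (le_trans (rV_coord_le _ _)).
Qed.

Lemma insert_coordE k (y : E2) (z : R) :
  insert_coord k y z 0 k = z /\ forall i, insert_coord k y z 0 (lift k i) = y 0 i.
Proof. by split=> [|i]; rewrite mxE ?unlift_none// liftK. Qed.

Lemma insert_coord_norm k (y : E2) (z : R) : `|y| <= `|insert_coord k y z| /\ `|z| <= `|insert_coord k y z|.
Proof.
have [e1 e2] := insert_coordE k y z; split.
  by apply: rV_norm_le => // i; rewrite -e2; exact: rV_coord_le.
by rewrite -{1}e1; exact: rV_coord_le.
Qed.

Let I3P (k : 'I_3) : [\/ k = ord0, k = lift ord0 ord0 | k = ord_max].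
Proof.
case: k => [[|[|[|//]]] h]; [constructor 1|constructor 2|constructor 3]; exact: val_inj.
Qed.

(** The product measure integrates the third coordinate innermost. The permutation [tau] puts that
    coordinate in position k, and it preserves integrals because it is composed of the two
    transpositions above. Every chart direction thus becomes the vertical one. *)
Lemma insert_coord_vec k : exists2 tau : R * R * R -> R * R * R,
  (forall q, vec3 (tau q) = insert_coord k (vec2 q.1) q.2) &
  forall G M r, box_bounded G M r -> box_bounded (G \o tau) M r /\
    \int[nu3]_q G q = \int[nu3]_q G (tau q).
Proof.
have [->|->|->] := I3P k.
- exists (fun q => (q.2, q.1.1, q.1.2)).
    move=> q; apply/rowP => j; rewrite !mxE; have [->|->|->] := I3P j.
    + by rewrite unlift_none.
    + by rewrite liftK mxE.
    + by rewrite (_ : ord_max = lift ord0 ord_max) ?liftK ?mxE//; exact: val_inj.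
  move=> G M r bG; have b1 := box_bounded_swap01 bG; have b2 := box_bounded_swap12 b1.
  by split => //; rewrite (int_swap01 bG) (int_swap12 b1).
- exists (fun q => (q.1.1, q.2, q.1.2)).
    move=> q; apply/rowP => j; rewrite !mxE; have [->|->|->] := I3P j.
    + by rewrite (_ : ord0 = lift (lift ord0 ord0) ord0) ?liftK ?mxE//; exact: val_inj.
    + by rewrite unlift_none.
    + by rewrite (_ : ord_max = lift (lift ord0 ord0) ord_max) ?liftK ?mxE//; exact: val_inj.
  by move=> G M r bG; split; [exact: box_bounded_swap12|exact: int_swap12 bG].
- exists id.
    move=> [[a b] c]; apply/rowP => j; rewrite !mxE; have [->|->|->] := I3P j.
    + by rewrite (_ : ord0 = lift ord_max ord0) ?liftK ?mxE//; exact: val_inj.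
    + by rewrite (_ : lift ord0 ord0 = lift ord_max ord_max) ?liftK ?mxE//; exact: val_inj.
    + by rewrite unlift_none.
  by [].
Qed.

Lemma bms3_bfs f : bms3 f -> bfs nu3 (fun q => f (vec3 q)).
Proof. by move=> /bms3_box[M [r bf]]; have [] := iterated_int bf. Qed.

Lemma bms2_bfs g : bms2 g -> bfs nu2 (fun q => g (vec2 q)).
Proof.
move=> [mg [M hM]]; split => //.
exists (`[- M, M]%classic `*` `[- M, M]%classic), M; split.
- exact: measurableX.
- by apply: finite_sq => //; exact: finite_itv.
move=> [a b].
have [h0|h0] := eqVneq (g (vec2 (a, b))) 0.
  have M0 : 0 <= M by have [/(le_trans _)->] := hM 0.
  by rewrite h0 normr0 !mulr_ge0.
have xM : `|vec2 (a, b)| <= M.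
  by rewrite leNgt; apply/negP => /(hM _).2/eqP; rewrite (negPf h0).
have [/= e1 e2] := vec2E (a, b).
rewrite indicE mem_set ?mulr1; first exact: (hM _).1.
by split => /=; rewrite in_itv/= -ler_norml; [rewrite -e1|rewrite -e2]; rewrite (le_trans (rV_coord_le _ _)).
Qed.

Lemma coordinate_Fubini k f : bms3 f ->
  [/\ forall y : E2, bfs mu (fun z => f (insert_coord k y z)),
      bms2 (fun y => \int[mu]_z f (insert_coord k y z)) &
      \int[nu3]_q f (vec3 q) = integral_R2 (fun y => \int[mu]_z f (insert_coord k y z))].
Proof.
move=> bf; have [M [r bG]] := bms3_box bf.
have [tau tauE htau] := insert_coord_vec k.
have [bt ->] := htau _ _ _ bG.
have mI : measurable (`[- r, r]%classic : set R) by exact: measurable_itv.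
have fI := finite_itv (- r) r.
have [h1 h2] := @bfs_Fubini1 _ _ _ _ _ lebesgue2 mu _ _ _ _ bt.1 (measurableX mI mI) mI (finite_sq mI fI) fI (box_bounded_pair1 bt).
have vE (y : E2) : y = vec2 (y 0 ord0, y 0 ord_max).
  apply/rowP => j; rewrite !mxE; case: j => [[|[|//]] h] /=; congr (y 0 _); exact: val_inj.
have bs (y : E2) : bfs mu (fun z => f (insert_coord k y z)).
  have := @bfs_pair1 _ _ _ _ _ mu _ _ _ _ bt.1 mI fI (box_bounded_pair1 bt) (y 0 ord0, y 0 ord_max).
  by under eq_fun do rewrite /= tauE /= -vE.
split; first exact: bs.
- split.
    have := h1.1; rewrite (_ : (fun x => _) = (fun q => \int[mu]_z f (insert_coord k (vec2 q) z)))//.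
    by apply/funext => q; apply: eq_Rintegral => z _; rewrite /= tauE.
  have [_ [M' hM']] := bf.
  exists (Num.max M' (M' * \int[mu]_z \1_(`[- M', M']) z)) => y.
  have M0 : 0 <= M' by have [/(le_trans _)->] := hM' 0.
  have bI : bfs mu (\1_(`[- M', M']%classic) : R -> R).
    split; first exact: measurable_indic.
    exists `[- M', M']%classic, 1; split => // [|x]; first exact: finite_itv.
    by rewrite mul1r ger0_norm.
  split.
    rewrite le_max; apply/orP; right; rewrite -bfs_intZ//.
    apply: bfs_int_norm => //; first exact: bfsZ.
    move=> z; have [h0|h0] := eqVneq (f (insert_coord k y z)) 0.
      by rewrite h0 normr0 mulr_ge0.
    have xM : `|insert_coord k y z| <= M'.
      by rewrite leNgt; apply/negP => /(hM' _).2/eqP; rewrite (negPf h0).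
    rewrite indicE mem_set ?mulr1; first exact: (hM' _).1.
    by rewrite /= in_itv/= -ler_norml (le_trans (insert_coord_norm k y z).2).
  rewrite gt_max => /andP[My _]; rewrite (_ : (fun z => _) = fun=> 0).
    by rewrite Rintegral_cst// mul0r.
  by apply/funext => z; apply: (hM' _).2; rewrite (lt_le_trans My)// (insert_coord_norm k y z).1.
- rewrite h2; apply: eq_Rintegral => q _; apply: eq_Rintegral => z _.
  by rewrite /= tauE.
Qed.

End CoordinateFubini.

(** * Fluxes through graphs *)

Section OneDimension.
Context {R : realType}.
Notation mu := (@lebesgue_measure R).

Lemma FTC_C1 (F f : R -> R) a b : a < b ->
  (forall x : R, is_derive x (1 : R) F (f x)) -> continuous f ->
  (forall x, x < a \/ b < x -> f x = 0) ->
  bfs mu f /\ \int[mu]_x f x = F b - F a.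
Proof.
move=> ab dF cf f0.
have mf : measurable_fun setT f by exact: continuous_measurable_fun.
have dFd x : derivable F x 1 by have [] := dF x.
have fE : (fun x => f x) = f \_ `[a, b].
  apply/funext => x; rewrite patchE; case: ifPn => // /negP xab; apply: f0.
  have [xa|xa] := ltP x a; [by left|right].
  by rewrite ltNge; apply/negP => xb; apply: xab; rewrite inE/= in_itv/= xa xb.
have [c cI hc] : exists2 c, c \in `[a, b] & forall t, t \in `[a, b] -> `|f t| <= `|f c|.
  apply: (@EVT_max R (fun x => `|f x|)); first exact: ltW.
  by apply: continuous_subspaceT => x; apply: cvg_norm; exact: cf.
have bf : bfs mu f.
  split => //; exists `[a, b]%classic, `|f c|; split => //; first exact: finite_itv.
  move=> x; rewrite indicE; have [xI|xI] := boolP (x \in `[a, b]%classic).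
    by rewrite mulr1 hc//; move: xI; rewrite inE.
  by have := congr1 (fun h => h x) fE; rewrite /= patchE (negPf xI) mulr0 => ->; rewrite normr0.
split => //.
rewrite fE -Rintegral_mkcond /Rintegral (@continuous_FTC2 _ _ F)//.
- exact: continuous_subspaceT.
- have cF x : {for x, continuous F} by apply: differentiable_continuous; apply/derivable1_diffP.
  split; [by move=> x _| |].
    by apply: cvg_at_right_filter; exact: cF.
  by apply: cvg_at_left_filter; exact: cF.
- by move=> x _; rewrite derive1E; have [_ ->] := dF x.
Qed.

Variable S : R -> R.
Hypothesis hS : smooth_step S.

(** For s = 1 or -1, an approximate identity at c as a grows: it has mass 1 and lives on the side s
    of c, at distance between 1 / a and 2 / a. *)
Definition layer_kernel (s c a r : R) : R := a * 'D_1 S (a * (s * (r - c)) - 1).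

Variables (s c : R).
Hypothesis s1 : s * s = 1.
Notation kappa := (layer_kernel s c).

Let s_norm : `|s| = 1.
Proof. by apply/eqP; rewrite -sqrp_eq1// -normrX expr2 s1 normr1. Qed.

Lemma layer_kernel_supp a r : kappa a r != 0 -> 1 <= a * (s * (r - c)) <= 2.
Proof.
apply: contraNT => h; rewrite /layer_kernel step_derive0 ?mulr0//.
by move: h; rewrite negb_and -!ltNge => /orP[h|h]; apply/orP; [left|right]; lra.
Qed.

Lemma layer_kernel_dist a r : 0 < a -> kappa a r != 0 -> 0 < s * (r - c) /\ `|r - c| <= 2 / a.
Proof.
move=> a0 /layer_kernel_supp/andP[h1 h2].
have p : 0 < s * (r - c) by rewrite -(pmulr_rgt0 _ a0) (lt_le_trans ltr01).
split => //.
have -> : `|r - c| = s * (r - c) by rewrite -(ger0_norm (ltW p)) normrM s_norm mul1r.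
by rewrite ler_pdivlMr// mulrC.
Qed.

Lemma is_derive_affine1 (a b t : R) : is_derive t (1 : R) (fun t : R => a * t + b) a.
Proof.
apply: DeriveDef; last exact: derive_affine1.
apply/derivable1_diffP; apply: (@differentiableD _ _ _ (fun t => a * t) (cst b)).
  by apply: (@differentiableM _ _ (cst a) id).
exact: differentiable_cst.
Qed.

Lemma layer_step_derive a (r : R) :
  is_derive r (1 : R) (fun r => S (a * (s * (r - c)) - 1)) (s * kappa a r).
Proof.
have e : (fun r : R => a * (s * (r - c)) - 1) = (fun r => (a * s) * r + (- (a * s * c) - 1)).
  by apply/funext => x; rewrite mulrA mulrBr addrA.
have dA : is_derive r (1 : R) (fun r : R => a * (s * (r - c)) - 1) (a * s).
  by rewrite e; exact: is_derive_affine1.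
have dS : is_derive (a * (s * (r - c)) - 1) (1 : R) S ('D_1 S (a * (s * (r - c)) - 1)).
  by apply: DeriveDef => //; apply/derivable1_diffP; exact: step_differentiable.
have := @is_derive1_comp _ S (fun r => a * (s * (r - c)) - 1) r _ _ dS dA.
rewrite (_ : 'D_1 S _ * _ = s * kappa a r)//.
by rewrite /layer_kernel [LHS]mulrC [a * s]mulrC -[LHS]mulrA.
Qed.

Lemma layer_kernel_continuous a : continuous (kappa a).
Proof.
move=> r.
have e : (fun r : R => a * (s * (r - c)) - 1) = (fun r => (a * s) * r + (- (a * s * c) - 1)).
  by apply/funext => x; rewrite mulrA mulrBr addrA.
have cA : {for r, continuous (fun r : R => a * (s * (r - c)) - 1)}.
  apply: differentiable_continuous; apply/derivable1_diffP; rewrite e.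
  by have [] := is_derive_affine1 (a * s) (- (a * s * c) - 1) r.
have cD := continuous_comp cA (@step_derive_continuous _ _ hS _).
by apply: (@continuousM _ _ (cst a) _ r _ cD); exact: cst_continuous.
Qed.

Lemma layer_kernel_int a : 0 < a -> bfs mu (kappa a) /\ \int[mu]_r kappa a r = 1.
Proof.
(* The endpoints at distance 3 / a lie beyond the support, which ends at 2 / a; there the step takes
   the values 0 and 1. *)
move=> a0; have e0 : 0 < 3 / a :> R by rewrite divr_gt0.
have e23 : 2 / a < 3 / a :> R by rewrite ltr_pM2r ?invr_gt0//; lra.
have dF r : is_derive r (1 : R) (fun r => s * S (a * (s * (r - c)) - 1)) (kappa a r).
  have [d1 d2] := layer_step_derive a r.
  apply: DeriveDef; first exact: (derivableM (derivable_cst s r 1) d1).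
  by rewrite (deriveMl s d1) d2 mulrA s1 mul1r.
have ab : c - 3 / a < c + 3 / a.
  by rewrite ltrD2l gtrN.
have off r : r < c - 3 / a \/ c + 3 / a < r -> kappa a r = 0.
  move=> h; apply/eqP; apply: contraPT h => /(layer_kernel_dist a0)[_].
  move: (2 / a) (3 / a) e23 => x y xy; rewrite ler_norml => /andP[h1 h2] [h3|h3]; lra.
have [b ->] := FTC_C1 ab dF (@layer_kernel_continuous a) off.
split => //.
have [S0 S1] : (forall x, x <= 0 -> S x = 0) /\ (forall x, 1 <= x -> S x = 1) by have [_ h1 h2 _] := hS.
have a3 : a * (3 / a) = 3 by rewrite mulrC divfK ?gt_eqF.
have e1 : a * (s * (c + 3 / a - c)) - 1 = s * 3 - 1.
  by rewrite addrAC subrr add0r mulrCA a3.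
have e2 : a * (s * (c - 3 / a - c)) - 1 = - (s * 3) - 1.
  by rewrite addrAC subrr add0r !mulrN mulrCA a3.
rewrite e1 e2.
have : (s - 1) * (s + 1) = 0 by rewrite mulrDr mulr1 mulrBl s1 mul1r addrA subrK subrr.
move/eqP; rewrite mulf_eq0 subr_eq0 addr_eq0 => /orP[/eqP->|/eqP->].
  by rewrite S1 ?S0; lra.
by rewrite S0 ?S1; lra.
Qed.

(** The kernel is at most a C on an interval of length 6 / a, so the bound does not depend on a. *)
Lemma layer_kernel_L1 C a : 0 < C -> (forall x, `|'D_1 S x| <= C) -> 0 < a ->
  \int[mu]_r `|kappa a r| <= 6 * C.
Proof.
move=> C0 hC a0; have [bk _] := layer_kernel_int a0.
have e0 : 0 < 3 / a :> R by rewrite divr_gt0.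
have e23 : 2 / a < 3 / a :> R by rewrite ltr_pM2r ?invr_gt0//; lra.
pose I : set R := `[c - 3 / a, c + 3 / a]%classic.
have mI : measurable I by exact: measurable_itv.
have fI : (mu I < +oo)%E by exact: finite_itv.
have bI : bfs mu (\1_I : R -> R).
  split; first exact: measurable_indic.
  by exists I, 1; split => // x; rewrite mul1r ger0_norm.
have iI : \int[mu]_r (\1_I r : R) = 6 / a.
  have eI : mu I = (6 / a)%:E.
    have := lebesgue_measure_itv `[c - 3 / a, c + 3 / a]; rewrite /= lte_fin.
    have -> : c - 3 / a < c + 3 / a by rewrite ltrD2l gtrN.
    rewrite -EFinB => ->; congr (_%:E).
    by rewrite opprB addrC addrA subrK -mulrDl; congr (_ / _); lra.
  have eint : (\int[mu]_x (\1_I x)%:E)%E = mu I by rewrite integral_indic ?setIT.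
  by rewrite /Rintegral eint eI.
have -> : 6 * C = \int[mu]_r ((a * C) * \1_I r).
  rewrite (bfs_intZ _ bI) iI mulrAC [a * _]mulrC divfK ?gt_eqF//.
apply: bfs_int_le; [exact: bfs_norm|exact: bfsZ|].
move=> r; have [->|kr] := eqVneq (kappa a r) 0.
  by rewrite normr0 mulr_ge0// mulr_ge0// ltW.
have [_ hr] := layer_kernel_dist a0 kr.
rewrite indicE mem_set ?mulr1.
  by rewrite normrM gtr0_norm// ler_wpM2l// ltW.
rewrite /I/= in_itv/=.
move: hr; rewrite ler_norml => /andP[]; move: (2 / a) (3 / a) e23 => x y xy h1 h2.
by apply/andP; split; lra.
Qed.

Let bkg a (g : R -> R) (M : R) : 0 < a -> measurable_fun setT g -> (forall r, `|g r| <= M) ->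
  bfs mu (fun r => kappa a r * g r).
Proof.
move=> a0 mg hg; rewrite (_ : (fun r => _) = fun r => g r * kappa a r).
  exact: (@bfsMl _ _ _ mu g (kappa a) M mg hg (layer_kernel_int a0).1).
by apply/funext => r; rewrite mulrC.
Qed.

(** Because the kernel sits on the side s of c, only the one-sided limit of g enters. As the mass is
    1, the error is the oscillation of g - L near c times the uniform L1 bound. *)
Lemma layer_kernel_cvg (g : R -> R) M L : measurable_fun setT g -> (forall r, `|g r| <= M) ->
  (forall e, 0 < e -> exists2 d, 0 < d & forall r, 0 < s * (r - c) -> `|r - c| < d -> `|g r - L| <= e) ->
  \int[mu]_r (kappa n.+1%:R r * g r) @[n --> \oo] --> L.
Proof.
move=> mg hg hL; have [C' C'0 hC'] := step_derive_bound hS.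
have C0 : 0 < 6 * C' by rewrite mulr_gt0.
have hC a : 0 < a -> \int[mu]_r `|kappa a r| <= 6 * C' by exact: layer_kernel_L1.
move: (6 * C') C0 hC => C C0 hC.
apply/cvgrPdist_le => e e0; have [d d0 hd] := hL (e / C) (divr_gt0 e0 C0).
near=> n.
have a0 : 0 < n.+1%:R :> R by [].
have nd : 2 / n.+1%:R < d :> R.
  rewrite ltr_pdivrMr// mulrC -ltr_pdivrMr//; near: n.
  exists (Num.bound (2 / d)) => // n /= hn.
  rewrite (lt_le_trans (archi_boundP _)) ?divr_ge0 ?(ltW d0)// ler_nat.
  exact: leq_trans hn (leqnSn _).
move: nd; move: (n.+1%:R) a0 => a a0 nd.
have [bk k1] := layer_kernel_int a0.
have b1 := bkg a0 mg hg.
have bkL : bfs mu (fun r => L * kappa a r) by exact: bfsZ.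
rewrite -[L]mulr1 -k1 -bfs_intZ// -bfs_intB//.
apply: (@le_trans _ _ (\int[mu]_r (e / C * `|kappa a r|))); last first.
  rewrite bfs_intZ; last exact: bfs_norm.
  by rewrite mulrAC ler_pdivrMr// ler_pM2l//; exact: hC.
apply: bfs_int_norm; [exact: bfsB|by apply: bfsZ; exact: bfs_norm|].
move=> r; rewrite mulrC -mulrBr normrM mulrC.
have [->|kr] := eqVneq (kappa a r) 0; first by rewrite normr0 !mulr0.
have [h1 h2] := layer_kernel_dist a0 kr.
by rewrite ler_wpM2r// distrC hd// (le_lt_trans h2).
Unshelve. all: by end_near. Qed.

Lemma layer_kernel_bound C a (g : R -> R) M : 0 < C -> (forall x, `|'D_1 S x| <= C) -> 0 < a ->
  measurable_fun setT g -> (forall r, `|g r| <= M) ->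
  bfs mu (fun r => kappa a r * g r) /\ `|\int[mu]_r (kappa a r * g r)| <= 6 * C * M.
Proof.
move=> C0 hC a0 mg hg.
have [bk _] := layer_kernel_int a0.
have b1 := bkg a0 mg hg.
split => //; apply: (@le_trans _ _ (\int[mu]_r (M * `|kappa a r|))); last first.
  rewrite bfs_intZ; last exact: bfs_norm.
  by rewrite mulrC ler_wpM2r ?layer_kernel_L1// (le_trans _ (hg c)).
apply: bfs_int_norm => //; first by apply: bfsZ; exact: bfs_norm.
by move=> r; rewrite normrM mulrC ler_wpM2r.
Qed.

End OneDimension.

(** * Volume integrals of bounded functions with bounded support *)

Section BoundedSupport3.
Context {R : realType}.
Notation mu := (@lebesgue_measure R).
Notation nu3 := ((mu \x mu) \x mu)%E.
Notation E := 'rV[R]_3.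
Notation E2 := 'rV[R]_2.

Definition mf3 (f : E -> R) := measurable_fun setT (fun q => f (vec3 q)).
Definition I3 (f : E -> R) : R := \int[nu3]_q f (vec3 q).

Lemma integral_R3E (A : set E) f : integral_R3 A f = I3 (f \_ A).
Proof.
rewrite /integral_R3 /eintegral_R3 -[LHS]/(Rintegral _ _ _) Rintegral_mkcond /I3.
by congr (Rintegral _ _ _).
Qed.

Lemma measurable_vec3 i : measurable_fun setT (fun q : R * R * R => vec3 q 0 i).
Proof.
have -> : (fun q : R * R * R => vec3 q 0 i) = fun q => [:: q.1.1; q.1.2; q.2]`_i.
  by apply/funext => q; rewrite mxE.
case: i => [[|[|[|//]]] hi] /=.
- by apply: measurableT_comp; exact: measurable_fst.
- by apply: measurableT_comp; [exact: measurable_snd|exact: measurable_fst].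
- exact: measurable_snd.
Qed.

Lemma measurable_vec2 i : measurable_fun setT (fun q : R * R => vec2 q 0 i).
Proof.
have -> : (fun q : R * R => vec2 q 0 i) = fun q => [:: q.1; q.2]`_i.
  by apply/funext => q; rewrite mxE.
by case: i => [[|[|//]] hi] /=; [exact: measurable_fst|exact: measurable_snd].
Qed.

Lemma mf3_continuous f : continuous f -> mf3 f.
Proof. by move=> cf; apply: (measurable_continuous measurable_vec3 cf). Qed.

Lemma measurable_open3 (A : set E) : open A -> measurable (vec3 @^-1` A).
Proof. by move=> oA; exact: (measurable_preimage_open measurable_vec3 oA). Qed.

Lemma mf3_restrictP (A : set E) f : open A ->
  measurable_fun (vec3 @^-1` A) (fun q => f (vec3 q)) <-> mf3 (f \_ A).
Proof. by move=> oA; apply: measurable_restrictT; exact: measurable_open3. Qed.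

Lemma mf3_restrict_continuous (A : set E) f : open A ->
  (forall x, A x -> {for x, continuous f}) -> mf3 (f \_ A).
Proof.
move=> oA cf; apply/(mf3_restrictP _ oA).
exact: (measurable_continuous_open measurable_vec3 oA cf).
Qed.

Lemma mf3M f g : mf3 f -> mf3 g -> mf3 (fun x => f x * g x).
Proof. by move=> mf mg; exact: measurable_funM. Qed.

Lemma bms3_le (f g : E -> R) : mf3 f -> (forall x, `|f x| <= `|g x|) -> bms3 g -> bms3 f.
Proof.
move=> mf fg [_ [M hM]]; split => //; exists M => x; split.
  exact: le_trans (fg x) (hM x).1.
by move=> /(hM x).2 g0; apply/eqP; rewrite -normr_le0 (le_trans (fg x))// g0 normr0.
Qed.

Lemma bms3_intro (f : E -> R) K M : mf3 f -> (forall x, `|f x| <= M) -> (forall x, f x != 0 -> `|x| <= K) ->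
  bms3 f.
Proof.
move=> mf h1 h2; split => //; exists (Num.max M K) => x; split; first by rewrite le_max h1.
rewrite gt_max => /andP[_ Kx]; apply/eqP; apply: contraTT Kx => /h2.
by rewrite -leNgt.
Qed.

Lemma bms3_norm (f : E -> R) : bms3 f -> bms3 (fun x => `|f x|).
Proof.
move=> hf; apply: (bms3_le _ _ hf) => [|x]; last by rewrite normr_id.
by apply: measurableT_comp => //; exact: hf.1.
Qed.

Lemma bms3D (f g : E -> R) : bms3 f -> bms3 g -> bms3 (fun x => f x + g x).
Proof.
move=> [mf [M hM]] [mg [N hN]].
apply: (@bms3_intro _ (Num.max M N) (M + N)).
- exact: measurable_funD.
- by move=> x; rewrite (le_trans (ler_normD _ _))// lerD// ?(hM x).1 ?(hN x).1.
- move=> x; apply: contraNT; rewrite -ltNge gt_max => /andP[/(hM x).2 -> /(hN x).2 ->].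
  by rewrite addr0.
Qed.

Lemma bms3Ml (g f : E -> R) M : mf3 g -> (forall x, `|g x| <= M) -> bms3 f -> bms3 (fun x => g x * f x).
Proof.
move=> mg hg [mf [N hN]]; apply: (@bms3_intro _ N (M * N)).
- exact: measurable_funM.
- by move=> x; rewrite normrM ler_pM// (hN x).1.
- move=> x; apply: contraNT; rewrite -ltNge => /(hN x).2 ->.
  by rewrite mulr0.
Qed.

Lemma bms3Z (k : R) (f : E -> R) : bms3 f -> bms3 (fun x => k * f x).
Proof. by move=> hf; apply: (@bms3Ml (cst k) f `|k|) => //; exact: measurable_cst. Qed.

Lemma bms3N (f : E -> R) : bms3 f -> bms3 (fun x => - f x).
Proof.
move=> hf; rewrite (_ : (fun x => - f x) = fun x => -1 * f x); first exact: bms3Z.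
by apply/funext => x; rewrite mulN1r.
Qed.

Lemma bms30 : bms3 (fun=> 0 : R).
Proof.
apply: (@bms3_intro _ 0 0) => [|x|x]; first exact: measurable_cst.
  by rewrite normr0.
by rewrite eqxx.
Qed.

Lemma bms3_sum (I : Type) (r : seq I) (P : pred I) (F : I -> E -> R) :
  (forall i, P i -> bms3 (F i)) -> bms3 (fun x => \sum_(i <- r | P i) F i x).
Proof.
move=> h; elim: r => [|i r IH].
  by rewrite (_ : (fun x : E => _) = fun=> 0 : R); [exact: bms30|apply/funext => x; rewrite big_nil].
have [Pi|Pi] := boolP (P i).
  rewrite (_ : (fun x => _) = fun x => F i x + \sum_(i <- r | P i) F i x).
    by apply: bms3D => //; exact: h.
  by apply/funext => x; rewrite big_cons Pi.
rewrite (_ : (fun x => _) = fun x => \sum_(i <- r | P i) F i x) //.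
by apply/funext => x; rewrite big_cons (negPf Pi).
Qed.

Lemma I3D (f g : E -> R) : bms3 f -> bms3 g -> I3 (fun x => f x + g x) = I3 f + I3 g.
Proof. by move=> /bms3_bfs hf /bms3_bfs hg; exact: (bfs_intD hf hg). Qed.

Lemma I3B (f g : E -> R) : bms3 f -> bms3 g -> I3 (fun x => f x - g x) = I3 f - I3 g.
Proof. by move=> /bms3_bfs hf /bms3_bfs hg; exact: (bfs_intB hf hg). Qed.

Lemma I3N (f : E -> R) : bms3 f -> I3 (fun x => - f x) = - I3 f.
Proof. by move=> /bms3_bfs hf; exact: (bfs_intN hf). Qed.

Lemma I3Z (k : R) (f : E -> R) : bms3 f -> I3 (fun x => k * f x) = k * I3 f.
Proof. by move=> /bms3_bfs hf; exact: (bfs_intZ k hf). Qed.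

Lemma I3_sum (I : Type) (r : seq I) (P : pred I) (F : I -> E -> R) :
  (forall i, P i -> bms3 (F i)) ->
  I3 (fun x => \sum_(i <- r | P i) F i x) = \sum_(i <- r | P i) I3 (F i).
Proof.
move=> h; apply: (@bfs_int_sum _ _ _ nu3 _ r P (fun i q => F i (vec3 q))) => i Pi.
exact: bms3_bfs (h i Pi).
Qed.

Lemma I3_norm (f g : E -> R) : bms3 f -> bms3 g -> (forall x, `|f x| <= g x) -> `|I3 f| <= I3 g.
Proof.
by move=> /bms3_bfs hf /bms3_bfs hg fg; apply: (bfs_int_norm hf hg) => q; exact: fg.
Qed.

Lemma eq_I3 (f g : E -> R) : (forall x, f x = g x) -> I3 f = I3 g.
Proof. by move=> fg; apply: eq_Rintegral => q _; exact: fg. Qed.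

Lemma I3_dominated (f_ : nat -> E -> R) (f g : E -> R) : (forall n, mf3 (f_ n)) ->
  (forall x, f_ n x @[n --> \oo] --> f x) -> bms3 g -> (forall n x, `|f_ n x| <= g x) ->
  mf3 f /\ I3 (f_ n) @[n --> \oo] --> I3 f.
Proof.
move=> mf ff /bms3_bfs/bfs_integrable ig fg.
apply: (@Rdominated_cvg _ _ _ nu3 (fun n q => f_ n (vec3 q)) (fun q => f (vec3 q))
  (fun q => g (vec3 q)) mf (fun q => ff (vec3 q)) ig) => n q; exact: fg.
Qed.

Lemma bms3_continuous_compact (f : E -> R) (K : set E) : continuous f -> compact K ->
  (forall x, ~ K x -> f x = 0) -> bms3 f.
Proof.
move=> cf cK f0.
have [M hM] : exists M, forall x, K x -> `|f x| <= M.
  have [/eqP K0|/set0P K0] := boolP (K == set0).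
    by exists 0 => x; rewrite K0.
  have cn : {within K, continuous (fun x => `|f x|)}.
    apply: continuous_subspaceT => x.
  exact: (@continuous_comp _ _ _ f (fun r : R => `|r|) x (cf x) (@norm_continuous _ R (f x))).
  have [c _ hc] := EVT_max_rV K0 cK cn.
  by exists `|f c| => x Kx; apply: hc; exact: mem_set.
have [r r0 hr] := compact_rV_bounded cK.
apply: (@bms3_intro _ r `|M|); first exact: mf3_continuous.
  move=> x; have [Kx|Kx] := pselect (K x).
    by rewrite (le_trans (hM _ Kx))// ler_norm.
  by rewrite f0// normr0.
move=> x fx; apply/ltW/hr; apply: contrapT => /f0/eqP; exact/negP.
Qed.

Lemma insert_coord_line k (y : E2) (z t : R) :
  insert_coord k y (t + z) = t *: basis_vec k + insert_coord k y z.
Proof.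
apply/rowP => j; rewrite !mxE eqxx/=.
case: (unliftP k j) => [i ->|->]; last by rewrite eqxx mulr1.
by rewrite eq_sym (negPf (neq_lift _ _)) mulr0 add0r.
Qed.

Lemma is_derive_line k (f : E -> R) (y : E2) (z : R) : differentiable f (insert_coord k y z) ->
  is_derive z (1 : R) (fun z => f (insert_coord k y z)) (partial k f (insert_coord k y z)).
Proof.
move=> df.
have hE (t : R) : insert_coord k y (t *: (1 : R) + z) = t *: basis_vec k + insert_coord k y z.
  by rewrite [t *: 1]mulr1 insert_coord_line.
have e : (fun t : R => f (insert_coord k y (t *: (1 : R) + z))) =
    (fun t : R => f (t *: basis_vec k + insert_coord k y z)).
  by apply/funext => t; rewrite hE.
have ie : insert_coord k y = (fun z => z *: basis_vec k + insert_coord k y 0).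
  by apply/funext => t; rewrite -insert_coord_line addr0.
have di : differentiable (insert_coord k y) z.
  rewrite ie; apply: differentiableD; last exact: differentiable_cst.
  by apply: differentiableZl.
apply: DeriveDef; last by rewrite derive_line e -derive_line.
apply: diff_derivable; exact: (@differentiable_comp R _ _ _ (insert_coord k y) f z di df).
Qed.

(** On each line in direction j, the fundamental theorem of calculus leaves two values of f outside
    its support. *)
Lemma I3_partial0 f j : Ck 1 setT f -> compact (tsupport f) ->
  bms3 (partial j f) /\ I3 (partial j f) = 0.
Proof.
move=> Cf cf.
have df y : differentiable f y by exact: (CkS_differentiable Cf).
have cp : continuous (partial j f).
  by move=> x; apply: (@Ck_continuous _ _ _ 0 setT) => //; exact: CkS_derive Cf.
have p0 x : ~ tsupport f x -> partial j f x = 0.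
  by move=> /tsupport_off_near f0; rewrite /partial (@near_eq_derive _ _ _ _ (cst 0)) ?derive_cst.
have bp : bms3 (partial j f) by exact: bms3_continuous_compact cp cf p0.
split => //.
have [_ _ e] := coordinate_Fubini j bp; rewrite /I3 e.
rewrite (_ : (fun y => _) = fun=> 0); first by rewrite /integral_R2 Rintegral_cst// mul0r.
apply/funext => y.
have [r r0 hr] := compact_rV_bounded cf.
have off z : r <= `|z| -> ~ tsupport f (insert_coord j y z).
  move=> rz /hr; apply/negP; rewrite -leNgt (le_trans rz)//.
  exact: (insert_coord_norm j y z).2.
have dl (z : R) : is_derive z (1 : R) (fun z => f (insert_coord j y z))
    (partial j f (insert_coord j y z)) by exact: is_derive_line.
have cl : continuous (fun z => partial j f (insert_coord j y z)).
  move=> z; apply: (@continuous_comp _ _ _ (fun z => insert_coord j y z)); last exact: cp.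
  have -> : (fun z => insert_coord j y z) = (fun z => z *: basis_vec j + insert_coord j y 0).
    by apply/funext => t; rewrite -insert_coord_line addr0.
  apply: differentiable_continuous.
  by apply: differentiableD => //; apply: differentiableZl.
have rr : - r < r by rewrite gtrN.
have [|_ ->] := FTC_C1 rr dl cl.
  move=> z hz; apply/p0/off; case: hz => hz.
    by rewrite ler_normr; apply/orP; right; rewrite lerNr ltW.
  by rewrite ler_normr ltW.
have rn : r <= `|r| by rewrite ler_norm.
by rewrite !(tsupport_off (off _ _)) ?subrr// normrN.
Qed.

End BoundedSupport3.

(** * The boundary layer of a single chart *)

Section LayerFunctions.
Context {R : realType}.
Notation mu := (@lebesgue_measure R).
Notation E := 'rV[R]_3.
Notation E2 := 'rV[R]_2.

Lemma rV_continuous_for (T : topologicalType) n (f : T -> 'rV[R]_n) (x : T) :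
  (forall i, {for x, continuous (fun y => f y 0 i)}) -> {for x, continuous f}.
Proof.
move=> h; apply/cvgrPdist_lt => e e0.
have : \forall y \near x, forall i, `|f x 0 i - f y 0 i| < e.
  by apply: filter_forall => i; move/cvgrPdist_lt: (h i); apply.
by apply: filterS => y hy; apply: rV_norm_lt => // i; rewrite !mxE.
Qed.

Lemma col'_continuous k : continuous (col' k : E -> E2).
Proof.
move=> x; apply: rV_continuous_for => i.
rewrite (_ : (fun y => _) = (fun y : E => y 0 (lift k i))); last by apply/funext => y; rewrite mxE.
exact: coord_continuous.
Qed.

Lemma derive_coord n (k : 'I_n) (x v : 'rV[R]_n) : 'D_v (fun x : 'rV[R]_n => x 0 k) x = v 0 k.
Proof.
rewrite derive_line (_ : (fun t : R => _) = (fun t : R => v 0 k * t + x 0 k)) ?derive_affine1//.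
by apply/funext => t; rewrite !mxE mulrC.
Qed.

Lemma compact_norm_le n (r : R) : compact [set y : 'rV[R]_n | `|y| <= r].
Proof.
have c0 : compact [set 0 : 'rV[R]_n] by exact: compact_set1.
rewrite (_ : [set y : 'rV[R]_n | _] = near_set [set 0] r); first exact: compact_near_set.
apply/seteqP; split => y /=.
  by exists 0 => //; rewrite subr0.
by move=> [z ->]; rewrite subr0.
Qed.

Lemma compact_bound n (K : set 'rV[R]_n) (f : 'rV[R]_n -> R) : compact K -> continuous f ->
  exists2 N, 0 < N & forall y, K y -> `|f y| <= N.
Proof.
move=> cK cf.
have [/eqP K0|/set0P K0] := boolP (K == set0); first by exists 1 => // x; rewrite K0.
have cn : {within K, continuous (fun x => `|f x|)}.
  apply: continuous_subspaceT => x.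
  exact: (@continuous_comp _ _ _ f (fun r : R => `|r|) x (cf x) (@norm_continuous _ R (f x))).
have [x _ hx] := EVT_max_rV K0 cK cn.
exists (`|f x| + 1) => [|y hy]; first by rewrite ltr_wpDl.
by rewrite (le_trans (hx y (mem_set hy)))// lerDl.
Qed.

(** For properties that survive enlarging the bound; one plus the sum of the individual bounds
    dominates each of them. *)
Lemma fin_bound (I : finType) (P : I -> R -> Prop) :
  (forall i N N', N <= N' -> P i N -> P i N') -> (forall i, exists2 N, 0 < N & P i N) ->
  exists2 N, 0 < N & forall i, P i N.
Proof.
move=> hP h.
have h' i : exists N, 0 < N /\ P i N by have [N N0 PN] := h i; exists N.
have [N hN] := fin_all_exists h'.
have N0 i : 0 <= N i by apply/ltW; have [] := hN i.
exists (1 + \sum_i N i); first by rewrite ltr_pwDl// sumr_ge0.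
move=> i; apply: (hP i (N i)); last by have [] := hN i.
by rewrite (bigD1 i)//= addrCA lerDl addr_ge0// sumr_ge0.
Qed.

Lemma col'_insert_coord k (y : E2) z : col' k (insert_coord k y z) = y.
Proof. by apply/rowP => i; rewrite !mxE liftK. Qed.

Lemma insert_coord_continuous (T : topologicalType) k (f : T -> E2) (g : T -> R) t :
  {for t, continuous f} -> {for t, continuous g} ->
  {for t, continuous (fun t => insert_coord k (f t) (g t))}.
Proof.
move=> cf cg; apply: rV_continuous_for => j.
case: (unliftP k j) => [i ->|->].
  rewrite (_ : (fun y => _) = (fun y => f y 0 i)).
    by apply: (@continuous_comp _ _ _ f (fun x : E2 => x 0 i) t cf); exact: coord_continuous.
  by apply/funext => y; rewrite (insert_coordE k (f y) (g y)).2.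
rewrite (_ : (fun y => _) = g) //.
by apply/funext => y; rewrite (insert_coordE k (f y) (g y)).1.
Qed.

Definition chart_sign (c : chart R) : R := (-1) ^+ cneg c.

Lemma chart_signM c : chart_sign c * chart_sign c = 1.
Proof. by rewrite /chart_sign -expr2 sqrr_sign. Qed.

Definition height (c : chart R) (x : E) : R :=
  chart_sign c * (x 0 (ck c) - cgraph c (col' (ck c) x)).

(* minus the outward normal times the area factor *)
Definition conormal (c : chart R) (y : E2) : E :=
  chart_sign c *: insert_coord (ck c) (- grad (cgraph c) y) 1.

Definition graph_point (c : chart R) (y : E2) : E := insert_coord (ck c) y (cgraph c y).

Variable c : chart R.
Hypothesis Cgraph : Ck 4 setT (cgraph c).
Notation k := (ck c).
Notation gam := (cgraph c).
Notation s := (chart_sign c).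

Lemma graph_Ck m : (m <= 4)%N -> Ck m setT gam.
Proof. by move=> m4; exact: CkW Cgraph. Qed.

Lemma graph_continuous : continuous gam.
Proof. by move=> y; exact: (Ck_continuous Cgraph). Qed.

Lemma grad_continuous i : continuous (partial i gam).
Proof.
move=> y; apply: (@Ck_continuous _ _ _ 0 setT) => //.
by apply: CkS_derive; exact: (@graph_Ck 1).
Qed.

Lemma conormal_continuous j : continuous (fun y => conormal c y 0 j).
Proof.
case: (unliftP k j) => [i ->|->] y.
  rewrite (_ : (fun y => _) = (fun y => (- s) * partial i gam y)).
    by apply: (@continuousM _ _ (cst (- s)) (partial i gam)); [exact: cst_continuous|exact: grad_continuous].
  by apply/funext => z; rewrite /conormal mxE (insert_coordE _ _ _).2 !mxE mulrN mulNr.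
rewrite (_ : (fun y => _) = cst s); first exact: cst_continuous.
by apply/funext => z; rewrite /conormal mxE (insert_coordE _ _ _).1 mulr1.
Qed.

Lemma graph_point_continuous : continuous (graph_point c).
Proof. by move=> y; apply: insert_coord_continuous; [exact: cvg_id|exact: graph_continuous]. Qed.

Let col'L : {linear E -> E2} := @col' R 1 3 k.

Lemma heightE : height c =
  cst s * ((fun x : E => x 0 k) + cst (-1) * (gam \o col'L)).
Proof.
apply/funext => x; rewrite /height -[RHS]/(s * (x 0 k + (-1) * gam (col' k x))).
by rewrite mulN1r.
Qed.

Lemma height_Ck m : (m <= 4)%N -> Ck m setT (height c).
Proof.
move=> m4; rewrite heightE; apply: CkM; [exact: openT|exact: Ck_cst|].
apply: CkD; [exact: openT|exact: Ck_coord|].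
apply: CkM; [exact: openT|exact: Ck_cst|].
apply: (@Ck_comp_linear _ _ _ _ _ setT setT); [exact: col'_continuous|exact: openT|by []|].
exact: graph_Ck.
Qed.

Lemma height_continuous : continuous (height c).
Proof. by move=> x; exact: (Ck_continuous (@height_Ck 0 isT)). Qed.

Lemma height_graph_point y : height c (graph_point c y) = 0.
Proof.
by rewrite /height /graph_point col'_insert_coord (insert_coordE _ _ _).1 subrr mulr0.
Qed.

Lemma partial_height j x : partial j (height c) x = conormal c (col' k x) 0 j.
Proof.
have dg : differentiable gam (col'L x) by exact: (CkS_differentiable (@graph_Ck 1 isT)).
have cL : continuous col'L by exact: col'_continuous.
have dgL : differentiable (gam \o col'L) x.
  by apply: differentiable_comp => //; exact: linear_differentiable.
have dc : differentiable (fun x : E => x 0 k) x by exact: differentiable_coord.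
have e1 : 'D_(basis_vec j) (fun x : E => x 0 k) x = (k == j)%:R.
  by rewrite derive_coord mxE eqxx.
have d2 : derivable (cst (-1) * (gam \o col'L)) x (basis_vec j).
  by apply/diff_derivable/differentiableM => //; exact: differentiable_cst.
have d1 : derivable (fun x : E => x 0 k) x (basis_vec j) by exact: diff_derivable.
have dM (a : R) (g : E -> R) : derivable g x (basis_vec j) ->
    'D_(basis_vec j) (cst a * g) x = a * 'D_(basis_vec j) g x.
  move=> dgx; rewrite (_ : cst a * g = a *: g) ?deriveZ//.
rewrite /partial heightE dM; last exact: derivableD.
rewrite deriveD// e1 dM; last exact: diff_derivable.
rewrite derive_comp_linear// /conormal mxE; congr (_ * _).
case: (unliftP k j) => [i ->|->].
  rewrite (_ : col'L (basis_vec _) = basis_vec i); last first.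
    by apply/rowP => l; rewrite !mxE eqxx/= (inj_eq lift_inj).
  by rewrite (negPf (neq_lift _ _)) add0r mulN1r (insert_coordE _ _ _).2 [in RHS]mxE [in RHS]mxE.
rewrite (_ : col'L (basis_vec _) = 0); last first.
  by apply/rowP => l; rewrite !mxE eqxx/= eq_sym (negPf (neq_lift _ _)).
by rewrite eqxx derive0 mulr0 addr0 (insert_coordE _ _ _).1.
Qed.

Variable S : R -> R.
Hypothesis hS : smooth_step S.

(** The shift by 1 makes the layer vanish up to height 1 / a, so that its product with a cut-off of
    the chart domain is supported inside Omega. From height 2 / a on it is 1. *)
Definition layer (a : R) (x : E) : R := S (a * height c x - 1).

Lemma layerE a : layer a = S \o (cst a * height c + cst (-1)).
Proof. by []. Qed.

Let affine_height_Ck a m : (m <= 4)%N -> Ck m setT (cst a * height c + cst (-1)).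
Proof.
move=> m4; apply: CkD; [exact: openT| |exact: Ck_cst].
by apply: CkM; [exact: openT|exact: Ck_cst|exact: height_Ck].
Qed.

Lemma layer_Ck a m : (m <= 4)%N -> Ck m setT (layer a).
Proof.
move=> m4; rewrite layerE; apply: (@Ck_comp1 _ _ _ _ setT) => //; first exact: openT.
  exact: step_Ck.
exact: affine_height_Ck.
Qed.

Lemma layer_ge0 a x : 0 <= layer a x. Proof. exact: step_ge0. Qed.

Lemma layer_le1 a x : layer a x <= 1. Proof. exact: step_le1. Qed.

Lemma layer_neq0 a x : 0 < a -> layer a x != 0 -> a^-1 <= height c x.
Proof.
move=> a0; apply: contraNT; rewrite -ltNge => h; apply/eqP.
have [_ S0 _ _] := hS; apply: S0.
by rewrite subr_le0 mulrC -ler_pdivlMr// mul1r ltW.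
Qed.

Lemma layer_cvg x : 0 < height c x -> \forall n \near \oo, layer n.+1%:R x = 1.
Proof.
move=> h0; have [_ _ S1 _] := hS.
exists (Num.bound (2 / height c x)) => // n /= hn; apply: S1.
rewrite lerBrDr -ler_pdivrMr// (_ : 1 + 1 = 2)//.
rewrite ltW// (lt_le_trans (archi_boundP _)) ?divr_ge0 ?(ltW h0)// ler_nat.
exact: leq_trans hn (leqnSn _).
Qed.

(** The factorisation that makes the limit computable: the kernel acts along the vertical line over
    [col' k x], and the conormal is constant along it. *)
Lemma partial_layer j a x : partial j (layer a) x =
  layer_kernel S s (gam (col' k x)) a (x 0 k) * conormal c (col' k x) 0 j.
Proof.
have dh : differentiable (height c) x by exact: (CkS_differentiable (@height_Ck 1 isT)).
have dah : differentiable (cst a * height c + cst (-1)) x.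
  exact: (CkS_differentiable (@affine_height_Ck a 1 isT)).
rewrite /partial layerE derive_comp1//; last exact: step_differentiable.
have d1 : derivable (cst a * height c) x (basis_vec j).
  by apply/diff_derivable/differentiableM => //; exact: differentiable_cst.
rewrite (deriveD d1 (derivable_cst _ _ _)).
rewrite derive_cst addr0 (_ : cst a * height c = a *: height c) // deriveZ; last exact: diff_derivable.
rewrite -[X in _ * (_ *: X)]/(partial j (height c) x) partial_height.
by rewrite [a *: conormal _ _ _ _]/(a * _) mulrA [X in X * _]mulrC.
Qed.

Lemma partial_layer_continuous j a : continuous (partial j (layer a)).
Proof.
move=> x; apply: (@Ck_continuous _ _ _ 0 setT) => //.
by apply: CkS_derive; exact: (@layer_Ck a 1).
Qed.

(** Minus the integral of f times the j-th component of the outward normal over the graph: the area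
    factor cancels the normalisation of the normal, so no square root remains. *)
Definition graph_flux (f : E -> R) j : R :=
  integral_R2 (fun y => f (graph_point c y) * conormal c y 0 j).

Variable psi : E -> R.
Hypothesis cpsi : continuous psi.
Hypothesis kpsi : compact (tsupport psi).

Let psi_bound : exists2 K, 0 < K & forall x, `|psi x| <= K /\ (psi x != 0 -> `|x| <= K).
Proof.
have [_ [K hK]] : bms3 psi.
  by apply: bms3_continuous_compact cpsi kpsi _ => x; exact: tsupport_off.
have K0 : 0 <= K by have [/(le_trans (normr_ge0 _))] := hK 0.
exists (K + 1) => [|x]; first by rewrite ltr_wpDl.
split; first by rewrite (le_trans (hK x).1)// lerDl.
apply: contraNT; rewrite -ltNge => h; apply/eqP/(hK x).2.
by rewrite (lt_trans _ h)// ltrDl.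
Qed.

Let conormal_bound r : exists2 N, 0 < N & forall j y, `|y| <= r -> `|conormal c y 0 j| <= N.
Proof.
apply: (@fin_bound _ (fun j N => forall y, `|y| <= r -> `|conormal c y 0 j| <= N)).
  by move=> j N N' NN h y /h /le_trans; apply.
move=> j; have [N N0 hN] := compact_bound (@compact_norm_le 2 r) (@conormal_continuous j).
by exists N.
Qed.

Lemma bms3_layer j a (G : E -> R) M : mf3 G -> (forall x, `|G x| <= M) ->
  bms3 (fun x => psi x * G x * partial j (layer a) x).
Proof.
move=> mG hG.
rewrite (_ : (fun x => _) = fun x => G x * (psi x * partial j (layer a) x)); last first.
  by apply/funext => x; rewrite mulrCA mulrA.
apply: bms3Ml mG hG _.
apply: bms3_continuous_compact kpsi _.
  by move=> x; apply: continuousM; [exact: cpsi|exact: partial_layer_continuous].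
by move=> x /tsupport_off ->; rewrite mul0r.
Qed.

Let measurable_slice (G : E -> R) M y : mf3 G -> (forall x, `|G x| <= M) ->
  measurable_fun setT (fun z => psi (insert_coord k y z) * G (insert_coord k y z)).
Proof.
move=> mG hG.
have b : bms3 (fun x => psi x * G x).
  rewrite (_ : (fun x => _) = fun x => G x * psi x); last by apply/funext => x; rewrite mulrC.
  apply: bms3Ml mG hG _; apply: bms3_continuous_compact cpsi kpsi _ => x; exact: tsupport_off.
have [h _ _] := coordinate_Fubini k b; have := h y; exact: bfs_measurable.
Qed.

Let slice_int j a (G : E -> R) M : mf3 G -> (forall x, `|G x| <= M) ->
  bms2 (fun y => conormal c y 0 j * \int[mu]_z (layer_kernel S s (gam y) a z *
    (psi (insert_coord k y z) * G (insert_coord k y z)))) /\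
  I3 (fun x => psi x * G x * partial j (layer a) x) =
  integral_R2 (fun y => conormal c y 0 j * \int[mu]_z (layer_kernel S s (gam y) a z *
    (psi (insert_coord k y z) * G (insert_coord k y z)))).
Proof.
move=> mG hG.
have [h1 h2 h3] := coordinate_Fubini k (bms3_layer j a mG hG).
have e : (fun y => \int[mu]_z (psi (insert_coord k y z) * G (insert_coord k y z) *
      partial j (layer a) (insert_coord k y z))) =
    (fun y => conormal c y 0 j * \int[mu]_z (layer_kernel S s (gam y) a z *
    (psi (insert_coord k y z) * G (insert_coord k y z)))).
  apply/funext => y; have hy := h1 y.
  (* Integrability of the slice is known with the conormal factor included; it is removed by
     division, hence the separate case. *)
  have [c0|c0] := eqVneq (conormal c y 0 j) 0.
    rewrite c0 mul0r (_ : (fun z => _) = fun=> 0); first by rewrite Rintegral_cst// mul0r.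
    by apply/funext => z; rewrite partial_layer col'_insert_coord c0 !mulr0.
  have e z : psi (insert_coord k y z) * G (insert_coord k y z) *
      partial j (layer a) (insert_coord k y z) = conormal c y 0 j *
      (layer_kernel S s (gam y) a z * (psi (insert_coord k y z) * G (insert_coord k y z))).
    by rewrite partial_layer col'_insert_coord (insert_coordE _ _ _).1; ring.
  rewrite -bfs_intZ.
    by apply: eq_Rintegral => z _; exact: e.
  have := @bfsZ _ _ _ mu (conormal c y 0 j)^-1 _ hy.
  by congr (bfs mu _); apply/funext => z; rewrite e mulKf.
by rewrite e in h2 h3.
Qed.

(** A dominating function that is independent of the scale a: the vertical integral is controlled by
    the L1 norm of the kernel, and it vanishes for y off a ball that contains the shadow of the
    support of psi. *)
Let slice_dominated : exists C K, 0 < C /\ forall j a (G : E -> R) M y, 0 < a ->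
  mf3 G -> (forall x, `|G x| <= M) ->
  `|conormal c y 0 j * \int[mu]_z (layer_kernel S s (gam y) a z *
    (psi (insert_coord k y z) * G (insert_coord k y z)))| <= C * M * \1_[set y : E2 | `|y| <= K] y.
Proof.
have [D D0 hD] := step_derive_bound hS.
have [K K0 hK] := psi_bound.
have [N N0 hN] := conormal_bound K.
exists (N * (6 * D * K)), K; split; first by rewrite !mulr_gt0.
move=> j a G M y a0 mG hG.
have M0 : 0 <= M by exact: le_trans (hG 0).
have hg z : `|psi (insert_coord k y z) * G (insert_coord k y z)| <= K * M.
  by rewrite normrM ler_pM//; exact: (hK _).1.
have [_ hk] := layer_kernel_bound hS (gam y) (chart_signM c) D0 hD a0 (measurable_slice y mG hG) hg.
rewrite indicE; have [yK|yK] := leP `|y| K.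
  rewrite mem_set//= mulr1 normrM -[N * _ * M]mulrA ler_pM//; first exact: hN.
  by rewrite -[6 * D * K * M]mulrA.
rewrite (_ : (fun z => _) = fun=> 0).
  by rewrite Rintegral_cst// mul0r mulr0 normr0 mulr_ge0// !mulr_ge0// ltW.
apply/funext => z; rewrite (_ : psi _ = 0) ?mul0r ?mulr0//; apply/eqP.
apply: contraTT yK => /(hK _).2 h; rewrite -leNgt (le_trans _ h)//.
exact: (insert_coord_norm _ _ _).1.
Qed.

Lemma bms2_ball K : bms2 (\1_[set y : E2 | `|y| <= K] : E2 -> R).
Proof.
split.
  rewrite (_ : (fun q => _) = (\1_(vec2 @^-1` [set y : E2 | `|y| <= K]) : R * R -> R)).
    apply: measurable_indic; apply: (measurable_preimage_closed measurable_vec2).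
    apply: compact_closed (@compact_norm_le 2 K); exact: norm_hausdorff.
  by apply/funext => q; rewrite !indicE; congr (_%:R); apply/idP/idP; rewrite !inE.
exists (Num.max 1 K) => y; split; first by rewrite ger0_norm// indicE le_max lern1 leq_b1.
rewrite gt_max => /andP[_ yK]; rewrite indicE memNset//=.
by apply/negP; rewrite -ltNge.
Qed.

Lemma layer_integral_bound : exists2 C, 0 < C & forall j a (G : E -> R) M, 0 < a ->
  mf3 G -> (forall x, `|G x| <= M) ->
  `|I3 (fun x => psi x * G x * partial j (layer a) x)| <= C * M.
Proof.
have [C [K [C0 hC]]] := slice_dominated.
pose A := integral_R2 (\1_[set y : E2 | `|y| <= K] : E2 -> R).
have A0 : 0 <= A by apply: Rintegral_ge0 => q _; rewrite indicE.
exists (C * A + 1); first by rewrite ltr_wpDl// mulr_ge0// ltW.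
move=> j a G M a0 mG hG.
have M0 : 0 <= M by exact: le_trans (hG 0).
have [b ->] := slice_int j a mG hG.
rewrite mulrDl mul1r ler_wpDr// mulrAC -(bfs_intZ _ (bms2_bfs (bms2_ball K))).
apply: bfs_int_norm; [exact: bms2_bfs b|by apply: bfsZ; exact: bms2_bfs (bms2_ball K)|].
by move=> q; exact: hC.
Qed.

Lemma layer_integral_cvg j :
  I3 (fun x => psi x * partial j (layer n.+1%:R) x) @[n --> \oo] --> graph_flux psi j.
Proof.
(* The estimates above carry a bounded factor G; here it is trivial. *)
pose G : E -> R := cst 1; pose M : R := 1.
have cG : continuous G by exact: cst_continuous.
have mG := mf3_continuous cG.
have hG x : `|G x| <= M by rewrite /G /M normr1.
have psi1 x : psi x = psi x * G x by rewrite mulr1.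
rewrite (_ : graph_flux psi j = integral_R2 (fun y =>
    psi (graph_point c y) * G (graph_point c y) * conormal c y 0 j)); last first.
  by congr integral_R2; apply/funext => y; rewrite -psi1.
have [C [K [C0 hC]]] := slice_dominated.
have ib : (mu \x mu)%E.-integrable setT
    (EFin \o (fun q => C * M * \1_[set y : E2 | `|y| <= K] (vec2 q))).
  by apply: bfs_integrable; apply: bfsZ; exact: (bms2_bfs (bms2_ball K)).
have sl n := slice_int j n.+1%:R mG hG.
rewrite (_ : (fun n => _) = (fun n => integral_R2 (fun y => conormal c y 0 j *
    \int[mu]_z (layer_kernel S s (gam y) n.+1%:R z * (psi (insert_coord k y z) * G (insert_coord k y z)))))).
  apply: (@Rdominated_cvg _ _ _ (mu \x mu)%E (fun n q => conormal c (vec2 q) 0 j *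
    \int[mu]_z (layer_kernel S s (gam (vec2 q)) n.+1%:R z *
      (psi (insert_coord k (vec2 q) z) * G (insert_coord k (vec2 q) z))))
    _ (fun q => C * M * \1_[set y : E2 | `|y| <= K] (vec2 q)) _ _ ib _).2.
  - by move=> n; exact: (sl n).1.1.
  - move=> q; move: (vec2 q) => y.
    rewrite [X in _ --> X]mulrC.
    have [P P0 hP] := psi_bound.
    have hg z : `|psi (insert_coord k y z) * G (insert_coord k y z)| <= P * M.
      by rewrite normrM ler_pM//; exact: (hP _).1.
    have cz : {for gam y, continuous (fun z => psi (insert_coord k y z) * G (insert_coord k y z))}.
      have ci : {for gam y, continuous (fun z => insert_coord k y z)}.
        by apply: insert_coord_continuous; [exact: cst_continuous|exact: cvg_id].
      by apply: continuousM; apply: continuous_comp ci _; [exact: cpsi|exact: cG].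
    apply: (@cvgM _ _ _ _ (cst _)); first exact: cvg_cst.
    apply: (layer_kernel_cvg hS (chart_signM c) (measurable_slice y mG hG) hg).
    move=> e e0; have /cvgrPdist_lt/(_ e e0)/nbhs_normP[d /= d0 hd] := cz.
    exists d => // r _ rd; rewrite distrC ltW//; apply: hd; by rewrite /ball_/= distrC.
  - by move=> n q; exact: hC.
by apply/funext => n; rewrite -(sl n).2; apply: eq_I3 => x; rewrite -psi1.
Qed.

Lemma bms2_graph j : bms2 (fun y => psi (graph_point c y) * conormal c y 0 j).
Proof.
have [P P0 hP] := psi_bound.
have [N N0 hN] := conormal_bound P.
split.
  apply: (@measurable_continuous _ _ _ _ _ measurable_vec2
    (fun y => psi (graph_point c y) * conormal c y 0 j)) => y.
  have c1 : {for y, continuous (psi \o graph_point c)}.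
    exact: continuous_comp (@graph_point_continuous y) (@cpsi _).
  apply: (continuousM c1); exact: conormal_continuous.
have PN : 0 < P * N by rewrite !mulr_gt0.
exists (Num.max (P * N) P) => y.
have [->|p0] := eqVneq (psi (graph_point c y)) 0.
  by rewrite !mul0r normr0 le_max (ltW PN).
have yP : `|y| <= P.
  by rewrite (le_trans _ ((hP _).2 p0))//; exact: (insert_coord_norm _ _ _).1.
split; last by rewrite gt_max => /andP[_]; rewrite ltNge yP.
rewrite le_max; apply/orP; left.
by rewrite normrM ler_pM// ?hN//; exact: (hP _).1.
Qed.

End LayerFunctions.

(** * Boundary charts and normals *)

Section DomainGeometry.
Context {R : realType}.
Notation E := 'rV[R]_3.

Lemma dotC n (x y : 'rV[R]_n) : dot x y = dot y x.
Proof. by apply: eq_bigr => i _; rewrite mulrC. Qed.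

Lemma dotNl n (x y : 'rV[R]_n) : dot (- x) y = - dot x y.
Proof. by rewrite /dot -sumrN; apply: eq_bigr => i _; rewrite mxE mulNr. Qed.

Lemma dotDl n (x y z : 'rV[R]_n) : dot (x + y) z = dot x z + dot y z.
Proof. by rewrite /dot -big_split; apply: eq_bigr => i _; rewrite mxE mulrDl. Qed.

Lemma dotBl n (x y z : 'rV[R]_n) : dot (x - y) z = dot x z - dot y z.
Proof. by rewrite dotDl dotNl. Qed.

Lemma dotBr n (x y z : 'rV[R]_n) : dot z (x - y) = dot z x - dot z y.
Proof. by rewrite dotC dotBl !(dotC z). Qed.

Lemma dot_ge0 n (x : 'rV[R]_n) : 0 <= dot x x.
Proof. by rewrite sumr_ge0// => i _; rewrite -expr2 sqr_ge0. Qed.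

Lemma dot_eq0 n (x : 'rV[R]_n) : dot x x = 0 -> x = 0.
Proof.
move=> /eqP; rewrite psumr_eq0; last by move=> i _; rewrite -expr2 sqr_ge0.
move=> /allP h; apply/rowP => j; have := h j (mem_index_enum _).
by rewrite /= mulf_eq0 orbb mxE => /eqP.
Qed.

Lemma unit_vectors n (m m' : 'rV[R]_n) : dot m m = 1 -> dot m' m' = 1 ->
  dot (m' - m) m = dot m' m - 1 /\ dot (m - m') m' = dot m' m - 1 /\ (1 <= dot m' m -> m = m').
Proof.
move=> mm mm'; have e2 : dot (m - m') m' = dot m' m - 1 by rewrite dotBl mm' dotC.
split; first by rewrite dotBl mm.
split=> // h1; apply/subr0_eq/dot_eq0/eqP; rewrite eq_le dot_ge0 andbT.
by rewrite dotBr e2 dotBl mm opprB -mulr2n pmulrn_lle0// subr_le0.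
Qed.

Lemma derive_pos_near (V : normedModType R) (f : V -> R) x v : differentiable f x -> f x = 0 ->
  0 < 'D_v f x -> \forall t \near (0 : R)^'+, 0 < f (t *: v + x).
Proof.
move=> df h0 d0; have dv : derivable f x v by exact: diff_derivable.
have := dv; rewrite /derivable => /cvg_ex[l hl].
have el : l = 'D_v f x by rewrite /derive; apply/esym/(cvg_lim _ hl); exact: norm_hausdorff.
have l0 : 0 < l by rewrite el.
have : \forall t \near (0 : R)^', 0 < t^-1 *: (f (t *: v + x) - f x).
  by have := hl _ (lt_nbhsr l0 : nbhs l [set r | 0 < r]).
rewrite /dnbhs /at_right !near_withinE; apply: filterS => t ht t0.
have := ht (lt0r_neq0 t0); rewrite h0 subr0.
by rewrite [_ *: _]/(_ * _) pmulr_rgt0// invr_gt0.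
Qed.

Variable Omega : set E.
Hypothesis oO : open Omega.
Hypothesis bO : bounded_set Omega.

Lemma boundaryE x : boundary Omega x <-> closure Omega x /\ ~ Omega x.
Proof. by have e : interior Omega = Omega; [rewrite -interior_id|rewrite /boundary e]. Qed.

Lemma compact_closure_bounded : compact (closure Omega).
Proof.
apply: bounded_closed_compact; last exact: closed_closure.
case: bO => M [Mr hM]; exists M; split => // r Mr' x cx.
have h : Omega `<=` [set x : E | `|x| <= r] by move=> y Oy; exact: hM Oy.
have cl : closed [set x : E | `|x| <= r].
  by apply: compact_closed (@compact_norm_le _ 3 r); exact: norm_hausdorff.
by move: cx; rewrite closureE; apply.
Qed.

Lemma compact_boundary : compact (boundary Omega).
Proof.
apply: subclosed_compact compact_closure_bounded _; last by move=> x [].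
by apply: closedI; [exact: closed_closure|exact: (open_closedC (@open_interior _ _))].
Qed.

Section one_chart.
Variables (c : chart R) (hc : is_C4_chart Omega c).

Let Cg : Ck 4 setT (cgraph c). Proof. by case: hc. Qed.

Lemma chart_height x : cdom c x -> (Omega x <-> 0 < height c x).
Proof. by case: hc => _ _; apply. Qed.

Lemma height_shift x t : height c (t *: basis_vec (ck c) + x) = chart_sign c * t + height c x.
Proof.
rewrite /height -mulrDr; congr (_ * _).
have -> : col' (ck c) (t *: basis_vec (ck c) + x) = col' (ck c) x.
  apply/rowP => l; rewrite !mxE eqxx/= eq_sym (negPf (neq_lift _ _)).
  by rewrite mulr0 add0r.
by rewrite !mxE !eqxx mulr1 addrA.
Qed.

(** Where the height is negative there are no points of Omega nearby; where it is 0, points of Omega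
    accumulate from the inner side. *)
Lemma chart_boundary x : cdom c x -> (boundary Omega x <-> height c x = 0).
Proof.
move=> cx; have [oc _ _] := hc; rewrite boundaryE (chart_height cx); split.
  move=> [clx /negP]; rewrite -leNgt => hx; apply/eqP; rewrite eq_le hx/= leNgt; apply/negP => hx0.
  have oV : open (cdom c `&` (height c @^-1` [set r | r < 0])).
    apply: openI => //; apply: open_comp; last exact: open_lt.
    by move=> y _; exact: height_continuous.
  have [y [Oy [cy /=]]] := clx _ (open_nbhs_nbhs (conj oV (conj cx hx0))).
  by move/(chart_height cy): Oy => /lt_trans/[apply]; rewrite ltxx.
move=> h0; split; last by rewrite h0 ltxx.
move=> V nV.
(* A point of height 0 is approached from inside along the vertical direction, oriented by the sign
   of the chart. *)
have ce : {for (0 : R), continuous (fun t : R => (chart_sign c * t) *: basis_vec (ck c) + x : E)}.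
  have := @differentiable_continuous R R E 0 (fun t : R => (chart_sign c * t) *: basis_vec (ck c) + x).
  apply; apply: differentiableD; last exact: differentiable_cst.
  apply: differentiableZl; apply: (@differentiableM _ _ (cst (chart_sign c)) id) => //.
have : nbhs ((chart_sign c * 0) *: basis_vec (ck c) + x : E) (V `&` cdom c).
  by rewrite mulr0 scale0r add0r; apply: filterI => //; exact: open_nbhs_nbhs.
move=> /ce/nbhs_normP[d /= d0 hd].
have [|Vz cz] := hd (d / 2).
  by rewrite /ball_/= sub0r normrN gtr0_norm ?divr_gt0// gtr_pMr// invf_lt1// ltr1n.
exists ((chart_sign c * (d / 2)) *: basis_vec (ck c) + x); split => //.
by apply/(chart_height cz); rewrite height_shift mulrA chart_signM mul1r h0 addr0 divr_gt0.
Qed.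

Lemma graph_point_boundary y : cdom c (graph_point c y) -> boundary Omega (graph_point c y).
Proof. by move=> cy; apply/(chart_boundary cy); exact: height_graph_point. Qed.

Lemma conormalE y : conormal c y 0 (ck c) = chart_sign c /\
  forall i, conormal c y 0 (lift (ck c) i) = - (chart_sign c * grad (cgraph c) y 0 i).
Proof.
have [e1 e2] := insert_coordE (ck c) (- grad (cgraph c) y) 1.
rewrite /conormal; split; first by rewrite mxE e1 mulr1.
by move=> i; rewrite mxE e2 [in LHS]mxE mulrN.
Qed.

Lemma area_factorE y : area_factor c y ^+ 2 = dot (conormal c y) (conormal c y).
Proof.
rewrite sqr_sqrtr; last by rewrite addr_ge0// dot_ge0.
rewrite [in RHS]/dot (bigD1_ord (ck c))//= (conormalE y).1 chart_signM.
congr (_ + _); apply: eq_bigr => i _.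
by rewrite !(conormalE y).2 mulrNN mulrACA chart_signM mul1r.
Qed.

Lemma area_factor_gt0 y : 0 < area_factor c y.
Proof. by rewrite sqrtr_gt0 ltr_wpDr// dot_ge0. Qed.

Lemma chart_normalE x j :
  area_factor c (col' (ck c) x) * chart_normal c x 0 j = - conormal c (col' (ck c) x) 0 j.
Proof.
have a0 := lt0r_neq0 (area_factor_gt0 (col' (ck c) x)).
rewrite /chart_normal mxE -/(chart_sign c) mulrA [_ * (_ / _)]mulrC divfK//.
have [e1 e2] := insert_coordE (ck c) (grad (cgraph c) (col' (ck c) x)) (-1).
case: (unliftP (ck c) j) => [i ->|->]; first by rewrite e2 (conormalE _).2 opprK.
by rewrite e1 (conormalE _).1 mulrN1.
Qed.

Lemma chart_normal_unit x : dot (chart_normal c x) (chart_normal c x) = 1.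
Proof.
have a0 := area_factor_gt0 (col' (ck c) x).
apply: (mulfI (lt0r_neq0 (exprn_gt0 2 a0))); rewrite mulr1 {2}area_factorE /dot big_distrr.
apply: eq_bigr => j _ /=.
by rewrite expr2 mulrACA chart_normalE mulrNN.
Qed.

Lemma derive_height x v : 'D_v (height c) x =
  - area_factor c (col' (ck c) x) * dot v (chart_normal c x).
Proof.
rewrite derive_partial; last exact: (CkS_differentiable (height_Ck Cg (isT : (1 <= 4)%N))).
rewrite /dot big_distrr/=; apply: eq_bigr => j _.
by rewrite partial_height// -[RHS]mulrCA -[conormal _ _ _ _]opprK -chart_normalE mulNr.
Qed.

End one_chart.

(** If the normals m and m' differed, the direction m' - m would satisfy (m' - m) . m < 0 and (m' -
    m) . m' > 0. A short move along it would then enter Omega according to c and leave it according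
    to c'. *)
Lemma chart_normal_unique c c' x : is_C4_chart Omega c -> is_C4_chart Omega c' ->
  cdom c x -> cdom c' x -> boundary Omega x -> chart_normal c x = chart_normal c' x.
Proof.
move=> hc hc' cx cx' bx.
set m := chart_normal c x; set m' := chart_normal c' x.
have mm : dot m m = 1 by exact: chart_normal_unit.
have mm' : dot m' m' = 1 by exact: chart_normal_unit.
have [e1 [e2 e3]] := unit_vectors mm mm'.
have [/e3//|h1] := leP 1 (dot m' m).
have x0 : height c x = 0 by apply/(chart_boundary hc cx).
have x0' : height c' x = 0 by apply/(chart_boundary hc' cx').
have d1 : 0 < 'D_(m' - m) (height c) x.
  by rewrite derive_height// -/m e1 mulNr -mulrN mulr_gt0 ?area_factor_gt0// opprB subr_gt0.
have dh := CkS_differentiable (height_Ck (let: And3 _ h _ := hc in h) (isT : (1 <= 4)%N)).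
have dh' := CkS_differentiable (height_Ck (let: And3 _ h _ := hc' in h) (isT : (1 <= 4)%N)).
have d2 : 0 < 'D_(m' - m) (- height c') x.
  rewrite deriveN; last exact/diff_derivable/dh'.
  rewrite derive_height// -/m' -opprB dotNl e2 mulNr mulrN opprK -mulrN opprB.
  by rewrite mulr_gt0 ?area_factor_gt0// subr_gt0.
have n1 := derive_pos_near (dh x I) x0 d1.
have n2 := @derive_pos_near E (- height c') x (m' - m) (differentiableN (dh' x I)) _ d2.
have {}n2 := n2 (etrans (congr1 -%R x0') (oppr0 _)).
have nc : \forall t \near (0 : R)^'+, (cdom c `&` cdom c') (t *: (m' - m) + x).
  have oc : open (cdom c `&` cdom c') by case: hc; case: hc' => o2 _ _ o1 _ _; exact: openI.
  have ct : {for (0 : R), continuous (fun t : R => t *: (m' - m) + x)}.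
    apply: differentiable_continuous; apply: differentiableD; last exact: differentiable_cst.
    by apply: differentiableZl.
  rewrite /at_right near_withinE.
  have : nbhs (0 *: (m' - m) + x) (cdom c `&` cdom c').
    by apply: open_nbhs_nbhs; split => //; rewrite scale0r add0r.
  by move=> /ct hn; near=> t => _; near: t; exact: hn.
have [t [ht1 [ht2 [hc1 hc2]]]] := filter_ex (filterI n1 (filterI n2 nc)).
have /(chart_height hc' hc2) : Omega (t *: (m' - m) + x) by apply/(chart_height hc hc1).
move: ht2; rewrite -[(- height c') _]/(- height c' _) oppr_gt0 => /lt_trans/[apply].
by rewrite ltxx.
Unshelve. all: by end_near. Qed.

Lemma outward_normalE c x : is_C4_chart Omega c -> cdom c x -> boundary Omega x ->
  outward_normal Omega x = chart_normal c x.
Proof.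
move=> hc cx bx; rewrite /outward_normal; set P := [set v | _].
have [c' [hc' cx' ->]] : P (get P) by apply: getPex; exists (chart_normal c x); exists c.
exact: chart_normal_unique.
Qed.

Lemma area_normal c y j : is_C4_chart Omega c -> cdom c (graph_point c y) ->
  area_factor c y * outward_normal Omega (graph_point c y) 0 j = - conormal c y 0 j.
Proof.
move=> hc cy; rewrite (outward_normalE hc cy); last exact: graph_point_boundary.
by rewrite -{1}(col'_insert_coord (ck c) y (cgraph c y)) chart_normalE col'_insert_coord.
Qed.

Hypothesis C4O : C4_boundary Omega.

Lemma outward_normal_unit x : boundary Omega x ->
  dot (outward_normal Omega x) (outward_normal Omega x) = 1.
Proof.
move=> bx; have [c [hc cx]] := C4O bx.
by rewrite (outward_normalE hc cx bx) chart_normal_unit.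
Qed.

Variable S : R -> R.
Hypothesis hS : smooth_step S.

Definition box_bump (x0 : E) (r : R) (x : E) : R :=
  \prod_j (S (r^-1 * (x 0 j - x0 0 j) + 2) * S (2 - r^-1 * (x 0 j - x0 0 j))).

Let step_affine_Ck m (a b : R) j : Ck m setT (fun x : E => S (a * x 0 j + b)).
Proof.
rewrite (_ : (fun x => _) = S \o (cst a * (fun x : E => x 0 j) + cst b)) //.
apply: (@Ck_comp1 _ _ _ _ setT) => //; [exact: openT|exact: step_Ck|].
apply: CkD; [exact: openT| |exact: Ck_cst].
by apply: CkM; [exact: openT|exact: Ck_cst|exact: Ck_coord].
Qed.

Lemma box_bump_smooth x0 r : smooth setT (box_bump x0 r).
Proof.
move=> m; apply: Ck_prod => [|j _]; first exact: openT.
rewrite (_ : (fun x => _) = (fun x : E => S (r^-1 * x 0 j + (2 - r^-1 * x0 0 j))) *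
  (fun x : E => S ((- r^-1) * x 0 j + (2 + r^-1 * x0 0 j)))).
  by apply: CkM; [exact: openT|exact: step_affine_Ck|exact: step_affine_Ck].
by apply/funext => x; congr (S _ * S _); ring.
Qed.

Lemma box_bump_ge0 x0 r x : 0 <= box_bump x0 r x <= 1.
Proof.
have hM (a b : R) : 0 <= a <= 1 -> 0 <= b <= 1 -> 0 <= a * b <= 1.
  by move=> /andP[a0 a1] /andP[b0 b1]; rewrite mulr_ge0//= mulr_ile1.
rewrite /box_bump; elim/big_ind : _ => //; first by rewrite ler01 lexx.
by move=> j _; apply: hM; rewrite step_ge0 ?step_le1.
Qed.

Lemma box_bump1 x0 r x : 0 < r -> `|x - x0| <= r -> box_bump x0 r x = 1.
Proof.
move=> r0 hx; have [_ _ S1 _] := hS; rewrite /box_bump big1// => j _.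
have : `|r^-1 * (x 0 j - x0 0 j)| <= 1.
  rewrite normrM gtr0_norm ?invr_gt0// mulrC ler_pdivrMr// mul1r.
  by have := rV_coord_le (x - x0) j; rewrite !mxE => /le_trans; apply.
move: (r^-1 * _) => a; rewrite ler_norml => /andP[a1 a2].
by rewrite !S1 ?mulr1//; lra.
Qed.

Lemma box_bump_supp x0 r x : 0 < r -> box_bump x0 r x != 0 -> `|x - x0| <= 2 * r.
Proof.
move=> r0 hx; have [_ S0 _ _] := hS; apply: rV_norm_le => [|j]; first by rewrite mulr_ge0// ltW.
rewrite leNgt; apply/negP => h; move/eqP: hx; apply.
rewrite /box_bump (bigD1 j)//= (_ : _ * _ = 0) ?mul0r//.
have : 2 < `|r^-1 * (x 0 j - x0 0 j)|.
  rewrite normrM gtr0_norm ?invr_gt0// mulrC ltr_pdivlMr//.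
  by move: h; rewrite !mxE.
move: (r^-1 * (x 0 j - x0 0 j)) => a; rewrite lter_normr => /orP[h2|h2].
  by rewrite [S (2 - a)]S0 ?mulr0 ?mul0r//; lra.
by rewrite S0 ?mul0r//; lra.
Qed.

(** Converts bumps into a partition of unity without dividing: the sum is 1 wherever one of the
    bumps is 1. *)
Lemma sum_prod_telescope N (b : nat -> R) :
  \sum_(i < N) b i * \prod_(j < i) (1 - b j) = 1 - \prod_(j < N) (1 - b j).
Proof.
elim: N => [|N IH]; first by rewrite !big_ord0 subrr.
by rewrite big_ord_recr/= IH [in RHS]big_ord_recr/= mulrBr mulr1 opprB [b N * _]mulrC; ring.
Qed.

(** The partition sums to 1 on an open neighbourhood U of the boundary, more than an atlas asks for.
    Hence the complementary function 1 - sum psi_i vanishes near the boundary. *)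
Lemma exists_atlas : exists N (c : 'I_N -> chart R) (psi : 'I_N -> E -> R) (U : set E),
  [/\ is_atlas Omega c psi, open U, boundary Omega `<=` U &
    forall x, U x -> \sum_(i < N) psi i x = 1].
Proof.
pose good x (p : chart R * R) := [/\ is_C4_chart Omega p.1, 0 < p.2 &
  forall z, `|z - x| <= 2 * p.2 -> cdom p.1 z].
have h x : exists p, boundary Omega x -> good x p.
  have [bx|bx] := pselect (boundary Omega x); last first.
    by exists (Chart set0 ord0 false (fun=> 0), 0).
  have [c [hc cx]] := C4O bx; have [oc _ _] := hc.
  have /nbhs_normP[r /= r0 hr] := open_nbhs_nbhs (conj oc cx).
  (* The bump of radius r / 4 is supported in the cube of radius r / 2, inside the chart domain. *)
  exists (c, r / 4) => _; split => //=; first by rewrite divr_gt0.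
  move=> z hz; apply: hr => /=; rewrite /ball_/= distrC (le_lt_trans hz)//.
  by rewrite mulrCA gtr_pMr//; lra.
have [f hf] := choice h.
pose B p := [set z : E | `|z - p| < (f p).2].
have oB p : open (B p).
  rewrite (_ : B p = ball p (f p).2); first exact: ball_open.
  by apply/seteqP; split => z; rewrite -ball_normE/= /B/= distrC.
have [s sg cs] : exists2 s : seq E, (forall p, p \in s -> boundary Omega p) &
    forall x, boundary Omega x -> exists2 p, p \in s & B p x.
  have := compact_boundary; rewrite compact_cover => /(_ _ (boundary Omega) B (fun p _ => oB p)).
  case=> [x bx|D Dg cD].
    by exists x => //; rewrite /B/= subrr normr0; have [] := hf x bx.
  exists (finmap.enum_fset D) => [p pD|x bx]; first exact/set_mem/Dg.
  by have [p /= pD Bp] := cD x bx; exists p.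
(* No centres means an empty boundary, for which the empty family is an atlas. *)
have [s0|s0] := eqVneq s [::].
  exists 0%N, (fun=> Chart set0 ord0 false (fun=> 0)), (fun _ _ => 0), set0.
  have b0 x : ~ boundary Omega x by move=> /cs[p]; rewrite s0.
  split; [|exact: open0|by move=> x /b0|by []].
  by split; [case|case|case|move=> x /b0].
have [p0 p0s] : exists p0, p0 \in s by case: (s) s0 => // p t _; exists p; rewrite mem_head.
(* The default p0 is a boundary point as well, so [good] holds at every index. *)
pose p i := nth p0 s i.
have gp i : good (p i) (f (p i)).
  apply: hf; have [hi|hi] := ltnP i (size s); first by apply: sg; rewrite mem_nth.
  by rewrite /p nth_default//; exact: sg.
pose b i := box_bump (p i) (f (p i)).2.
pose psi i (x : E) := b i x * \prod_(j < i) (1 - b j x).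
exists (size s), (fun i => (f (p i)).1), (fun i => psi i), (\bigcup_(q in [set` s]) B q).
have sum1 x : (\bigcup_(q in [set` s]) B q) x -> \sum_(i < size s) psi i x = 1.
  move=> [q /= qs Bq]; rewrite /psi (sum_prod_telescope _ (fun i => b i x)).
  have iq : (index q s < size s)%N by rewrite index_mem.
  rewrite (bigD1 (Ordinal iq))//= [X in 1 - X]mulrC [1 - b _ _](_ : _ = 0) ?mulr0 ?subr0//.
  have [_ r0 _] := gp (index q s).
  by apply/eqP; rewrite subr_eq0 /b box_bump1// /p nth_index// ltW.
split; [|by apply: bigcup_open => q _; exact: oB|by move=> x /cs[q qs Bq]; exists q|exact: sum1].
split.
- by move=> i; case: (gp i).
- move=> i; have [_ r0 hr] := gp i.
  have supp : tsupport (psi i) `<=` near_set [set (p i)] (2 * (f (p i)).2).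
    apply: tsupport_sub_closed.
      by apply: closed_near_set; exact: compact_set1.
    move=> x; rewrite mulf_eq0 negb_or => /andP[bx _].
    by exists (p i) => //; exact: box_bump_supp.
  split.
  + move=> m; apply: CkM; [exact: openT|exact: box_bump_smooth|].
    apply: Ck_prod => [|j _]; first exact: openT.
    rewrite (_ : (fun x => _) = cst 1 + cst (-1) * b j).
      apply: CkD; [exact: openT|exact: Ck_cst|].
      by apply: CkM; [exact: openT|exact: Ck_cst|exact: box_bump_smooth].
    by apply/funext => x; rewrite -[RHS]/(1 + (-1) * b j x) mulN1r.
  + apply: subclosed_compact supp; first exact: closed_closure.
    by apply: compact_near_set; exact: compact_set1.
  + by move=> x /supp[z -> hz]; exact: hr.
- move=> i x; rewrite mulr_ge0//; first by case/andP: (box_bump_ge0 (p i) (f (p i)).2 x).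
  by apply: prodr_ge0 => j _; case/andP: (box_bump_ge0 (p j) (f (p j)).2 x) => _; rewrite subr_ge0.
- by move=> x /cs[q qs Bq]; apply: sum1; exists q.
Qed.

End DomainGeometry.

(** * The flux through the boundary *)

Section AtlasLayers.
Context {R : realType}.
Notation mu := (@lebesgue_measure R).
Notation E := 'rV[R]_3.
Notation E2 := 'rV[R]_2.

Lemma tsupportMl (f g : E -> R) : tsupport (fun x => f x * g x) `<=` tsupport f.
Proof.
apply: tsupport_sub_closed; first exact: closed_closure.
by move=> x; rewrite mulf_eq0 negb_or => /andP[fx _]; exact: subset_closure.
Qed.

Lemma compact_tsupportMl (f g : E -> R) : compact (tsupport f) ->
  compact (tsupport (fun x => f x * g x)).
Proof.
by move=> cf; apply: subclosed_compact cf (@tsupportMl f g); exact: closed_closure.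
Qed.

Lemma continuous_CkW m (f : E -> R) : Ck m setT f -> continuous f.
Proof. by move=> Cf x; exact: (Ck_continuous Cf). Qed.

Lemma partialM (f g : E -> R) j x : Ck 1 setT f -> Ck 1 setT g ->
  partial j (fun x => f x * g x) x = f x * partial j g x + g x * partial j f x.
Proof.
move=> Cf Cg; have df := CkS_differentiable Cf (I : setT x).
have dg := CkS_differentiable Cg (I : setT x).
by rewrite /partial -[fun x => _]/(f * g) deriveM //; exact: diff_derivable.
Qed.

Lemma partial_continuous (f : E -> R) j : Ck 1 setT f -> continuous (partial j f).
Proof. by move=> Cf; apply: (@continuous_CkW 0); exact: CkS_derive Cf. Qed.

Lemma partial_off (f : E -> R) j x : ~ tsupport f x -> partial j f x = 0.
Proof.
by move=> /tsupport_off_near f0; rewrite /partial (@near_eq_derive _ _ _ _ (cst 0)) ?derive_cst.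
Qed.

Lemma CkM1 m (f g : E -> R) : Ck m setT f -> Ck m setT g -> Ck m setT (fun x => f x * g x).
Proof. by move=> Cf Cg; apply: (@CkM _ m _ setT f g) => //; exact: openT. Qed.

Lemma CkD1 m (f g : E -> R) : Ck m setT f -> Ck m setT g -> Ck m setT (fun x => f x + g x).
Proof. by move=> Cf Cg; apply: (@CkD _ _ _ m setT f g) => //; exact: openT. Qed.

Lemma Ck_cst1 m (a : R) : Ck m setT (fun _ : E => a).
Proof. exact: Ck_cst. Qed.

Lemma CkB1 m (f g : E -> R) : Ck m setT f -> Ck m setT g -> Ck m setT (fun x => f x - g x).
Proof.
move=> Cf Cg; rewrite (_ : (fun x => _) = fun x => f x + (-1) * g x).
  exact: (CkD1 Cf (CkM1 (Ck_cst1 m (-1)) Cg)).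
by apply/funext => x; rewrite mulN1r.
Qed.

Variable Omega : set E.
Hypothesis oO : open Omega.
Hypothesis bO : bounded_set Omega.

Lemma bms3_indic : bms3 (\1_Omega : E -> R).
Proof.
have [M hM] : exists M, forall x, Omega x -> `|x| <= M.
  have [M M0 hM] := compact_rV_bounded (compact_closure_bounded bO).
  by exists M => x Ox; apply/ltW/hM/subset_closure.
apply: (@bms3_intro _ _ M 1).
- rewrite (_ : (\1_Omega : E -> R) = (cst 1 : E -> R) \_ Omega).
    by apply: mf3_restrict_continuous => // x _; exact: cst_continuous.
  by apply/funext => x; rewrite patchE indicE; case: ifP.
- by move=> x; rewrite ger0_norm// indicE lern1 leq_b1.
- move=> x; rewrite indicE pnatr_eq0 eqb0 negbK => /set_mem; exact: hM.
Qed.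

Lemma bms3_restrict (f : E -> R) M : mf3 (f \_ Omega) -> (forall x, Omega x -> `|f x| <= M) ->
  bms3 (f \_ Omega).
Proof.
move=> mf hf; apply: (@bms3_le _ _ (fun x => M * \1_Omega x)) => //; last exact: bms3Z bms3_indic.
move=> x; rewrite patchE indicE; case: ifPn => [/set_mem Ox|]; last by rewrite normr0 mulr0 normr0.
by rewrite mulr1 (le_trans (hf x Ox))// ler_norm.
Qed.

Section restriction.
Variables (f : E -> R) (U : set E).
Hypothesis oU : open U.
Hypothesis bU : boundary Omega `<=` U.
Hypothesis f0 : forall x, U x -> f x = 0.

Let oV : open (~` closure Omega `|` U).
Proof. by apply: openU => //; apply: closed_openC; exact: closed_closure. Qed.

Let covV x : Omega x \/ (~` closure Omega `|` U) x.
Proof.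
have [Ox|Ox] := pselect (Omega x); first by left.
have [cx|cx] := pselect (closure Omega x); last by right; left.
by right; right; apply/bU/(boundaryE oO).
Qed.

Let eqV x : (~` closure Omega `|` U) x -> (f \_ Omega) x = 0.
Proof.
rewrite patchE => -[cx|Ux]; last by case: ifP => // _; exact: f0.
by rewrite memNset// => /subset_closure.
Qed.

Let eqO x : Omega x -> (f \_ Omega) x = f x.
Proof. by move=> Ox; rewrite patchE mem_set. Qed.

(** Space is the union of two open sets: Omega, where nothing changes, and the points off the
    closure or in U, where the restriction is 0. *)
Lemma restrict_Ck m : Ck m setT f -> Ck m setT (f \_ Omega).
Proof.
move=> Cf; apply: (@sub_Ck _ _ _ _ (Omega `|` (~` closure Omega `|` U))).
  by move=> x _; exact: covV.
apply: CkU.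
  apply: (@eq_Ck _ _ _ _ _ f) => //; first by move=> x /eqO.
  exact: sub_Ck Cf.
apply: (@eq_Ck _ _ _ _ _ (cst 0)) => //; first by move=> x /eqV.
exact: Ck_cst.
Qed.

Lemma restrict_partial j x : partial j (f \_ Omega) x = (partial j f \_ Omega) x.
Proof.
have h : (~` closure Omega `|` U) x -> partial j (f \_ Omega) x = 0.
  by move=> Vx; rewrite /partial (@eq_derive_open _ _ _ _ _ (cst 0) _ oV) ?derive_cst.
rewrite patchE; case: ifPn => [/set_mem Ox|/negP Ox].
  by rewrite /partial (@eq_derive_open _ _ _ _ _ f _ oO).
by have [/mem_set//|/h] := covV x.
Qed.

Lemma restrict_tsupport : compact (tsupport (f \_ Omega)) /\ tsupport (f \_ Omega) `<=` Omega.
Proof.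
have h : tsupport (f \_ Omega) `<=` closure Omega `&` ~` U.
  apply: tsupport_sub_closed; first by apply: closedI; [exact: closed_closure|exact: open_closedC].
  move=> x fx; have [Ox|Vx] := covV x; last by rewrite eqV ?eqxx in fx.
  split; first exact: subset_closure.
  by move=> Ux; rewrite eqO// f0 ?eqxx in fx.
split.
  apply: subclosed_compact (compact_closure_bounded bO) _; first exact: closed_closure.
  by move=> x /h[].
move=> x /h[cx nU]; apply: contrapT => nO; apply: nU; apply: bU; exact/(boundaryE oO).
Qed.

End restriction.

Variable S : R -> R.
Hypothesis hS : smooth_step S.

Section one_chart.
Variable c : chart R.
Hypothesis hc : is_C4_chart Omega c.
Let Cg : Ck 4 setT (cgraph c). Proof. by case: hc. Qed.
Notation chi n := (layer c S n.+1%:R).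

Lemma layer_domain n x : cdom c x -> chi n x != 0 -> Omega x.
Proof.
move=> cx /(layer_neq0 hS (ltr0Sn _ n)) h; apply/(chart_height hc cx).
by apply: lt_le_trans h; rewrite invr_gt0.
Qed.

Lemma layer_eventually1 x : cdom c x -> Omega x -> \forall n \near \oo, chi n x = 1.
Proof. by move=> cx /(chart_height hc cx); exact: layer_cvg. Qed.

Lemma layer_norm n x : `|chi n x| <= 1.
Proof. by rewrite ger0_norm ?layer_ge0 ?layer_le1. Qed.

Lemma layer_mul_tsupport n (f : E -> R) : compact (tsupport f) -> tsupport f `<=` cdom c ->
  compact (tsupport (fun x => f x * chi n x)) /\ tsupport (fun x => f x * chi n x) `<=` Omega.
Proof.
move=> cf fc; split; first exact: compact_tsupportMl.
have h : tsupport (fun x => f x * chi n x) `<=` tsupport f `&` [set x | n.+1%:R^-1 <= height c x].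
  apply: tsupport_sub_closed.
    apply: closedI; first exact: closed_closure.
    apply: (@preimage_closed _ _ (height c) [set r | n.+1%:R^-1 <= r]); last exact: closed_ge.
    by move=> x _; exact: height_continuous.
  move=> x; rewrite mulf_eq0 negb_or => /andP[fx cx]; split; first exact: subset_closure.
  exact: (layer_neq0 hS (ltr0Sn _ n)).
move=> x /h[/fc cx hx]; apply/(chart_height hc cx); apply: lt_le_trans hx.
by rewrite invr_gt0.
Qed.

(** The divergence theorem in one chart. The product of f and a layer has compact support, so its
    derivative integrates to 0. In the product rule, the derivative of the layer converges to the
    flux and the derivative of f to the volume integral. *)
Lemma graph_flux_C1 (f : E -> R) j : Ck 1 setT f -> compact (tsupport f) -> tsupport f `<=` cdom c ->
  graph_flux c f j = - I3 (partial j f \_ Omega).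
Proof.
move=> Cf kf fc.
have cf := continuous_CkW Cf.
have h1 := @layer_integral_cvg _ _ Cg _ hS _ cf kf j.
have Cchi n : Ck 1 setT (chi n) by exact: (layer_Ck Cg hS).
have cp := @partial_continuous f j Cf.
have e n : I3 (fun x => f x * partial j (chi n) x) = - I3 (fun x => partial j f x * chi n x).
  have [k1 _] := layer_mul_tsupport n kf fc.
  have [_] := I3_partial0 j (CkM1 Cf (Cchi n)) k1.
  rewrite (_ : partial j _ = fun x => f x * partial j (chi n) x + partial j f x * chi n x); last first.
    by apply/funext => x; rewrite partialM// [chi n x * _]mulrC.
  rewrite I3D.
  - by move=> /eqP; rewrite addr_eq0 => /eqP.
  - apply: (bms3_continuous_compact _ kf).
      by move=> x; apply: continuousM; [exact: cf|exact: partial_layer_continuous].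
    by move=> x /tsupport_off ->; rewrite mul0r.
  - apply: (bms3_continuous_compact _ kf).
      move=> x; apply: continuousM; [exact: cp|exact: (continuous_CkW (Cchi n))].
    by move=> x /partial_off ->; rewrite mul0r.
have h2 : I3 (fun x => partial j f x * chi n x) @[n --> \oo] --> I3 (partial j f \_ Omega).
  have bp : bms3 (partial j f).
    by apply: (bms3_continuous_compact cp kf) => x; exact: partial_off.
  apply: (I3_dominated _ _ (bms3_norm bp) _).2.
  - move=> n; apply: mf3_continuous => x.
    by apply: continuousM; [exact: cp|exact: (continuous_CkW (Cchi n))].
  - move=> x; have [tx|tx] := pselect (tsupport f x); last first.
      rewrite patchE partial_off// if_same.
      by rewrite (_ : (fun n => _) = cst 0); [exact: cvg_cst|apply/funext => n; rewrite mul0r].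
    rewrite patchE; case: ifPn => [/set_mem Ox|/negP Ox].
      apply: cvg_near_cst; have := layer_eventually1 (fc x tx) Ox.
      by apply: filterS => n ->; rewrite mulr1.
    rewrite (_ : (fun n => _) = cst 0); first exact: cvg_cst.
    apply/funext => n; have [->|cn] := eqVneq (chi n x) 0; first by rewrite mulr0.
    by case: Ox; apply/mem_set/(layer_domain (fc x tx) cn).
  - move=> n x; rewrite normrM ler_piMr//; exact: layer_norm.
apply: (cvg_unique _ h1); first exact: norm_hausdorff.
by rewrite (_ : (fun n => _) = (fun n => - I3 (fun x => partial j f x * chi n x)));
  [exact: cvgN|apply/funext => n; exact: e].
Qed.

(** Continuity of the flux in the sup norm on the support of psi, needed to pass from smooth to
    continuous integrands. *)
Lemma graph_flux_lipschitz (psi : E -> R) j : continuous psi -> compact (tsupport psi) ->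
  exists2 C, 0 < C & forall (f g : E -> R) e, continuous f -> continuous g -> 0 <= e ->
    (forall x, psi x != 0 -> `|f x - g x| <= e) ->
    `|graph_flux c (fun x => psi x * f x) j - graph_flux c (fun x => psi x * g x) j| <= C * e.
Proof.
move=> cp kp.
have bp := bms2_bfs (bms2_graph Cg cp kp j).
pose I := integral_R2 (fun y => `|psi (graph_point c y) * conormal c y 0 j|).
have I0 : 0 <= I by apply: Rintegral_ge0 => q _; exact: normr_ge0.
exists (I + 1) => [|f g e cf cg e0 fg]; first by rewrite ltr_wpDl.
have cM (h : E -> R) : continuous h -> continuous (fun x => psi x * h x).
  by move=> ch x; apply: continuousM; [exact: cp|exact: ch].
have bf := bms2_bfs (bms2_graph Cg (cM _ cf) (compact_tsupportMl kp) j).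
have bg := bms2_bfs (bms2_graph Cg (cM _ cg) (compact_tsupportMl kp) j).
rewrite /graph_flux /integral_R2 -bfs_intB// mulrDl mul1r ler_wpDr//.
rewrite mulrC -(bfs_intZ _ (bfs_norm bp)).
apply: bfs_int_norm; [exact: bfsB|by apply: bfsZ; exact: bfs_norm|] => q /=.
move: (vec2 q) => y; rewrite -mulrBl -mulrBr.
have [->|py] := eqVneq (psi (graph_point c y)) 0; first by rewrite !mul0r normr0 mulr0.
by rewrite mulrAC normrM mulrC ler_wpM2r// fg.
Qed.

End one_chart.

Section families.
Variables (N : nat) (c : 'I_N -> chart R) (psi : 'I_N -> E -> R).
Hypothesis hA : is_atlas Omega c psi.

(** With the sign of [graph_flux], this is minus the surface integral of G times the j-th component
    of the outward normal. *)
Definition flux (G : E -> R) j : R := \sum_i graph_flux (c i) (fun x => psi i x * G x) j.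

Let hc i : is_C4_chart Omega (c i). Proof. by case: hA => h _ _ _. Qed.
Let psi_Ck m i : Ck m setT (psi i).
Proof. by case: hA => _ h _ _; case: (h i) => + _ _; exact. Qed.
Let psi_cpt i : compact (tsupport (psi i)).
Proof. by case: hA => _ h _ _; case: (h i). Qed.
Let psi_dom i : tsupport (psi i) `<=` cdom (c i).
Proof. by case: hA => _ h _ _; case: (h i). Qed.

Let psi_graph i y : psi i (graph_point (c i) y) != 0 ->
  cdom (c i) (graph_point (c i) y) /\ boundary Omega (graph_point (c i) y).
Proof.
move=> py; have cy : cdom (c i) (graph_point (c i) y) by apply/psi_dom/subset_closure.
by split => //; exact: (graph_point_boundary oO (hc i)).
Qed.

Lemma flux_eq G G' j : (forall x, boundary Omega x -> G x = G' x) -> flux G j = flux G' j.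
Proof.
move=> h; apply: eq_bigr => i _; apply: eq_Rintegral => q _; move: (vec2 q) => y.
have [->|py] := eqVneq (psi i (graph_point (c i) y)) 0; first by rewrite !mul0r.
by rewrite h//; case: (psi_graph py).
Qed.

(** On the graph the area factor times the outward normal is minus the conormal; this is the source
    of the sign. *)
Lemma atlas_integral_flux (G : 'I_3 -> E -> R) (f : E -> R) : (forall j, continuous (G j)) ->
  (forall x, boundary Omega x -> f x = \sum_j outward_normal Omega x 0 j * G j x) ->
  atlas_integral c psi f = - \sum_j flux (G j) j.
Proof.
move=> cG fG; rewrite /atlas_integral /flux exchange_big/= -sumrN; apply: eq_bigr => i _.
have b j : bfs (mu \x mu)%E (fun q => psi i (graph_point (c i) (vec2 q)) *
    G j (graph_point (c i) (vec2 q)) * conormal (c i) (vec2 q) 0 j).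
  have Cg : Ck 4 setT (cgraph (c i)) by case: (hc i).
  apply: (bms2_bfs (@bms2_graph _ _ Cg (fun x => psi i x * G j x) _ _ j)).
    by move=> x; apply: continuousM; [exact: (continuous_CkW (psi_Ck 0 i))|exact: cG].
  exact: compact_tsupportMl.
have -> : \sum_j graph_flux (c i) (fun x => psi i x * G j x) j =
    \int[(mu \x mu)%E]_q \sum_j (psi i (graph_point (c i) (vec2 q)) * G j (graph_point (c i) (vec2 q)) *
      conormal (c i) (vec2 q) 0 j).
  by apply/esym/bfs_int_sum => j _; exact: b.
rewrite /integral_R2 -bfs_intN; last by apply: bfs_sum => j _; exact: b.
apply: eq_Rintegral => q _; move: (vec2 q) => y; rewrite /= -/(graph_point (c i) y).
have [->|py] := eqVneq (psi i (graph_point (c i) y)) 0.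
  by rewrite !mul0r big1 ?oppr0// => j _; rewrite !mul0r.
have [cy bx] := psi_graph py.
rewrite fG// mulrAC big_distrr/= -sumrN; apply: eq_bigr => j _ /=.
rewrite -[conormal _ _ _ _]opprK -(area_normal oO _ (hc i) cy); ring.
Qed.

(** The sum of the psi_i stays under the derivative: an atlas prescribes its value on the boundary
    only. *)
Lemma flux_C1 (G : E -> R) j : Ck 1 setT G ->
  flux G j = - I3 (partial j (fun x => (\sum_i psi i x) * G x) \_ Omega).
Proof.
move=> CG; have CpG i : Ck 1 setT (fun x => psi i x * G x) by apply: CkM1.
have kpG i : compact (tsupport (fun x => psi i x * G x)) by exact: compact_tsupportMl.
have b i : bms3 (partial j (fun x => psi i x * G x) \_ Omega).
  have cp := @partial_continuous _ j (CpG i).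
  have [_ [M hM]] : bms3 (partial j (fun x => psi i x * G x)).
    by apply: (bms3_continuous_compact cp (kpG i)) => x; exact: partial_off.
  apply: (@bms3_restrict _ M).
    by apply: mf3_restrict_continuous => // x _; exact: cp.
  by move=> x _; exact: (hM x).1.
rewrite (_ : partial j _ \_ Omega = fun x => \sum_i (partial j (fun x => psi i x * G x) \_ Omega) x).
  rewrite I3_sum => [|i _]; last exact: b.
  rewrite /flux -sumrN; apply: eq_bigr => i _; 
  apply: (@graph_flux_C1 (c i) (hc i) (fun x => psi i x * G x) j (CpG i) (@kpG i)).
  by move=> x /tsupportMl; exact: psi_dom.
apply/funext => x; rewrite patchE; case: ifPn => xO; last first.
  by rewrite big1// => i _; rewrite patchE (negPf xO).
have -> : (fun x => (\sum_i psi i x) * G x) = \sum_i (fun x => psi i x * G x).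
  by apply/funext => z; rewrite fct_sumE big_distrl.
have [_] := @derive_bigsum R E R _ (index_enum 'I_N) xpredT (fun i x => psi i x * G x) x (basis_vec j)
  (fun i _ => diff_derivable (CkS_differentiable (CpG i) (I : setT x))).
by rewrite /partial => ->; apply: eq_bigr => i _; rewrite patchE xO.
Qed.

Lemma flux_lipschitz j : exists2 C, 0 < C & forall (f g : E -> R) e, continuous f -> continuous g ->
    0 <= e -> (forall i x, psi i x != 0 -> `|f x - g x| <= e) -> `|flux f j - flux g j| <= C * e.
Proof.
have h i : exists C, 0 < C /\ forall (f g : E -> R) e, continuous f -> continuous g -> 0 <= e ->
    (forall x, psi i x != 0 -> `|f x - g x| <= e) ->
    `|graph_flux (c i) (fun x => psi i x * f x) j - graph_flux (c i) (fun x => psi i x * g x) j| <= C * e.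
  have [C C0 hC] := graph_flux_lipschitz (hc i) j (continuous_CkW (psi_Ck 0 i)) (@psi_cpt i).
  by exists C.
have [C hC] := fin_all_exists h.
exists (1 + \sum_i C i).
  by rewrite ltr_pwDl// sumr_ge0// => i _; have [/ltW] := hC i.
move=> f g e cf cg e0 fg; rewrite /flux -sumrB (le_trans (ler_norm_sum _ _ _))//.
rewrite mulrDl mul1r ler_wpDl// big_distrl ler_sum// => i _.
by have [_] := hC i; apply => // x; exact: fg.
Qed.

End families.

Section independence.
Variables (N : nat) (c : 'I_N -> chart R) (psi : 'I_N -> E -> R) (U : set E).
Hypothesis hA : is_atlas Omega c psi.
Hypothesis oU : open U.
Hypothesis bU : boundary Omega `<=` U.
Hypothesis sumU : forall x, U x -> \sum_i psi i x = 1.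
Variables (N' : nat) (c' : 'I_N' -> chart R) (psi' : 'I_N' -> E -> R).
Hypothesis hA' : is_atlas Omega c' psi'.

Let sum_Ck n (d : 'I_n -> chart R) (chi : 'I_n -> E -> R) m : is_atlas Omega d chi ->
  Ck m setT (fun x => \sum_i chi i x).
Proof.
move=> [_ h _ _]; rewrite (_ : (fun x => _) = \sum_i chi i).
  by apply: Ck_sum => [|i _]; [exact: openT|case: (h i) => + _ _; exact].
by apply/funext => x; rewrite fct_sumE.
Qed.

(** The two volume integrals differ by that of the derivative of gG = (Psi' - Psi) G. This function
    vanishes on the boundary but perhaps not near it, so it is split into Psi gG, whose integral is
    a flux of zero boundary values, and (1 - Psi) gG. *)
Let flux_indep_C1 (G : E -> R) j : Ck 1 setT G -> flux c' psi' G j = flux c psi G j.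
Proof.
move=> CG.
pose Psi (x : E) := \sum_i psi i x; pose Psi' (x : E) := \sum_i psi' i x.
have CP : Ck 1 setT Psi by exact: sum_Ck hA.
have CP' : Ck 1 setT Psi' by exact: sum_Ck hA'.
have C1P : Ck 1 setT (fun x => 1 - Psi x) by exact: (CkB1 (Ck_cst1 1 1) CP).
pose gG (x : E) := (Psi' x - Psi x) * G x.
have CgG : Ck 1 setT gG by exact: (CkM1 (CkB1 CP' CP) CG).
have i1 : flux c psi gG j = 0.
  rewrite (flux_eq hA (G' := cst 0)) => [|x bx].
    rewrite /flux big1// => i _; rewrite /graph_flux (_ : (fun y => _) = fun=> 0).
      by rewrite /integral_R2 Rintegral_cst// mul0r.
    by apply/funext => y; rewrite mulr0 mul0r.
  have e : Psi x = 1 by exact/sumU/bU.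
  have e' : Psi' x = 1 by case: hA' => _ _ _; apply.
  by rewrite /gG e e' subrr mul0r.
(* As Psi is 1 on U, this part extends by 0 to a C^1 function with compact support. *)
have i2 : I3 (partial j (fun x => (1 - Psi x) * gG x) \_ Omega) = 0.
  pose f (x : E) := (1 - Psi x) * gG x.
  have f0 x : U x -> f x = 0 by move=> Ux; rewrite /f {1}/Psi sumU// subrr mul0r.
  have Cf : Ck 1 setT f by exact: (CkM1 C1P CgG).
  have [k1 k2] := restrict_tsupport oU bU f0.
  have [_] := I3_partial0 j (restrict_Ck oU bU f0 Cf) k1.
  by congr (_ = _); apply: eq_I3 => x; exact: (restrict_partial oU bU f0).
have mr (f : E -> R) : Ck 1 setT f -> bms3 (partial j f \_ Omega).
  move=> Cf; have cp := @partial_continuous f j Cf.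
  have [M _ hM] := compact_bound (compact_closure_bounded bO) cp.
  apply: (@bms3_restrict _ M); first by apply: mf3_restrict_continuous => // x _; exact: cp.
  by move=> x Ox; apply/hM/subset_closure.
have pD (f g : E -> R) : Ck 1 setT f -> Ck 1 setT g ->
    I3 (partial j (fun x => f x + g x) \_ Omega) = I3 (partial j f \_ Omega) + I3 (partial j g \_ Omega).
  move=> Cf Cg; rewrite -I3D; [|exact: mr|exact: mr]; apply: eq_I3 => x.
  rewrite !patchE; case: ifPn => _; last by rewrite addr0.
  rewrite {1}/partial (@deriveD _ _ _ f g) //; apply: diff_derivable.
    exact: (CkS_differentiable Cf).
  exact: (CkS_differentiable Cg).
have i3 : I3 (partial j gG \_ Omega) = 0.
  rewrite (_ : gG = fun x => Psi x * gG x + (1 - Psi x) * gG x); last first.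
    by apply/funext => x; ring.
  rewrite (pD _ _ (CkM1 CP CgG) (CkM1 C1P CgG)).
  by rewrite i2 addr0; apply: oppr_inj; rewrite -(flux_C1 hA j CgG) i1 oppr0.
rewrite (flux_C1 hA' j CG) (flux_C1 hA j CG) -/Psi.
rewrite (_ : (fun x => (\sum_i psi' i x) * G x) = fun x => Psi x * G x + gG x); last first.
  by apply/funext => x; rewrite /gG -/(Psi' x); ring.
by rewrite (pD _ _ (CkM1 CP CG) CgG) i3 addr0.
Qed.

Lemma flux_indep (G : E -> R) j : continuous G -> flux c' psi' G j = flux c psi G j.
Proof.
move=> cG; have [C C0 hC] := flux_lipschitz hA j; have [C' C'0 hC'] := flux_lipschitz hA' j.
have [r r0 hr] : exists2 r, 0 < r & (forall i x, psi i x != 0 -> `|x| <= r) /\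
    (forall i x, psi' i x != 0 -> `|x| <= r).
  have h n (d : 'I_n -> chart R) (chi : 'I_n -> E -> R) : is_atlas Omega d chi ->
      exists2 r, 0 < r & forall i x, chi i x != 0 -> `|x| <= r.
    move=> [_ ht _ _]; apply: (@fin_bound _ _ (fun i r => forall x, chi i x != 0 -> `|x| <= r)).
      by move=> i N1 N2 NN hN x /hN/le_trans; apply.
    move=> i; case: (ht i) => _ kt _; have [r r0 hr] := compact_rV_bounded kt.
    by exists r => // x cx; apply/ltW/hr/subset_closure.
  have [r r0 hr] := h _ _ _ hA; have [r' r'0 hr'] := h _ _ _ hA'.
  exists (r + r'); first exact: addr_gt0.
  split=> i x; first by move=> /hr/le_trans; apply; rewrite lerDl ltW.
  by move=> /hr'/le_trans; apply; rewrite lerDr ltW.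
have uc e : 0 < e -> exists2 d, 0 < d & forall x y : E, `|x| <= r -> `|y| <= r ->
    `|x - y| < d -> `|G x - G y| < e.
  move=> e0; have [d d0 hd] := compact_continuous_near (@compact_norm_le _ 3 r) (fun x _ => cG x) e0.
  by exists d => // x y xr _; exact: hd.
apply/eqP; rewrite -subr_eq0 -normr_le0; apply/ler_addgt0Pl => e e0; rewrite addr0.
have e1 : 0 < e / (C + C') by rewrite divr_gt0// addr_gt0.
have [g gs hg] := uniform_approx_smooth hS (fun x h => h) uc e1.
have cg := continuous_CkW (gs 0%N).
have -> : flux c' psi' G j - flux c psi G j =
    (flux c' psi' G j - flux c' psi' g j) + (flux c psi g j - flux c psi G j).
  by rewrite (flux_indep_C1 j (gs 1%N)) addrA subrK.
rewrite (le_trans (ler_normD _ _))//.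
rewrite (_ : e = C' * (e / (C + C')) + C * (e / (C + C'))); last first.
  by rewrite -mulrDl [C' + C]addrC mulrC divfK// gt_eqF// addr_gt0.
apply: lerD.
  by apply: hC' => //; [exact: ltW|move=> i x /hr.2 xr; rewrite distrC; exact: hg].
by apply: hC => //; [exact: ltW|move=> i x /hr.1 xr; exact: hg].
Qed.

End independence.

End AtlasLayers.

(** * Cut-offs supported inside the domain *)

Section InteriorCutoff.
Context {R : realType}.
Notation mu := (@lebesgue_measure R).
Notation E := 'rV[R]_3.

Definition compactly_inside (A : set E) (f : E -> R) :=
  compact (tsupport f) /\ tsupport f `<=` A.

Lemma compactly_insideD A f g : compactly_inside A f -> compactly_inside A g ->
  compactly_inside A (fun x => f x + g x).
Proof.
move=> [kf fA] [kg gA].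
have h : tsupport (fun x => f x + g x) `<=` tsupport f `|` tsupport g.
  apply: tsupport_sub_closed; first by apply: closedU; exact: closed_closure.
  move=> x; have [f0|f0 _] := eqVneq (f x) 0; last by left; exact: subset_closure.
  by rewrite f0 add0r => gx; right; exact: subset_closure.
split; last by move=> x /h[/fA|/gA].
by apply: subclosed_compact (compactU kf kg) h; exact: closed_closure.
Qed.

Lemma compactly_inside_sum A n (f : 'I_n -> E -> R) : (forall i, compactly_inside A (f i)) ->
  compactly_inside A (fun x => \sum_i f i x).
Proof.
move=> h; elim: n f h => [|n IH] f h.
  have e : tsupport (fun x : E => \sum_(i < 0) f i x) = set0.
    rewrite -subset0 /tsupport (_ : [set x | _] = set0) ?closure0//.
    by rewrite -subset0 => x /=; rewrite big_ord0 eqxx.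
  by rewrite /compactly_inside e; split => //; exact: compact0.
rewrite (_ : (fun x => _) = fun x => \sum_(i < n) f (widen_ord (leqnSn n) i) x + f ord_max x).
  by apply: compactly_insideD; [exact: IH|exact: h].
by apply/funext => x; rewrite big_ord_recr.
Qed.

Lemma cvg_bigsum n (u : 'I_n -> nat -> R) (l : 'I_n -> R) : (forall i, u i k @[k --> \oo] --> l i) ->
  \sum_i u i k @[k --> \oo] --> \sum_i l i.
Proof.
elim: n u l => [|n IH] u l h.
  rewrite big_ord0 (_ : (fun k => _) = cst 0); first exact: cvg_cst.
  by apply/funext => k; rewrite big_ord0.
rewrite big_ord_recr (_ : (fun k => _) = fun k => \sum_(i < n) u (widen_ord (leqnSn n) i) k + u ord_max k).
  by apply: cvgD; [apply: IH|exact: h].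
by apply/funext => k; rewrite big_ord_recr.
Qed.

Lemma Ck_sum1 m n (f : 'I_n -> E -> R) : (forall i, Ck m setT (f i)) ->
  Ck m setT (fun x => \sum_i f i x).
Proof.
move=> h; rewrite (_ : (fun x => _) = \sum_i f i); first by apply: Ck_sum => //; exact: openT.
by apply/funext => x; rewrite fct_sumE.
Qed.

Lemma partial_sum n (f : 'I_n -> E -> R) j x : (forall i, Ck 1 setT (f i)) ->
  partial j (fun x => \sum_i f i x) x = \sum_i partial j (f i) x.
Proof.
move=> h; rewrite (_ : (fun x => _) = \sum_i f i); last by apply/funext => z; rewrite fct_sumE.
have [_] := @derive_bigsum R E R _ (index_enum 'I_n) xpredT f x (basis_vec j)
  (fun i _ => diff_derivable (CkS_differentiable (h i) (I : setT x))).
by [].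
Qed.

Lemma partialD (f g : E -> R) j x : Ck 1 setT f -> Ck 1 setT g ->
  partial j (fun x => f x + g x) x = partial j f x + partial j g x.
Proof.
move=> Cf Cg; rewrite /partial (@deriveD _ _ _ f g) //; apply: diff_derivable.
  exact: (CkS_differentiable Cf).
exact: (CkS_differentiable Cg).
Qed.

Variable Omega : set E.
Hypothesis oO : open Omega.
Hypothesis bO : bounded_set Omega.
Variable S : R -> R.
Hypothesis hS : smooth_step S.
Variables (N : nat) (c : 'I_N -> chart R) (psi : 'I_N -> E -> R) (U : set E).
Hypothesis hA : is_atlas Omega c psi.
Hypothesis oU : open U.
Hypothesis bU : boundary Omega `<=` U.
Hypothesis sumU : forall x, U x -> \sum_i psi i x = 1.

(** The atlas that [get] selects is unknown; independence of the atlas replaces it by the fixed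
    one. *)
Lemma surface_integral_flux (G : 'I_3 -> E -> R) (f : E -> R) : (forall j, continuous (G j)) ->
  (forall x, boundary Omega x -> f x = \sum_j outward_normal Omega x 0 j * G j x) ->
  surface_integral Omega f = - \sum_j flux c psi (G j) j.
Proof.
move=> cG fG; rewrite /surface_integral; set P := [set I | _].
have [N' [c' [psi' [hA' ->]]]] : P (get P).
  by apply: getPex; exists (atlas_integral c psi f), N, c, psi.
rewrite (atlas_integral_flux oO hA' cG fG); congr (- _); apply: eq_bigr => j _.
exact: (flux_indep oO bO hS hA oU bU sumU hA').
Qed.

Let hc i : is_C4_chart Omega (c i). Proof. by case: hA => h _ _ _. Qed.
Let Cg i : Ck 4 setT (cgraph (c i)). Proof. by case: (hc i). Qed.
Let psi_Ck m i : Ck m setT (psi i).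
Proof. by case: hA => _ h _ _; case: (h i) => + _ _; exact. Qed.
Let psi_cont i : continuous (psi i). Proof. exact: (continuous_CkW (psi_Ck 0 i)). Qed.
Let psi_cpt i : compact (tsupport (psi i)).
Proof. by case: hA => _ h _ _; case: (h i). Qed.
Let psi_dom i : tsupport (psi i) `<=` cdom (c i).
Proof. by case: hA => _ h _ _; case: (h i). Qed.

Notation chi n i := (layer (c i) S n.+1%:R).
Let rest (x : E) := 1 - \sum_i psi i x.

Let chi_Ck n i : Ck 1 setT (chi n i). Proof. exact: (layer_Ck (Cg i) hS). Qed.

Let rest_Ck : Ck 1 setT rest.
Proof. apply: CkB1; [exact: Ck_cst1|exact: (Ck_sum1 (psi_Ck 1))]. Qed.

Let rest0 x : U x -> rest x = 0. Proof. by move=> Ux; rewrite /rest sumU// subrr. Qed.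

(** The complementary function 1 - sum psi_i has to be cut to Omega, being 1 far outside too. The
    cut keeps it C^1 because the function vanishes on U. *)
Definition interior_cutoff n (x : E) : R :=
  (rest \_ Omega) x + \sum_i psi i x * layer (c i) S n.+1%:R x.
Notation eta := interior_cutoff.

Let psichi_Ck n i : Ck 1 setT (fun x => psi i x * chi n i x).
Proof. exact: (CkM1 (psi_Ck 1 i) (chi_Ck n i)). Qed.

Lemma interior_cutoff_Ck n : Ck 1 setT (eta n).
Proof.
apply: CkD1; first exact: (restrict_Ck oO oU bU rest0 rest_Ck).
exact: (Ck_sum1 (psichi_Ck n)).
Qed.

Lemma interior_cutoff_inside n : compactly_inside Omega (eta n).
Proof.
apply: compactly_insideD; first exact: (restrict_tsupport oO bO oU bU rest0).
apply: compactly_inside_sum => i.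
exact: (layer_mul_tsupport hS (hc i) n (@psi_cpt i) (@psi_dom i)).
Qed.

Let psi_bound : exists2 B, 0 < B & forall i, (forall x, `|psi i x| <= B) /\
  forall j x, `|partial j (psi i) x| <= B.
Proof.
apply: (@fin_bound _ _ (fun i B => (forall x, `|psi i x| <= B) /\
  forall j x, `|partial j (psi i) x| <= B)).
  by move=> i B1 B2 B12 [h1 h2]; split=> [x|j x]; rewrite (le_trans _ B12).
move=> i; have [B B0 hB] := compact_bound (@psi_cpt i) (@psi_cont i).
have [C C0 hC] : exists2 C, 0 < C & forall j x, `|partial j (psi i) x| <= C.
  apply: (@fin_bound _ _ (fun j C => forall x, `|partial j (psi i) x| <= C)).
    by move=> j C1 C2 C12 h x; rewrite (le_trans _ C12).
  move=> j; have [C C0 hC] := compact_bound (@psi_cpt i) (@partial_continuous _ _ j (psi_Ck 1 i)).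
  exists C => // x; have [tx|tx] := pselect (tsupport (psi i) x); first exact: hC.
  by rewrite partial_off// normr0 ltW.
exists (B + C); first exact: addr_gt0.
split=> [x|j x]; last by rewrite (le_trans (hC j x))// lerDr ltW.
have [tx|tx] := pselect (tsupport (psi i) x).
  by rewrite (le_trans (hB x tx))// lerDl ltW.
by rewrite (tsupport_off tx) normr0 addr_ge0 ?ltW.
Qed.

Lemma interior_cutoff_bound : exists2 B, 0 < B & forall n x, `|eta n x| <= B.
Proof.
have [B B0 hB] := psi_bound; exists (1 + B *+ N + B *+ N).
  by rewrite -addrA ltr_pwDl// addr_ge0// mulrn_wge0// ltW.
have sB (f : 'I_N -> R) : (forall i, `|f i| <= B) -> `|\sum_i f i| <= B *+ N.
  move=> h; rewrite (le_trans (ler_norm_sum _ _ _))//.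
  by rewrite -[N in B *+ N]card_ord -sumr_const ler_sum.
move=> n x; rewrite (le_trans (ler_normD _ _))// lerD//.
  have r0 : `|rest x| <= 1 + B *+ N.
    rewrite (le_trans (ler_normB _ _))// normr1 lerD2l; apply: sB => i; exact: (hB i).1.
  rewrite patchE; case: ifP => // _; by rewrite normr0 addr_ge0// mulrn_wge0// ltW.
apply: sB => i; rewrite normrM -[B]mulr1 ler_pM//; first exact: (hB i).1.
exact: layer_norm.
Qed.

Let chi_eventually i x : psi i x != 0 \/ tsupport (psi i) x -> Omega x ->
  \forall n \near \oo, chi n i x = 1.
Proof.
move=> h Ox; apply: (layer_eventually1 hS (hc i)) => //.
by apply: psi_dom; case: h => // h; exact: subset_closure.
Qed.

Lemma interior_cutoff_cvg x : Omega x -> \forall n \near \oo, eta n x = 1.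
Proof.
move=> Ox.
have : \forall n \near \oo, forall i, psi i x * chi n i x = psi i x.
  apply: filter_forall => i; have [p0|p0] := eqVneq (psi i x) 0.
    by near=> n; rewrite p0 mul0r.
  have := @chi_eventually i x (or_introl p0) Ox; apply: filterS => n ->.
  by rewrite mulr1.
apply: filterS => n hn; rewrite /interior_cutoff patchE mem_set//.
by under eq_bigr => i _ do rewrite hn; rewrite /rest subrK.
Unshelve. all: by end_near. Qed.

(** The part of the derivative of [eta n] in which no layer is differentiated. As [rest] and the
    psi_i add up to 1, it is 0 at any given point once the layers have reached 1 there; being
    bounded, it drops out in the limit. *)
Let remainder n j (x : E) :=
  (partial j rest \_ Omega) x + \sum_i partial j (psi i) x * chi n i x.

Let partial_eta n j x : partial j (eta n) x =
  remainder n j x + \sum_i psi i x * partial j (chi n i) x.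
Proof.
rewrite partialD; last 2 first.
- exact: (restrict_Ck oO oU bU rest0 rest_Ck).
- exact: (Ck_sum1 (psichi_Ck n)).
rewrite (restrict_partial oO oU bU rest0) partial_sum; last exact: (psichi_Ck n).
rewrite /remainder -addrA; congr (_ + _); rewrite -big_split/=; apply: eq_bigr => i _.
by rewrite partialM// addrC [chi n i x * _]mulrC.
Qed.

Let partial_rest j x : partial j rest x = - \sum_i partial j (psi i) x.
Proof.
rewrite -(partial_sum _ _ (psi_Ck 1)).
have h : partial j (fun x => rest x + \sum_i psi i x) x = 0.
  rewrite (_ : (fun x => _) = cst 1) ?/partial ?derive_cst//.
  by apply/funext => z; rewrite /rest subrK.
move: h; rewrite partialD => [/eqP|//|]; last exact: (Ck_sum1 (psi_Ck 1)).
by rewrite addr_eq0 => /eqP.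
Qed.

Let remainder_off n j x : ~ Omega x -> remainder n j x = 0.
Proof.
move=> Ox; rewrite /remainder patchE memNset// add0r big1// => i _.
have [tx|tx] := pselect (tsupport (psi i) x); last by rewrite partial_off// mul0r.
have [->|cx] := eqVneq (chi n i x) 0; first by rewrite mulr0.
by case: Ox; apply: (layer_domain hS (hc i) (psi_dom tx) cx).
Qed.

Let remainder_cvg j x : \forall n \near \oo, remainder n j x = 0.
Proof.
have [Ox|Ox] := pselect (Omega x); last by near=> n; exact: remainder_off.
have : \forall n \near \oo, forall i, partial j (psi i) x * chi n i x = partial j (psi i) x.
  apply: filter_forall => i; have [tx|tx] := pselect (tsupport (psi i) x); last first.
    by near=> n; rewrite partial_off// mul0r.
  have := @chi_eventually i x (or_intror tx) Ox; apply: filterS => n ->.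
  by rewrite mulr1.
apply: filterS => n hn; rewrite /remainder patchE mem_set// partial_rest.
by under [X in _ + X]eq_bigr => i _ do rewrite hn; rewrite addNr.
Unshelve. all: by end_near. Qed.

Let remainder_bound : exists2 B, 0 < B & forall n j x, `|remainder n j x| <= B * \1_Omega x.
Proof.
have [B B0 hB] := psi_bound; exists (1 + B *+ N + B *+ N).
  by rewrite -addrA ltr_pwDl// addr_ge0// mulrn_wge0// ltW.
have sB (f : 'I_N -> R) : (forall i, `|f i| <= B) -> `|\sum_i f i| <= B *+ N.
  move=> h; rewrite (le_trans (ler_norm_sum _ _ _))//.
  by rewrite -[N in B *+ N]card_ord -sumr_const ler_sum.
move=> n j x; have [Ox|Ox] := pselect (Omega x); last first.
  by rewrite remainder_off// normr0 indicE memNset// mulr0.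
rewrite indicE mem_set// mulr1 /remainder patchE mem_set// (le_trans (ler_normD _ _))// lerD//.
  by rewrite partial_rest normrN ler_wpDl//; apply: sB => i; exact: (hB i).2.
apply: sB => i; rewrite normrM -[B]mulr1 ler_pM//; first exact: (hB i).2.
exact: layer_norm.
Qed.

Let bms3_psichi n i j (G : E -> R) : mf3 G -> (exists M, forall x, `|G x| <= M) ->
  bms3 (fun x => psi i x * G x * partial j (chi n i) x).
Proof.
by move=> mG [M hG]; exact: (bms3_layer (Cg i) hS (@psi_cont i) (@psi_cpt i) _ _ mG hG).
Qed.

Let remainder_mf n j : mf3 (remainder n j).
Proof.
apply: measurable_funD.
  apply: mf3_restrict_continuous => // x _; exact: (@partial_continuous _ _ j rest_Ck).
rewrite (_ : (fun q => _) = (fun x => \sum_i partial j (psi i) x * chi n i x) \o vec3) //.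
apply: (mf3_continuous (f := fun x => \sum_i partial j (psi i) x * chi n i x)).
apply: (@continuous_CkW _ 0); apply: Ck_sum1 => i; apply: CkM1.
  by apply: (@CkS_derive _ _ _ 0); exact: psi_Ck.
by apply: (@CkW _ _ _ 0 1) => //; exact: chi_Ck.
Qed.

Let I3_partial_eta n j (G : E -> R) : mf3 G -> (exists M, forall x, `|G x| <= M) ->
  bms3 (fun x => G x * remainder n j x) /\
  I3 (fun x => G x * partial j (eta n) x) =
  I3 (fun x => G x * remainder n j x) + \sum_i I3 (fun x => psi i x * G x * partial j (chi n i) x).
Proof.
move=> mG [M hG].
have b1 : bms3 (fun x => G x * remainder n j x).
  apply: (bms3Ml mG hG); have [B B0 hB] := remainder_bound.
  apply: (@bms3_le _ _ (fun x => B * \1_Omega x)); last exact: bms3Z (bms3_indic oO bO).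
    exact: remainder_mf.
  by move=> x; rewrite (le_trans (hB n j x))// ler_norm.
have b2 i : bms3 (fun x => psi i x * G x * partial j (chi n i) x) by apply: bms3_psichi => //; exists M.
split=> //.
rewrite -I3_sum => [|i _]; last exact: b2.
rewrite -I3D//; last by apply: bms3_sum => i _; exact: b2.
apply: eq_I3 => x; rewrite partial_eta mulrDr; congr (_ + _); rewrite big_distrr/=.
by apply: eq_bigr => i _; rewrite mulrCA mulrA.
Qed.

Lemma cutoff_flux_cvg (G : E -> R) M j : continuous G -> (forall x, `|G x| <= M) ->
  I3 (fun x => G x * partial j (eta n) x) @[n --> \oo] --> flux c psi G j.
Proof.
move=> cG hG; have mG := mf3_continuous cG.
have b n := I3_partial_eta n j mG (ex_intro _ M hG).
rewrite (_ : (fun n => _) = fun n => I3 (fun x => G x * remainder n j x) +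
    \sum_i I3 (fun x => psi i x * G x * partial j (chi n i) x)); last first.
  by apply/funext => n; rewrite (b n).2.
rewrite -[flux _ _ _ _]add0r; apply: cvgD.
  have [B B0 hB] := remainder_bound.
  have bB : bms3 (fun x => M * (B * \1_Omega x)) by do 2!apply: bms3Z; exact: bms3_indic.
  have -> : 0 = I3 (fun=> 0) :> R by rewrite /I3 Rintegral_cst// mul0r.
  apply: (I3_dominated _ _ bB _).2.
  - by move=> n; exact: (b n).1.1.
  - move=> x; apply: cvg_near_cst; apply: filterS (remainder_cvg j x) => n ->.
    by rewrite mulr0.
  - by move=> n x; rewrite normrM ler_pM.
rewrite /flux; apply: cvg_bigsum => i.
apply: (@layer_integral_cvg _ _ (Cg i) _ hS (fun x => psi i x * G x)).
  by move=> x; apply: continuousM; [exact: psi_cont|exact: cG].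
exact: (compact_tsupportMl (@psi_cpt i)).
Qed.

(** For measurable G and uniformly in n: the uniform L1 bound of the kernels is used here, not their
    convergence. *)
Lemma cutoff_flux_bound : exists2 C, 0 < C & forall n j (G : E -> R) M, mf3 G ->
  (forall x, `|G x| <= M) -> bms3 (fun x => G x * partial j (eta n) x) /\
  `|I3 (fun x => G x * partial j (eta n) x)| <= C * M.
Proof.
have [B B0 hB] := remainder_bound.
have [D D0 hD] : exists2 D, 0 < D & forall i n j (G : E -> R) M, mf3 G -> (forall x, `|G x| <= M) ->
    `|I3 (fun x => psi i x * G x * partial j (chi n i) x)| <= D * M.
  apply: (@fin_bound _ _ (fun i D => forall n j (G : E -> R) M, mf3 G -> (forall x, `|G x| <= M) ->
    `|I3 (fun x => psi i x * G x * partial j (chi n i) x)| <= D * M)).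
    move=> i D1 D2 D12 h n j G M mG hG; rewrite (le_trans (h n j G M mG hG))// ler_wpM2r//.
    exact: le_trans (hG 0).
  move=> i; have [D D0 hD] := layer_integral_bound (Cg i) hS (@psi_cont i) (@psi_cpt i).
  by exists D => // n j G M; exact: hD.
have V0 : 0 <= I3 (\1_Omega : E -> R) by apply: Rintegral_ge0 => q _; rewrite indicE.
exists (1 + B * I3 (\1_Omega : E -> R) + D *+ N).
  by rewrite -addrA ltr_pwDl// addr_ge0 ?mulrn_wge0 ?mulr_ge0// ltW.
move=> n j G M mG hG; have M0 : 0 <= M by exact: le_trans (hG 0).
have [b1 ->] := I3_partial_eta n j mG (ex_intro _ M hG); split.
  rewrite (_ : (fun x => _) = fun x => G x * remainder n j x +
      \sum_i psi i x * G x * partial j (chi n i) x).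
    by apply: bms3D => //; apply: bms3_sum => i _; apply: bms3_psichi => //; exists M.
  apply/funext => x; rewrite partial_eta mulrDr; congr (_ + _); rewrite big_distrr/=.
  by apply: eq_bigr => i _; rewrite mulrCA mulrA.
rewrite (le_trans (ler_normD _ _))// mulrDl lerD//.
  rewrite mulrDl mul1r ler_wpDl// mulrAC -(I3Z _ (bms3_indic oO bO)).
  apply: I3_norm => //; first exact: bms3Z (bms3_indic oO bO).
  by move=> x; rewrite normrM mulrC [B * M]mulrC -mulrA [leRHS]mulrC ler_pM.
have : \sum_i `|I3 (fun x => psi i x * G x * partial j (chi n i) x)| <= \sum_(i < N) D * M.
  by apply: ler_sum => i _; exact: hD.
by rewrite sumr_const card_ord mulrnAl; apply: le_trans; exact: ler_norm_sum.
Qed.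

End InteriorCutoff.

(** * Continuous extension to the closure *)

Section ClosureExtension.
Context {R : realType}.
Notation E := 'rV[R]_3.

Definition ucont (A : set E) (f : E -> R) := forall e, 0 < e ->
  exists2 d, 0 < d & forall x y, A x -> A y -> `|x - y| < d -> `|f x - f y| < e.

Variable Omega : set E.
Hypothesis oO : open Omega.
Hypothesis bO : bounded_set Omega.

Lemma within_closure_proper (x : E) : closure Omega x -> ProperFilter (within Omega (nbhs x)).
Proof.
move=> cx; apply: Build_ProperFilter_ex => A; rewrite /within/= => hA.
have [y [Oy Ay]] := cx _ hA; by exists y; exact: Ay.
Qed.

Lemma within_cvg (f F : E -> R) x : {for x, continuous F} -> (forall y, Omega y -> F y = f y) ->
  f y @[y --> within Omega (nbhs x)] --> F x.
Proof.
move=> cF Ff; apply/cvgrPdist_lt => e e0; rewrite near_withinE.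
move/cvgrPdist_lt : cF => /(_ e e0); apply: filterS => y h Oy.
by rewrite -Ff.
Qed.

Lemma btrace_cvg (f : E -> R) x l : closure Omega x ->
  f y @[y --> within Omega (nbhs x)] --> l -> btrace Omega f x = l.
Proof.
move=> /within_closure_proper pf h; apply: cvg_lim h; exact: norm_hausdorff.
Qed.

Lemma btrace_ext (f F : E -> R) x : {for x, continuous F} -> (forall y, Omega y -> F y = f y) ->
  closure Omega x -> btrace Omega f x = F x.
Proof. by move=> cF Ff cx; apply: btrace_cvg => //; exact: within_cvg. Qed.

Lemma ucont_cvg (f : E -> R) x : ucont Omega f -> closure Omega x ->
  f y @[y --> within Omega (nbhs x)] --> btrace Omega f x.
Proof.
move=> uf cx; have pf := within_closure_proper cx.
suff /cvg_ex[l hl] : cvg (f y @[y --> within Omega (nbhs x)]) by rewrite (btrace_cvg cx hl).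
apply: cauchy_cvg; apply: cauchy_exP => e e0.
have [d d0 hd] := uf e e0.
have d2 : 0 < d / 2 by rewrite divr_gt0.
have [z [Oz xz]] := cx _ (near_dist x d2).
exists (f z); have : \forall y \near within Omega (nbhs x), `|f z - f y| < e.
  rewrite near_withinE; have := near_dist x d2; apply: filterS => y xy Oy.
  apply: hd => //.
  by rewrite -(subrK x z) -addrA (le_lt_trans (ler_normD _ _))// [d]splitr ltrD// distrC.
by apply: filterS => y h; rewrite -ball_normE.
Qed.

Lemma ucont_closure_continuous (f : E -> R) : ucont Omega f ->
  {within closure Omega, continuous (btrace Omega f)}.
Proof.
move=> uf; apply/subspace_continuousP => x cx.
apply/cvgrPdist_lt => e e0; rewrite near_withinE.
have e3 : 0 < e / 3 by rewrite divr_gt0.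
have [d d0 hd] := uf _ e3.
have d3 : 0 < d / 3 by rewrite divr_gt0.
have pick y : closure Omega y -> exists z, [/\ Omega z, `|y - z| < d / 3 & `|btrace Omega f y - f z| < e / 3].
  move=> cy; have := ucont_cvg uf cy => /cvgrPdist_lt/(_ _ e3).
  rewrite near_withinE => h.
  have [z [Oz [h1 h2]]] := cy _ (filterI h (near_dist y d3)).
  by exists z; split => //; exact: h1.
have := near_dist x d3; apply: filterS => y xy cy.
have [x' [Ox xx fx]] := pick x cx; have [y' [Oy yy fy]] := pick y cy.
have h : `|f x' - f y'| < e / 3.
  apply: hd => //; rewrite (_ : x' - y' = (x' - x) + (x - y) + (y - y')); last by rewrite 2!subrKA.
  rewrite (_ : d = d / 3 + d / 3 + d / 3); last by lra.
  do 2!rewrite (le_lt_trans (ler_normD _ _))// ltrD//; by rewrite distrC.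
suff : `|btrace Omega f x - btrace Omega f y| < e by [].
have fy' : `|f y' - btrace Omega f y| < e / 3 by rewrite distrC.
move: (btrace Omega f x) (btrace Omega f y) fx fy' => a b fx fy'.
rewrite (_ : a - b = (a - f x') + (f x' - f y') + (f y' - b)); last by rewrite 2!subrKA.
have -> : e = e / 3 + e / 3 + e / 3 by lra.
by rewrite (le_lt_trans (ler_normD _ _))// ltrD// (le_lt_trans (ler_normD _ _))// ltrD.
Qed.

(** Tietze's theorem for the trace on the closure. With a continuous representative on the whole
    space, boundary values become plain evaluations. *)
Lemma ucont_extension (f : E -> R) M : ucont Omega f -> (forall x, Omega x -> `|f x| <= M) ->
  exists F : E -> R, [/\ continuous F, forall x, Omega x -> F x = f x & exists M, forall x, `|F x| <= M].
Proof.
move=> uf fM.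
have M0 : 0 < `|M| + 1 by rewrite ltr_wpDl.
have bM x : closure Omega x -> `|btrace Omega f x| <= `|M| + 1.
  move=> cx; have := ucont_cvg uf cx => /cvgrPdist_lt/(_ _ ltr01); rewrite near_withinE => h.
  have [z [Oz h1]] := cx _ h.
  rewrite -(subrK (f z) (btrace Omega f x)) (le_trans (ler_normD _ _))// addrC lerD//.
    by rewrite (le_trans (fM z Oz))// ler_norm.
  exact/ltW/h1.
have nE : normal_space E by exact: (@pseudometric_normal R E).
have [F [F1 F2 F3]] := @continuous_bounded_extension E R nE _ (@closed_closure _ Omega) (btrace Omega f) _ M0
  (ucont_closure_continuous uf) bM.
exists F; split => //; last by exists (`|M| + 1).
move=> x Ox; have cx : closure Omega x by exact: subset_closure.
rewrite -F1; last exact: mem_set.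
apply: (btrace_cvg cx); apply/cvgrPdist_lt => e e0; have [d d0 hd] := uf e e0.
rewrite near_withinE; have := near_dist x d0; apply: filterS => y xy Oy; exact: hd.
Qed.

Lemma closure_cover (P : R -> E -> Prop) :
  (forall x, closure Omega x -> \forall x' \near x & d \near (0 : R)^'+, P d x') ->
  exists2 d, 0 < d & forall x, closure Omega x -> P d x.
Proof.
move=> h; have cK := compact_closure_bounded bO.
have : \forall d \near (0 : R)^'+, closure Omega `<=` P d.
  move/compact_near_coveringP : cK; apply => x cx; exact: h.
move=> hn; have [d [d0 hd]] := filter_ex (filterI (nbhs_right_gt (0 : R)) hn).
by exists d.
Qed.

(** Near each point of the closure f is close to its limit there; compactness of the closure makes
    the radius uniform. *)
Lemma trace_ucont (f : E -> R) : (forall x, Omega x -> {for x, continuous f}) ->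
  (forall x, boundary Omega x -> cvg (f y @[y --> within Omega (nbhs x)])) ->
  ucont Omega f /\ exists M, forall x, Omega x -> `|f x| <= M.
Proof.
move=> cf tf.
have tr x : closure Omega x -> exists l : R, f y @[y --> within Omega (nbhs x)] --> l.
  move=> cx; have [Ox|Ox] := pselect (Omega x).
    by exists (f x); apply: within_cvg => //; exact: cf.
  have [|l hl] := (cvg_ex _).1 (tf x _); last by exists l.
  exact/(boundaryE oO).
have loc x e : closure Omega x -> 0 < e -> exists l r, 0 < r /\
    forall y, Omega y -> `|x - y| < r -> `|l - f y| < e.
  move=> cx e0; have [l hl] := tr x cx; exists l.
  move/cvgrPdist_lt : hl => /(_ e e0); rewrite near_withinE => /nbhs_normP[r /= r0 hr].
  by exists r; split => // y Oy xy; apply: hr.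
split.
  move=> e e0; have e2 : 0 < e / 2 by rewrite divr_gt0.
  have [d d0 hd] : exists2 d, 0 < d & forall x, closure Omega x ->
      forall y, Omega x -> Omega y -> `|x - y| < d -> `|f x - f y| < e.
    apply: closure_cover => x cx; have [l [r [r0 hr]]] := loc x _ cx e2.
    have r2 : 0 < r / 2 by rewrite divr_gt0.
    exists ([set y | `|x - y| < r / 2], [set d | d < r / 2]).
      by split; [exact: (@near_dist R E)|exact: nbhs_right_lt].
    move=> [z d] [/= xz dr] y Oz Oy zy.
    rewrite -(subrK l (f z)) -addrA (le_lt_trans (ler_normD _ _))// [e]splitr ltrD//.
      by rewrite distrC hr// (lt_trans xz)// gtr_pMr// invf_lt1// ltr1n.
    apply: hr => //; rewrite -(subrK z x) -addrA (le_lt_trans (ler_normD _ _))// [r]splitr ltrD//.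
    exact: lt_trans zy dr.
  by exists d => // x y Ox Oy; apply: hd => //; exact: subset_closure.
(* The bound is written as d times |f x| at most 1 to fit the covering lemma, whose parameter tends
   to 0. *)
have [d d0 hd] : exists2 d, 0 < d & forall x, closure Omega x -> Omega x -> d * `|f x| <= 1.
  apply: closure_cover => x cx; have [l [r [r0 hr]]] := loc x 1 cx ltr01.
  have l1 : 0 < (`|l| + 1)^-1 by rewrite invr_gt0 ltr_wpDl.
  exists ([set y | `|x - y| < r], [set d | d < (`|l| + 1)^-1]).
    by split; [exact: (@near_dist R E)|exact: nbhs_right_lt].
  move=> [z d] [/= xz dr] Oz.
  have fl : `|f z| <= `|l| + 1.
    rewrite -(subrK l (f z)) (le_trans (ler_normD _ _))// addrC lerD2l distrC ltW//.
    exact: hr.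
  have e1 : (`|l| + 1)^-1 * (`|l| + 1) = 1 by rewrite mulVf// gt_eqF// ltr_wpDl.
  have [d0|d0] := leP 0 d; first by rewrite -e1; apply: ler_pM => //; exact: ltW.
  by rewrite (@le_trans _ _ 0)// mulr_le0_ge0// ltW.
exists d^-1 => x Ox; rewrite -[d^-1]mul1r ler_pdivlMr// mulrC; apply: hd => //.
exact: subset_closure.
Qed.

Lemma holder_norm_bound (W : normedModType R) alpha (f : E -> W) M x : 0 < alpha ->
  (holder_norm alpha Omega f <= M%:E)%E -> Omega x ->
  (`|f x| <= M) /\ forall y, Omega y -> `|f x - f y| <= M * `|x - y| `^ alpha.
Proof.
move=> a0 hM Ox.
move: hM; rewrite /holder_norm; set s1 := ereal_sup [set _ | x in _]; set s2 := ereal_sup [set _ | z in _] => hM.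
have h1 y : Omega y -> (`|f y|%:E <= s1)%E by move=> Oy; apply: ereal_sup_ubound; exists y.
have h2 y z : Omega y -> Omega z -> ((`|f y - f z| / `|y - z| `^ alpha)%:E <= s2)%E.
  by move=> Oy Oz; apply: ereal_sup_ubound; exists (y, z).
(* Nonnegativity of both suprema lets the bound on their sum pass to each; for the seminorm the pair
   (x, x) serves. *)
have s10 : (0 <= s1)%E by apply: le_trans (h1 x Ox); rewrite lee_fin.
have s20 : (0 <= s2)%E.
  by apply: le_trans (h2 x x Ox Ox); rewrite lee_fin divr_ge0// powR_ge0.
have hs1 : (s1 <= M%:E)%E by apply: le_trans hM; rewrite leeDl.
have hs2 : (s2 <= M%:E)%E by apply: le_trans hM; rewrite leeDr.
split; first by rewrite -lee_fin (le_trans (h1 x Ox)).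
move=> y Oy; have [->|xy] := eqVneq x y.
  by rewrite !subrr !normr0 powR0 ?mulr0// gt_eqF.
rewrite -ler_pdivrMr; last by rewrite powR_gt0// normr_gt0 subr_eq0.
by rewrite -lee_fin (le_trans (h2 x y Ox Oy)).
Qed.

Lemma holder_ucont (f : E -> R) alpha M : 0 < alpha ->
  (forall x y, Omega x -> Omega y -> `|f x - f y| <= M * `|x - y| `^ alpha) -> ucont Omega f.
Proof.
move=> a0 hf e e0.
have M0 : 0 < `|M| + 1 by rewrite ltr_wpDl.
exists ((e / (`|M| + 1)) `^ alpha^-1); first by rewrite powR_gt0// divr_gt0.
move=> x y Ox Oy xy; rewrite (le_lt_trans (hf x y Ox Oy))//.
rewrite (@le_lt_trans _ _ ((`|M| + 1) * `|x - y| `^ alpha))//.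
  by rewrite ler_wpM2r ?powR_ge0// (le_trans (ler_norm _))// lerDl.
rewrite mulrC -ltr_pdivlMr//.
rewrite (@lt_le_trans _ _ (((e / (`|M| + 1)) `^ alpha^-1) `^ alpha))//.
  by rewrite gt0_ltr_powR// nnegrE// powR_ge0.
by rewrite -powRrM mulVf ?gt_eqF// powRr1// divr_ge0// ltW.
Qed.

Lemma smooth_closure_ucont Phi vs : smooth_closure Omega Phi ->
  ucont Omega (iter_derive vs Phi) /\ exists M, forall x, Omega x -> `|iter_derive vs Phi x| <= M.
Proof.
move=> [sP tP]; apply: trace_ucont => [x Ox|x bx]; last exact: tP.
by have [_] := sP (size vs) vs x Ox; exact.
Qed.

End ClosureExtension.

(** * Space-time functions and weak formulations *)

Section SpaceTime.
Context {R : realType}.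
Notation mu := (@lebesgue_measure R).
Notation nu3 := ((mu \x mu) \x mu)%E.
Notation E := 'rV[R]_3.

Lemma sigma_finite_lebesgue3 : sigma_finite setT nu3.
Proof.
pose I n : set R := `[- n%:R, n%:R]%classic.
have mI n : measurable (I n) by exact: measurable_itv.
exists (fun n => I n `*` I n `*` I n).
  apply/seteqP; split => // -[[a b] c] _.
  exists (Num.bound (`|a| + `|b| + `|c|)) => //.
  have hN := archi_boundP (addr_ge0 (addr_ge0 (normr_ge0 a) (normr_ge0 b)) (normr_ge0 c)).
  split; [split|]; rewrite /I/= in_itv/= -ler_norml (le_trans _ (ltW hN))//.
  - by rewrite -addrA lerDl addr_ge0.
  - by rewrite addrAC lerDr addr_ge0.
  - by rewrite lerDr addr_ge0.
move=> n; split; first exact: (measurableX (measurableX (mI n) (mI n)) (mI n)).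
have e := @product_measure1E _ _ _ _ _ (mu \x mu)%E mu _ _ (measurableX (mI n) (mI n)) (mI n).
apply: (@le_lt_trans _ _ ((mu \x mu)%E (I n `*` I n) * mu (I n))%E); first by rewrite -e.
apply: lte_mul_pinfty => //; last exact: finite_itv.
by rewrite ge0_fin_numE//; apply: finite_sq => //; exact: finite_itv.
Qed.

Definition lebesgue3 :
    {sigma_finite_measure set (measurableTypeR R * measurableTypeR R * measurableTypeR R)%type -> \bar R} :=
  HB.pack_for {sigma_finite_measure set (measurableTypeR R * measurableTypeR R * measurableTypeR R)%type -> \bar R}
    nu3 (@Measure_isSigmaFinite.Build _ _ _ nu3 sigma_finite_lebesgue3).

Variable Omega : set E.
Hypothesis oO : open Omega.
Hypothesis bO : bounded_set Omega.
Variable T : R.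
Notation I0T := (`]0, T[%classic : set R).

(* stf: bounded space-time function *)
Definition stf (f : R -> E -> R) :=
  measurable_fun setT (fun q : R * R * R * R => f q.2 (vec3 q.1)) /\
  exists M, forall t x, `|f t x| <= M * \1_Omega x * \1_I0T t.

Lemma stf_slice (f : R -> E -> R) t : stf f -> bms3 (f t).
Proof.
move=> [mf [M hM]].
have mft : mf3 (f t).
  apply: (@measurableT_comp _ _ _ _ _ _ _ _ (fun q => (q, t)) mf).
  by apply: measurable_fun_pair; [exact: measurable_id|exact: measurable_cst].
apply: (@bms3_le _ _ (fun x => (M * \1_I0T t) * \1_Omega x) mft); last exact: bms3Z (bms3_indic oO bO).
by move=> x; rewrite (le_trans (hM t x))// mulrAC ler_norm.
Qed.

Let mO : measurable (vec3 @^-1` Omega). Proof. exact: measurable_open3. Qed.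

Let fO : (nu3 (vec3 @^-1` Omega) < +oo)%E.
Proof.
have [A [M' [mA fA hA]]] := (bms3_bfs (bms3_indic oO bO)).2.
apply: le_lt_trans fA; apply: le_measure; rewrite ?inE// => q Oq.
have := hA q; rewrite indicE mem_set// normr1 => h; apply: contrapT => Aq.
by move: h; rewrite indicE memNset// mulr0 ler10.
Qed.

Let mI : measurable I0T. Proof. exact: measurable_itv. Qed.

Let fI : (mu I0T < +oo)%E.
Proof. by apply: (@le_lt_trans _ _ (mu `[0, T])); [apply: le_measure; rewrite ?inE//; exact: subset_itv_oo_cc|exact: finite_itv]. Qed.

Lemma stf_int (f : R -> E -> R) : stf f -> bfs mu (fun t => I3 (f t)).
Proof.
move=> [mf [M hM]].
by have [] := @bfs_Fubini2 _ _ _ _ _ lebesgue3 mu (fun p => f p.2 (vec3 p.1)) _ _ M mf mO mI fO fI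
  (fun q t => hM t (vec3 q)).
Qed.

Definition J (f : R -> E -> R) : R := \int[mu]_t I3 (f t).

Lemma stf_intro (f : R -> E -> R) M : measurable_fun setT (fun q : R * R * R * R => f q.2 (vec3 q.1)) ->
  (forall t x, `|f t x| <= M) -> (forall t x, f t x != 0 -> Omega x /\ I0T t) -> stf f.
Proof.
move=> mf hM h; split => //; exists M => t x; have [->|f0] := eqVneq (f t x) 0.
  by rewrite normr0 !mulr_ge0// (le_trans _ (hM t x)).
by have [Ox It] := h t x f0; rewrite !indicE !mem_set// !mulr1.
Qed.

Lemma stf_bound (f : R -> E -> R) : stf f -> exists2 M, 0 < M & (forall t x, `|f t x| <= M) /\
  forall t x, f t x != 0 -> Omega x /\ I0T t.
Proof.
move=> [_ [M hM]]; exists (`|M| + 1); first by rewrite ltr_wpDl.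
split=> t x.
  rewrite (le_trans (hM t x))// (le_trans (ler_norm _))// !normrM.
  by rewrite -[leRHS]mulr1 -[X in _ <= X]mulr1 !ler_pM ?mulr_ge0 ?lerDl// indicE ger0_norm// lern1 leq_b1.
move=> f0; split; apply: contrapT => h; move: (hM t x); move/eqP: f0; apply: contra_not;
  rewrite [X in _ * X * _]indicE [X in _ * X]indicE (memNset h) ?mulr0 ?mul0r normr_le0 => /eqP //.
Qed.

Lemma stfMl f (g : R * R * R * R -> R) (G : R -> E -> R) B : stf f ->
  (forall q, G q.2 (vec3 q.1) = g q) -> measurable_fun setT g ->
  (forall t x, `|G t x| <= B) -> stf (fun t x => f t x * G t x).
Proof.
move=> hf Gg mg hG; have [M M0 [h1 h2]] := stf_bound hf.
apply: (@stf_intro _ (M * B)).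
- by apply: measurable_funM; [exact: hf.1|move: mg; congr measurable_fun; apply/funext => q; rewrite Gg].
- by move=> t x; rewrite normrM ler_pM.
- by move=> t x; rewrite mulf_eq0 negb_or => /andP[/h2].
Qed.

Lemma stfM (f g : R -> E -> R) : stf f -> stf g -> stf (fun t x => f t x * g t x).
Proof.
move=> hf hg; have [M _ [h _]] := stf_bound hg.
exact: (@stfMl _ (fun q => g q.2 (vec3 q.1)) _ M hf (fun q => erefl) hg.1 h).
Qed.

Lemma stfMx f (X : E -> R) M : stf f -> mf3 (X \_ Omega) -> (forall x, Omega x -> `|X x| <= M) ->
  stf (fun t x => f t x * X x).
Proof.
move=> hf mX hX; have [_ _ [_ h2]] := stf_bound hf.
rewrite (_ : (fun t x => f t x * X x) = fun t x => f t x * (X \_ Omega) x); last first.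
  apply/funext => t; apply/funext => x; rewrite patchE.
  case: ifPn => // /negP Ox; have [->|/h2[Ox' _]] := eqVneq (f t x) 0; first by rewrite !mul0r.
  by case: Ox; apply/mem_set.
apply: (@stfMl _ (fun q => (X \_ Omega) (vec3 q.1)) (fun _ x => (X \_ Omega) x) `|M| hf) => //.
  exact: (measurableT_comp mX (@measurable_fst _ _ _ _)).
move=> t x; rewrite patchE; case: ifPn => [/set_mem Ox|_]; last by rewrite normr0.
by rewrite (le_trans (hX x Ox))// ler_norm.
Qed.

Lemma stfMt f (th : R -> R) M : stf f -> measurable_fun setT th -> (forall t, `|th t| <= M) ->
  stf (fun t x => f t x * th t).
Proof.
move=> hf mt ht; apply: (@stfMl _ (fun q => th q.2) (fun t _ => th t) M hf) => //.
exact: (measurableT_comp mt (@measurable_snd _ _ _ _)).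
Qed.

Lemma stfD (f g : R -> E -> R) : stf f -> stf g -> stf (fun t x => f t x + g t x).
Proof.
move=> hf hg; have [M M0 [h1 h2]] := stf_bound hf; have [N N0 [k1 k2]] := stf_bound hg.
apply: (@stf_intro _ (M + N)).
- by apply: measurable_funD; [exact: hf.1|exact: hg.1].
- by move=> t x; rewrite (le_trans (ler_normD _ _))// lerD.
- move=> t x; have [->|/h2//] := eqVneq (f t x) 0; rewrite add0r; exact: k2.
Qed.

Lemma stfZ k f : stf f -> stf (fun t x => k * f t x).
Proof.
move=> hf; rewrite (_ : (fun t x => _) = fun t x => f t x * (fun=> k) t).
  by apply: (@stfMt _ _ `|k| hf) => //; exact: measurable_cst.
by apply/funext => t; apply/funext => x; rewrite mulrC.
Qed.

Lemma stfB (f g : R -> E -> R) : stf f -> stf g -> stf (fun t x => f t x - g t x).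
Proof.
move=> hf hg; rewrite (_ : (fun t x => _) = fun t x => f t x + (-1) * g t x).
  by apply: stfD => //; exact: stfZ.
by apply/funext => t; apply/funext => x; rewrite mulN1r.
Qed.

Lemma stf0 : stf (fun _ _ => 0).
Proof.
apply: (@stf_intro _ 0); first exact: measurable_cst.
  by move=> t x; rewrite normr0.
by move=> t x; rewrite eqxx.
Qed.

Lemma stf_sum n (f : 'I_n -> R -> E -> R) : (forall i, stf (f i)) -> stf (fun t x => \sum_i f i t x).
Proof.
elim: n f => [|n IH] f h.
  rewrite (_ : (fun t x => _) = fun _ _ => 0); first exact: stf0.
  by apply/funext => t; apply/funext => x; rewrite big_ord0.
rewrite (_ : (fun t x => _) = fun t x => \sum_(i < n) f (widen_ord (leqnSn n) i) t x + f ord_max t x).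
  by apply: stfD; [apply: IH => i|]; exact: h.
by apply/funext => t; apply/funext => x; rewrite big_ord_recr.
Qed.

Lemma J_D (f g : R -> E -> R) : stf f -> stf g -> J (fun t x => f t x + g t x) = J f + J g.
Proof.
move=> hf hg; rewrite /J -bfs_intD; [|exact: stf_int|exact: stf_int].
by apply: eq_Rintegral => t _; rewrite I3D//; exact: stf_slice.
Qed.

Lemma J_B (f g : R -> E -> R) : stf f -> stf g -> J (fun t x => f t x - g t x) = J f - J g.
Proof.
move=> hf hg; rewrite /J -bfs_intB; [|exact: stf_int|exact: stf_int].
by apply: eq_Rintegral => t _; rewrite I3B//; exact: stf_slice.
Qed.

Lemma J_t f (th : R -> R) : stf f -> J (fun t x => f t x * th t) = \int[mu]_t (th t * I3 (f t)).
Proof.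
move=> hf; apply: eq_Rintegral => t _; rewrite -I3Z; last exact: stf_slice.
by apply: eq_I3 => x; rewrite mulrC.
Qed.

Lemma J_bound : exists2 C, 0 < C & forall f B, stf f -> 0 <= B ->
  (forall t x, Omega x -> I0T t -> `|f t x| <= B) -> `|J f| <= C * B.
Proof.
have hg : stf (fun t x => \1_Omega x * \1_I0T t).
  apply: (@stf_intro _ 1).
  - apply: measurable_funM.
      apply: (measurableT_comp (bms3_indic oO bO).1 (@measurable_fst _ _ _ _)).
    have mi : measurable_fun setT (\1_I0T : R -> R) by exact: measurable_indic.
    exact: (measurableT_comp mi (@measurable_snd _ _ _ _)).
  - by move=> t x; rewrite !indicE -natrM mulnb ger0_norm// lern1 leq_b1.
  - by move=> t x; rewrite !indicE -natrM mulnb pnatr_eq0 eqb0 negbK => /andP[/set_mem ? /set_mem].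
have J0 : 0 <= J (fun t x => \1_Omega x * \1_I0T t).
  apply: Rintegral_ge0 => t _; apply: Rintegral_ge0 => q _; by rewrite !indicE mulr_ge0.
exists (1 + J (fun t x => \1_Omega x * \1_I0T t)); first by rewrite ltr_pwDl.
move=> f B hf B0 hB; rewrite mulrDl mul1r ler_wpDl// mulrC.
have -> : B * J (fun t x => \1_Omega x * \1_I0T t) = \int[mu]_t I3 (fun x => B * (\1_Omega x * \1_I0T t)).
  rewrite /J -bfs_intZ; last exact: stf_int.
  by apply: eq_Rintegral => t _; rewrite I3Z//; exact: (stf_slice t hg).
apply: bfs_int_norm; [exact: stf_int|exact: (stf_int (stfZ B hg))|] => t.
apply: I3_norm; [exact: stf_slice|exact: (stf_slice t (stfZ B hg))|] => x.
have [M _ [_ h2]] := stf_bound hf.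
have [->|f0] := eqVneq (f t x) 0; first by rewrite normr0 mulr_ge0// !indicE mulr_ge0.
by have [Ox It] := h2 t x f0; rewrite !indicE !mem_set// !mulr1 hB.
Qed.

End SpaceTime.

(** * The weak equations for C^1 test fields *)

Section WeakLimit.
Context {R : realType}.
Notation mu := (@lebesgue_measure R).
Notation nu3 := ((mu \x mu) \x mu)%E.
Notation E := 'rV[R]_3.

Variable Omega : set E.
Hypothesis oO : open Omega.
Hypothesis bO : bounded_set Omega.

(** The class to which the extension theorem applies. *)
Definition okf (Y : E -> R) := ucont Omega Y /\ exists M, forall x, Omega x -> `|Y x| <= M.

Lemma okf_ext Y : okf Y -> exists F : E -> R,
  [/\ continuous F, forall x, Omega x -> F x = Y x & exists M, forall x, `|F x| <= M].
Proof. by move=> [uY [M hM]]; exact: (ucont_extension uY hM). Qed.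

Lemma okf_mf3 Y : okf Y -> mf3 (Y \_ Omega).
Proof.
move=> /okf_ext[F [cF FY _]]; rewrite (_ : Y \_ Omega = F \_ Omega).
  by apply: mf3_restrict_continuous => // x _; exact: cF.
by apply/funext => x; rewrite !patchE; case: ifPn => // /set_mem /FY.
Qed.

Lemma okfB Y Z : okf Y -> okf Z -> okf (fun x => Y x - Z x).
Proof.
move=> [uY [M hM]] [uZ [M' hM']]; split.
  move=> e e0; have e2 : 0 < e / 2 by rewrite divr_gt0.
  have [d d0 hd] := uY _ e2; have [d' d'0 hd'] := uZ _ e2.
  exists (Num.min d d') => [|x y Ox Oy]; first by rewrite lt_min d0.
  rewrite lt_min => /andP[h1 h2].
  rewrite (_ : _ - _ = (Y x - Y y) - (Z x - Z y)); last by ring.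
  rewrite [e]splitr (le_lt_trans (ler_normB _ _))//.
  by rewrite ltrD ?hd ?hd'.
exists (M + M') => x Ox; rewrite (le_trans (ler_normB _ _))// lerD ?hM ?hM'//.
Qed.

Lemma okf_Ck (f : E -> R) : continuous f -> okf f.
Proof.
move=> cf; have cK := compact_closure_bounded bO; split.
  move=> e e0; have [d d0 hd] := compact_continuous_near cK (fun x _ => cf x) e0.
  by exists d => // x y Ox _; apply: hd; exact: subset_closure.
have [M _ hM] := compact_bound cK cf; exists M => x Ox; exact/hM/subset_closure.
Qed.

Variable T : R.
Notation I0T := (`]0, T[%classic : set R).
Notation stf := (stf Omega T).

Lemma stfMo f Y : stf f -> okf Y -> stf (fun t x => f t x * Y x).
Proof. by move=> hf hY; have [_ [M hM]] := hY; apply: (@stfMx _ _ _ _ Y M hf) => //; exact: okf_mf3. Qed.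

Lemma time_test_bound (th : R -> R) : test_function I0T th ->
  [/\ measurable_fun setT th, measurable_fun setT ('D_1 th), test_function I0T ('D_1 th) &
    exists2 B, 0 < B & forall t, `|th t| <= B /\ `|'D_1 th t| <= B].
Proof.
move=> [sth kth thI].
have Cth m : Ck m setT th by exact: sth.
have cth : continuous th by move=> x; exact: (Ck_continuous (Cth 0%N)).
have sth' := smooth_derive (1 : R) sth.
have cth' : continuous ('D_1 th) by move=> x; exact: (Ck_continuous (sth' 0%N)).
have sub : tsupport ('D_1 th) `<=` tsupport th.
  apply: tsupport_sub_closed; first exact: closed_closure.
  move=> x; apply: contraPP => /tsupport_off_near f0.
  by rewrite (@near_eq_derive _ _ _ _ (cst 0)) ?derive_cst ?eqxx.
have k' : compact (tsupport ('D_1 th)).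
  by apply: subclosed_compact kth sub; exact: closed_closure.
have bd (g : R -> R) : continuous g -> compact (tsupport g) -> exists2 B, 0 < B & forall t, `|g t| <= B.
  move=> cg kg; have [M [Mr hM]] := compact_bounded (continuous_compact (continuous_subspaceT cg) kg).
  exists (`|M| + 1); first by rewrite ltr_wpDl.
  move=> t; have [gt|gt] := pselect (tsupport g t); last by rewrite (tsupport_off gt) normr0 addr_ge0.
  apply: (hM (`|M| + 1)); last by exists t.
  by rewrite (le_lt_trans (ler_norm _))// ltrDl.
split.
- exact: continuous_measurable_fun.
- exact: continuous_measurable_fun.
- by split => // x /sub /thI.
- have [B B0 hB] := bd _ cth kth; have [B' B'0 hB'] := bd _ cth' k'.
  exists (B + B') => [|t]; first exact: addr_gt0.
  by rewrite (le_trans (hB t)) ?(le_trans (hB' t)) ?lerDl ?lerDr ?ltW.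
Qed.

Variable S : R -> R.
Hypothesis hS : smooth_step S.

Variables (V : 'I_3 -> R -> E -> R) (Q : R -> E -> R).
Hypothesis sV : forall i, stf (V i).
Hypothesis sQ : stf Q.

(** The momentum integrand for the separated field theta(t) X(x), with V and Q for the truncated
    velocity and pressure. *)
Definition momentum_form (th : R -> R) (X : 'I_3 -> E -> R) t x :=
  (\sum_i V i t x * X i x) * 'D_1 th t +
  (\sum_i \sum_j V i t x * V j t x * partial j (X i) x + Q t x * \sum_i partial i (X i) x) * th t.

Hypothesis momentum : forall th X, test_function I0T th -> (forall i, test_function Omega (X i)) ->
  J (momentum_form th X) = 0.
Hypothesis divfree : forall th Z, test_function I0T th -> test_function Omega Z ->
  J (fun t x => (\sum_i V i t x * partial i Z x) * th t) = 0.

Lemma VQ_bound : exists2 M, 0 < M & forall t x, (forall i, `|V i t x| <= M) /\ `|Q t x| <= M.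
Proof.
have [M M0 hM] : exists2 M, 0 < M & forall i t x, `|V i t x| <= M.
  apply: (@fin_bound _ _ (fun i M => forall t x, `|V i t x| <= M)).
    by move=> i N N' NN h t x; rewrite (le_trans _ NN).
  by move=> i; have [M M0 [h _]] := stf_bound (sV i); exists M.
have [N N0 [hN _]] := stf_bound sQ.
exists (M + N); first exact: addr_gt0.
move=> t x; split=> [i|]; first by rewrite (le_trans (hM i t x))// lerDl ltW.
by rewrite (le_trans (hN t x))// lerDr ltW.
Qed.

Let stf_momentum th X : test_function I0T th -> (forall i, Ck 1 setT (X i)) -> stf (momentum_form th X).
Proof.
move=> /time_test_bound[m1 m2 _ [B B0 hB]] CX.
have oX i : okf (X i) by apply: okf_Ck; exact: continuous_CkW (CX i).
have opX i j : okf (partial j (X i)) by apply: okf_Ck; exact: partial_continuous.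
apply: stfD.
  apply: (@stfMt _ _ _ _ _ B _ m2) => [|t]; last exact: (hB t).2.
  by apply: stf_sum => i; exact: stfMo.
apply: (@stfMt _ _ _ _ _ B _ m1) => [|t]; last exact: (hB t).1.
apply: stfD.
  by apply: stf_sum => i; apply: stf_sum => j; apply: stfMo => //; exact: stfM.
rewrite (_ : (fun t x => _) = fun t x => \sum_i Q t x * partial i (X i) x).
  by apply: stf_sum => i; exact: stfMo.
by apply/funext => t; apply/funext => x; rewrite big_distrr.
Qed.

Lemma norm_sum3 (f : 'I_3 -> R) B : (forall i, `|f i| <= B) -> `|\sum_i f i| <= B *+ 3.
Proof.
move=> h; rewrite (le_trans (ler_norm_sum _ _ _))//.
have : \sum_i `|f i| <= \sum_(i < 3) B by apply: ler_sum => i _; exact: h.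
by rewrite sumr_const card_ord.
Qed.

(** The form is linear in X and controlled by the sup norms of X and its first derivatives, so
    smooth approximation in C^1 suffices. *)
Lemma momentum_C1 th X : test_function I0T th ->
  (forall i, Ck 1 setT (X i) /\ compactly_inside Omega (X i)) -> J (momentum_form th X) = 0.
Proof.
move=> hth hX; have CX i : Ck 1 setT (X i) by case: (hX i).
have [C C0 hC] := J_bound oO bO T.
have [m1 m2 _ [B B0 hB]] := time_test_bound hth.
have [M M0 hM] := VQ_bound.
(* Sup bounds of the three groups of terms for a field of C^1 size 1: three components against
   theta', nine quadratic terms and three pressure terms against theta. *)
pose K := C * ((M *+ 3 + (M * M *+ 3 *+ 3 + M *+ 3)) * B).
have K0 : 0 < K by rewrite !mulr_gt0// !addr_gt0// ?pmulrn_lgt0// ?mulr_gt0.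
apply/eqP; rewrite -normr_le0; apply/ler_addgt0Pl => e e0; rewrite addr0.
have [eps e1 eK] : exists2 eps, 0 < eps & e = K * eps.
  by exists (e / K); [rewrite divr_gt0|rewrite mulrC divfK// gt_eqF].
have hg i : exists g : E -> R, [/\ test_function Omega g, forall x, `|g x - X i x| <= eps &
    forall j x, `|partial j g x - partial j (X i) x| <= eps].
  by have [CXi [kX XO]] := hX i; exact: (C1_approx_smooth hS oO CXi kX XO e1).
have [g hg'] := choice hg.
have tg i : test_function Omega (g i) by case: (hg' i).
have Cg i : Ck 1 setT (g i) by case: (tg i) => + _ _; exact.
have -> : J (momentum_form th X) = - J (fun t x => momentum_form th g t x - momentum_form th X t x).
  by rewrite (J_B oO bO (stf_momentum hth Cg) (stf_momentum hth CX)) (momentum hth tg) sub0r opprK.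
rewrite normrN.
rewrite eK /K -[C * _ * _]mulrA; apply: hC.
- exact: (stfB (stf_momentum hth Cg) (stf_momentum hth CX)).
- by rewrite !mulr_ge0 ?(ltW e1) ?(ltW B0)// !addr_ge0// ?mulrn_wge0// ?mulr_ge0// ltW.
move=> t x _ _; have [hV hQ] := hM t x.
rewrite (_ : momentum_form th g t x - momentum_form th X t x =
  (\sum_i V i t x * (g i x - X i x)) * 'D_1 th t +
  (\sum_i \sum_j V i t x * V j t x * (partial j (g i) x - partial j (X i) x) +
   Q t x * \sum_i (partial i (g i) x - partial i (X i) x)) * th t); last first.
  rewrite /momentum_form.
  have s1 (f h : 'I_3 -> R) (v : 'I_3 -> R) : \sum_i v i * (f i - h i) = \sum_i v i * f i - \sum_i v i * h i.
    by rewrite -sumrB; apply: eq_bigr => i _; rewrite mulrBr.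
  rewrite (s1 (fun i => g i x)).
  under [X in _ = _ + (X + _) * _]eq_bigr => i _ do
    rewrite (s1 (fun j => partial j (g i) x) (fun j => partial j (X i) x) (fun j => V i t x * V j t x)).
  rewrite [X in _ = _ + (X + _) * _]sumrB [X in _ = _ + (_ + _ * X) * _]sumrB; ring.
have k1 : `|\sum_i V i t x * (g i x - X i x)| <= M * eps *+ 3.
  apply: norm_sum3 => i; rewrite normrM ler_pM//; by case: (hg' i).
have k2 : `|\sum_i \sum_j V i t x * V j t x * (partial j (g i) x - partial j (X i) x)| <=
    M * M * eps *+ 3 *+ 3.
  apply: norm_sum3 => i; apply: norm_sum3 => j; rewrite !normrM ler_pM ?mulr_ge0 ?ler_pM//.
  by case: (hg' i).
have k3 : `|Q t x * \sum_i (partial i (g i) x - partial i (X i) x)| <= M * eps *+ 3.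
  rewrite normrM -mulrnAr ler_pM//; apply: norm_sum3 => i; by case: (hg' i).
have [hB1 hB2] := hB t.
rewrite (le_trans (ler_normD _ _))// !normrM mulrAC mulrDl.
move: k1 k2 k3; set s1 := `|\sum_i _|; set s2 := \sum_i _; set s3 := Q t x * _ => k1 k2 k3.
have s10 : 0 <= s1 by exact: normr_ge0.
rewrite [X in _ <= X]mulrDl; apply: lerD; apply: ler_pM => //; first by rewrite mulrnAl.
rewrite (le_trans (ler_normD _ _))// mulrDl; apply: lerD; first by rewrite !mulrnAl.
by rewrite mulrnAl.
Qed.

Lemma divfree_C1 th Z : test_function I0T th -> Ck 1 setT Z -> compactly_inside Omega Z ->
  J (fun t x => (\sum_i V i t x * partial i Z x) * th t) = 0.
Proof.
move=> hth CZ [kZ ZO].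
have [C C0 hC] := J_bound oO bO T.
have [m1 m2 _ [B B0 hB]] := time_test_bound hth.
have [M M0 hM] := VQ_bound.
have sf (Y : E -> R) : Ck 1 setT Y -> stf (fun t x => (\sum_i V i t x * partial i Y x) * th t).
  move=> CY; apply: (@stfMt _ _ _ _ _ B _ m1) => [|t]; last exact: (hB t).1.
  apply: stf_sum => i; apply: stfMo => //; apply: okf_Ck; exact: partial_continuous.
pose K := C * (M *+ 3 * B).
have K0 : 0 < K by rewrite !mulr_gt0// ?pmulrn_lgt0.
apply/eqP; rewrite -normr_le0; apply/ler_addgt0Pl => e e0; rewrite addr0.
have [eps e1 eK] : exists2 eps, 0 < eps & e = K * eps.
  by exists (e / K); [rewrite divr_gt0|rewrite mulrC divfK// gt_eqF].
have [g [tg _ hg]] := C1_approx_smooth hS oO CZ kZ ZO e1.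
have Cg : Ck 1 setT g by case: tg => + _ _; exact.
have -> : J (fun t x => (\sum_i V i t x * partial i Z x) * th t) = - J (fun t x =>
    (\sum_i V i t x * partial i g x) * th t - (\sum_i V i t x * partial i Z x) * th t).
  by rewrite (J_B oO bO (sf _ Cg) (sf _ CZ)) (divfree hth tg) sub0r opprK.
rewrite normrN.
rewrite eK /K -[C * _ * _]mulrA; apply: hC.
- exact: (stfB (sf _ Cg) (sf _ CZ)).
- by rewrite !mulr_ge0 ?(ltW e1) ?(ltW B0)// ?mulrn_wge0// ltW.
move=> t x _ _; have [hV hQ] := hM t x; have [hB1 _] := hB t.
rewrite -mulrBl -sumrB normrM mulrAC; apply: ler_pM => //; rewrite mulrnAl; apply: norm_sum3 => i.
by rewrite -mulrBr normrM ler_pM.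
Qed.

End WeakLimit.

(** * Passage to the limit in the boundary layer *)

Section LayerForm.
Context {R : realType}.
Notation mu := (@lebesgue_measure R).
Notation nu3 := ((mu \x mu) \x mu)%E.
Notation E := 'rV[R]_3.

Variable Omega : set E.
Hypothesis oO : open Omega.
Hypothesis bO : bounded_set Omega.
Variable T : R.
Notation I0T := (`]0, T[%classic : set R).
Notation stf := (stf Omega T).
Notation okf := (okf Omega).
Variable S : R -> R.
Hypothesis hS : smooth_step S.
Variables (V : 'I_3 -> R -> E -> R) (Q : R -> E -> R).
Hypothesis sV : forall i, stf (V i).
Hypothesis sQ : stf Q.
Variables (N : nat) (c : 'I_N -> chart R) (psi : 'I_N -> E -> R) (U : set E).
Hypothesis hA : is_atlas Omega c psi.
Hypothesis oU : open U.
Hypothesis bU : boundary Omega `<=` U.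
Hypothesis sumU : forall x, U x -> \sum_i psi i x = 1.
Notation eta := (interior_cutoff Omega S c psi).

Implicit Types (a : 'I_3 -> 'I_3 -> E -> R) (b : 'I_3 -> E -> R).

Definition bulk a t (x : E) := \sum_i \sum_j V i t x * V j t x * a i j x + Q t x * \sum_i a i i x.

Definition edge b j t (x : E) := V j t x * (\sum_i V i t x * b i x) + Q t x * b j x.

(** The Hessian a and the gradient b are independent arguments: the form is linear in the pair, so
    the bound below also controls the difference of two potentials. *)
Definition layer_form a b n t : R := I3 (fun x => eta n x * bulk a t x) +
  \sum_j I3 (fun x => edge b j t x * partial j (eta n) x).

Lemma stf_bulk a : (forall i j, okf (a i j)) -> stf (bulk a).
Proof.
move=> oa; apply: stfD.
  by apply: stf_sum => i; apply: stf_sum => j; apply: stfMo => //; exact: stfM.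
rewrite (_ : (fun t x => _) = fun t x => \sum_i Q t x * a i i x).
  by apply: stf_sum => i; exact: stfMo.
by apply/funext => t; apply/funext => x; rewrite big_distrr.
Qed.

Lemma stf_edge b j : (forall i, okf (b i)) -> stf (edge b j).
Proof.
move=> ob; apply: stfD; last exact: stfMo.
by apply: stfM => //; apply: stf_sum => i; exact: stfMo.
Qed.

Let stf_mfb f t : stf f -> mf3 (f t) /\ exists M, forall x, `|f t x| <= M.
Proof.
by move=> hf; have [m _] := stf_slice oO bO t hf; have [M _ [h _]] := stf_bound hf; split => //; exists M.
Qed.

Let eta_mf n : mf3 (eta n).
Proof. by apply: mf3_continuous; apply: continuous_CkW; exact: (interior_cutoff_Ck oO hS hA oU bU sumU n). Qed.

Let stf_eta f n : stf f -> stf (fun t x => eta n x * f t x).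
Proof.
move=> hf; rewrite (_ : (fun t x => _) = fun t x => f t x * eta n x).
  apply: (stfMo oO hf); apply: (okf_Ck bO).
  exact: (continuous_CkW (interior_cutoff_Ck oO hS hA oU bU sumU n)).
by apply/funext => t; apply/funext => x; rewrite mulrC.
Qed.

Let stf_deta f n j : stf f -> stf (fun t x => f t x * partial j (eta n) x).
Proof.
move=> hf; apply: (stfMo oO hf); apply: (okf_Ck bO).
exact: (partial_continuous (interior_cutoff_Ck oO hS hA oU bU sumU n)).
Qed.

Lemma bulk_bound : exists2 K, 0 < K & forall a eps t x, 0 <= eps -> (forall i j, `|a i j x| <= eps) ->
  `|bulk a t x| <= K * eps.
Proof.
have [M M0 hM] := VQ_bound sV sQ.
exists (M * M *+ 3 *+ 3 + M *+ 3); first by rewrite addr_gt0// ?pmulrn_lgt0// ?mulr_gt0.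
move=> a eps t x e0 ha; have [hV hQ] := hM t x.
rewrite (le_trans (ler_normD _ _))// mulrDl lerD//.
  rewrite !mulrnAl; apply: norm_sum3 => i; apply: norm_sum3 => j.
  by rewrite !normrM ler_pM ?mulr_ge0 ?ler_pM.
by rewrite normrM mulrnAl -mulrnAr ler_pM//; apply: norm_sum3 => i.
Qed.

Lemma edge_bound : exists2 K, 0 < K & forall b eps j t x, 0 <= eps -> (forall i, `|b i x| <= eps) ->
  `|edge b j t x| <= K * eps.
Proof.
have [M M0 hM] := VQ_bound sV sQ.
exists (M * M *+ 3 + M); first by rewrite addr_gt0// ?pmulrn_lgt0// ?mulr_gt0.
move=> b eps j t x e0 hb; have [hV hQ] := hM t x.
rewrite (le_trans (ler_normD _ _))// mulrDl lerD//; last by rewrite normrM ler_pM.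
rewrite normrM mulrnAl -mulrA -mulrnAr ler_pM//; apply: norm_sum3 => i.
by rewrite normrM ler_pM.
Qed.

Let indic_le f (B : R) t : 0 <= B -> stf f -> (forall x, Omega x -> `|f t x| <= B) ->
  forall x, `|f t x| <= B.
Proof.
move=> B0 hf h x; have [M _ [_ h2]] := stf_bound hf.
by have [->|/h2[/h]//] := eqVneq (f t x) 0; rewrite normr0.
Qed.

Let I3_le f (B : R) t : 0 <= B -> stf f -> (forall x, Omega x -> `|f t x| <= B) ->
  `|I3 (f t)| <= B * I3 (\1_Omega : E -> R).
Proof.
move=> B0 hf h; have [M _ [_ h2]] := stf_bound hf.
rewrite -(I3Z _ (bms3_indic oO bO)); apply: I3_norm; [exact: (stf_slice oO bO t hf)|exact: bms3Z (bms3_indic oO bO)|].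
move=> x; have [->|f0] := eqVneq (f t x) 0; first by rewrite normr0 mulr_ge0// indicE.
by have [Ox _] := h2 t x f0; rewrite indicE mem_set// mulr1 h.
Qed.

Lemma layer_form_bound : exists2 K, 0 < K & forall a b eps n t,
  (forall i j, okf (a i j)) -> (forall i, okf (b i)) -> 0 <= eps ->
  (forall i j x, Omega x -> `|a i j x| <= eps) -> (forall i x, Omega x -> `|b i x| <= eps) ->
  `|layer_form a b n t| <= K * eps.
Proof.
have [K K0 hK] := bulk_bound; have [L L0 hL] := edge_bound.
have [B B0 hB] := interior_cutoff_bound hS hA.
have [C C0 hC] := cutoff_flux_bound oO bO hS hA oU bU sumU.
have V0 : 0 <= I3 (\1_Omega : E -> R) by apply: Rintegral_ge0 => q _; rewrite indicE.
exists (1 + B * K * I3 (\1_Omega : E -> R) + C * L *+ 3).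
  by rewrite -addrA ltr_pwDl// addr_ge0// ?mulrn_wge0 ?mulr_ge0// ltW.
move=> a b eps n t oa ob e0 ha hb; rewrite (le_trans (ler_normD _ _))// [leRHS]mulrDl; apply: lerD.
  rewrite mulrDl mul1r ler_wpDl// mulrAC.
  apply: (@I3_le (fun t x => eta n x * bulk a t x)).
  - by rewrite !mulr_ge0// ltW.
  - exact/stf_eta/stf_bulk.
  - by move=> x Ox; rewrite normrM -mulrA ler_pM// hK// => i j; exact: ha.
rewrite mulrnAl; apply: norm_sum3 => j.
have [mG _] := stf_mfb t (stf_edge j ob).
have [_] := hC n j _ (L * eps) mG (indic_le (mulr_ge0 (ltW L0) e0) (stf_edge j ob)
  (fun x Ox => hL b eps j t x e0 (fun i => hb i x Ox))).
by rewrite mulrA.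
Qed.

(** [edge] is 0 on the boundary itself, where V and Q vanish; the limit is the flux of a continuous
    extension G of its values inside. *)
Lemma layer_form_cvg a b t (G : 'I_3 -> E -> R) M : (forall i j, okf (a i j)) ->
  (forall j, continuous (G j)) -> (forall j x, `|G j x| <= M) ->
  (forall j x, Omega x -> G j x = edge b j t x) -> (forall i, okf (b i)) ->
  layer_form a b n t @[n --> \oo] --> I3 (bulk a t) + \sum_j flux c psi (G j) j.
Proof.
move=> oa cG hG eG ob.
have [B B0 hB] := interior_cutoff_bound hS hA.
have deta0 n j x : ~ Omega x -> partial j (eta n) x = 0.
  move=> Ox; apply: partial_off => tx; apply: Ox.
  exact: (interior_cutoff_inside oO bO hS hA oU bU sumU n).2.
apply: cvgD.
  have bb := stf_slice oO bO t (stf_bulk oa).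
  apply: (I3_dominated _ _ (bms3Z B (bms3_norm bb)) _).2.
  - by move=> n; exact: (mf3M (eta_mf n) bb.1).
  - move=> x; have [_ _ [_ h2]] := stf_bound (stf_bulk oa).
    have [->|/h2[Ox _]] := eqVneq (bulk a t x) 0.
      by rewrite (_ : (fun n => _) = cst 0); [exact: cvg_cst|apply/funext => n; rewrite mulr0].
    apply: cvg_near_cst; have := interior_cutoff_cvg hS hA Ox; apply: filterS => n ->.
    by rewrite mul1r.
  - by move=> n x; rewrite normrM ler_wpM2r.
apply: cvg_bigsum => j.
rewrite (_ : (fun n => _) = fun n => I3 (fun x => G j x * partial j (eta n) x)).
  exact: (@cutoff_flux_cvg _ _ oO bO _ hS _ _ _ _ hA oU bU sumU (G j) M j (cG j) (hG j)).
apply/funext => n; apply: eq_I3 => x; have [Ox|Ox] := pselect (Omega x); first by rewrite eG.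
by rewrite deta0// !mulr0.
Qed.

Lemma layer_form_bfs a b n : (forall i j, okf (a i j)) -> (forall i, okf (b i)) ->
  bfs mu (layer_form a b n) /\ forall t, ~ I0T t -> layer_form a b n t = 0.
Proof.
move=> oa ob.
have off f t : stf f -> ~ I0T t -> I3 (f t) = 0.
  move=> hf It; have [_ _ [_ h2]] := stf_bound hf.
  rewrite (_ : f t = fun=> 0); first by rewrite /I3 Rintegral_cst// mul0r.
  by apply/funext => x; apply/eqP/negP => /negP/h2[_ /It].
split.
  apply: bfsD; first exact: (stf_int oO bO (stf_eta n (stf_bulk oa))).
  apply: bfs_sum => j _; exact: (stf_int oO bO (stf_deta n j (stf_edge j ob))).
move=> t It; rewrite /layer_form (off _ _ (stf_eta n (stf_bulk oa)) It) add0r big1// => j _.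
exact: (off _ _ (stf_deta n j (stf_edge j ob)) It).
Qed.

End LayerForm.

(** * Functions of time that integrate to 0 against all tests *)

Section TestingInTime.
Context {R : realType}.
Notation mu := (@lebesgue_measure R).
Variable S : R -> R.
Hypothesis hS : smooth_step S.

Definition time_bump (a b : R) n (t : R) : R :=
  S (n.+1%:R * (t - a) - 1) * S (n.+1%:R * (b - t) - 1).

Let affine_Ck m (k l : R) : Ck m setT (fun t : R => k * t + l).
Proof.
rewrite (_ : (fun t => _) = cst k * id + cst l)//.
by apply: CkD; [exact: openT|apply: CkM; [exact: openT|exact: Ck_cst|exact: Ck_id]|exact: Ck_cst].
Qed.

Lemma time_bump_test a b T n : 0 <= a -> b <= T -> test_function (`]0, T[%classic : set R) (time_bump a b n).
Proof.
move=> a0 bT; have [_ S0 _ _] := hS.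
have k0 : 0 < n.+1%:R :> R by [].
have k1 : 0 < (n.+1%:R)^-1 :> R by rewrite invr_gt0.
have sub : tsupport (time_bump a b n) `<=` `[a + n.+1%:R^-1, b - n.+1%:R^-1]%classic.
  apply: tsupport_sub_closed; first exact: interval_closed.
  have h (r : R) : S (n.+1%:R * r - 1) != 0 -> n.+1%:R^-1 <= r.
    apply: contraNT; rewrite -ltNge => h; apply/eqP/S0.
    by rewrite subr_le0 mulrC -ler_pdivlMr// mul1r ltW.
  move=> t; rewrite mulf_eq0 negb_or => /andP[/h h1 /h h2]; rewrite /= in_itv/=.
  by move: h1 h2; move: (n.+1%:R^-1) => e h1 h2; apply/andP; split; lra.
split.
- move=> m; rewrite (_ : time_bump a b n =
    (S \o (fun t => n.+1%:R * t + (- (n.+1%:R * a) - 1))) * (S \o (fun t => (- n.+1%:R) * t + (n.+1%:R * b - 1)))).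
    apply: CkM; first exact: openT.
      exact: (@Ck_comp1 R m R setT setT S _ openT (fun _ _ => I) (step_Ck hS m) (@affine_Ck m _ _)).
    exact: (@Ck_comp1 R m R setT setT S _ openT (fun _ _ => I) (step_Ck hS m) (@affine_Ck m _ _)).
  apply/funext => t; rewrite /time_bump -[RHS]/(S _ * S _); move: (n.+1%:R) => k.
  by congr (S _ * S _); ring.
- by apply: subclosed_compact (@segment_compact _ _ _) sub; exact: closed_closure.
- move=> t /sub; rewrite /= !in_itv/=; move: k1; move: (n.+1%:R^-1) => e k1 /andP[h1 h2].
  by apply/andP; split; lra.
Qed.

Lemma time_bump_norm a b n t : `|time_bump a b n t| <= 1.
Proof.
by rewrite normrM mulr_ile1// ger0_norm ?step_ge0 ?step_le1.
Qed.

Lemma time_bump_cvg a b t : time_bump a b n t @[n --> \oo] --> (\1_(`]a, b[%classic : set R) t : R).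
Proof.
have [_ S0 S1 _] := hS.
have ev r : 0 < r -> \forall n \near \oo, S (n.+1%:R * r - 1) = 1.
  move=> r0; exists (Num.bound (2 / r)) => // n /= hn; apply: S1.
  have : 2 / r < n.+1%:R :> R.
    rewrite (lt_le_trans (archi_boundP _)) ?divr_ge0 ?(ltW r0)// ler_nat.
    exact: leq_trans hn (leqnSn _).
  by rewrite ltr_pdivrMr//; move: (_ * r) => k h; lra.
have z n r : r <= 0 -> S (n.+1%:R * r - 1) = 0.
  by move=> r0; apply: S0; rewrite subr_le0 (le_trans _ ler01)// mulr_ge0_le0.
apply: cvg_near_cst; rewrite indicE.
have [h|h] := boolP (t \in `]a, b[%classic).
  move: h; rewrite inE /= in_itv/= => /andP[h1 h2].
  have e1' : 0 < t - a by rewrite subr_gt0.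
  have e2' : 0 < b - t by rewrite subr_gt0.
  have hn : \forall n \near \oo, S (n.+1%:R * (t - a) - 1) = 1 /\ S (n.+1%:R * (b - t) - 1) = 1.
    by apply: filterI; exact: ev.
  by apply: filterS hn => n [e1 e2]; rewrite /time_bump e1 e2 mulr1.
near=> n; rewrite /time_bump.
move: h; rewrite notin_setE /= in_itv/= => /negP; rewrite negb_and -!leNgt => /orP[h|h].
  by rewrite z ?mul0r// subr_le0.
by rewrite [X in _ * X]z ?mulr0// subr_le0.
Unshelve. all: by end_near. Qed.

Variables (T : R) (F : R -> R) (M : R).
Hypothesis mF : measurable_fun setT F.
Hypothesis hF : forall t, `|F t| <= M.
Hypothesis F0 : forall t, ~ (`]0, T[%classic : set R) t -> F t = 0.

Let bF : bfs mu F.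
Proof.
split => //; exists (`]0, T[%classic), M; split.
- exact: measurable_itv.
- apply: le_lt_trans (finite_itv 0 T); apply: le_measure; rewrite ?inE//; try exact: measurable_itv.
  exact: subset_itv_oo_cc.
- move=> t; have [It|It] := pselect ((`]0, T[%classic : set R) t).
    by rewrite indicE mem_set// mulr1.
  by rewrite F0// normr0 mulr_ge0// ?indicE// (le_trans _ (hF 0)).
Qed.

Hypothesis testF : forall th : R -> R, test_function (`]0, T[%classic : set R) th -> \int[mu]_t (th t * F t) = 0.

Lemma int_itv_zero a b : 0 <= a -> b <= T -> \int[mu]_t (\1_(`]a, b[%classic : set R) t * F t) = 0.
Proof.
move=> a0 bT.
have h : \int[mu]_t (time_bump a b n t * F t) @[n --> \oo] -->
    \int[mu]_t (\1_(`]a, b[%classic : set R) t * F t).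
  apply: (@Rdominated_cvg _ _ _ mu (fun n t => time_bump a b n t * F t)
    (fun t => \1_(`]a, b[%classic : set R) t * F t) (fun t => `|F t|) _ _
    (bfs_integrable (bfs_norm bF)) _).2.
  - move=> n; apply: measurable_funM => //.
    have [st _ _] := time_bump_test n a0 bT.
    by apply: continuous_measurable_fun => t; exact: (Ck_continuous (st 0%N)).
  - by move=> t; apply: cvgM; [exact: time_bump_cvg|exact: cvg_cst].
  - by move=> n t; rewrite normrM ler_piMl// time_bump_norm.
apply: (cvg_unique _ h); first exact: norm_hausdorff.
rewrite (_ : (fun n => _) = cst 0); first exact: cvg_cst.
by apply/funext => n; exact: testF (time_bump_test n a0 bT).
Qed.

Lemma ae_sub (P P' : set R) : (forall t, P t -> P' t) ->
  {ae mu, forall t, P t} -> {ae mu, forall t, P' t}.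
Proof. by move=> h; apply: negligibleS => t /= h1 /h. Qed.

(** At a Lebesgue point t the mean of |F - F t| over short intervals around t tends to 0. It is at
    least |F t|, because F itself has mean 0 over those intervals. *)
Lemma ae_zero : {ae mu, forall t, F t = 0}.
Proof.
have lF : locally_integrable setT F.
  by apply: open_integrable_locally; [exact: openT|exact: bfs_integrable].
have := lebesgue_differentiation lF; apply: ae_sub => t lt.
have [It|It] := pselect ((`]0, T[%classic : set R) t); last exact: F0.
have [t0 tT] : 0 < t /\ t < T by move: It; rewrite /= in_itv/= => /andP.
apply/eqP; rewrite -normr_le0 -lee_fin.
apply: (cvge_to_ge lt); near=> r.
have r0 : 0 < r by [].
(* The interval of radius r has to stay inside ]0, T[. *)
have rt : r < t by near: r; exact: nbhs_right_lt.
have rT : r < T - t by near: r; apply: nbhs_right_lt; rewrite subr_gt0.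
set B : set R := `]t - r, t + r[%classic.
have mB : measurable B by exact: measurable_itv.
have muB : mu B = (r *+ 2)%:E by have := lebesgue_measure_ball t (ltW r0); rewrite ball_itv.
have bB : bfs mu (\1_B : R -> R).
  split; first exact: measurable_indic.
  by exists B, 1; split => [//||x]; [rewrite [X in (X < _)%E]muB ltry|rewrite mul1r ger0_norm].
have iB : \int[mu]_y (\1_B y : R) = r *+ 2 by rewrite /Rintegral integral_indic ?setIT// [X in fine X]muB.
have bBF : bfs mu (fun y => \1_B y * F y).
  apply: (@bfsMl _ _ _ mu (\1_B) F 1) => //.
  by move=> x; rewrite ger0_norm// indicE lern1 leq_b1.
pose g y := \1_B y * F y - F t * \1_B y.
have bg : bfs mu g.
  by apply: bfsB => //; exact: bfsZ.
have ig : \int[mu]_y g y = - (F t * (r *+ 2)).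
  rewrite bfs_intB//; last exact: bfsZ.
    rewrite int_itv_zero ?sub0r ?bfs_intZ ?iB//; first by rewrite subr_ge0 ltW.
    by rewrite addrC -lerBrDr ltW.
have eD : davg F t r = ((r *+ 2)^-1 * \int[mu]_y `|g y|)%:E.
  rewrite /davg /iavg ball_itv -/B muB inver gt_eqF ?pmulrn_lgt0// EFinM; congr (_ * _)%E.
  rewrite integral_mkcond /Rintegral fineK.
    apply: eq_integral => y _; rewrite patchE /g; case: ifPn => yB.
      by rewrite -[LHS]/(`|F y - F t|%:E) !indicE yB mul1r mulr1.
    by rewrite indicE (negPf yB) mul0r mulr0 subr0 normr0.
  apply: integrable_fin_num => //; exact: (bfs_integrable (bfs_norm bg)).
rewrite eD lee_fin ler_pdivlMl ?pmulrn_lgt0//.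
have r2 : 0 < r *+ 2 by rewrite pmulrn_lgt0.
rewrite -{1}(ger0_norm (ltW r2)) -normrM mulrC -normrN -ig.
by apply: bfs_int_norm => //; exact: bfs_norm.
Unshelve. all: by end_near. Qed.

End TestingInTime.

(** * The limit equation for a single potential *)

Section WeakPressureEquation.
Context {R : realType}.
Notation mu := (@lebesgue_measure R).
Notation nu3 := ((mu \x mu) \x mu)%E.
Notation E := 'rV[R]_3.

Variable Omega : set E.
Hypothesis oO : open Omega.
Hypothesis bO : bounded_set Omega.
Variable T : R.
Notation I0T := (`]0, T[%classic : set R).
Notation stf := (stf Omega T).
Notation okf := (okf Omega).
Variable S : R -> R.
Hypothesis hS : smooth_step S.
Variables (V : 'I_3 -> R -> E -> R) (Q : R -> E -> R).
Hypothesis sV : forall i, stf (V i).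
Hypothesis sQ : stf Q.
Hypothesis momentum : forall th X, test_function I0T th -> (forall i, test_function Omega (X i)) ->
  J (momentum_form V Q th X) = 0.
Hypothesis divfree : forall th Z, test_function I0T th -> test_function Omega Z ->
  J (fun t x => (\sum_i V i t x * partial i Z x) * th t) = 0.
Variables (N : nat) (c : 'I_N -> chart R) (psi : 'I_N -> E -> R) (U : set E).
Hypothesis hA : is_atlas Omega c psi.
Hypothesis oU : open U.
Hypothesis bU : boundary Omega `<=` U.
Hypothesis sumU : forall x, U x -> \sum_i psi i x = 1.
Notation eta := (interior_cutoff Omega S c psi).
Hypothesis oV : forall i t, okf (V i t).
Hypothesis oQ : forall t, okf (Q t).
Hypothesis impV : forall t x, boundary Omega x ->
  \sum_i btrace Omega (V i t) x * outward_normal Omega x 0 i = 0.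

(** Pointwise algebra for the field [eta grad Phi]: h and e stand for eta and its gradient, a and b
    for the Hessian and the gradient of the potential. *)
Lemma layer_expansion (v e b : 'I_3 -> R) (a : 'I_3 -> 'I_3 -> R) (q h : R) :
  \sum_i \sum_j v i * v j * (h * a i j + b i * e j) + q * \sum_i (h * a i i + b i * e i) =
  (\sum_i \sum_j v i * v j * a i j + q * \sum_i a i i) * h +
  \sum_j (v j * (\sum_i v i * b i) + q * b j) * e j.
Proof.
have s1 : \sum_i \sum_j v i * v j * (h * a i j + b i * e j) =
    (\sum_i \sum_j v i * v j * a i j) * h + \sum_j v j * (\sum_i v i * b i) * e j.
  rewrite big_distrl/=.
  have -> : \sum_j v j * (\sum_i v i * b i) * e j = \sum_i \sum_j v i * v j * (b i * e j).
    rewrite exchange_big/=; apply: eq_bigr => j _; rewrite big_distrr big_distrl/=.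
    by apply: eq_bigr => i _; ring.
  rewrite -big_split/=; apply: eq_bigr => i _; rewrite big_distrl -big_split/=.
  by apply: eq_bigr => j _; ring.
have s2 : q * \sum_i (h * a i i + b i * e i) = q * (\sum_i a i i) * h + \sum_j q * b j * e j.
  rewrite big_split/= mulrDr -big_distrr/= [h * _]mulrC mulrA; congr (_ + _).
  by rewrite big_distrr/=; apply: eq_bigr => i _; rewrite mulrA.
rewrite s1 s2 [in RHS]mulrDl addrACA -big_split/=; congr (_ + _).
by apply: eq_bigr => j _; rewrite mulrDl.
Qed.

(** The sum of fluxes is minus a surface integral of the normal component, so tangential parts do
    not matter. *)
Lemma flux_sum_eq (G G' : 'I_3 -> E -> R) : (forall j, continuous (G j)) -> (forall j, continuous (G' j)) ->
  (forall x, boundary Omega x -> \sum_j outward_normal Omega x 0 j * G j x =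
    \sum_j outward_normal Omega x 0 j * G' j x) ->
  \sum_j flux c psi (G j) j = \sum_j flux c psi (G' j) j.
Proof.
move=> cG cG' e; apply: oppr_inj.
pose f x := \sum_j outward_normal Omega x 0 j * G j x.
rewrite -(atlas_integral_flux oO hA cG (f := f)) => [|x bx]; last by [].
by rewrite -(atlas_integral_flux oO hA cG' (f := f)) => [//|x bx]; exact: e.
Qed.

Lemma okf_ext3 (Y : 'I_3 -> E -> R) : (forall i, okf (Y i)) -> exists F : 'I_3 -> E -> R, exists M,
  [/\ forall i, continuous (F i), forall i x, Omega x -> F i x = Y i x & forall i x, `|F i x| <= M].
Proof.
move=> oY; have h i : exists F : E -> R, [/\ continuous F, forall x, Omega x -> F x = Y i x &
    exists2 M, 0 < M & forall x, `|F x| <= M].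
  have [F [cF FY [M hM]]] := okf_ext (oY i); exists F; split => //.
  exists (`|M| + 1) => [|x]; first by rewrite ltr_wpDl.
  by rewrite (le_trans (hM x))// (le_trans (ler_norm _))// lerDl.
have [F hF] := choice h.
have [M M0 hM] : exists2 M, 0 < M & forall i x, `|F i x| <= M.
  apply: (@fin_bound _ _ (fun i M => forall x, `|F i x| <= M)).
    by move=> i N1 N2 N12 hN x; rewrite (le_trans _ N12).
  by move=> i; have [_ _ ?] := hF i.
by exists F, M; split => // i; have [] := hF i.
Qed.

Let normal_sum0 t (FV : 'I_3 -> E -> R) x : (forall i, continuous (FV i)) ->
  (forall i x, Omega x -> FV i x = V i t x) -> boundary Omega x ->
  \sum_i outward_normal Omega x 0 i * FV i x = 0.
Proof.
move=> cF eF bx; rewrite -[RHS](impV t bx); apply: eq_bigr => i _.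
rewrite mulrC (@btrace_ext _ _ _ (FV i))//; first exact: cF.
  by move=> y; exact: eF.
by case: bx.
Qed.

(** The boundary density is V (V . b) + Q b. Its first part is a multiple of V, whose normal
    component vanishes, and the pressure part remains. FQ and Fb may be any continuous extensions,
    as they are determined on the closure. *)
Lemma layer_form_limit a b t (FQ : E -> R) (Fb : 'I_3 -> E -> R) :
  (forall i j, okf (a i j)) -> (forall i, okf (b i)) ->
  continuous FQ -> (forall x, Omega x -> FQ x = Q t x) ->
  (forall i, continuous (Fb i)) -> (forall i x, Omega x -> Fb i x = b i x) ->
  layer_form Omega S V Q c psi a b n t @[n --> \oo] -->
    I3 (bulk V Q a t) + \sum_j flux c psi (fun x => FQ x * Fb j x) j.
Proof.
move=> oa ob cQ eQ cb eb.
have [FV [MV [cV eV hV]]] := okf_ext3 (fun i => oV i t).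
have [FQ' [cQ' eQ' [MQ hQ]]] := okf_ext (oQ t).
have [Fb' [Mb [cb' eb' hb]]] := okf_ext3 ob.
pose G j (x : E) := FV j x * (\sum_i FV i x * Fb' i x) + FQ' x * Fb' j x.
have cM (f g : E -> R) : continuous f -> continuous g -> continuous (fun x => f x * g x).
  by move=> cf cg x; apply: continuousM; [exact: cf|exact: cg].
have cG j : continuous (G j).
  have C0 (f : E -> R) : continuous f -> Ck 0 setT f by move=> cf; apply/Ck0P => x _; exact: cf.
  apply: (@continuous_CkW _ 0); apply: CkD1; last exact: (CkM1 (C0 _ cQ') (C0 _ (cb' j))).
  apply: (CkM1 (C0 _ (cV j))); apply: Ck_sum1 => i; exact: (CkM1 (C0 _ (cV i)) (C0 _ (cb' i))).
have MV0 : 0 <= MV by exact: le_trans (hV ord0 0).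
have Mb0 : 0 <= Mb by exact: le_trans (hb ord0 0).
have bG j x : `|G j x| <= MV * (MV * Mb *+ 3) + MQ * Mb.
  rewrite (le_trans (ler_normD _ _))// lerD// normrM ler_pM//.
  by apply: norm_sum3 => i; rewrite normrM ler_pM.
have eG j x : Omega x -> G j x = edge V Q b j t x.
  move=> Ox; rewrite /G /edge eV// eQ'// eb'//; congr (_ * _ + _).
  by apply: eq_bigr => i _; rewrite eV// eb'.
have := layer_form_cvg oO bO hS sV sQ hA oU bU sumU oa cG bG eG ob.
rewrite (@flux_sum_eq G (fun j x => FQ x * Fb j x))//; first by move=> j; exact: cM.
move=> x bx; have cx : closure Omega x by case: bx.
(* Two continuous functions that agree in Omega agree at the boundary point x. *)
have eqc (f g : E -> R) : continuous f -> continuous g -> (forall y, Omega y -> f y = g y) -> f x = g x.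
  move=> cf cg fg; rewrite -(btrace_ext (cg x) (fun y _ => erefl) cx).
  by apply/esym/btrace_ext => //; exact: cf.
rewrite (eqc FQ FQ') => [|//|//|y Oy]; last by rewrite eQ// eQ'.
under eq_bigr => j _ do rewrite /G mulrDr.
rewrite big_split/=.
under [X in X + _]eq_bigr => j _ do rewrite mulrA.
rewrite -big_distrl/= (normal_sum0 cV eV bx) mul0r add0r; apply: eq_bigr => j _.
by rewrite (eqc (Fb j) (Fb' j)) => [//|//|//|y Oy]; rewrite eb// eb'.
Qed.

Section one_potential.
Variable Phi : E -> R.
Hypothesis sPhi : smooth_closure Omega Phi.

Let oPhi vs : okf (iter_derive vs Phi).
Proof. exact: (smooth_closure_ucont oO bO vs sPhi). Qed.

Definition hess i j : E -> R := partial j (partial i Phi).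

Lemma okf_hess i j : okf (hess i j). Proof. exact: (oPhi [:: basis_vec j; basis_vec i]). Qed.
Lemma okf_partial i : okf (partial i Phi). Proof. exact: (oPhi [:: basis_vec i]). Qed.
Lemma okf_potential : okf Phi. Proof. exact: (oPhi [::]). Qed.

(** The function g need be regular in Omega only, whatever its values elsewhere: the product is 0
    off the support of [eta n]. *)
Lemma cutoff_mul n (g : E -> R) : Ck 1 Omega g ->
  [/\ Ck 1 setT (fun x => eta n x * g x), compactly_inside Omega (fun x => eta n x * g x) &
   forall j x, Omega x -> partial j (fun x => eta n x * g x) x =
     eta n x * partial j g x + g x * partial j (eta n) x].
Proof.
move=> Cg; have Ce := interior_cutoff_Ck oO hS hA oU bU sumU n.
have [ke eO] := interior_cutoff_inside oO bO hS hA oU bU sumU n.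
have oC : open (~` tsupport (eta n)) by apply: closed_openC; exact: closed_closure.
split.
- apply: (@sub_Ck _ _ _ _ (Omega `|` ~` tsupport (eta n))).
    by move=> x _; have [/eO|] := pselect (tsupport (eta n) x); [left|right].
  apply: CkU; first by apply: (@CkM _ _ _ Omega (eta n) g) => //; exact: sub_Ck Ce.
  apply: (@eq_Ck _ _ _ _ _ (cst 0)) => //; last exact: Ck_cst.
  by move=> x /tsupport_off ->; rewrite mul0r.
- by split; [exact: compact_tsupportMl|move=> x /tsupportMl/eO].
- move=> j x Ox; rewrite /partial -[fun x => _]/(eta n * g) deriveM //; apply: diff_derivable.
    exact: (CkS_differentiable Ce).
  exact: (CkS_differentiable Cg).
Qed.

Notation b := (fun i => partial i Phi).
Notation LF := (layer_form Omega S V Q c psi hess b).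

Let sPV j : stf (fun t x => V j t x * Phi x). Proof. by apply: stfMo => //; exact: okf_potential. Qed.

Let seta f n : stf f -> stf (fun t x => f t x * eta n x).
Proof.
move=> hf; apply: (stfMo oO hf); apply: (okf_Ck bO).
exact: (continuous_CkW (interior_cutoff_Ck oO hS hA oU bU sumU n)).
Qed.

Let sdeta f n j : stf f -> stf (fun t x => f t x * partial j (eta n) x).
Proof.
move=> hf; apply: (stfMo oO hf); apply: (okf_Ck bO).
exact: (partial_continuous (interior_cutoff_Ck oO hS hA oU bU sumU n)).
Qed.

(** The layer term that the divergence equation substitutes for the time derivative. *)
Definition drift n t := \sum_j I3 (fun x => V j t x * Phi x * partial j (eta n) x).

Let PhiC1 i : Ck 1 Omega (partial i Phi).
Proof. by have [sP _] := sPhi; exact: (smooth_derive (basis_vec i) sP 1%N). Qed.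

Lemma layer_form_test (th : R -> R) n : test_function I0T th ->
  \int[mu]_t (th t * LF n t) = \int[mu]_t ('D_1 th t * drift n t).
Proof.
move=> hth; have [m1 m2 hth' [B B0 hB]] := time_test_bound hth.
have hX i : Ck 1 setT (fun x => eta n x * partial i Phi x) /\
    compactly_inside Omega (fun x => eta n x * partial i Phi x).
  by have [h1 h2 _] := cutoff_mul n (PhiC1 i).
have CP : Ck 1 Omega Phi by case: sPhi => + _; exact.
have [Z1 Z2 Z3] := cutoff_mul n CP.
have e1 := momentum_C1 oO bO hS sV sQ momentum hth hX.
(* The divergence equation is tested in time with theta', so that it contains the same integral of
   theta' eta (u . grad Phi) as the momentum equation; at the end that integral cancels. *)
have e2 := divfree_C1 oO bO hS sV sQ divfree hth' Z1 Z2.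
pose f1 t (x : E) := bulk V Q hess t x * eta n x + \sum_j edge V Q b j t x * partial j (eta n) x.
pose f2 t (x : E) := \sum_j V j t x * Phi x * partial j (eta n) x.
have sB : stf (fun t x => bulk V Q hess t x * eta n x).
  by apply: seta; apply: stf_bulk => // i j; exact: okf_hess.
have sE j : stf (fun t x => edge V Q b j t x * partial j (eta n) x).
  by apply: sdeta; apply: stf_edge => // i; exact: okf_partial.
have sD j : stf (fun t x => V j t x * Phi x * partial j (eta n) x) by exact: sdeta.
have sf1 : stf f1 by apply: stfD => //; exact: stf_sum.
have sf2 : stf f2 by apply: stf_sum => j; exact: sdeta.
have sf3 : stf (fun t x => (\sum_i V i t x * partial i Phi x) * eta n x) by apply: seta; apply: stf_sum => i; apply: stfMo => //; exact: okf_partial.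
have i1 : J (fun t x => f1 t x * th t) = \int[mu]_t (th t * LF n t).
  rewrite (@J_t _ _ oO bO _ _ _ sf1); apply: eq_Rintegral => t _; congr (_ * _).
  rewrite /f1 I3D.
  - congr (_ + _); first by apply: eq_I3 => x; rewrite mulrC.
    by rewrite I3_sum// => j _; exact: (stf_slice oO bO t (sE j)).
  - exact: (stf_slice oO bO t sB).
  - by apply: bms3_sum => j _; exact: (stf_slice oO bO t (sE j)).
have i2 : J (fun t x => f2 t x * 'D_1 th t) = \int[mu]_t ('D_1 th t * drift n t).
  rewrite (@J_t _ _ oO bO _ _ _ sf2); apply: eq_Rintegral => t _; congr (_ * _).
  by rewrite /f2 I3_sum// => j _; exact: (stf_slice oO bO t (sD j)).
rewrite -i1 -i2.
have st1 f : stf f -> stf (fun t x => f t x * th t).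
  by move=> hf; apply: (stfMt hf m1) => t; exact: (hB t).1.
have st2 f : stf f -> stf (fun t x => f t x * 'D_1 th t).
  by move=> hf; apply: (stfMt hf m2) => t; exact: (hB t).2.
have off t x : ~ Omega x -> (forall i, V i t x = 0) /\ Q t x = 0.
  move=> Ox; have h f : stf f -> f t x = 0.
    by move=> /stf_bound[_ _ [_ h2]]; apply/eqP/negP => /negP/h2[].
  by split => [i|]; exact: h.
have e1' : J (fun t x => (\sum_i V i t x * partial i Phi x) * eta n x * 'D_1 th t) +
    J (fun t x => f1 t x * th t) = 0.
  rewrite -(J_D oO bO (st2 _ sf3) (st1 _ sf1)) -[RHS]e1; apply: eq_Rintegral => t _; apply: eq_I3 => x.
  have [Ox|Ox] := pselect (Omega x).
    rewrite /momentum_form; congr (_ * _ + _ * _).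
      by rewrite big_distrl/=; apply: eq_bigr => i _; ring.
    have eX i j : partial j (fun x => eta n x * partial i Phi x) x =
        eta n x * hess i j x + partial i Phi x * partial j (eta n) x.
      by have [_ _ ->] := cutoff_mul n (PhiC1 i).
    under [X in _ = X + _]eq_bigr => i _ do under eq_bigr => j _ do rewrite eX.
    under [X in _ = _ + _ * X]eq_bigr => i _ do rewrite eX.
    by rewrite layer_expansion.
  have [V0 Q0] := off t x Ox.
  have s1 (g : 'I_3 -> R) : \sum_i V i t x * g i = 0 by rewrite big1// => i _; rewrite V0 mul0r.
  have s2 (g : 'I_3 -> 'I_3 -> R) : \sum_i \sum_j V i t x * V j t x * g i j = 0.
    by rewrite big1// => i _; rewrite big1// => j _; rewrite V0 !mul0r.
  have s3 : \sum_j edge V Q b j t x * partial j (eta n) x = 0.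
    by rewrite big1// => j _; rewrite /edge V0 Q0 !mul0r addr0 mul0r.
  by rewrite /f1 s3 /bulk /momentum_form Q0 !s1 !s2 !mul0r !addr0 !mul0r.
have e2' : J (fun t x => (\sum_i V i t x * partial i Phi x) * eta n x * 'D_1 th t) +
    J (fun t x => f2 t x * 'D_1 th t) = 0.
  rewrite -(J_D oO bO (st2 _ sf3) (st2 _ sf2)) -[RHS]e2; apply: eq_Rintegral => t _; apply: eq_I3 => x.
  have [Ox|Ox] := pselect (Omega x).
    rewrite -mulrDl; congr (_ * _).
    rewrite big_distrl/= -big_split/=; apply: eq_bigr => i _.
    by rewrite Z3//; ring.
  have [V0 Q0] := off t x Ox; rewrite /f2 !big1 ?mul0r ?addr0// => i _; by rewrite V0 !mul0r.
by move: e1'; rewrite -[RHS]e2' => /addrI.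
Qed.

Lemma drift_bfs n : bfs mu (drift n).
Proof. by apply: bfs_sum => j _; apply: (stf_int oO bO); exact: sdeta. Qed.

(** The limit is the flux of Phi u, whose normal component on the boundary is 0. *)
Lemma drift_cvg t : drift n t @[n --> \oo] --> 0.
Proof.
have [FV [MV [cV eV hV]]] := okf_ext3 (fun i => oV i t).
have [FP [cP eP [MP hP]]] := okf_ext okf_potential.
have cG j : continuous (fun x => FV j x * FP x).
  by move=> x; apply: continuousM; [exact: cV|exact: cP].
have hG j x : `|FV j x * FP x| <= MV * MP by rewrite normrM ler_pM.
have z : \sum_j flux c psi (fun x => FV j x * FP x) j = 0.
  rewrite (@flux_sum_eq _ (fun _ _ => 0)) => [|//|j x|x bx]; last 2 first.
  - exact: cst_continuous.
  - rewrite [RHS]big1; last by move=> j _; rewrite mulr0.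
    under eq_bigr => j _ do rewrite mulrA.
    by rewrite -big_distrl/= (normal_sum0 cV eV bx) mul0r.
  rewrite big1// => j _; rewrite /flux big1// => i _; rewrite /graph_flux (_ : (fun y => _) = fun=> 0).
    by rewrite /integral_R2 Rintegral_cst// mul0r.
  by apply/funext => y; rewrite mulr0 mul0r.
rewrite -z; apply: cvg_bigsum => j.
rewrite (_ : (fun n => _) = fun n => I3 (fun x => FV j x * FP x * partial j (eta n) x)).
  exact: (@cutoff_flux_cvg _ _ oO bO _ hS _ _ _ _ hA oU bU sumU _ _ j (cG j) (hG j)).
apply/funext => n; apply: eq_I3 => x; have [Ox|Ox] := pselect (Omega x); first by rewrite eV// eP.
rewrite partial_off ?mulr0// => tx; apply: Ox.
exact: (interior_cutoff_inside oO bO hS hA oU bU sumU n).2.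
Qed.

Lemma drift_bound : exists2 B, 0 < B & forall n t, `|drift n t| <= B.
Proof.
have [C C0 hC] := cutoff_flux_bound oO bO hS hA oU bU sumU.
have [B B0 hB] : exists2 B, 0 < B & forall j t x, `|V j t x * Phi x| <= B.
  apply: (@fin_bound _ _ (fun j B => forall t x, `|V j t x * Phi x| <= B)).
    by move=> j B1 B2 B12 h t x; rewrite (le_trans _ B12).
  by move=> j; have [B B0 [h _]] := stf_bound (sPV j); exists B.
exists (C * B *+ 3) => [|n t]; first by rewrite pmulrn_lgt0// mulr_gt0.
apply: norm_sum3 => j; have [m _] := stf_slice oO bO t (sPV j).
by have [_] := hC n j _ B m (hB j t).
Qed.

Lemma layer_form_vanishes : {ae mu, forall t, LF n t @[n --> \oo] --> 0}.
Proof.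
have [FQc hFQ] : exists FQ : R -> E -> R, forall t, continuous (FQ t) /\ forall x, Omega x -> FQ t x = Q t x.
  have h t : exists F : E -> R, continuous F /\ forall x, Omega x -> F x = Q t x.
    by have [F [h1 h2 _]] := okf_ext (oQ t); exists F.
  by have [F hF] := choice h; exists F.
have [Fb [_ [cb eb _]]] := okf_ext3 okf_partial.
(* Measurability of F comes from being a pointwise limit, so the extension of Q is chosen at each
   time separately. *)
pose F t := I3 (bulk V Q hess t) + \sum_j flux c psi (fun x => FQc t x * Fb j x) j.
have cvgF t : LF n t @[n --> \oo] --> F t.
  have [h1 h2] := hFQ t.
  by apply: layer_form_limit => //; [exact: okf_hess|exact: okf_partial].
have LFb n := layer_form_bfs oO bO hS sV sQ hA oU bU sumU n okf_hess okf_partial.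
have [M hM] : exists M, forall n t, `|LF n t| <= M.
  have [K K0 hK] := layer_form_bound oO bO hS sV sQ hA oU bU sumU.
  have [e1 e10 he1] : exists2 e, 0 < e & forall ij : 'I_3 * 'I_3, forall x, Omega x -> `|hess ij.1 ij.2 x| <= e.
    apply: (@fin_bound _ _ (fun (ij : 'I_3 * 'I_3) e => forall x, Omega x -> `|hess ij.1 ij.2 x| <= e)).
      by move=> ij B1 B2 B12 h x Ox; rewrite (le_trans _ B12)// h.
    move=> [i j]; have [_ [B hB]] := okf_hess i j; exists (`|B| + 1); first by rewrite ltr_wpDl.
    by move=> x Ox; rewrite (le_trans (hB x Ox))// (le_trans (ler_norm _))// lerDl.
  have [e2 e20 he2] : exists2 e, 0 < e & forall i x, Omega x -> `|partial i Phi x| <= e.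
    apply: (@fin_bound _ _ (fun i e => forall x, Omega x -> `|partial i Phi x| <= e)).
      by move=> i B1 B2 B12 h x Ox; rewrite (le_trans _ B12)// h.
    move=> i; have [_ [B hB]] := okf_partial i; exists (`|B| + 1); first by rewrite ltr_wpDl.
    by move=> x Ox; rewrite (le_trans (hB x Ox))// (le_trans (ler_norm _))// lerDl.
  exists (K * (e1 + e2)) => n t; apply: hK; [exact: okf_hess|exact: okf_partial|..].
  - by rewrite addr_ge0// ltW.
  - by move=> i j x Ox; rewrite (le_trans (he1 (i, j) x Ox))// lerDl ltW.
  - by move=> i x Ox; rewrite (le_trans (he2 i x Ox))// lerDr ltW.
have [B B0 hB] := drift_bound.
have th_bfs (th : R -> R) : test_function I0T th -> bfs mu th.
  move=> hth; have [m1 _ _ [B1 B10 hB1]] := time_test_bound hth; have [_ _ thI] := hth.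
  split => //; exists I0T, B1; split.
  - exact: measurable_itv.
  - apply: le_lt_trans (finite_itv 0 T); apply: le_measure; rewrite ?inE//; try exact: measurable_itv.
    exact: subset_itv_oo_cc.
  - move=> t; have [It|It] := pselect (I0T t).
      by rewrite indicE mem_set// mulr1; exact: (hB1 t).1.
    by rewrite (tsupport_off (fun h => It (thI _ h))) normr0 mulr_ge0// ?indicE// ltW.
have intF (th : R -> R) : test_function I0T th -> measurable_fun setT F /\ \int[mu]_t (th t * F t) = 0.
  move=> hth; have [m1 m2 hth' _] := time_test_bound hth.
  split; first by apply: (@measurable_fun_cvg _ _ _ _ LF) => // n; exact: (LFb n).1.1.
  have h1 : \int[mu]_t (th t * LF n t) @[n --> \oo] --> \int[mu]_t (th t * F t).
    apply: (@Rdominated_cvg _ _ _ mu (fun n t => th t * LF n t) (fun t => th t * F t)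
      (fun t => M * `|th t|) _ _ (bfs_integrable (bfsZ M (bfs_norm (th_bfs _ hth)))) _).2.
    - by move=> n; apply: measurable_funM => //; exact: (LFb n).1.1.
    - by move=> t; apply: cvgM; [exact: cvg_cst|exact: cvgF].
    - by move=> n t; rewrite normrM mulrC ler_wpM2r.
  have h2 : \int[mu]_t ('D_1 th t * drift n t) @[n --> \oo] --> \int[mu]_t ('D_1 th t * 0).
    apply: (@Rdominated_cvg _ _ _ mu (fun n t => 'D_1 th t * drift n t) (fun t => 'D_1 th t * 0)
      (fun t => B * `|'D_1 th t|) _ _ (bfs_integrable (bfsZ B (bfs_norm (th_bfs _ hth')))) _).2.
    - by move=> n; apply: measurable_funM => //; exact: (drift_bfs n).1.
    - by move=> t; apply: cvgM; [exact: cvg_cst|exact: drift_cvg].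
    - by move=> n t; rewrite normrM mulrC ler_wpM2r.
  rewrite (_ : (fun n => _) = fun n => \int[mu]_t ('D_1 th t * drift n t)) in h1; last first.
    by apply/funext => n; exact: layer_form_test.
  rewrite -(cvg_unique _ h2 h1); last exact: norm_hausdorff.
  by under eq_Rintegral do rewrite mulr0; rewrite /Rintegral integral0.
(* The zero test function serves to extract from [intF] the measurability of F. *)
have z : test_function I0T (fun=> 0 : R).
  split; first by move=> m; exact: Ck_cst.
    by rewrite (_ : tsupport _ = set0); [exact: compact0|rewrite /tsupport; apply/seteqP; split => // x; rewrite (_ : [set _ | _] = set0) ?closure0//; apply/seteqP; split => // y /=; rewrite eqxx].
  move=> x; rewrite /tsupport (_ : [set _ | _] = set0) ?closure0//.
  by apply/seteqP; split => // y /=; rewrite eqxx.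
have F0 : {ae mu, forall t, F t = 0}.
  apply: (@ae_zero _ S hS T F M).
  - exact: (intF _ z).1.
  - move=> t; apply: (cvgr_to_le (cvg_norm (cvgF t))); near=> n; exact: hM.
  - move=> t It; apply: (cvg_unique _ (cvgF t)); first exact: norm_hausdorff.
    rewrite (_ : (fun n => _) = cst 0); first exact: cvg_cst.
    by apply/funext => n; exact: (LFb n).2.
  - by move=> th /intF[].
by apply: ae_sub F0 => t Ft; rewrite -[X in _ --> X]Ft; exact: cvgF.
Unshelve. all: by end_near.
Qed.

End one_potential.
End WeakPressureEquation.

(** * A null set independent of the potential *)

Section CountableTesting.
Context {R : realType}.
Notation mu := (@lebesgue_measure R).
Notation E := 'rV[R]_3.

Lemma rat_approx (r e : R) : 0 < e -> exists q : rat, `|r - ratr q| < e.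
Proof.
move=> e0; have h : r - e < r + e by lra.
have [q /= hq] := rat_in_itvoo h.
by exists q; rewrite distrC ltr_distl; move: hq; rewrite in_itv.
Qed.

Lemma seq_approx (I : finType) (s : seq E) (g : I -> E -> R) e : 0 < e ->
  exists q : {ffun I -> seq rat}, forall i z, z \in s -> `|g i z - ratr (nth 0 (q i) (index z s))| < e.
Proof.
move=> e0; have [q hq] := choice (fun r : R => rat_approx r e0).
exists [ffun i => map (fun z => q (g i z)) s] => i z zs.
by rewrite ffunE (nth_map 0) ?index_mem// nth_index.
Qed.

Lemma finite_net (A : set E) e : bounded_set A -> 0 < e ->
  exists s : seq E, {in s, forall z, A z} /\ forall y, A y -> exists2 z, z \in s & `|y - z| < e.
Proof.
move=> bA e0; have := compact_closure_bounded bA; rewrite compact_cover => cA.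
have cov : closure A `<=` \bigcup_(z in A) ball z e.
  move=> y cy; have [z [Az yz]] := cy _ (nbhsx_ballx y e e0).
  by exists z => //; exact: ball_sym.
have [|D DA hD] := cA E A (fun z => ball z e) _ cov; first by move=> z _; exact: ball_open.
exists (finmap.enum_fset D); split=> [z zD|y Ay].
  by apply/set_mem/DA.
have [z /= zD yz] := hD y (subset_closure Ay).
by exists z => //; rewrite distrC; move: yz; rewrite -ball_normE.
Qed.

Lemma cvg0_approx (u : nat -> R) :
  (forall e, 0 < e -> exists2 v : nat -> R, v n @[n --> \oo] --> 0 & forall n, `|u n - v n| <= e) ->
  u n @[n --> \oo] --> 0.
Proof.
move=> h; apply/cvgr0Pnorm_lt => e e0; have e2 : 0 < e / 2 by rewrite divr_gt0.
have [v /cvgr0Pnorm_lt/(_ _ e2) v0 uv] := h _ e2; apply: filterS v0 => n hn.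
by rewrite -[u n](subrK (v n)) [e]splitr (le_lt_trans (ler_normD _ _))// ler_ltD.
Qed.

(* The countable family has one member for each realised modulus of continuity and rational
   profile on a finite net. *)
Lemma ucont_separable (A : set E) (X : Type) (K : set X) (x0 : X) (I : finType) (f : I -> X -> E -> R) :
  bounded_set A -> K x0 -> (forall i x, K x -> ucont A (f i x)) ->
  exists2 D : nat -> X, forall n, K (D n) & forall x e, K x -> 0 < e ->
    exists n, forall i y, A y -> `|f i x y - f i (D n) y| <= e.
Proof.
move=> bA K0 uf.
have k0 (k : nat) : 0 < k.+1%:R^-1 :> R by rewrite invr_gt0.
have [net hnet] := choice (fun k : nat => finite_net bA (k0 k)).
pose prof (c : nat * nat * {ffun I -> seq rat}) x :=
  (forall i y z, A y -> A z -> `|y - z| < c.1.2.+1%:R^-1 -> `|f i x y - f i x z| < c.1.1.+1%:R^-1) /\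
  forall i z, z \in net c.1.2 -> `|f i x z - ratr (nth 0 (c.2 i) (index z (net c.1.2)))| < c.1.1.+1%:R^-1.
(* The representative of a profile realises it whenever some element of K does; x0 stands for the
   other profiles. *)
have hp c : exists x, K x /\ ((exists2 x', K x' & prof c x') -> prof c x).
  have [[x' Kx' px']|h] := pselect (exists2 x', K x' & prof c x'); first by exists x'.
  by exists x0.
have [pk hpk] := choice hp.
exists (fun n => if unpickle n is Some c then pk c else x0) => [n|x e Kx e0].
  by case: unpickle => // c; case: (hpk c).
(* Four errors of size 1 / (m + 1) add up: from y to the net and to the rational value for x, and
   back again for the representative. *)
have e4 : 0 < e / 4 by rewrite divr_gt0.
have inv r : 0 < r -> exists m : nat, m.+1%:R^-1 < r :> R.
  move=> r0; exists (Num.bound r^-1); rewrite invf_plt ?posrE//.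
  by rewrite (lt_le_trans (archi_boundP _)) ?invr_ge0 ?(ltW r0)// ler_nat.
have [m hm] := inv _ e4.
(* Here d is the reciprocal of a modulus of continuity; in this form the property is monotone in d,
   as [fin_bound] requires. *)
have [d d0 hd] : exists2 d, 0 < d & forall i, (fun i d => forall y z, A y -> A z -> d * `|y - z| < 1 ->
    `|f i x y - f i x z| < m.+1%:R^-1) i d.
  apply: fin_bound => [i d1 d2 d12 h y z Ay Az yz|i].
    by apply: h => //; rewrite (le_lt_trans _ yz)// ler_wpM2r.
  have [d d0 hd] := uf i x Kx _ (k0 m); exists d^-1; first by rewrite invr_gt0.
  by move=> y z Ay Az; rewrite mulrC ltr_pdivrMr// mul1r; exact: hd.
have [k hk] := inv d^-1 ltac:(by rewrite invr_gt0).
have [q hq] := seq_approx (net k) (fun i => f i x) (k0 m).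
have px : prof (m, k, q) x.
  split=> //= i y z Ay Az yz; apply: hd => //.
  by rewrite mulrC -ltr_pdivlMr// mul1r (lt_trans yz).
exists (pickle (m, k, q)) => i y Ay; rewrite pickleK.
have [_ hpx] := hpk (m, k, q); have [pd1 pd2] := hpx (ex_intro2 _ _ x Kx px).
have [px1 px2] := px; move: pd1 pd2 px1 px2 => /= pd1 pd2 px1 px2.
have [nA hn] := hnet k; have [z zn yz] := hn y Ay; have Az := nA z zn.
have h1 := px1 i y z Ay Az yz; have h2 := px2 i z zn.
have h3 := pd1 i y z Ay Az yz; have h4 := pd2 i z zn.
move: h1 h2 h3 h4 hm; move: (m.+1%:R^-1) (ratr _ : R) (f i x y) (f i x z) (f i (pk _) y) (f i (pk _) z).
move=> r w a b a' b'; rewrite !ltr_norml ler_norml.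
by move=> /andP[? ?] /andP[? ?] /andP[? ?] /andP[? ?] ?; apply/andP; split; lra.
Qed.

Variable Omega : set E.
Hypothesis oO : open Omega.
Hypothesis bO : bounded_set Omega.
Variable T : R.
Notation I0T := (`]0, T[%classic : set R).
Notation stf := (stf Omega T).
Notation okf := (okf Omega).
Variable S : R -> R.
Hypothesis hS : smooth_step S.
Variables (V : 'I_3 -> R -> E -> R) (Q : R -> E -> R).
Hypothesis sV : forall i, stf (V i).
Hypothesis sQ : stf Q.
Variables (N : nat) (c : 'I_N -> chart R) (psi : 'I_N -> E -> R) (U : set E).
Hypothesis hA : is_atlas Omega c psi.
Hypothesis oU : open U.
Hypothesis bU : boundary Omega `<=` U.
Hypothesis sumU : forall x, U x -> \sum_i psi i x = 1.
Notation eta := (interior_cutoff Omega S c psi).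

Lemma layer_form_B a b a' b' n t : (forall i j, okf (a i j)) -> (forall i, okf (b i)) ->
  (forall i j, okf (a' i j)) -> (forall i, okf (b' i)) ->
  layer_form Omega S V Q c psi (fun i j x => a i j x - a' i j x) (fun i x => b i x - b' i x) n t =
  layer_form Omega S V Q c psi a b n t - layer_form Omega S V Q c psi a' b' n t.
Proof.
move=> oa ob oa' ob'.
have cC (F : E -> R) : okf F -> forall f, stf f -> stf (fun t x => F x * f t x).
  move=> hF f hf; rewrite (_ : (fun t x => _) = fun t x => f t x * F x); first exact: stfMo.
  by apply/funext => s; apply/funext => x; rewrite mulrC.
have oe : okf (eta n).
  apply: (okf_Ck bO).
  exact: (continuous_CkW (interior_cutoff_Ck oO hS hA oU bU sumU n)).
have od j : okf (partial j (eta n)).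
  apply: (okf_Ck bO).
  exact: (partial_continuous (interior_cutoff_Ck oO hS hA oU bU sumU n)).
have s1 a0 : (forall i j, okf (a0 i j)) -> bms3 (fun x => eta n x * bulk V Q a0 t x).
  move=> o; exact: (stf_slice oO bO t (cC _ oe _ (stf_bulk oO sV sQ o))).
have s2 b0 j : (forall i, okf (b0 i)) -> bms3 (fun x => edge V Q b0 j t x * partial j (eta n) x).
  move=> o; exact: (stf_slice oO bO t (stfMo oO (stf_edge oO sV sQ j o) (od j))).
have d3 (v f g : 'I_3 -> R) : \sum_i v i * (f i - g i) = \sum_i v i * f i - \sum_i v i * g i.
  by rewrite -sumrB; apply: eq_bigr => i _; rewrite mulrBr.
rewrite /layer_form opprD addrACA -(I3B (s1 _ oa) (s1 _ oa')); congr (_ + _).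
  apply: eq_I3 => x; rewrite -mulrBr; congr (_ * _); rewrite /bulk opprD addrACA -mulrBr.
  congr (_ + _ * _); last by rewrite sumrB.
  rewrite -sumrB; apply: eq_bigr => i _; exact: d3.
rewrite -sumrB; apply: eq_bigr => j _; rewrite -(I3B (s2 _ j ob) (s2 _ j ob')).
apply: eq_I3 => x; rewrite -mulrBl; congr (_ * _); rewrite /edge opprD addrACA -!mulrBr.
by congr (_ * _ + _ * _); exact: d3.
Qed.

Hypothesis momentum : forall th X, test_function I0T th -> (forall i, test_function Omega (X i)) ->
  J (momentum_form V Q th X) = 0.
Hypothesis divfree : forall th Z, test_function I0T th -> test_function Omega Z ->
  J (fun t x => (\sum_i V i t x * partial i Z x) * th t) = 0.
Hypothesis oV : forall i t, okf (V i t).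
Hypothesis oQ : forall t, okf (Q t).
Hypothesis impV : forall t x, boundary Omega x ->
  \sum_i btrace Omega (V i t) x * outward_normal Omega x 0 i = 0.

Lemma weak_pressure_flux : {ae mu, forall t, forall (Phi : E -> R) (FQ : E -> R) (Fb : 'I_3 -> E -> R),
  smooth_closure Omega Phi -> continuous FQ -> (forall x, Omega x -> FQ x = Q t x) ->
  (forall i, continuous (Fb i)) -> (forall i x, Omega x -> Fb i x = partial i Phi x) ->
  I3 (bulk V Q (hess Phi) t) + \sum_j flux c psi (fun x => FQ x * Fb j x) j = 0}.
Proof.
(* First and second derivatives are indexed together, so that one member of the countable family
   approximates all of them at once. *)
pose f (k : option 'I_3 * 'I_3) (Phi : E -> R) : E -> R :=
  if k.1 is Some j then hess Phi k.2 j else partial k.2 Phi.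
have uf k Phi : smooth_closure Omega Phi -> ucont Omega (f k Phi).
  move=> sP; case: k => -[j|] i; first exact: (okf_hess oO bO sP i j).1.
  exact: (okf_partial oO bO sP i).1.
have s0 : smooth_closure Omega (fun=> 0 : R).
  split=> [m|vs x _]; first exact: Ck_cst.
  have -> : iter_derive vs (fun=> 0 : R) = cst 0 :> (E -> R).
    by elim: vs => //= v vs ->; apply/funext => y; exact: derive_cst.
  exact: is_cvg_cst.
have [D KD hD] := ucont_separable bO s0 uf.
have := ae_foralln (fun n => layer_form_vanishes oO bO hS sV sQ momentum divfree hA oU bU sumU oV oQ impV (KD n)).
apply: ae_sub => t h Phi FQ Fb sP cQ eQ cb eb.
have oh i j := okf_hess oO bO sP i j; have op i := okf_partial oO bO sP i.
have lim := layer_form_limit oO bO hS sV sQ hA oU bU sumU oV oQ impV oh op cQ eQ cb eb.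
apply: (cvg_unique _ lim); first exact: norm_hausdorff.
have [K K0 hK] := layer_form_bound oO bO hS sV sQ hA oU bU sumU.
(* The approximating potential does not depend on n, and neither does the distance between the two
   layer forms. *)
apply: cvg0_approx => e e0.
have eK : 0 < e / K by rewrite divr_gt0.
have [m hm] := hD Phi _ sP eK.
exists (fun n => layer_form Omega S V Q c psi (hess (D m)) (fun i => partial i (D m)) n t); first exact: h.
have oh' i j := okf_hess oO bO (KD m) i j; have op' i := okf_partial oO bO (KD m) i.
move=> n; have := hK _ _ _ n t (fun i j => okfB (oh i j) (oh' i j)) (fun i => okfB (op i) (op' i)) (ltW eK)
  (fun i j x Ox => hm (Some j, i) x Ox) (fun i x Ox => hm (None, i) x Ox).
by rewrite layer_form_B// mulrC divfK ?gt_eqF.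
Qed.

End CountableTesting.

(** * Reduction of the weak formulations *)

Section ProductTestFunctions.
Context {R : realType}.
Notation E := 'rV[R]_3.

Let c1 : continuous (fst : E * R -> E). Proof. by move=> x; exact: cvg_fst. Qed.
Let c2 : continuous (snd : E * R -> R). Proof. by move=> x; exact: cvg_snd. Qed.

Definition prod_fun (th : R -> R) (Z : E -> R) (z : E * R) : R := th z.2 * Z z.1.

Lemma prod_funE th Z : prod_fun th Z = (th \o snd) * (Z \o fst).
Proof. by []. Qed.

Lemma prod_fun_Ck m th Z : Ck m setT th -> Ck m setT Z -> Ck m setT (prod_fun th Z).
Proof.
move=> Ct CZ; rewrite prod_funE; apply: CkM; first exact: openT.
  exact: (@Ck_comp_linear R m _ R R setT setT (snd : {linear (E * R)%type -> R}) th c2 openT (fun _ _ => I) Ct).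
exact: (@Ck_comp_linear R m _ E R setT setT (fst : {linear (E * R)%type -> E}) Z c1 openT (fun _ _ => I) CZ).
Qed.

Lemma prod_fun_derive th Z (v z : E * R) : Ck 1 setT th -> Ck 1 setT Z ->
  'D_v (prod_fun th Z) z = th z.2 * 'D_(v.1) Z z.1 + Z z.1 * 'D_(v.2) th z.2.
Proof.
move=> Ct CZ.
have dt : differentiable th z.2 by exact: (CkS_differentiable Ct).
have dZ : differentiable Z z.1 by exact: (CkS_differentiable CZ).
have d1 : differentiable (fst : {linear (E * R)%type -> E}) z by exact: linear_differentiable.
have d2 : differentiable (snd : {linear (E * R)%type -> R}) z by exact: linear_differentiable.
rewrite prod_funE deriveM; [|exact/diff_derivable/differentiable_comp|exact/diff_derivable/differentiable_comp].
rewrite (@derive_comp_linear R _ _ _ (fst : {linear (E * R)%type -> E}))//.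
Qed.

Lemma prod_fun_dx th Z i x t : Ck 1 setT th -> Ck 1 setT Z ->
  dx i (prod_fun th Z) (x, t) = th t * partial i Z x.
Proof. by move=> Ct CZ; rewrite /dx prod_fun_derive//= derive0 mulr0 addr0. Qed.

Lemma prod_fun_dt th Z x t : Ck 1 setT th -> Ck 1 setT Z ->
  dt (prod_fun th Z) (x, t) = Z x * 'D_1 th t.
Proof. by move=> Ct CZ; rewrite /dt prod_fun_derive//= derive0 mulr0 add0r. Qed.

Variables (Omega : set E) (I0 : set R).

Lemma prod_fun_test th Z : test_function I0 th -> test_function Omega Z ->
  test_function (Omega `*` I0) (prod_fun th Z).
Proof.
move=> [st kt tI] [sZ kZ ZO].
have sub : tsupport (prod_fun th Z) `<=` tsupport Z `*` tsupport th.
  apply: tsupport_sub_closed; first by apply: compact_closed; [exact: norm_hausdorff|exact: compact_setX].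
  move=> z; rewrite mulf_eq0 negb_or => /andP[t0 Z0].
  by split; exact: subset_closure.
split; first by move=> m; apply: prod_fun_Ck; [exact: st|exact: sZ].
  by apply: subclosed_compact (compact_setX kZ kt) sub; exact: closed_closure.
by move=> z /sub[/ZO ? /tI ?].
Qed.

Definition prod_field th (X : 'I_3 -> E -> R) (z : E * R) : E := \row_i prod_fun th (X i) z.

Lemma prod_fieldE th X : prod_field th X = \sum_i (fun z => prod_fun th (X i) z *: basis_vec i).
Proof.
apply/funext => z; rewrite fct_sumE [LHS]rV_sum_basis; apply: eq_bigr => i _; by rewrite mxE.
Qed.

Lemma prod_field_Ck m th X : Ck m setT th -> (forall i, Ck m setT (X i)) -> Ck m setT (prod_field th X).
Proof.
move=> Ct CX; rewrite prod_fieldE; apply: Ck_sum; first exact: openT.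
move=> i _; apply: (@CkZ _ _ _ _ _ (prod_fun th (X i)) (cst (basis_vec i))); first exact: openT.
  exact: prod_fun_Ck.
by exists (basis_vec i).
Qed.

Lemma prod_field_coord th X v z i : Ck 1 setT th -> (forall i, Ck 1 setT (X i)) ->
  'D_v (prod_field th X) z 0 i = 'D_v (prod_fun th (X i)) z.
Proof.
move=> Ct CX; have df : differentiable (prod_field th X) z by exact: (CkS_differentiable (prod_field_Ck Ct CX)).
have -> : prod_fun th (X i) = (fun x : E => x 0 i) \o prod_field th X by apply/funext => y; rewrite /= mxE.
have dc : differentiable (fun x : E => x 0 i) (prod_field th X z) by exact: differentiable_coord.
rewrite !deriveE//; last exact: differentiable_comp.
by rewrite diff_comp//= -[in RHS]deriveE// derive_coord.
Qed.

Lemma prod_field_test th X : test_function I0 th -> (forall i, test_function Omega (X i)) ->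
  test_function (Omega `*` I0) (prod_field th X).
Proof.
move=> ht hX.
pose K := \big[setU/set0]_i tsupport (prod_fun th (X i)).
have hP i := prod_fun_test ht (hX i).
have kK : compact K by apply: bigsetU_compact => i _; case: (hP i).
have cK : closed K by apply: compact_closed => //; exact: norm_hausdorff.
have sub : tsupport (prod_field th X) `<=` K.
  rewrite ((closure_id K).1 cK); apply: closureS => z; apply: contraPP => Kz; apply/negP; rewrite negbK; apply/eqP.
  apply/rowP => i; rewrite !mxE; apply: tsupport_off => h; apply: Kz.
  by rewrite /K (bigD1 i)//=; left.
split.
- move=> m; apply: prod_field_Ck => [|i]; first by case: ht.
  by case: (hX i).
- by apply: subclosed_compact kK sub; exact: closed_closure.
- move=> z /sub; rewrite /K; apply: (big_ind (fun A => A z -> (Omega `*` I0) z)) => //.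
    by move=> A B hA hB [].
  by move=> i _ h; have [_ _] := hP i; exact.
Qed.

End ProductTestFunctions.

(** No integrability is at hand, so Tonelli's theorem is applied to the positive and the negative
    part. *)
Lemma measurable_slice_integral (d1 d2 : measure_display) (X : measurableType d1) (Y : measurableType d2)
    (R : realType) (m : {sigma_finite_measure set X -> \bar R}) (g : X * Y -> R) :
  measurable_fun setT g -> measurable_fun setT (fun y => \int[m]_x g (x, y)).
Proof.
move=> /measurable_EFinP mg.
have m1 := measurable_fun_fubini_tonelli_G (m1 := m) _ (measurable_funepos mg) (fun _ => funepos_ge0 _ _).
have m2 := measurable_fun_fubini_tonelli_G (m1 := m) _ (measurable_funeneg mg) (fun _ => funeneg_ge0 _ _).
have := measurableT_comp (@fine_measurable R setT (@measurableT _ _)) (emeasurable_funB m1 m2).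
congr measurable_fun; apply/funext => t /=; rewrite /Rintegral [in RHS]integralE.
by congr (fine (_ - _)%E); apply: eq_integral => q _; rewrite ?funeposE ?funenegE.
Qed.

(** * Truncation to the domain and to good times *)

Section Truncation.
Context {R : realType}.
Notation mu := (@lebesgue_measure R).
Notation nu3 := ((mu \x mu) \x mu)%E.
Notation E := 'rV[R]_3.

Variable Omega : set E.
Hypothesis oO : open Omega.
Hypothesis bO : bounded_set Omega.
Variable T : R.
Notation I0T := (`]0, T[%classic : set R).
Notation stf := (stf Omega T).
Notation okf := (okf Omega).
Notation mst f := (measurable_fun setT (fun q : R * R * R * R => f q.2 (vec3 q.1) : R)).

(** With G a set of good times of full measure, bounds valid for almost every t become bounds for
    all t, while time integrals do not change. *)
Definition trunc (G : set R) (f : R -> E -> R) : R -> E -> R :=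
  fun t x => ((fun q : E * R => f q.2 q.1) \_ (Omega `*` G)) (x, t).

Lemma truncE G f t x : Omega x -> G t -> trunc G f t x = f t x.
Proof. by move=> Ox Gt; rewrite /trunc patchE mem_set. Qed.

Lemma trunc0 G f t x : ~ (Omega x /\ G t) -> trunc G f t x = 0.
Proof. by move=> h; rewrite /trunc patchE memNset. Qed.

Lemma trunc_measurable G f : measurable_spacetime Omega T f -> measurable G -> G `<=` I0T -> mst (trunc G f).
Proof.
move=> mf mG GI.
have mOG : measurable ((vec3 @^-1` Omega) `*` G) by apply: measurableX => //; exact: measurable_open3.
have h := (measurable_restrictT (fun q : R * R * R * R => f q.2 (vec3 q.1)) mOG).1.
apply: h; apply: measurable_funS mf => //.
  by apply: measurableX; [exact: measurable_open3|exact: measurable_itv].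
by move=> q [? /GI].
Qed.

Lemma I3_measurable f : mst f -> measurable_fun setT (fun t => I3 (f t)).
Proof. exact: (@measurable_slice_integral _ _ _ _ _ (@lebesgue3 R)). Qed.

(** K is the integrand truncated to the whole of ]0, T[ and K' the one truncated to good times. They
    agree off a null set of times, and measurability of both is enough to compare their
    integrals. *)
Lemma weak_integral (F K K' : R -> E -> R) (G : set R) : mst K -> mst K' ->
  (forall t x, Omega x -> I0T t -> K t x = F t x) -> (forall t x, ~ (Omega x /\ I0T t) -> K t x = 0) ->
  {ae mu, forall t, I0T t -> G t} -> (forall t x, G t \/ ~ I0T t -> K' t x = K t x) ->
  \int[mu]_(t in I0T) integral_R3 Omega (F t) = J K'.
Proof.
move=> mK mK' KF K0 aeG KK'.
have -> : \int[mu]_(t in I0T) integral_R3 Omega (F t) = J K.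
  rewrite Rintegral_mkcond; apply: eq_Rintegral => t _; rewrite patchE.
  have [/set_mem It|It] := boolP (t \in I0T).
    rewrite integral_R3E; apply: eq_I3 => x; rewrite patchE.
    by have [/set_mem Ox|/negP Ox] := boolP (x \in Omega); [rewrite KF|rewrite K0// => -[/mem_set]].
  rewrite (_ : K t = fun=> 0); first by rewrite /I3 Rintegral_cst// mul0r.
  by apply/funext => x; apply: K0 => -[_ /mem_set]; apply/negP.
have mI3 f : mst f -> measurable_fun setT (EFin \o (fun t => I3 (f t))).
  by move=> mf; apply/measurable_EFinP; exact: I3_measurable.
have e : ae_eq mu setT (EFin \o (fun t => I3 (K t))) (EFin \o (fun t => I3 (K' t))).
  apply: ae_sub aeG => t h _; congr (_%:E); apply: eq_I3 => x; apply/esym/KK'.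
  by have [It|It] := pselect (I0T t); [left; exact: h|right].
exact: (congr1 fine (@ae_eq_integral _ _ _ mu setT _ _ measurableT (mI3 _ mK) (mI3 _ mK') e)).
Qed.

Lemma mst_fst (f : E -> R) : continuous f -> mst (fun (_ : R) x => f x).
Proof. move=> cf; exact: (measurableT_comp (mf3_continuous cf) (@measurable_fst _ _ _ _)). Qed.

Lemma mst_snd (th : R -> R) : measurable_fun setT th -> mst (fun t (_ : E) => th t).
Proof. move=> mt; exact: (measurableT_comp mt (@measurable_snd _ _ _ _)). Qed.

Lemma mst_momentum (V : 'I_3 -> R -> E -> R) Q th X : (forall i, mst (V i)) -> mst Q ->
  test_function I0T th -> (forall i, test_function Omega (X i)) -> mst (momentum_form V Q th X).
Proof.
move=> mV mQ hth hX; have [m1 m2 _ _] := time_test_bound hth.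
have CX i : Ck 1 setT (X i) by case: (hX i) => + _ _; exact.
apply: measurable_funD; (apply: measurable_funM; last by [exact: (mst_snd m2)|exact: (mst_snd m1)]).
  apply: measurable_sum => i; apply: measurable_funM; first exact: mV.
  by apply: mst_fst; exact: continuous_CkW (CX i).
apply: measurable_funD.
  apply: measurable_sum => i; apply: measurable_sum => j; apply: measurable_funM.
    by apply: measurable_funM; exact: mV.
  by apply: mst_fst; exact: partial_continuous.
apply: measurable_funM => //; apply: measurable_sum => i.
by apply: mst_fst; exact: partial_continuous.
Qed.

Lemma mst_divfree (V : 'I_3 -> R -> E -> R) th Z : (forall i, mst (V i)) ->
  test_function I0T th -> test_function Omega Z -> mst (fun t x => (\sum_i V i t x * partial i Z x) * th t).
Proof.
move=> mV hth [sZ _ _]; have [m1 m2 _ _] := time_test_bound hth.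
apply: measurable_funM; last exact: mst_snd.
apply: measurable_sum => i; apply: measurable_funM => //.
by apply: mst_fst; exact: partial_continuous (sZ 1%N).
Qed.

Variables (u : R -> E -> E) (p : R -> E -> R) (alpha : R).
Hypothesis alpha_gt0 : 0 < alpha.
Hypothesis hu : Linfty_holder_vec alpha Omega T u.
Hypothesis hp : Linfty_holder alpha Omega T p.

Notation tru G := (fun i => trunc G (fun t x => u t x 0 i)).

Lemma weak_momentum_trunc G : measurable G -> G `<=` I0T -> {ae mu, forall t, I0T t -> G t} ->
  weak_momentum Omega T u p -> forall th X, test_function I0T th ->
  (forall i, test_function Omega (X i)) -> J (momentum_form (tru G) (trunc G p) th X) = 0.
Proof.
move=> mG GI aeG wm th X hth hX.
rewrite -[RHS](wm _ (prod_field_test hth hX)); apply/esym.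
have Cth : Ck 1 setT th by case: hth => + _ _; exact.
have CX i : Ck 1 setT (X i) by case: (hX i) => + _ _; exact.
have mI : measurable I0T by exact: measurable_itv.
have mst_tr H : measurable H -> H `<=` I0T -> mst (momentum_form (tru H) (trunc H p) th X).
  move=> mH HI; apply: mst_momentum => // [i|]; apply: trunc_measurable => //; [exact: hu.1|exact: hp.1].
apply: (@weak_integral _ (momentum_form (tru I0T) (trunc I0T p) th X) _ G) => //; try exact: mst_tr.
- move=> t x Ox It; rewrite /momentum_form truncE//.
  under eq_bigr => i _ do rewrite truncE//.
  under [X in _ + (X + _) * _]eq_bigr => i _ do under eq_bigr => j _ do rewrite !truncE//.
  rewrite mulrDl addrA; congr (_ + _ + _).
  + rewrite /dot big_distrl/=; apply: eq_bigr => i _.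
    by rewrite /dt prod_field_coord// -/(dt _ _) prod_fun_dt// mulrA.
  + rewrite big_distrl/=; apply: eq_bigr => i _; rewrite big_distrl/=; apply: eq_bigr => j _.
    by rewrite /dx prod_field_coord// -/(dx _ _ _) prod_fun_dx// -!mulrA; congr (_ * (_ * _)); rewrite mulrC.
  + rewrite -mulrA big_distrl/=; congr (_ * _); apply: eq_bigr => i _.
    by rewrite /dx prod_field_coord// -/(dx _ _ _) prod_fun_dx// mulrC.
- move=> t x h; rewrite /momentum_form (trunc0 _ h).
  have s1 (g : 'I_3 -> R) : \sum_i trunc I0T (fun t x => u t x 0 i) t x * g i = 0.
    by rewrite big1// => i _; rewrite trunc0// mul0r.
  have s2 (g : 'I_3 -> 'I_3 -> R) : \sum_i \sum_j trunc I0T (fun t x => u t x 0 i) t x *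
      trunc I0T (fun t x => u t x 0 j) t x * g i j = 0.
    by rewrite big1// => i _; rewrite big1// => j _; rewrite trunc0// !mul0r.
  by rewrite s1 s2 !mul0r addr0 mul0r addr0.
- move=> t x h; have e f : trunc G f t x = trunc I0T f t x.
    have [[Ox It]|Oxt] := pselect (Omega x /\ I0T t).
      by rewrite !truncE//; case: h.
    by rewrite (trunc0 _ Oxt) trunc0// => -[Ox /GI It]; exact: Oxt.
  rewrite /momentum_form e; under eq_bigr => i _ do rewrite e.
  by under [X in _ + (X + _) * _]eq_bigr => i _ do under eq_bigr => j _ do rewrite !e.
Qed.

Lemma weak_div_free_trunc G : measurable G -> G `<=` I0T -> {ae mu, forall t, I0T t -> G t} ->
  weak_div_free Omega T u -> forall th Z, test_function I0T th ->
  test_function Omega Z -> J (fun t x => (\sum_i tru G i t x * partial i Z x) * th t) = 0.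
Proof.
move=> mG GI aeG wd th Z hth hZ.
rewrite -[RHS](wd _ (prod_fun_test hth hZ)); apply/esym.
have Cth : Ck 1 setT th by case: hth => + _ _; exact.
have CZ : Ck 1 setT Z by case: hZ => + _ _; exact.
have mI : measurable I0T by exact: measurable_itv.
have mst_tr H : measurable H -> H `<=` I0T -> mst (fun t x => (\sum_i tru H i t x * partial i Z x) * th t).
  move=> mH HI; apply: (@mst_divfree (tru H) th Z) => // i; apply: trunc_measurable => //; exact: hu.1.
apply: (@weak_integral _ (fun t x => (\sum_i tru I0T i t x * partial i Z x) * th t) _ G) => //; try exact: mst_tr.
- move=> t x Ox It; rewrite big_distrl/=; apply: eq_bigr => i _; rewrite truncE// prod_fun_dx//.
  by rewrite -mulrA; congr (_ * _); rewrite mulrC.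
- by move=> t x h; rewrite big1 ?mul0r// => i _; rewrite trunc0// mul0r.
- move=> t x h; congr (_ * _); apply: eq_bigr => i _; congr (_ * _).
  have [[Ox It]|Oxt] := pselect (Omega x /\ I0T t).
    by rewrite !truncE//; case: h.
  by rewrite (trunc0 _ Oxt) trunc0// => -[Ox /GI It]; exact: Oxt.
Qed.

Hypothesis up_sol : weak_solution Omega T u p.

Lemma holder_trunc M G f : measurable G -> G `<=` I0T -> measurable_spacetime Omega T f ->
  (forall t x, G t -> Omega x -> `|f t x| <= M /\ forall y, Omega y -> `|f t x - f t y| <= M * `|x - y| `^ alpha) ->
  stf (trunc G f) /\ forall t, okf (trunc G f t).
Proof.
move=> mG GI mf hM.
have b t x : `|trunc G f t x| <= `|M|.
  have [[Ox Gt]|h] := pselect (Omega x /\ G t); last by rewrite trunc0// normr0.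
  by rewrite truncE// (le_trans (hM t x Gt Ox).1)// ler_norm.
split=> [|t].
  apply: (@stf_intro _ _ _ _ `|M|) => //; first exact: trunc_measurable.
  move=> t x; have [[Ox Gt] _|h] := pselect (Omega x /\ G t); first by split=> //; exact: GI.
  by rewrite trunc0// eqxx.
split; last by exists `|M| => x _.
have [Gt|Gt] := pselect (G t); last first.
  by move=> e e0; exists 1 => // x y _ _ _; rewrite !trunc0 ?subrr ?normr0// => -[].
apply: (@holder_ucont _ _ _ alpha M alpha_gt0) => x y Ox Oy.
by rewrite !truncE//; exact: (hM t x Gt Ox).2.
Qed.

(** The good times avoid measurable null sets that contain the exceptional times of the bounds on u
    and p and of the impermeability condition. *)
Lemma good_times : exists G : set R, [/\ measurable G, G `<=` I0T, {ae mu, forall t, I0T t -> G t} &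
  [/\ forall i, stf (tru G i) /\ forall t, okf (tru G i t),
      stf (trunc G p) /\ forall t, okf (trunc G p t) &
      forall t x, boundary Omega x ->
        \sum_i btrace Omega (tru G i t) x * outward_normal Omega x 0 i = 0]].
Proof.
have [mu_ [Mu [N1 [mN1 N10 hN1]]]] := hu; have [mp [Mp [N2 [mN2 N20 hN2]]]] := hp.
have [_ _ _ _ [N3 [mN3 N30 hN3]]] := up_sol.
pose N := N1 `|` N2 `|` N3; pose G := I0T `\` N.
have mN : measurable N by do 2?apply: measurableU.
have mG : measurable G by apply: measurableD => //; exact: measurable_itv.
have N0 : mu N = 0%E by rewrite !measureU0//; exact: measurableU.
have good (P : R -> Prop) (M0 : set R) t : ~` [set t | I0T t -> P t] `<=` M0 -> M0 `<=` N -> G t -> P t.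
  by move=> hM MN [It Nt]; apply: contrapT => Pt; apply/Nt/MN/hM => /(_ It).
have GU t x : G t -> Omega x -> `|u t x| <= Mu /\ forall y, Omega y -> `|u t x - u t y| <= Mu * `|x - y| `^ alpha.
  move=> Gt Ox; apply: holder_norm_bound => //.
  by apply: (good (fun t => (holder_norm alpha Omega (u t) <= Mu%:E)%E) N1) => // s ?; left; left.
have GP t x : G t -> Omega x -> `|p t x| <= Mp /\ forall y, Omega y -> `|p t x - p t y| <= Mp * `|x - y| `^ alpha.
  move=> Gt Ox; apply: holder_norm_bound => //.
  by apply: (good (fun t => (holder_norm alpha Omega (p t) <= Mp%:E)%E) N2) => // s ?; left; right.
have GUi i : stf (tru G i) /\ forall t, okf (tru G i t).
  apply: (@holder_trunc Mu) => // [t []//|t x Gt Ox]; have [h1 h2] := GU t x Gt Ox.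
  split; first by rewrite (le_trans _ h1)// rV_coord_le.
  by move=> y Oy; rewrite (le_trans _ (h2 y Oy))// (le_trans _ (rV_coord_le _ i))// !mxE.
exists G; split => //; first by move=> t [].
  by exists N; split => // t /= h; apply: contrapT => Nt; apply: h => It; split.
split=> //; first by apply: (@holder_trunc Mp) => // t [].
move=> t x bx; have cx : closure Omega x by case: bx.
have [Gt|Gt] := pselect (G t).
  have := good (fun t => forall x, boundary Omega x ->
    \sum_i btrace Omega (fun y => u t y 0 i) x * outward_normal Omega x 0 i = 0) N3 t hN3 _ Gt x bx.
  move=> h; rewrite -[RHS]h; last by move=> s ?; right.
  apply: eq_bigr => i _; congr (_ * _).
  have [F [cF eF _]] := okf_ext ((GUi i).2 t).
  rewrite (btrace_ext (cF x) eF cx) (@btrace_ext _ _ _ F)//; first exact: cF.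
  by move=> y Oy; rewrite eF// truncE.
(* At the remaining times the truncated velocity is 0 in Omega, and so are its traces. *)
rewrite big1// => i _; rewrite (@btrace_ext _ _ _ (cst 0)) ?mul0r//; first exact: cst_continuous.
by move=> y Oy; rewrite trunc0// => -[].
Qed.

End Truncation.

(** * The tubular neighbourhood of the boundary *)

Section TubularNeighbourhood.
Context {R : realType}.
Notation E := 'rV[R]_3.

Definition nearby (V : normedModType R) (x : V) (P : V -> Prop) :=
  exists2 r, 0 < r & forall y, `|x - y| < r -> P y.

Lemma nearbyP (V : normedModType R) (x : V) P : nearby x P <-> \forall y \near x, P y.
Proof.
split=> [[r r0 h]|/nbhs_normP[r r0 h]]; first by apply/nbhs_normP; exists r.
by exists r => // y; exact: h.
Qed.

Lemma nearby_continuous (V W : normedModType R) (f : V -> W) x :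
  {for x, continuous f} <-> forall e, 0 < e -> nearby x (fun y => `|f x - f y| < e).
Proof.
split=> [/cvgrPdist_lt h e e0|h]; first exact/nearbyP/h.
by apply/cvgrPdist_lt => e e0; apply/nearbyP/h.
Qed.

Lemma nearbyI (V : normedModType R) (x : V) (P Q S : V -> Prop) : nearby x P -> nearby x Q ->
  (forall y, P y -> Q y -> S y) -> nearby x S.
Proof.
move=> [r r0 hr] [r' r'0 hr'] h; exists (Num.min r r'); first by rewrite lt_min r0.
by move=> y; rewrite lt_min => /andP[h1 h2]; apply: h; [exact: hr|exact: hr'].
Qed.

Lemma nearbyS (V : normedModType R) (x : V) (P Q : V -> Prop) : nearby x P ->
  (forall y, P y -> Q y) -> nearby x Q.
Proof. by move=> [r r0 hr] h; exists r => // y /hr /h. Qed.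

Lemma continuous_bigsum (V : normedModType R) n (f : 'I_n -> V -> R) x :
  (forall i, {for x, continuous (f i)}) -> {for x, continuous (fun y => \sum_i f i y)}.
Proof.
elim: n f => [|n IH] f h.
  rewrite (_ : (fun y => _) = cst 0); first exact: cst_continuous.
  by apply/funext => y; rewrite big_ord0.
rewrite (_ : (fun y => _) = (fun y => \sum_(i < n) f (widen_ord (leqnSn n) i) y + f ord_max y)).
  by apply: continuousD; [apply: IH => i|]; exact: h.
by apply/funext => y; rewrite big_ord_recr.
Qed.

(** Cauchy-Schwarz, from the nonnegative square of |y| x - |x| y. The product of the norms is
    cancelled at the end, so zero vectors come first. *)
Lemma dot_le (n : nat) (x y : 'rV[R]_n) : dot x y <= enorm x * enorm y.
Proof.
have [x0|x0] := eqVneq (enorm x) 0.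
  have /dot_eq0 -> : dot x x = 0.
    by apply/eqP; rewrite eq_le dot_ge0 andbT -sqrtr_eq0 -/(enorm x) x0 eqxx.
  rewrite /dot big1 ?mulr_ge0 ?sqrtr_ge0// => i _; by rewrite mxE mul0r.
have [y0|y0] := eqVneq (enorm y) 0.
  have /dot_eq0 -> : dot y y = 0.
    by apply/eqP; rewrite eq_le dot_ge0 andbT -sqrtr_eq0 -/(enorm y) y0 eqxx.
  rewrite /dot big1 ?mulr_ge0 ?sqrtr_ge0// => i _; by rewrite mxE mulr0.
have xx : dot x x = enorm x ^+ 2 by rewrite sqr_sqrtr ?dot_ge0.
have yy : dot y y = enorm y ^+ 2 by rewrite sqr_sqrtr ?dot_ge0.
have xp : 0 < enorm x by rewrite lt_def x0 sqrtr_ge0.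
have yp : 0 < enorm y by rewrite lt_def y0 sqrtr_ge0.
pose z := \row_i (enorm y * x 0 i - enorm x * y 0 i) : 'rV[R]_n.
have : 0 <= dot z z by exact: dot_ge0.
have -> : dot z z = enorm y ^+ 2 * dot x x + enorm x ^+ 2 * dot y y - 2 * enorm x * enorm y * dot x y.
  rewrite /dot !big_distrr/= -big_split -sumrB/=; apply: eq_bigr => i _; rewrite !mxE; ring.
rewrite xx yy => h.
have p : 0 < enorm x * enorm y by rewrite mulr_gt0.
by rewrite -(ler_pM2l p); move: h; move: (enorm x) (enorm y) (dot x y) => a b d h; nra.
Qed.

Lemma enorm_ge0 n (x : 'rV[R]_n) : 0 <= enorm x. Proof. exact: sqrtr_ge0. Qed.

Lemma enormD n (x y : 'rV[R]_n) : enorm (x + y) <= enorm x + enorm y.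
Proof.
rewrite -(ler_pXn2r (isT : (0 < 2)%N)) ?nnegrE ?addr_ge0 ?enorm_ge0//.
rewrite [X in X <= _]sqr_sqrtr ?dot_ge0// dotDl !(dotC _ (x + y)) !dotDl (dotC y x).
have xx : dot x x = enorm x ^+ 2 by rewrite sqr_sqrtr ?dot_ge0.
have yy : dot y y = enorm y ^+ 2 by rewrite sqr_sqrtr ?dot_ge0.
by rewrite xx yy; have := dot_le x y; move: (enorm x) (enorm y) (dot x y) => a b d; nra.
Qed.

Lemma enormN n (x : 'rV[R]_n) : enorm (- x) = enorm x.
Proof. by rewrite /enorm dotNl dotC dotNl opprK. Qed.

Lemma norm_le_enorm n (x : 'rV[R]_n) : `|x| <= enorm x.
Proof.
apply: rV_norm_le => [|i]; first exact: enorm_ge0.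
rewrite -sqrtr_sqr ler_sqrt ?dot_ge0// /dot (bigD1 i)//= expr2 lerDl sumr_ge0// => j _.
by rewrite -expr2 sqr_ge0.
Qed.

Lemma enorm_le_norm (x : E) : enorm x <= 3 * `|x|.
Proof.
have h : 0 <= 3 * `|x| by rewrite mulr_ge0.
rewrite -[leRHS](ger0_norm h) -sqrtr_sqr ler_sqrt ?sqr_ge0//.
apply: (@le_trans _ _ (\sum_(i < 3) `|x| ^+ 2)).
  by apply: ler_sum => i _; rewrite -expr2 -real_normK ?num_real// lerXn2r ?nnegrE// rV_coord_le.
rewrite sumr_const card_ord -mulr_natl; have := sqr_ge0 `|x|; move: (`|x|) => a; nra.
Qed.

Lemma enorm_coord (x : E) i : `|x 0 i| <= enorm x.
Proof. exact: le_trans (rV_coord_le x i) (norm_le_enorm x). Qed.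

Lemma near_enorm (x : E) e : 0 < e -> nearby x (fun y => enorm (x - y) < e).
Proof.
move=> e0; have e3 : 0 < e / 3 by rewrite divr_gt0.
exists (e / 3) => // y h.
by rewrite (le_lt_trans (enorm_le_norm _))// mulrC -ltr_pdivlMr.
Qed.

Lemma enorm_dist n (x y : 'rV[R]_n) : `|enorm x - enorm y| <= enorm (x - y).
Proof.
rewrite ler_norml; apply/andP; split.
  by rewrite lerNl opprB lerBlDl -(enormN (x - y)) opprB -{1}(subrK x y) addrC enormD.
by rewrite lerBlDl -{1}(subrK y x) addrC enormD.
Qed.

Lemma enorm_continuous_sub (x : E) : continuous (fun z : E => enorm (x - z)).
Proof.
move=> z; apply/nearby_continuous => e e0; apply: (nearbyS (@near_enorm z _ e0)) => y hy.
rewrite (le_lt_trans (enorm_dist _ _))// -enormN.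
by rewrite (_ : - _ = z - y)// opprB opprB addrC subrKA.
Qed.

Lemma edist_set_le (x y : E) (A : set E) : A y -> edist_set x A <= enorm (x - y).
Proof.
move=> Ay; apply: ge_inf; last by exists y.
by exists 0 => _ [z Az <-]; exact: enorm_ge0.
Qed.

Lemma edist_set_ge (x : E) (A : set E) r : A !=set0 -> (forall y, A y -> r <= enorm (x - y)) ->
  r <= edist_set x A.
Proof.
by move=> [y Ay] h; apply: lb_le_inf; [exists (enorm (x - y)), y|move=> _ [z Az <-]; exact: h].
Qed.

Lemma edist_set_lip (x y : E) (A : set E) : A !=set0 -> edist_set x A <= edist_set y A + enorm (x - y).
Proof.
move=> A0; rewrite -lerBlDr; apply: edist_set_ge => // z Az; rewrite lerBlDr addrC.
by rewrite (le_trans (edist_set_le x Az))// -[in leLHS](subrK y x) -addrA enormD.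
Qed.

Lemma edist_set_continuous (A : set E) : A !=set0 -> continuous (fun x => edist_set x A).
Proof.
move=> A0 x; apply/nearby_continuous => e e0; apply: (nearbyS (@near_enorm x _ e0)) => y hy.
rewrite (le_lt_trans _ hy)// ler_norml; apply/andP; split.
  by rewrite lerNl opprB lerBlDl -(enormN (x - y)) opprB edist_set_lip.
by rewrite lerBlDl edist_set_lip.
Qed.

Variable Omega : set E.
Hypothesis oO : open Omega.
Hypothesis bO : bounded_set Omega.
Hypothesis C4O : C4_boundary Omega.
Variable delta : R.
Hypothesis hd : tubular_radius Omega delta.
Notation K := (boundary Omega).
Notation d := (fun x => edist_set x K).
Notation pi_ := (boundary_proj Omega).

(** The infimum of the empty set is 0 by convention, so with an empty boundary every point would
    count as close to it and would have a nearest boundary point. *)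
Lemma boundary_neq0 : K !=set0.
Proof.
have [d0 h] := hd; apply: contrapT => K0.
have e : K = set0 by apply/eqP/negP => /negP/set0P.
have [|y [[Ky _] _]] := h 0; last by rewrite e in Ky.
by rewrite e /edist_set image_set0 inf0 mulr_ge0// ltW.
Qed.

Lemma boundary_proj_nearest x : d x <= 2 * delta -> nearest K x (pi_ x).
Proof. by move=> h; have [y [ny _]] := hd.2 x h; rewrite /boundary_proj; apply: getPex; exists y. Qed.

Lemma boundary_proj_unique x y : d x <= 2 * delta -> nearest K x y -> pi_ x = y.
Proof.
move=> h ny; have [z [nz uz]] := hd.2 x h.
by rewrite -(uz _ ny); apply/esym/uz/boundary_proj_nearest.
Qed.

Lemma boundary_dist_gt0 x : Omega x -> 0 < d x.
Proof.
move=> Ox; have [r r0 hr] := (nearbyP _ _).2 (open_nbhs_nbhs (conj oO Ox)).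
rewrite (lt_le_trans r0)//; apply: edist_set_ge; first exact: boundary_neq0.
move=> y /(boundaryE oO)[_ Oy]; rewrite (le_trans _ (norm_le_enorm _))// leNgt.
by apply/negP => h; apply: Oy; exact: hr.
Qed.

Lemma near_boundary_dist x r : d x < r -> nearby x (fun y => d y < r).
Proof.
move=> dx; have /nearby_continuous/(_ (r - d x)) := @edist_set_continuous K boundary_neq0 x.
rewrite subr_gt0 => /(_ dx) h; apply: (nearbyS h) => y; rewrite ltr_distl => /andP[h1 _].
by move: h1; move: (edist_set x K) (edist_set y K) => a b; lra.
Qed.

(** By compactness and uniqueness of the nearest point, boundary points at distance at least e from
    the projection of x are farther from x by a positive gap. *)
Lemma boundary_proj_continuous x e : d x < 2 * delta -> 0 < e -> nearby x (fun y => `|pi_ x - pi_ y| < e).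
Proof.
move=> dx e0; have nx := boundary_proj_nearest (ltW dx).
have ndx := near_boundary_dist dx.
pose K' := K `&` [set z | e <= `|pi_ x - z|].
have [[z0 K'z0]|K'0] := pselect (K' !=set0); last first.
  apply: (nearbyS ndx) => y dy; rewrite ltNge; apply/negP => h.
  by apply: K'0; exists (pi_ y); split=> //; exact: (boundary_proj_nearest (ltW dy)).1.
have kK : compact K by exact: compact_boundary.
have kK' : compact K'.
  apply: (subclosed_compact _ kK) => [|z []//]; apply: closedI.
    exact: compact_closed (@norm_hausdorff _ _) kK.
  apply: (@closed_comp _ _ (fun z : E => `|pi_ x - z|) [set r | e <= r]); last exact: closed_ge.
  by move=> z _; apply: (continuous_comp (f := fun z : E => pi_ x - z)); [apply: continuousB; [exact: cst_continuous|exact: cvg_id]|exact: norm_continuous].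
have [z1 /set_mem[Kz1 z1e] hz1] := @EVT_min_rV R 3 (fun z => enorm (x - z)) K' (ex_intro _ z0 K'z0) kK'
  (continuous_subspaceT (@enorm_continuous_sub x)).
have dz1 : d x < enorm (x - z1).
  rewrite lt_neqAle edist_set_le// andbT; apply/negP => /eqP h.
  have pz : pi_ x = z1 by apply: boundary_proj_unique; [exact: ltW|split].
  by move: z1e; rewrite /= pz subrr normr0 leNgt e0.
(* Half the gap, because moving from x to y changes both the distance to the boundary and the
   distance to the candidate by up to [enorm (x - y)]. *)
have m0 : 0 < (enorm (x - z1) - d x) / 2 by rewrite divr_gt0// subr_gt0.
apply: (nearbyI ndx (@near_enorm x _ m0)) => y dy hy.
rewrite ltNge; apply/negP => h.
have [Ky ey] := boundary_proj_nearest (ltW dy).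
have := hz1 (pi_ y); rewrite inE => /(_ (conj Ky h)) h1.
have h2 : enorm (x - pi_ y) <= enorm (x - y) + enorm (y - pi_ y).
  by rewrite -{1}(subrK y x) -addrA enormD.
have h3 := @edist_set_lip y x K boundary_neq0; rewrite -(enormN (y - x)) opprB in h3.
by move: h1 h2 h3 hy ey; move: (enorm _) (enorm _) (enorm _) (enorm _) (edist_set _ _) (edist_set _ _) => *; lra.
Qed.

Lemma chart_normal_continuous (c : chart R) i : Ck 4 setT (cgraph c) ->
  continuous (fun x => chart_normal c x 0 i).
Proof.
move=> Cg x.
have cm j : {for x, continuous (fun x : E => conormal c (col' (ck c) x) 0 j)}.
  apply: (@continuous_comp _ _ _ (col' (ck c)) (fun y => conormal c y 0 j)); first exact: col'_continuous.
  exact: conormal_continuous.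
have a0 z : area_factor c (col' (ck c) z) != 0 by exact: lt0r_neq0 (area_factor_gt0 _ _).
rewrite (_ : (fun z => _) = fun z => - conormal c (col' (ck c) z) 0 i / area_factor c (col' (ck c) z)); last first.
  by apply/funext => z; rewrite -chart_normalE mulrAC mulfV// mul1r.
have ca : {for x, continuous (fun z => area_factor c (col' (ck c) z))}.
  rewrite (_ : (fun z => _) = fun z => Num.sqrt (dot (conormal c (col' (ck c) z)) (conormal c (col' (ck c) z)))).
    apply: (@continuous_comp _ _ _ (fun z => dot (conormal c (col' (ck c) z)) (conormal c (col' (ck c) z))) Num.sqrt).
      by apply: continuous_bigsum => j; apply: (continuousM (cm j) (cm j)).
    exact: sqrt_continuous.
  by apply/funext => z; rewrite -area_factorE sqrtr_sqr ger0_norm// ltW// area_factor_gt0.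
have cn : {for x, continuous (fun z => - conormal c (col' (ck c) z) 0 i)} by apply: continuousN; exact: cm.
have cV : {for x, continuous (fun z => (area_factor c (col' (ck c) z))^-1)} by apply: continuousV ca; exact: a0.
exact: (@continuousM R E _ _ x cn cV).
Qed.

(** Projections of points near x remain in one chart, where the normal is given by a continuous
    formula. *)
Lemma normal_ext_continuous x i : d x < 2 * delta ->
  {for x, continuous (fun y => normal_ext Omega y 0 i)}.
Proof.
move=> dx; have [Kx _] := boundary_proj_nearest (ltW dx).
have [c [hc cx]] := C4O Kx; have [oc Cg _] := hc.
apply/nearby_continuous => e e0.
have := @chart_normal_continuous c i Cg (pi_ x) => /nearby_continuous/(_ e e0) h1.
have oc' : nearby (pi_ x) (cdom c) by apply/nearbyP; exact: (open_nbhs_nbhs (conj oc cx)).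
have [r r0 hr] := nearbyI oc' h1 (fun y h1 h2 => conj h1 h2).
have ndx := near_boundary_dist dx.
apply: (nearbyI ndx (boundary_proj_continuous dx r0)) => y dy py.
have [Ky _] := boundary_proj_nearest (ltW dy).
have [cy hy] := hr _ py.
by rewrite /normal_ext !(outward_normalE oO hc).
Qed.

Lemma normal_ext_le1 x i : d x <= 2 * delta -> `|normal_ext Omega x 0 i| <= 1.
Proof.
move=> dx; have [Kx _] := boundary_proj_nearest dx.
by rewrite (le_trans (enorm_coord _ _))// /enorm (outward_normal_unit oO C4O Kx) sqrtr1.
Qed.

End TubularNeighbourhood.

(** * The modified pressure and the final identity *)

Section PressureEquation.
Context {R : realType}.
Notation mu := (@lebesgue_measure R).

Lemma ae_and (A B : set R) : {ae mu, forall t, A t} -> {ae mu, forall t, B t} ->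
  {ae mu, forall t, A t /\ B t}.
Proof.
move=> hA hB; apply: (negligibleS _ (negligibleU hA hB)) => t /= h.
by have [At|At] := pselect (A t); [right => Bt; exact: h|left].
Qed.
Notation E := 'rV[R]_3.

Lemma restrict_mul_sum (A : set E) (h : E -> R) (Y : 'I_3 -> E -> R) :
  (fun x => h x * \sum_i Y i x) \_ A = fun x => \sum_i ((fun x => h x * Y i x) \_ A) x.
Proof.
apply/funext => x; rewrite patchE; case: ifPn => xO.
  by rewrite mulr_sumr; apply: eq_bigr => i _; rewrite patchE xO.
by rewrite big1// => i _; rewrite patchE (negPf xO).
Qed.

Variable Omega : set E.
Hypothesis oO : open Omega.
Hypothesis bO : bounded_set Omega.
Hypothesis C4O : C4_boundary Omega.
Variable delta : R.
Hypothesis hd : tubular_radius Omega delta.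
Variable phit : R -> R.
Hypothesis hphi : cutoff_profile delta phit.
Notation K := (boundary Omega).
Notation d := (fun x => edist_set x K).
Notation phi := (cutoff Omega phit).

Let K0 : K !=set0. Proof. exact: boundary_neq0 hd. Qed.

Let d_ge0 x : 0 <= d x.
Proof. by apply: edist_set_ge => // y _; exact: enorm_ge0. Qed.

Section normal_stress.
Variable FV : 'I_3 -> E -> R.
Hypothesis cV : forall i, continuous (FV i).
Variable M : R.
Hypothesis bV : forall i x, `|FV i x| <= M.
Hypothesis impV : forall x, K x -> \sum_i outward_normal Omega x 0 i * FV i x = 0.

Let g y := \sum_i FV i y * normal_ext Omega y 0 i.

Definition normal_stress y := phi y * g y ^+ 2.

Let g_continuous x : d x < 2 * delta -> {for x, continuous g}.
Proof.
move=> dx; apply: continuous_bigsum => i.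
have cn : {for x, continuous (fun y => normal_ext Omega y 0 i)} by exact: (normal_ext_continuous oO bO C4O hd dx).
exact: (@continuousM R E (FV i) (fun y => normal_ext Omega y 0 i) x (@cV i x) cn).
Qed.

Let phi01 x : 0 <= phi x <= 1. Proof. by have [_ h _ _ _] := hphi; exact: h. Qed.

Let phi_continuous x : Omega x -> {for x, continuous phi}.
Proof.
move=> Ox; have [sm _ _ _ _] := hphi.
apply: (@continuous_comp _ _ _ d phit); first exact: edist_set_continuous.
apply: (Ck_continuous (sm 0%N)); rewrite /= in_itv/= andbT.
exact: (boundary_dist_gt0 oO hd).
Qed.

Let phi0 x : 2 * delta <= d x -> phi x = 0.
Proof. by have [_ _ _ _ h] := hphi; exact: h. Qed.

Let M0 : 0 <= M. Proof. exact: le_trans (normr_ge0 _) (bV ord0 0). Qed.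

Lemma normal_stress_le x : `|normal_stress x| <= phi x * (M *+ 3) ^+ 2.
Proof.
have [h0 _] := andP (phi01 x).
have [dx|dx] := leP (2 * delta) (d x).
  by rewrite /normal_stress phi0// !mul0r normr0.
rewrite normrM ger0_norm// ler_wpM2l// normrX lerXn2r ?nnegrE ?mulrn_wge0//.
apply: norm_sum3 => i; rewrite normrM -[M]mulr1 ler_pM//.
exact: (normal_ext_le1 oO C4O hd i (ltW dx)).
Qed.

(** Smoothness of the profile is assumed for positive distances only. At the boundary, continuity
    comes instead from 0 <= phi <= 1 and from u . n tending to 0. *)
Lemma normal_stress_boundary x : K x -> normal_stress x = 0 /\ {for x, continuous normal_stress}.
Proof.
move=> Kx; have d0 : 0 < delta by case: hd.
have dx0 : d x = 0.
  apply/eqP; rewrite eq_le d_ge0 andbT (le_trans (edist_set_le x Kx))//.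
  by rewrite subrr /enorm /dot big1 ?sqrtr0// => i _; rewrite mxE mul0r.
have dx : d x < 2 * delta by rewrite dx0 mulr_gt0.
have px : boundary_proj Omega x = x.
  apply: (boundary_proj_unique hd (ltW dx)); split=> //.
  by rewrite dx0 subrr /enorm /dot big1 ?sqrtr0// => i _; rewrite mxE mul0r.
have gx : g x = 0.
  rewrite -[RHS](impV Kx); apply: eq_bigr => i _; by rewrite /normal_ext px mulrC.
have hx : normal_stress x = 0 by rewrite /normal_stress gx expr0n mulr0.
split=> //; apply/nearby_continuous => e e0.
(* A value of modulus less than 1 and less than e has square less than e. *)
have /nearby_continuous/(_ (Num.min 1 e)) := g_continuous dx.
rewrite lt_min ltr01 => /(_ e0) h; apply: (nearbyS h) => y; rewrite gx sub0r normrN hx sub0r normrN lt_min => /andP[h1 h2].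
have [p0 p1] := andP (phi01 y).
rewrite (le_lt_trans _ h2)// normrM (ger0_norm p0) normrX.
have := normr_ge0 (g y); move: h1 h2; move: (`|g y|) => a h1 h2 a0; nra.
Qed.

Lemma normal_stress_continuous x : Omega x -> {for x, continuous normal_stress}.
Proof.
move=> Ox; have cp := phi_continuous Ox.
have [dx|dx] := leP (2 * delta) (d x); last first.
  have cg := g_continuous dx.
  exact: (@continuousM R E phi (fun y => g y * g y) x cp (@continuousM R E g g x cg cg)).
have hx : normal_stress x = 0 by rewrite /normal_stress phi0// mul0r.
apply/nearby_continuous => e e0.
pose B := (M *+ 3) ^+ 2 + 1.
have B0 : 0 < B by rewrite ltr_wpDl// sqr_ge0.
have eB : 0 < e / B by rewrite divr_gt0.
have /nearby_continuous/(_ _ eB) h := cp; apply: (nearbyS h) => y.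
rewrite phi0// sub0r normrN hx sub0r normrN; have [p0 p1] := andP (phi01 y).
rewrite ger0_norm// ltr_pdivlMr// => hy; rewrite (le_lt_trans (normal_stress_le y))//.
by rewrite (le_lt_trans _ hy)// ler_wpM2l// lerDl.
Qed.

Lemma normal_stress_restrict (Y : E -> R) : okf Omega Y -> bms3 ((fun x => normal_stress x * Y x) \_ Omega).
Proof.
move=> oY; have [_ [B hB]] := oY.
apply: (@bms3_le _ _ (fun x => ((M *+ 3) ^+ 2 * B) * \1_Omega x)).
- rewrite (_ : _ \_ _ = fun x => (normal_stress \_ Omega) x * (Y \_ Omega) x).
    by apply: mf3M; [exact: mf3_restrict_continuous normal_stress_continuous|exact: okf_mf3].
  by apply/funext => x; rewrite !patchE; case: ifP => // _; rewrite mul0r.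
- move=> x; rewrite patchE; case: ifPn => [xO|_]; last by rewrite normr0.
  rewrite indicE xO mulr1 normrM [leRHS]ger0_norm; last first.
    by rewrite mulr_ge0 ?sqr_ge0// (le_trans _ (hB x (set_mem xO))).
  rewrite ler_pM ?hB ?(set_mem xO)//; last exact: set_mem.
  by rewrite (le_trans (normal_stress_le x))// ler_piMl ?sqr_ge0//; case/andP: (phi01 x).
- exact: bms3Z (bms3_indic oO bO).
Qed.

Lemma normal_stress_restrict_sum (Y : 'I_3 -> E -> R) : (forall i, okf Omega (Y i)) ->
  bms3 ((fun x => normal_stress x * \sum_i Y i x) \_ Omega).
Proof.
move=> oY; rewrite (_ : _ \_ _ = fun x => \sum_i ((fun x => normal_stress x * Y i x) \_ Omega) x).
  by apply: bms3_sum => i _; exact: normal_stress_restrict.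
exact: restrict_mul_sum.
Qed.

End normal_stress.

Variable T : R.
Notation I0T := (`]0, T[%classic : set R).
Variable S : R -> R.
Hypothesis hS : smooth_step S.
Variables (V : 'I_3 -> R -> E -> R) (Q : R -> E -> R).
Hypothesis sV : forall i, stf Omega T (V i).
Hypothesis sQ : stf Omega T Q.
Variables (N : nat) (c : 'I_N -> chart R) (psi : 'I_N -> E -> R) (U : set E).
Hypothesis hA : is_atlas Omega c psi.
Hypothesis oU : open U.
Hypothesis bU : boundary Omega `<=` U.
Hypothesis sumU : forall x, U x -> \sum_i psi i x = 1.
Hypothesis oV : forall i t, okf Omega (V i t).
Hypothesis oQ : forall t, okf Omega (Q t).
Hypothesis impV : forall t x, boundary Omega x ->
  \sum_i btrace Omega (V i t) x * outward_normal Omega x 0 i = 0.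
(** Both sides are combinations of the integrals of a pressure term q, a velocity term v and a
    normal-stress term l. As V and Q vanish off Omega, only l has to be restricted explicitly. *)
Lemma integral_bulk (H : 'I_3 -> 'I_3 -> E -> R) (w : 'I_3 -> E -> R) (h k Pt : E -> R) t :
  (forall i j, okf Omega (H i j)) -> (forall i x, Omega x -> V i t x = w i x) ->
  (forall x, Omega x -> Pt x = Q t x + h x) -> (forall x, Omega x -> k x = h x) ->
  bms3 ((fun x => h x * \sum_i H i i x) \_ Omega) ->
  integral_R3 Omega (fun x => Pt x * \sum_i H i i x) - I3 (bulk V Q H t) =
  integral_R3 Omega (fun x => - (\sum_i \sum_j w i x * w j x * H j i x) + k x * \sum_i H i i x).
Proof.
move=> oH Vw PE kE; set l := _ \_ _ => bl.
pose q x := Q t x * \sum_i H i i x.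
pose v x := \sum_i \sum_j V i t x * V j t x * H i j x.
have bq : bms3 q.
  have s : stf Omega T (fun t x => Q t x * \sum_i H i i x).
    rewrite (_ : (fun _ _ => _) = fun t x => \sum_i Q t x * H i i x).
      by apply: stf_sum => i; exact: stfMo.
    by apply/funext => s; apply/funext => x; rewrite big_distrr.
  exact: (stf_slice oO bO t s).
have bv : bms3 v.
  have s : stf Omega T (fun t x => \sum_i \sum_j V i t x * V j t x * H i j x).
    by apply: stf_sum => i; apply: stf_sum => j; apply: stfMo => //; exact: stfM.
  exact: (stf_slice oO bO t s).
have off x : ~ Omega x -> (forall i, V i t x = 0) /\ Q t x = 0.
  move=> Ox; have z f : stf Omega T f -> f t x = 0.
    by move=> /stf_bound[_ _ [_ h2]]; apply/eqP/negP => /negP/h2[].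
  by split => [i|]; exact: z.
have lE x : Omega x -> l x = h x * \sum_i H i i x by move=> Ox; rewrite /l patchE mem_set.
have l0 x : ~ Omega x -> l x = 0 by move=> Ox; rewrite /l patchE memNset.
have -> : integral_R3 Omega (fun x => Pt x * \sum_i H i i x) = I3 q + I3 l.
  rewrite integral_R3E -(I3D bq bl); apply: eq_I3 => x; rewrite patchE.
  case: ifPn => [/set_mem Ox|/negP xO]; first by rewrite PE// lE// mulrDl.
  have Ox : ~ Omega x by move=> ?; apply/xO/mem_set.
  by rewrite l0// /q (off x Ox).2 mul0r addr0.
have -> : integral_R3 Omega (fun x => - (\sum_i \sum_j w i x * w j x * H j i x) + k x * \sum_i H i i x) =
    - I3 v + I3 l.
  rewrite integral_R3E -(I3N bv) -(I3D (bms3N bv) bl); apply: eq_I3 => x; rewrite patchE.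
  case: ifPn => [/set_mem Ox|/negP xO].
    (* The double sum is relabelled, since the two sides list the derivatives in opposite orders. *)
    rewrite lE// kE//; congr (- _ + _); rewrite /v exchange_big/=.
    by apply: eq_bigr => i _; apply: eq_bigr => j _; rewrite !Vw// [w j x * _]mulrC.
  have Ox : ~ Omega x by move=> ?; apply/xO/mem_set.
  rewrite l0// /v big1 ?oppr0 ?addr0// => i _; rewrite big1// => j _.
  by rewrite (off x Ox).1 !mul0r.
have -> : I3 (bulk V Q H t) = I3 v + I3 q by rewrite -(I3D bv bq).
by move: (I3 q) (I3 l) (I3 v) => a b e; ring.
Qed.

Variables (u : R -> E -> E) (p : R -> E -> R) (t : R).
Hypothesis Vu : forall i x, Omega x -> V i t x = u t x 0 i.
Hypothesis Qp : forall x, Omega x -> Q t x = p t x.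
Variable Phi : E -> R.
Hypothesis sPhi : smooth_closure Omega Phi.
Hypothesis flux_identity : forall (FQ : E -> R) (Fb : 'I_3 -> E -> R),
  continuous FQ -> (forall x, Omega x -> FQ x = Q t x) ->
  (forall i, continuous (Fb i)) -> (forall i x, Omega x -> Fb i x = partial i Phi x) ->
  I3 (bulk V Q (hess Phi) t) + \sum_j flux c psi (fun x => FQ x * Fb j x) j = 0.

Let P := modified_pressure Omega phi u p.

Lemma pressure_equation :
  integral_R3 Omega (fun x => P t x * laplacian Phi x) -
  surface_integral Omega (fun x => btrace Omega (P t) x * normal_derivative Omega Phi x) =
  integral_R3 Omega (fun x =>
    - (\sum_i \sum_j u t x 0 i * u t x 0 j * partial i (partial j Phi) x) +
    dot (u t x) (normal_ext Omega x) ^+ 2 * phi x * laplacian Phi x).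
Proof.
have [FV [M [cV eV hV]]] := okf_ext3 (fun i => oV i t).
have [FQ [cQ eQ _]] := okf_ext (oQ t).
have [Fb [_ [cb eb _]]] := okf_ext3 (okf_partial oO bO sPhi).
have oh i j := okf_hess oO bO sPhi i j.
have nV x : K x -> \sum_i outward_normal Omega x 0 i * FV i x = 0.
  move=> Kx; rewrite -[RHS](impV t Kx); apply: eq_bigr => i _; rewrite mulrC.
  by rewrite (btrace_ext (cV i x) (eV i))//; case: Kx.
pose h := normal_stress FV.
have hE x : Omega x -> phi x * dot (u t x) (normal_ext Omega x) ^+ 2 = h x.
  move=> Ox; congr (_ * _ ^+ 2); apply: eq_bigr => i _; by rewrite eV// Vu.
have PE x : Omega x -> P t x = FQ x + h x.
  by move=> Ox; rewrite /P /modified_pressure hE// eQ// Qp.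
(* The normal stress tends to 0 at the boundary, so the modified pressure and the pressure have the
   same trace. *)
have tP x : K x -> btrace Omega (P t) x = FQ x.
  move=> Kx; have [h0 ch] := normal_stress_boundary cV nV Kx.
  have cF : {for x, continuous (fun y => FQ y + h y)} by apply: continuousD; [exact: cQ|exact: ch].
  have cx : closure Omega x by case: Kx.
  by rewrite (btrace_ext cF (fun y Oy => esym (PE y Oy)) cx) /h h0 addr0.
have SI : surface_integral Omega (fun x => btrace Omega (P t) x * normal_derivative Omega Phi x) =
    I3 (bulk V Q (hess Phi) t).
  rewrite (surface_integral_flux oO bO hS hA oU bU sumU (G := fun j x => FQ x * Fb j x)).
  - by apply/eqP; rewrite eqr_oppLR -subr_eq0 opprK addrC; apply/eqP; exact: flux_identity.
  - by move=> j x; apply: continuousM; [exact: cQ|exact: cb].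
  - move=> x Kx; rewrite tP// /normal_derivative big_distrr/=; apply: eq_bigr => i _.
    have -> : btrace Omega (partial i Phi) x = Fb i x.
      by apply: (btrace_ext (cb i x) (eb i)); case: Kx.
    exact: mulrCA.
rewrite SI; apply: (@integral_bulk (hess Phi) (fun i x => u t x 0 i) h _ (P t) t oh Vu).
- by move=> x Ox; rewrite PE// eQ.
- by move=> x Ox; rewrite -hE// mulrC.
- exact: (normal_stress_restrict_sum cV hV).
Qed.

End PressureEquation.

Theorem theorem3p7 (R : realType) (Omega : set 'rV[R]_3) (T alpha delta : R)
    (phit : R -> R)
    (u : R -> 'rV[R]_3 -> 'rV[R]_3) (p : R -> 'rV[R]_3 -> R)
    (Omega_open : open Omega) (Omega_bounded : bounded_set Omega)
    (Omega_sc : simply_connected Omega R) (Omega_C4 : C4_boundary Omega)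
    (T_gt0 : 0 < T) (alpha_gt0 : 0 < alpha) (alpha_lt1 : alpha < 1)
    (delta_tub : tubular_radius Omega delta)
    (phit_cutoff : cutoff_profile delta phit)
    (u_holder : Linfty_holder_vec alpha Omega T u)
    (p_holder : Linfty_holder alpha Omega T p)
    (up_sol : weak_solution Omega T u p) :
  let phi := cutoff Omega phit in
  let P := modified_pressure Omega phi u p in
  {ae (@lebesgue_measure R), forall t, `]0, T[%classic t ->
    forall Phi : 'rV[R]_3 -> R, smooth_closure Omega Phi ->
      integral_R3 Omega (fun x => P t x * laplacian Phi x) -
      surface_integral Omega (fun x =>
        btrace Omega (P t) x * normal_derivative Omega Phi x) =
      integral_R3 Omega (fun x =>
        - (\sum_i \sum_j u t x 0 i * u t x 0 j * partial i (partial j Phi) x) +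
        dot (u t x) (normal_ext Omega x) ^+ 2 * phi x * laplacian Phi x)}.
Proof.
move=> phi P; have [d0 _] := delta_tub.
(* This one step function generates the grid cells, the partition of unity, the layers and the bumps
   in time. *)
have [S hS] := exists_smooth_step d0 phit_cutoff.
have [N [c [psi [U [hA oU bU sumU]]]]] := exists_atlas Omega_bounded Omega_C4 hS.
have [G [mG GI aeG [hV hQ impV]]] := good_times Omega_open alpha_gt0 u_holder p_holder up_sol.
have sV i := (hV i).1; have oV i := (hV i).2.
have [_ _ wm wd _] := up_sol.
have wm' := weak_momentum_trunc Omega_open u_holder p_holder mG GI aeG wm.
have wd' := weak_div_free_trunc Omega_open u_holder mG GI aeG wd.
have F := weak_pressure_flux Omega_open Omega_bounded hS sV hQ.1 hA oU bU sumU wm' wd' oV hQ.2 impV.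
apply: ae_sub (ae_and aeG F) => t [Gt Ft] It Phi sPhi.
apply: (pressure_equation Omega_open Omega_bounded Omega_C4 delta_tub phit_cutoff hS sV hQ.1 hA oU bU sumU
  oV hQ.2 impV) => //.
- by move=> i x Ox; rewrite truncE//; exact: Gt.
- by move=> x Ox; rewrite truncE//; exact: Gt.
- by move=> FQ Fb; exact: Ft.
Qed.
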